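(* Let $d\ge 1$ be an integer and $\alpha\in(0,2)$ with $d>\alpha$. Let $\{w_{x,y}\}$ be random conductances on $\mathbb Z^d$ satisfying Assumption (H1) described in the context. Let $\lambda>0$ and $\gamma>0$. Then there is a $[1,\infty]$-valued random variable $k_0$, finite $\mathbb P$-almost surely and depending only on $\gamma,\alpha,\lambda$ (not on $f$), such that for every $f\in\mathscr S_0^\lambda$ there is a constant $C_0>0$ (depending on $f,\gamma,\alpha,\lambda$) such that for $\mathbb P$-a.e. $\omega$ and all integers $k>k_0(\omega)$, $$ \|R_\lambda^{k,\omega}f-\bar R_\lambda f\|_{L^2(\mathbb R^d;dx)}\le C_0\begin{cases}\min\Big\{k^{-\alpha/2}\log^{\frac{\alpha(1+\gamma)}{(4(d-\alpha))\wedge(2d)}}k,\ k^{-((1-\alpha)\wedge(d/2))}\log^{1/2}k\Big\}, & \alpha\in(0,1),\\[1mm] k^{-1/2}\log^{1+\frac{1+\gamma}{(4(d-1))\wedge(2d)}}k, & \alpha=1,\\[1mm] k^{-(2-\alpha)/2}\log^{\frac{\alpha(1+\gamma)}{(4(d-\alpha))\wedge(2d)}}k, & \alpha\in(1,2).\end{cases} $$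
   Context: Assumption (H1): on a probability space $(\Omega,\mathcal F,\mathbb P)$, $\{w_{x,y}:\{x,y\}\subset\mathbb Z^d,\ x\neq y\}$ is a family, indexed by unordered pairs of distinct points of $\mathbb Z^d$, of i.i.d. non-negative random variables with $w_{x,y}=w_{y,x}$, $\mathbb E[w_{x,y}]=1$, and $w_{x,y}\le M$ for all $x\ne y$ for some constant $M>0$. $|\cdot|$ is the Euclidean norm. For $k\in\{1,2,\dots\}$, $\mu^k$ is the measure on $k^{-1}\mathbb Z^d$ giving mass $k^{-d}$ to each point. The scaled operator is $\mathcal L^{k,\omega}g(x)=k^{-d}\sum_{y\in k^{-1}\mathbb Z^d,\,y\neq x}(g(y)-g(x))\frac{w_{kx,ky}(\omega)}{|x-y|^{d+\alpha}}$ for $x\in k^{-1}\mathbb Z^d$, $g\in L^2(k^{-1}\mathbb Z^d;\mu^k)$. For $f$ bounded continuous and in $L^2(k^{-1}\mathbb Z^d;\mu^k)$ (restricted to $k^{-1}\mathbb Z^d$), $R^{k,\omega}_\lambda f$ denotes the unique $u\in L^2(k^{-1}\mathbb Z^d;\mu^k)$ with $(\lambda-\mathcal L^{k,\omega})u=f$ on $k^{-1}\mathbb Z^d$, extended to $\mathbb R^d$ by $u(x)=u(z)$ for $x\in\prod_{i=1}^d(z_i,z_i+k^{-1}]$, $z\in k^{-1}\mathbb Z^d$. The limit operator is $\bar{\mathcal L}g(x)=\lim_{\varepsilon\to0}\int_{\{|y-x|\ge\varepsilon\}}(g(y)-g(x))|x-y|^{-d-\alpha}\,dy$ for $g\in C^2_c(\mathbb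 R^d)$ (a constant multiple of the fractional Laplacian $-(-\Delta)^{\alpha/2}$), and $\bar R_\lambda=(\lambda-\bar{\mathcal L})^{-1}$ is its resolvent on $L^2(\mathbb R^d;dx)$. Finally $\mathscr S_0^\lambda=\{(\lambda-\bar{\mathcal L})g:\ g\in C_c^\infty(\mathbb R^d)\}$. *)

(* Defs.v *)
From HB Require Import structures.
From mathcomp Require Import all_boot all_order all_algebra.
From mathcomp Require Import all_classical all_reals all_analysis measurable_realfun.
Set Implicit Arguments. Unset Strict Implicit. Unset Printing Implicit Defensive.
Import Order.TTheory GRing.Theory Num.Theory.
Import numFieldNormedType.Exports.
Local Open Scope classical_set_scope.
Local Open Scope ring_scope.

(* Z^d is 'rV[int]_d ; R^d is 'rV[R]_d for analysis (derivatives) and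
   d.-tuple R for measure theory (the product sigma-algebra on tuples). *)

Definition toRow (R : realType) (d : nat) (t : d.-tuple R) : 'rV[R]_d :=
  \row_i tnth t i.

Definition eucl (R : realType) (d : nat) (v : 'rV[R]_d) : R :=
  Num.sqrt (\sum_i v 0 i ^+ 2).

(* leb is the Lebesgue measure on (the Borel sets of) R^d: it gives every
   half-open box its volume (this determines it uniquely). *)
Definition is_lebesgue_tuple (R : realType) (d : nat)
    (leb : {measure set (d.-tuple R) -> \bar R}) : Prop :=
  forall a b : d.-tuple R,
    leb [set t | forall i, tnth a i < tnth t i <= tnth b i] =
    (\prod_i Num.max (tnth b i - tnth a i) 0)%:E.

Fixpoint iterD (R : realType) (d : nat) (vs : seq 'rV[R]_d)
    (f : 'rV[R]_d -> R) : 'rV[R]_d -> R :=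
  match vs with
  | [::] => f
  | v :: vs' => 'D_v (iterD vs' f)
  end.

Definition smooth (R : realType) (d : nat) (f : 'rV[R]_d -> R) : Prop :=
  forall (vs : seq 'rV[R]_d) (x : 'rV[R]_d), differentiable (iterD vs f) x.

Definition compact_support (R : realType) (d : nat) (f : 'rV[R]_d -> R) : Prop :=
  exists r : R, forall x, r < eucl x -> f x = 0.

Definition Lbar (R : realType) (d : nat) (leb : {measure set (d.-tuple R) -> \bar R})
    (alpha : R) (g : 'rV[R]_d -> R) (x : 'rV[R]_d) : R :=
  lim ((fun eps : R =>
     Rintegral leb [set t | eps <= eucl (toRow t - x)]
       (fun t => (g (toRow t) - g x) *
                 (eucl (toRow t - x)) `^ (- (d%:R + alpha)))) @ 0^'+).

Definition latpt (R : realType) (d : nat) (k : nat) (z : 'rV[int]_d) : 'rV[R]_d :=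
  map_mx (fun n : int => n%:~R / k%:R) z.

Definition lsum (R : realType) (d : nat) (F : 'rV[int]_d -> R) (A : set 'rV[int]_d) : R :=
  fine (\esum_(i in A) (Num.max (F i) 0)%:E) -
  fine (\esum_(i in A) (Num.max (- F i) 0)%:E).

(* u in L^2(k^{-1}Z^d; mu^k)  (u is indexed by z in Z^d, standing for z/k) *)
Definition l2lat (R : realType) (d : nat) (u : 'rV[int]_d -> R) : Prop :=
  (\esum_(z in [set: 'rV[int]_d]) ((u z) ^+ 2)%:E < +oo)%E.

Definition Lk (R : realType) (d : nat) (alpha : R) (wo : 'rV[int]_d -> 'rV[int]_d -> R)
    (k : nat) (u : 'rV[int]_d -> R) (z : 'rV[int]_d) : R :=
  (k%:R ^- d) *
  lsum (fun z' => (u z' - u z) * wo z z' /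
                  (eucl (latpt R k z - latpt R k z')) `^ (d%:R + alpha))
       [set z' | z' != z].

(* R^{k,omega}_lambda f : the (unique) L^2 solution of (lambda - L^{k,omega}) u = f *)
Definition resolvent_k (R : realType) (d : nat) (alpha lam : R)
    (wo : 'rV[int]_d -> 'rV[int]_d -> R) (k : nat) (f : 'rV[R]_d -> R)
    : 'rV[int]_d -> R :=
  get [set u | l2lat u /\
               forall z, lam * u z - Lk alpha wo k u z = f (latpt R k z)].

(* extension to R^d: u(x) = u(z) for x in prod_i (z_i, z_i + 1/k] *)
Definition ext_lat (R : realType) (d : nat) (k : nat) (u : 'rV[int]_d -> R)
    (t : d.-tuple R) : R :=
  u (\row_i (- Num.floor (- (k%:R * tnth t i)) - 1)).

Definition H1 (R : realType) (dO : measure_display) (Omega : measurableType dO)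
    (P : probability Omega R) (d : nat)
    (w : 'rV[int]_d -> 'rV[int]_d -> Omega -> R) (M : R) : Prop :=
  (forall x y, w x y = w y x) /\
  [/\
      forall x y, x != y -> measurable_fun setT (w x y),
      forall x y x' y', x != y -> x' != y' -> forall A : set R, measurable A ->
        P (w x y @^-1` A) = P (w x' y' @^-1` A),
      (* mutually independent over distinct unordered pairs *)
      forall (s : seq ('rV[int]_d * 'rV[int]_d)) (A : 'rV[int]_d * 'rV[int]_d -> set R),
        uniq s ->
        (forall e, e \in s -> e.1 != e.2 /\ (e.2, e.1) \notin s) ->
        (forall e, measurable (A e)) ->
        P (\bigcap_(e in [set` s]) (w e.1 e.2 @^-1` A e)) =
        (\prod_(e <- s) P (w e.1 e.2 @^-1` A e))%E,
      forall x y o, x != y -> 0 <= w x y o <= M &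
      forall x y, x != y -> (\int[P]_o (w x y o)%:E = 1%:E)%E].

Definition rate (R : realType) (d : nat) (alpha gamma : R) (k : nat) : R :=
  let kk : R := k%:R in
  let L := ln kk in
  let e := alpha * (1 + gamma) / Num.min (4 * (d%:R - alpha)) (2 * d%:R) in
  if alpha < 1 then
    Num.min (kk `^ (- (alpha / 2)) * L `^ e)
            (kk `^ (- Num.min (1 - alpha) (d%:R / 2)) * L `^ (1 / 2))
  else if alpha == 1 then
    kk `^ (- (1 / 2)) * L `^ (1 + (1 + gamma) / Num.min (4 * (d%:R - 1)) (2 * d%:R))
  else kk `^ (- ((2 - alpha) / 2)) * L `^ e.

(* Main.v *)
(**
  If [f = (lam - Lbar) g], the error [v = u - g] on the lattice solves
  [(lam - L) v = h], where [h] is the sum of a deterministic consistency defect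
  and of the noise [sum_y (g y - g x) (w_xy - 1) |x - y|^(- d - alpha)]. The
  defect is small in [l2] because the generator can be symmetrised into second
  differences of [g]. For the noise, test the equation against [v]: on every
  dyadic cube of the relevant scales, two-step paths through a third point give
  a Poincare inequality that is uniform in the environment beyond a random
  scale, so [v] may be replaced successively by its block averages at the cost
  of its energy, while the pairing of the noise with block averages is
  controlled by Hoeffding's inequality and a union bound.

  The random scale must not depend on [g]. A smooth compactly supported
  function, discretised at mesh [1/k], is a combination, with bounded total
  coefficient, of truncated products of one-dimensional ramps (the coefficients
  are iterated second differences). The concentration estimates are therefore
  only needed for a family of test functions of cardinality polynomial in [k],
  and the Borel-Cantelli argument is carried out once for all [g].
*)

Require Import Defs.
From HB Require Import structures.
From mathcomp Require Import all_boot all_order all_algebra.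
From mathcomp Require Import all_classical all_reals all_analysis measurable_realfun.
From mathcomp Require Import ring lra zify.
Set Implicit Arguments. Unset Strict Implicit. Unset Printing Implicit Defensive.
Import Order.TTheory GRing.Theory Num.Theory.
Import numFieldNormedType.Exports.
Local Open Scope classical_set_scope.
Local Open Scope ring_scope.

(** The exponents come from one computation. Two-step paths control a block of side [2^j] once its
    volume beats [ln k] by a positive power, so the finest usable side is of order
    [ln^((1+gamma)/d) k]. Replacing [v] by its averages over blocks of side [2^j] costs
    [(2^j/k)^(alpha/2)] times the square root of the energy, while averaging the noise over them
    divides the bound on its l2 norm by [2^(j d/2)]. The product decays like
    [2^(- j (d - alpha)/2)], which is where [alpha < d] enters: the finest scale dominates and
    leaves the factor [ln^((1+gamma) alpha/(2 d)) k]. The power of [k] is set by the Holder exponent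
    with which differences of the test functions are measured; square summability of the kernel
    limits it, and for [alpha < 1] an intermediate value yields both rates of the minimum at once.
    Good environments are defined without [g]: the radius of the test functions may grow up to [k],
    so each [g] is covered from some [k] on. The finitely many earlier [k] depend on [g] and are
    paid for by [C0], through a deterministic bound on the l2 error. *)

(** * Elementary inequalities for exponentials, logarithms and powers *)

Section real_inequalities.
Variable R : realType.
Implicit Types x y a b p q r s t : R.

Lemma powRD_gt0 x r s : 0 < x -> x `^ (r + s) = x `^ r * x `^ s.
Proof. by move=> x0; rewrite powRD//; apply/implyP => _; rewrite gt_eqF. Qed.

(** The linear term stays outside the exponential so that it cancels in a centred average and a
    Gaussian bound remains. Below 1, [exp (- t)] is bounded from below by [1 - t] or, for positive
    [t], by [(1 - t/2)^2], and the claim becomes polynomial. *)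
Lemma expR_le_sqr t : expR t <= t + expR (2 * t ^+ 2).
Proof.
have q1 : 1 + 2 * t ^+ 2 <= expR (2 * t ^+ 2) by exact: expR_ge1Dx.
have eN : 1 - t <= expR (- t) by exact: expR_ge1Dx.
have ee : expR t * expR (- t) = 1 by rewrite -expRD subrr expR0.
have et0 : 0 < expR t by exact: expR_gt0.
have [t1|t1] := leP 1 t.
  have : expR t <= expR (2 * t ^+ 2) by rewrite ler_expR; nra.
  by move=> h; lra.
have [t0|t0] := leP t 0.
  suff : expR t <= 1 + t + 2 * t ^+ 2 by lra.
  have h : expR t * (1 - t) <= 1 by rewrite -[leRHS]ee ler_pM2l.
  have : (1 + t + 2 * t ^+ 2) * (1 - t) >= 1 by nra.
  move=> h2; rewrite -(ler_pM2r (_ : 0 < 1 - t)); last lra.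
  exact: le_trans h h2.
suff : expR t <= 1 + t + 2 * t ^+ 2 by lra.
have eN2 : 1 - t / 2 <= expR (- (t / 2)) by exact: expR_ge1Dx.
have e2 : expR t * expR (- (t / 2)) ^+ 2 = 1.
  by rewrite expr2 -!expRD (_ : _ + _ = 0) ?expR0//; lra.
have h : expR t * (1 - t / 2) ^+ 2 <= 1.
  rewrite -[leRHS]e2 ler_pM2l// ler_sqr// nnegrE; last exact: expR_ge0.
  lra.
have h2 : (1 + t + 2 * t ^+ 2) * (1 - t / 2) ^+ 2 >= 1.
  have : (1 + t + 2 * t ^+ 2) * (1 - t / 2) ^+ 2 - 1 =
    t ^+ 2 * ((1 - t) * (5 / 4 - t / 2)) by field.
  have : 0 <= t ^+ 2 * ((1 - t) * (5 / 4 - t / 2)).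
    by rewrite mulr_ge0 ?sqr_ge0// mulr_ge0//; lra.
  by move=> *; lra.
rewrite -(ler_pM2r (_ : 0 < (1 - t / 2) ^+ 2)); last by rewrite exprn_gt0//; lra.
exact: le_trans h h2.
Qed.

Lemma CauchySchwarz_sum (I : finType) (P : pred I) (f g : I -> R) :
  (\sum_(i | P i) f i * g i) ^+ 2 <=
  (\sum_(i | P i) f i ^+ 2) * (\sum_(i | P i) g i ^+ 2).
Proof.
set A := \sum_(i | P i) f i ^+ 2; set B := \sum_(i | P i) g i ^+ 2.
set C := \sum_(i | P i) f i * g i.
have H s t : 0 <= s ^+ 2 * A - 2 * s * t * C + t ^+ 2 * B.
  rewrite [leRHS](_ : _ = \sum_(i | P i) (s * f i - t * g i) ^+ 2).
    by apply: sumr_ge0 => i _; exact: sqr_ge0.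
  rewrite /A /B /C !mulr_sumr -sumrB -big_split/=.
  by apply: eq_bigr => i _; ring.
have A0 : 0 <= A by apply: sumr_ge0 => i _; exact: sqr_ge0.
have B0 : 0 <= B by apply: sumr_ge0 => i _; exact: sqr_ge0.
have [Bp|Bn] := ltP 0 B.
  have := H B C.
  rewrite (_ : _ + _ = B * (A * B - C ^+ 2)); last by ring.
  by rewrite pmulr_rge0// subr_ge0.
have B00 : B = 0 by apply/eqP; rewrite eq_le B0 Bn.
(* Degenerate case [B = 0]: at this point the quadratic form equals [- C^2 (A + 2)]. *)
have := H C (A + 1).
rewrite B00 !mulr0 addr0 => h.
suff : C ^+ 2 * (A + 2) <= 0.
  by move=> h2; have := sqr_ge0 C; nra.
by nra.
Qed.

Lemma CauchySchwarz_sqrt (I : finType) (P : pred I) (f g : I -> R) :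
  \sum_(i | P i) f i * g i <=
  Num.sqrt (\sum_(i | P i) f i ^+ 2) * Num.sqrt (\sum_(i | P i) g i ^+ 2).
Proof.
rewrite -sqrtrM ?sumr_ge0// => [|i _]; last exact: sqr_ge0.
apply: le_trans (ler_norm _) _; rewrite -sqrtr_sqr ler_sqrt ?CauchySchwarz_sum//.
by apply: mulr_ge0; apply: sumr_ge0 => i _; exact: sqr_ge0.
Qed.

Lemma ln_le_powR x s : 0 < s -> 1 <= x -> ln x <= s^-1 * x `^ s.
Proof.
move=> s0 x1; have x0 : 0 < x by lra.
rewrite ler_pdivlMl// -ln_powR.
have := @le_ln1Dx R (x `^ s - 1); rewrite (addrC 1) subrK => h.
by have := h ltac:(have := powR_gt0 s x0; lra); lra.
Qed.

Lemma ln_powR_le p s : 0 <= p -> 0 < s ->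
  exists2 C, 0 < C & forall x, 1 <= x -> ln x `^ p <= C * x `^ s.
Proof.
move=> p0 s0; have [->|pn0] := eqVneq p 0.
  exists 1; first by []; move=> x x1; rewrite powRr0 mul1r.
  by rewrite -[leLHS](powRr0 x) ler_powR// ltW.
have pp : 0 < p by rewrite lt_neqAle eq_sym pn0.
exists ((s / p)^-1 `^ p) => [|x x1].
  by rewrite powR_gt0// invr_gt0 divr_gt0.
have h := ln_le_powR (divr_gt0 s0 pp) x1.
have -> : x `^ s = (x `^ (s / p)) `^ p by rewrite -powRrM divfK.
rewrite -powRM ?powR_ge0 ?invr_ge0 ?divr_ge0//; last exact: ltW.
rewrite ge0_ler_powR// ?nnegrE ?ln_ge0// mulr_ge0 ?powR_ge0// invr_ge0 divr_ge0//.
exact: ltW.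
Qed.

Lemma powRN_mono a b p : 0 <= p -> 0 < a -> a <= b -> b `^ (- p) <= a `^ (- p).
Proof.
move=> p0 a0 ab; rewrite !powRN lef_pV2 ?posrE ?powR_gt0//; last exact: lt_le_trans ab.
rewrite ge0_ler_powR// ?nnegrE; [exact: ltW|apply: ltW; exact: lt_le_trans ab].
Qed.

(** Once the quotient of the two powers is written as an exponential, this mean value bound and the
    one of [powR_sub_le] follow from [1 + s <= exp s] and [ln (1 + s) <= s]. *)
Lemma powR_sub_ge q a b : 0 < q -> 0 < a -> a <= b ->
  q * (b - a) * b `^ (- (q + 1)) <= a `^ (- q) - b `^ (- q).
Proof.
move=> q0 a0 ab; have b0 : 0 < b by exact: lt_le_trans ab.
have -> : a `^ (- q) = b `^ (- q) * expR (q * (ln b - ln a)).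
  rewrite /powR !gt_eqF// -expRD; congr expR; ring.
have h1 : (b - a) / b <= ln b - ln a.
  have := @le_ln1Dx R (a / b - 1).
  rewrite (addrC 1) subrK ln_div ?posrE// => h.
  have : -1 < a / b - 1 by rewrite ltrBrDl subrr divr_gt0.
  by move/h; rewrite mulrBl divff ?gt_eqF//; lra.
have h2 : 1 + q * (ln b - ln a) <= expR (q * (ln b - ln a)) by exact: expR_ge1Dx.
rewrite opprD powRD_gt0// powR_inv1; last exact: ltW.
have -> : q * (b - a) * (b `^ (- q) / b) = b `^ (- q) * (q * ((b - a) / b)) by ring.
rewrite -[X in _ <= _ - X]mulr1 -mulrBr ler_pM2l ?powR_gt0//.
apply: le_trans (_ : q * (ln b - ln a) <= _); last lra.
by rewrite ler_pM2l.
Qed.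

Lemma powR_sub_le q a b : 0 < q -> 0 < a -> a <= b ->
  a `^ (- q) - b `^ (- q) <= q * (b - a) * a `^ (- (q + 1)).
Proof.
move=> q0 a0 ab; have b0 : 0 < b by exact: lt_le_trans ab.
have -> : b `^ (- q) = a `^ (- q) * expR (q * (ln a - ln b)).
  rewrite /powR !gt_eqF// -expRD; congr expR; ring.
have h1 : ln b - ln a <= (b - a) / a.
  have := @le_ln1Dx R (b / a - 1).
  rewrite (addrC 1) subrK ln_div ?posrE// => h.
  have : -1 < b / a - 1 by rewrite ltrBrDl subrr divr_gt0.
  by move/h; rewrite mulrBl divff ?gt_eqF//; lra.
have h2 : 1 + q * (ln a - ln b) <= expR (q * (ln a - ln b)) by exact: expR_ge1Dx.
rewrite opprD powRD_gt0// powR_inv1; last exact: ltW.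
have -> : q * (b - a) * (a `^ (- q) / a) = a `^ (- q) * (q * ((b - a) / a)) by ring.
rewrite -[X in X - _ <= _]mulr1 -mulrBr ler_pM2l ?powR_gt0//.
apply: le_trans (_ : q * (ln b - ln a) <= _); first lra.
by rewrite ler_pM2l.
Qed.

Lemma powR_dist_le q a b m : 0 < q -> 0 < m -> m <= a -> m <= b ->
  `|a `^ (- q) - b `^ (- q)| <= q * `|a - b| * m `^ (- (q + 1)).
Proof.
move=> q0 m0 ma mb.
wlog ab : a b ma mb / a <= b.
  move=> H; have [ab|/ltW ba] := leP a b; first exact: H.
  by rewrite distrC (distrC a); exact: H.
have a0 : 0 < a by exact: lt_le_trans ma.
rewrite (distrC a) (ger0_norm (_ : 0 <= b - a)) ?subr_ge0//.
rewrite ger0_norm ?subr_ge0; last by rewrite powRN_mono// ltW.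
apply: le_trans (powR_sub_le q0 a0 ab) _.
rewrite ler_wpM2l//; first by rewrite mulr_ge0 ?subr_ge0// ltW.
by rewrite powRN_mono//; lra.
Qed.

(** Integral test by telescoping: [powR_sub_ge] bounds each term after the first by [1/q] times a
    difference of consecutive values of [n^(-q)], with [q = p - 1]. *)
Lemma sum_powR_bounded p : 1 < p ->
  exists2 C, 0 < C & forall n, \sum_(0 <= i < n) (i.+1%:R : R) `^ (- p) <= C.
Proof.
move=> p1; pose q := p - 1; have q0 : 0 < q by rewrite subr_gt0.
exists (1 + q^-1) => [|n]; first by rewrite addr_gt0// invr_gt0.
case: n => [|n]; first by rewrite big_nil addr_ge0// invr_ge0 ltW.
suff : \sum_(0 <= i < n.+1) (i.+1%:R : R) `^ (- p) <=
   1 + q^-1 * (1 - (n.+1%:R : R) `^ (- q)).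
  move/le_trans; apply; rewrite lerD2l -[leRHS]mulr1 ler_wpM2l ?invr_ge0//; first exact: ltW.
elim: n => [|n IH]; first by rewrite big_nat1 !powR1 subrr mulr0 addr0.
rewrite big_nat_recr//=; apply: le_trans (lerD IH (lexx _)) _.
rewrite -addrA lerD2l.
have := @powR_sub_ge q n.+1%:R n.+2%:R q0.
rewrite ltr0n ler_nat => /(_ isT (leqnSn _)).
rewrite -natrB// subSnn mulr1 (_ : q + 1 = p); last by rewrite /q subrK.
rewrite -ler_pdivlMl// => h; rewrite -lerBrDl.
apply: le_trans h _; rewrite le_eqVlt; apply/orP; left; apply/eqP; ring.
Qed.

End real_inequalities.

(** * Sums of nonnegative extended families *)

Section esum_theory.
Local Open Scope ereal_scope.
Variable R : realType.

Lemma esum_le_fin (T : choiceType) (a : T -> \bar R) C :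
  (forall s : seq T, uniq s -> \sum_(i <- s) a i <= C) ->
  \esum_(i in [set: T]) a i <= C.
Proof.
move=> h; apply: ge_ereal_sup => _ [X [finX _] <-].
by rewrite fsbig_finite//=; apply: h; exact: finmap.fset_uniq.
Qed.

Lemma esum_ge_fin (T : choiceType) (a : T -> \bar R) (s : seq T) : uniq s ->
  (forall i, 0 <= a i) -> \sum_(i <- s) a i <= \esum_(i in [set: T]) a i.
Proof.
move=> us a0; apply: esum_ge; exists [set` s].
  by split => //; exact: finite_seq.
by rewrite fsbig_seq.
Qed.

Lemma esum_ge_pt (T : choiceType) (a : T -> \bar R) i :
  (forall i, 0 <= a i) -> a i <= \esum_(i in [set: T]) a i.
Proof.
by move=> a0; have := @esum_ge_fin _ a [:: i] isT a0; rewrite big_seq1.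
Qed.

Lemma esum_ge_fintype (T : choiceType) (I : finType) (P : pred I) (f : I -> T)
    (a : T -> \bar R) : injective f -> (forall i, 0 <= a i) ->
  \sum_(i | P i) a (f i) <= \esum_(i in [set: T]) a i.
Proof.
move=> finj a0; rewrite -big_filter -(big_map f xpredT).
by apply: esum_ge_fin => //; rewrite map_inj_uniq// filter_uniq// index_enum_uniq.
Qed.

Lemma esumZl (T : choiceType) (a : T -> \bar R) (c : R) : (0 <= c)%R ->
  (forall i, 0 <= a i) ->
  \esum_(i in [set: T]) (c%:E * a i) = c%:E * \esum_(i in [set: T]) a i.
Proof.
have H (b : T -> \bar R) (e : R) : (0 <= e)%R -> (forall i, 0 <= b i) ->
    \esum_(i in [set: T]) (e%:E * b i) <= e%:E * \esum_(i in [set: T]) b i.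
  move=> e0 b0; apply: esum_le_fin => s us.
  rewrite -ge0_sume_distrr// lee_wpmul2l ?lee_fin//.
  exact: esum_ge_fin.
move=> c0 a0; apply/eqP; rewrite eq_le H//=.
have [->|cn0] := eqVneq c 0%R; first by rewrite mul0e esum_ge0// => i _; rewrite mul0e.
have cp : (0 < c)%R by rewrite lt_neqAle eq_sym cn0.
have := H (fun i => c%:E * a i) c^-1%R; rewrite invr_ge0 => /(_ c0).
under eq_esum do rewrite muleA -EFinM mulVf// mul1e.
move=> h; rewrite -lee_pdivlMl//; apply: h => i.
by rewrite mule_ge0.
Qed.

Lemma esum_exchange (T1 T2 : choiceType) (a : T1 -> T2 -> \bar R) :
  (forall i j, 0 <= a i j) ->
  \esum_(i in [set: T1]) \esum_(j in [set: T2]) a i j =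
  \esum_(j in [set: T2]) \esum_(i in [set: T1]) a i j.
Proof.
move=> a0; rewrite !esum_esum//.
rewrite (reindex_esum ([set: T2] `*`` (fun=> [set: T1]))
  ([set: T1] `*`` (fun=> [set: T2])) (fun x => (x.2, x.1)))//=.
split => //= [|[x y] _]; first by move=> [x y] [x' y'] _ _ /= [-> ->].
by exists (y, x).
Qed.

Lemma esum_shift (T : zmodType) (a : T -> \bar R) (m : T) :
  \esum_(i in [set: T]) a (i + m)%R = \esum_(i in [set: T]) a i.
Proof.
rewrite [RHS](reindex_esum [set: T] _ (fun i => i + m)%R)//=.
split => //= [x y _ _ /addIr //|y _]; exists (y - m)%R => //.
by rewrite subrK.
Qed.

Lemma esum_opp (T : zmodType) (a : T -> \bar R) :
  \esum_(i in [set: T]) a (- i)%R = \esum_(i in [set: T]) a i.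
Proof.
by rewrite [RHS](reindex_esum [set: T] _ (fun i => - i)%R).
Qed.

Lemma esum_finType (I : finType) (T : choiceType) (f : I -> T) (a : T -> \bar R) :
  injective f -> (forall i, 0 <= a i) -> (forall x, ~ range f x -> a x = 0) ->
  \esum_(i in [set: T]) a i = \sum_i a (f i).
Proof.
move=> finj a0 asupp; rewrite -big_enum -(big_map f xpredT).
have us : uniq [seq f i | i <- enum I] by rewrite map_inj_uniq// enum_uniq.
apply/eqP; rewrite eq_le esum_ge_fin// andbT.
apply: esum_le_fin => t ut.
rewrite (bigID (mem [seq f i | i <- enum I]))/= [X in _ + X]big1 => [|x xn]; last first.
  apply: asupp => -[i _ fx]; move/negP: xn; apply; rewrite -fx.
  by rewrite map_f// mem_enum.
rewrite adde0 -big_filter.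
rewrite [leRHS](bigID (mem t))/= -[X in X + _]big_filter.
rewrite [X in X <= _](_ : _ = \sum_(x <- [seq x <- [seq f i | i <- enum I] | x \in t]) a x).
  by rewrite leeDl// sume_ge0.
apply: perm_big; apply: uniq_perm; rewrite ?filter_uniq// => x.
by rewrite !mem_filter andbC.
Qed.

End esum_theory.

(** * Signed sums over an arbitrary index type *)

Section real_sums.
Variables (R : realType) (T : choiceType).
Implicit Types f g : T -> R.

Definition nnsum f : \bar R := (\esum_(i in [set: T]) (f i)%:E)%E.

Definition fins f : bool := (nnsum f < +oo)%E.

Definition summableR f := fins (fun i => `|f i|).

(** Same shape as [lsum] on the whole index type, so that [Lk] can be rewritten with it. Since
    [fine] maps [+oo] to 0, additivity needs summability. *)
Definition rsum f : R :=
  fine (nnsum (fun i => Num.max (f i) 0)) - fine (nnsum (fun i => Num.max (- f i) 0)).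

Lemma nnsum_ge0 f : (forall i, 0 <= f i) -> (0 <= nnsum f)%E.
Proof. by move=> f0; apply: esum_ge0 => i _; rewrite lee_fin. Qed.

Lemma le_nnsum f g : (forall i, f i <= g i) -> (nnsum f <= nnsum g)%E.
Proof. by move=> fg; apply: le_esum => i _; rewrite lee_fin. Qed.

Lemma eq_nnsum f g : f =1 g -> nnsum f = nnsum g.
Proof. by move=> /funext ->. Qed.

Lemma nnsumD f g : (forall i, 0 <= f i) -> (forall i, 0 <= g i) ->
  nnsum (fun i => f i + g i) = (nnsum f + nnsum g)%E.
Proof.
by move=> f0 g0; rewrite /nnsum -esumD// => i _; rewrite lee_fin.
Qed.

Lemma nnsumZ c f : 0 <= c -> (forall i, 0 <= f i) ->
  nnsum (fun i => c * f i) = (c%:E * nnsum f)%E.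
Proof. by move=> c0 f0; rewrite /nnsum -esumZl// => i; rewrite lee_fin. Qed.

Lemma nnsumK f : (forall i, 0 <= f i) -> fins f ->
  (fine (nnsum f))%:E = nnsum f.
Proof. by move=> f0 fy; rewrite fineK// ge0_fin_numE// nnsum_ge0. Qed.

Lemma fins_le f g : (forall i, f i <= g i) -> fins g -> fins f.
Proof. by move=> fg; apply: le_lt_trans; exact: le_nnsum. Qed.

Lemma finsD f g : (forall i, 0 <= f i) -> (forall i, 0 <= g i) ->
  fins f -> fins g -> fins (fun i => f i + g i).
Proof. by move=> f0 g0 sf sg; rewrite /fins nnsumD//; exact: lte_add_pinfty. Qed.

Lemma finsZ c f : 0 <= c -> (forall i, 0 <= f i) -> fins f -> fins (fun i => c * f i).
Proof.
by move=> c0 f0 sf; rewrite /fins nnsumZ//; exact: lte_mul_pinfty.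
Qed.

Lemma fine_nnsumZ c f : 0 <= c -> (forall i, 0 <= f i) -> fins f ->
  fine (nnsum (fun i => c * f i)) = c * fine (nnsum f).
Proof. by move=> c0 f0 sf; rewrite nnsumZ// -(nnsumK f0 sf). Qed.

Lemma fine_nnsumD f g : (forall i, 0 <= f i) -> (forall i, 0 <= g i) ->
  fins f -> fins g ->
  fine (nnsum (fun i => f i + g i)) = fine (nnsum f) + fine (nnsum g).
Proof. by move=> f0 g0 sf sg; rewrite nnsumD// -(nnsumK f0 sf) -(nnsumK g0 sg). Qed.

Lemma le_fine_nnsum f g : (forall i, 0 <= f i) -> (forall i, f i <= g i) ->
  fins g -> fine (nnsum f) <= fine (nnsum g).
Proof.
move=> f0 fg sg; have g0 i : 0 <= g i by exact: le_trans (f0 i) (fg i).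
by rewrite -lee_fin !nnsumK//; [exact: le_nnsum|exact: fins_le sg].
Qed.

Lemma fine_nnsum_ge0 f : (forall i, 0 <= f i) -> 0 <= fine (nnsum f).
Proof. by move=> f0; rewrite fine_ge0// nnsum_ge0. Qed.

Lemma fins_sub_bound f C : (nnsum f <= C%:E)%E -> fins f.
Proof. by move=> h; exact: le_lt_trans h (ltry _). Qed.

Lemma fine_nnsum_le f C : (forall i, 0 <= f i) -> (nnsum f <= C%:E)%E ->
  fine (nnsum f) <= C.
Proof. by move=> f0 h; rewrite -lee_fin nnsumK//; exact: fins_sub_bound h. Qed.

Lemma summable_le f g : (forall i, `|f i| <= g i) -> fins g -> summableR f.
Proof. by move=> fg; apply: le_lt_trans; exact: le_nnsum. Qed.

Lemma nnsum_fin_summable f : (forall i, 0 <= f i) -> fins f -> summableR f.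
Proof. by move=> f0; apply: summable_le => i; rewrite ger0_norm. Qed.

Lemma summableRD f g : summableR f -> summableR g -> summableR (fun i => f i + g i).
Proof.
move=> sf sg; apply: (@summable_le _ (fun i => `|f i| + `|g i|)) => [i|].
  exact: ler_normD.
exact: finsD.
Qed.

Lemma summableRZ c f : summableR f -> summableR (fun i => c * f i).
Proof.
move=> sf; apply: (@summable_le _ (fun i => `|c| * `|f i|)) => [i|].
  by rewrite normrM.
exact: finsZ.
Qed.

Lemma summableRN f : summableR f -> summableR (fun i => - f i).
Proof. by apply: summable_le => i; rewrite normrN. Qed.

(** From [f^+ + b = f^- + a]: every splitting of [f] into nonnegative parts of finite sum computes
    the same value, so linearity of [rsum] reduces to choosing a splitting. *)
Lemma rsum_decomp f a b : (forall i, 0 <= a i) -> (forall i, 0 <= b i) ->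
  fins a -> fins b -> (forall i, f i = a i - b i) ->
  rsum f = fine (nnsum a) - fine (nnsum b).
Proof.
move=> a0 b0 ay by_ fE.
have p0 i : 0 <= Num.max (f i) 0 by rewrite le_max lexx orbT.
have n0 i : 0 <= Num.max (- f i) 0 by rewrite le_max lexx orbT.
have py : fins (fun i => Num.max (f i) 0).
  by apply: le_lt_trans ay; apply: le_nnsum => i; rewrite ge_max a0 andbT fE gerBl.
have ny : fins (fun i => Num.max (- f i) 0).
  by apply: le_lt_trans by_; apply: le_nnsum => i; rewrite ge_max b0 andbT fE opprB gerBl.
have : (nnsum (fun i => Num.max (f i) 0)%R + nnsum b =
        nnsum (fun i => Num.max (- f i) 0)%R + nnsum a)%E.
  rewrite -!nnsumD//; apply: eq_nnsum => i.
  have [h|h] := leP (f i) 0; have [h'|h'] := leP (- f i) 0; have := fE i; lra.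
rewrite -(nnsumK p0 py) -(nnsumK n0 ny) -(nnsumK a0 ay) -(nnsumK b0 by_) -!EFinD.
by move=> [] h; rewrite /rsum; lra.
Qed.

Lemma summable_pos f : summableR f ->
  fins (fun i => Num.max (f i) 0) /\
  fins (fun i => Num.max (- f i) 0).
Proof.
move=> sf; split; apply: le_lt_trans sf; apply: le_nnsum => i.
  by rewrite ge_max normr_ge0 ler_norm.
by rewrite ge_max normr_ge0 -normrN ler_norm.
Qed.

Lemma posnegE f i : f i = Num.max (f i) 0 - Num.max (- f i) 0.
Proof. by have [h|h] := leP (f i) 0; have [h'|h'] := leP (- f i) 0; lra. Qed.

Let max0 (x : R) : 0 <= Num.max x 0. Proof. by rewrite le_max lexx orbT. Qed.

Lemma rsum_nneg f : (forall i, 0 <= f i) -> fins f -> rsum f = fine (nnsum f).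
Proof.
have z : nnsum (fun=> 0 : R) = 0%E by rewrite /nnsum esum1.
move=> f0 fy; rewrite (@rsum_decomp f f (fun=> 0))// ?z ?subr0// => [|i].
  by rewrite /fins z.
by rewrite subr0.
Qed.

Lemma rsumD f g : summableR f -> summableR g ->
  rsum (fun i => f i + g i) = rsum f + rsum g.
Proof.
move=> /summable_pos[fp fn] /summable_pos[gp gn].
rewrite (@rsum_decomp _ (fun i => Num.max (f i) 0 + Num.max (g i) 0)
  (fun i => Num.max (- f i) 0 + Num.max (- g i) 0)).
- rewrite !nnsumD// !fineD ?ge0_fin_numE ?nnsum_ge0// /rsum.
  ring.
- by move=> i; rewrite addr_ge0.
- by move=> i; rewrite addr_ge0.
- exact: finsD.
- exact: finsD.
- by move=> i; rewrite {1}(posnegE f) {1}(posnegE g); ring.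
Qed.

Lemma rsumN f : rsum (fun i => - f i) = - rsum f.
Proof.
rewrite /rsum opprB; congr (_ - fine _).
by apply: eq_nnsum => i; rewrite opprK.
Qed.

Lemma rsumB f g : summableR f -> summableR g ->
  rsum (fun i => f i - g i) = rsum f - rsum g.
Proof. by move=> sf sg; rewrite rsumD// ?rsumN//; exact: summableRN. Qed.

Lemma rsumZ c f : summableR f -> rsum (fun i => c * f i) = c * rsum f.
Proof.
wlog c0 : c / 0 <= c => [H sf|].
  have [c0|c0] := leP 0 c; first exact: H.
  transitivity (rsum (fun i => - ((- c) * f i))).
    by congr rsum; apply/funext => i; rewrite mulNr opprK.
  by rewrite rsumN H// ?mulNr ?opprK// oppr_ge0 ltW.
move=> /summable_pos[fp fn].
rewrite (@rsum_decomp _ (fun i => c * Num.max (f i) 0) (fun i => c * Num.max (- f i) 0)).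
- by rewrite /rsum mulrBr; congr (_ - _); exact: fine_nnsumZ.
- by move=> i; rewrite mulr_ge0.
- by move=> i; rewrite mulr_ge0.
- exact: finsZ.
- exact: finsZ.
- by move=> i; rewrite -mulrBr -posnegE.
Qed.

Lemma rsum_norm_le f : summableR f -> `|rsum f| <= fine (nnsum (fun i => `|f i|)).
Proof.
move=> sf; have [fp fn] := summable_pos sf.
have -> : nnsum (fun i => `|f i|) =
  (nnsum (fun i => Num.max (f i) 0)%R + nnsum (fun i => Num.max (- f i) 0)%R)%E.
  rewrite -nnsumD//; apply: eq_nnsum => i.
  have [h|h] := leP (f i) 0; have [h'|h'] := leP (- f i) 0;
    rewrite ?(ler0_norm h) ?(gtr0_norm h); lra.
rewrite fineD ?ge0_fin_numE ?nnsum_ge0// /rsum.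
apply: le_trans (ler_normB _ _) _.
by rewrite !ger0_norm// fine_ge0// nnsum_ge0.
Qed.

Lemma rsum_norm_bound f g : (forall i, `|f i| <= g i) -> fins g ->
  `|rsum f| <= fine (nnsum g).
Proof.
move=> fg gy; apply: le_trans (rsum_norm_le (summable_le fg gy)) _.
have g0 i : 0 <= g i by exact: le_trans (fg i).
rewrite -lee_fin !nnsumK//; first exact: le_nnsum.
exact: summable_le gy.
Qed.

Lemma rsum_fin (I : finType) (h : I -> T) f : injective h ->
  (forall x, ~ range h x -> f x = 0) -> rsum f = \sum_i f (h i).
Proof.
move=> hinj fsupp; rewrite /rsum /nnsum !(esum_finType hinj).
- rewrite !sumEFin/= -sumrB; apply: eq_bigr => i _.
  by rewrite -posnegE.
- by move=> i; rewrite lee_fin.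
- by move=> x /fsupp ->; rewrite oppr0 maxxx.
- by move=> i; rewrite lee_fin.
- by move=> x /fsupp ->; rewrite maxxx.
Qed.

(** Finiteness comes from [u <= 1 + u^2], the inequality from expanding [p (u - m)^2 >= 0] with [m]
    the weighted sum. Total weight at most 1 is enough, because it only multiplies [m^2]. *)
Lemma nnsum_jensen (p u : T -> R) : (forall i, 0 <= p i) -> (forall i, 0 <= u i) ->
  (nnsum p <= 1)%E -> fins (fun i => p i * u i ^+ 2) ->
  fins (fun i => (p i * u i)%R) /\
  fine (nnsum (fun i => p i * u i)) ^+ 2 <= fine (nnsum (fun i => p i * u i ^+ 2)).
Proof.
move=> p0 u0 p1 s2.
have pu0 i : 0 <= p i * u i by rewrite mulr_ge0.
have pu20 i : 0 <= p i * u i ^+ 2 by rewrite mulr_ge0// sqr_ge0.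
have puy : fins (fun i => (p i * u i)%R).
  apply: (@le_lt_trans _ _ (nnsum (fun i => p i + p i * u i ^+ 2))).
    apply: le_nnsum => i.
    rewrite -[X in _ <= X + _]mulr1 -mulrDr ler_wpM2l//.
    by have := sqr_ge0 (u i - 1); have := u0 i; nra.
  by apply: finsD => //; exact: le_lt_trans p1 (ltry _).
split => //.
set m := fine _; have m0 : 0 <= m by rewrite fine_ge0// nnsum_ge0.
have : (nnsum (fun i => (2 * m) * (p i * u i))%R <=
        nnsum (fun i => p i * u i ^+ 2 + m ^+ 2 * p i)%R)%E.
  apply: le_nnsum => i.
  by have := mulr_ge0 (p0 i) (sqr_ge0 (u i - m)); nra.
rewrite nnsumD// => [|i]; last by rewrite mulr_ge0// sqr_ge0.
rewrite !nnsumZ ?mulr_ge0 ?sqr_ge0//.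
rewrite -(nnsumK pu0 puy) -/m -(nnsumK pu20 s2) -EFinM => h.
have : ((2 * m * m)%:E <= (fine (nnsum (fun i => p i * u i ^+ 2)) + m ^+ 2)%R%:E)%E.
  apply: le_trans h _; rewrite EFinD leeD2l//.
  by rewrite -[leRHS]mule1 lee_wpmul2l// lee_fin sqr_ge0.
rewrite lee_fin /=; nra.
Qed.

End real_sums.

(** * The Euclidean norm on lattice points *)

Section lattice.
Variables (R : realType) (d : nat).
Local Notation L := 'rV[int]_d.
Implicit Types m z : L.

Definition lnorm m : R := eucl (map_mx intr m : 'rV[R]_d).

Lemma eucl_ge0 (v : 'rV[R]_d) : 0 <= eucl v.
Proof. exact: sqrtr_ge0. Qed.

Lemma sqr_eucl (v : 'rV[R]_d) : eucl v ^+ 2 = \sum_i v 0 i ^+ 2.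
Proof. by rewrite sqr_sqrtr// sumr_ge0// => i _; exact: sqr_ge0. Qed.

Lemma eucl_coord (v : 'rV[R]_d) i : `|v 0 i| <= eucl v.
Proof.
rewrite -sqrtr_sqr ler_sqrt; last by rewrite sumr_ge0// => j _; exact: sqr_ge0.
by rewrite (bigD1 i)//= lerDl sumr_ge0// => j _; exact: sqr_ge0.
Qed.

Lemma eucl_le_max (v : 'rV[R]_d) c : 0 <= c -> (forall i, `|v 0 i| <= c) ->
  eucl v <= Num.sqrt d%:R * c.
Proof.
move=> c0 vc; rewrite -[X in _ * X](ger0_norm c0) -sqrtr_sqr -sqrtrM//.
rewrite ler_sqrt; last by rewrite mulr_ge0// sqr_ge0.
apply: le_trans (_ : \sum_(i < d) c ^+ 2 <= _).
  apply: ler_sum => i _.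
  by rewrite -real_normK ?num_real// ler_sqr ?nnegrE.
by rewrite sumr_const card_ord mulr_natl.
Qed.

Lemma euclZ (c : R) (v : 'rV[R]_d) : eucl (c *: v) = `|c| * eucl v.
Proof.
rewrite /eucl -sqrtr_sqr -sqrtrM ?sqr_ge0// mulr_sumr; congr Num.sqrt.
by apply: eq_bigr => i _; rewrite mxE exprMn.
Qed.

Lemma euclN (v : 'rV[R]_d) : eucl (- v) = eucl v.
Proof. by rewrite -scaleN1r euclZ normrN1 mul1r. Qed.

Lemma eucl0 : eucl (0 : 'rV[R]_d) = 0.
Proof. by rewrite /eucl big1 ?sqrtr0// => i _; rewrite mxE expr0n. Qed.

Lemma euclD (u v : 'rV[R]_d) : eucl (u + v) <= eucl u + eucl v.
Proof.
rewrite -(ler_sqr (_ : _ \is Num.nneg)) ?nnegrE ?eucl_ge0 ?addr_ge0 ?eucl_ge0//.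
rewrite sqr_eucl sqrrD !sqr_eucl -[X in _ + X + _]mulr_natl.
under eq_bigr do rewrite mxE sqrrD -[X in _ + X + _]mulr_natl.
rewrite !big_split/= lerD2r lerD2l -mulr_sumr.
by rewrite ler_pM2l// CauchySchwarz_sqrt.
Qed.

Lemma lnorm_ge0 m : 0 <= lnorm m. Proof. exact: eucl_ge0. Qed.

Lemma lnorm0 : lnorm 0 = 0.
Proof. by rewrite /lnorm map_mx0 eucl0. Qed.

Lemma lnormN m : lnorm (- m) = lnorm m.
Proof. by rewrite /lnorm map_mxN euclN. Qed.

Lemma lnorm_ge_coord m i : `|(m 0 i)%:~R| <= lnorm m.
Proof. by have := eucl_coord (map_mx intr m) i; rewrite mxE. Qed.

Lemma lnorm_ge1 m : m != 0 -> 1 <= lnorm m.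
Proof.
move=> m0; have [i mi] : exists i, m 0 i != 0.
  apply/existsP; rewrite -[X in is_true X]negbK negb_exists; apply/negP => /forallP h.
  by move/negP: m0; apply; apply/eqP/rowP => i; rewrite mxE; apply/eqP; rewrite -[_ == _]negbK.
apply: le_trans (lnorm_ge_coord m i).
rewrite -intr_norm -[1](mulr1z 1) ler_int.
by move: (m 0 i) mi; lia.
Qed.

Lemma lnorm_gt0 m : m != 0 -> 0 < lnorm m.
Proof. by move/lnorm_ge1; exact: lt_le_trans. Qed.

Lemma eucl_latpt (k : nat) z z' :
  eucl (latpt R k z - latpt R k z') = lnorm (z - z') / k%:R.
Proof.
have -> : latpt R k z - latpt R k z' = (k%:R)^-1 *: map_mx intr (z - z').
  by apply/rowP => i; rewrite !mxE intrB mulrBr ![_^-1 * _]mulrC.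
by rewrite euclZ ger0_norm ?invr_ge0// mulrC.
Qed.

(** This includes negative [p]: the jump kernel vanishes on the diagonal, so sums over the whole
    lattice need not exclude the origin. *)
Lemma lnorm_powR0 (p : R) : p != 0 -> lnorm 0 `^ p = 0.
Proof. by move=> p0; rewrite lnorm0 powR0. Qed.

End lattice.

(** * Finite boxes of the lattice *)

Section box.
Variable d : nat.
Local Notation L := 'rV[int]_d.

(** The half-open cube [[-N, N)^d], shifted to nonnegative coordinates. Its side [2 N] is a power of
    two when [N] is, so it splits exactly into dyadic cubes. *)
Definition box (N : nat) := {ffun 'I_d -> 'I_N.*2}.

Definition boxpt N (F : box N) : L := \row_i ((F i : nat)%:Z - N%:Z).

Lemma boxpt_inj N : injective (@boxpt N).
Proof.
move=> F G /rowP h; apply/ffunP => i; apply: val_inj.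
by have := h i; rewrite !mxE /=; lia.
Qed.

Lemma boxptP N (m : L) : (forall i, - N%:Z <= m 0 i < N%:Z) -> range (@boxpt N) m.
Proof.
move=> h; have hb i : (absz (m 0%R i + N%:Z)%R < N.*2)%N by have := h i; lia.
exists [ffun i => Ordinal (hb i)] => //; apply/rowP => i.
by rewrite mxE ffunE/=; have := h i; lia.
Qed.

Lemma boxpt_bound N (F : box N) i : - N%:Z <= boxpt F 0 i < N%:Z.
Proof. by rewrite mxE; have := ltn_ord (F i); lia. Qed.

Lemma boxPn N (m : L) : ~ range (@boxpt N) m -> exists i, N%:Z <= `|m 0 i|.
Proof.
move=> h; apply: contrapT => /forallNP h2; apply: h; apply: boxptP => i.
by have := h2 i; lia.
Qed.

Lemma seq_in_box (s : seq L) : exists N, forall m, m \in s -> range (@boxpt N) m.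
Proof.
elim: s => [|m s [N IH]]; first by exists 0%N.
exists (N + \sum_i (absz (m 0%R i)).+1)%N => m'; rewrite inE => /orP[/eqP ->|ms].
  apply: boxptP => i; have : ((absz (m 0%R i)).+1 <= \sum_i (absz (m 0%R i)).+1)%N.
    by rewrite (bigD1 i)//= leq_addr.
  lia.
have [F _ FE] := IH _ ms; apply: boxptP => i.
by have := boxpt_bound F i; rewrite FE; lia.
Qed.

Lemma card_box N : #|{: box N}| = (N.*2 ^ d)%N.
Proof. by rewrite card_ffun !card_ord. Qed.

End box.

(** * Summability of power kernels and Schur-type bounds *)

Section lattice_sums.
Variables (R : realType) (d : nat).
Local Notation L := 'rV[int]_d.

Lemma nnsum_prod_le (f : int -> R) (C : R) : (forall n, 0 <= f n) ->
  (forall N : nat, \sum_(j < N.*2) f (j%:Z - N%:Z) <= C) ->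
  (nnsum (fun m : L => \prod_i f (m 0 i))%R <= (C ^+ d)%:E)%E.
Proof.
move=> f0 hC; apply: esum_le_fin => s us.
pose G (m : L) := \prod_i f (m 0 i).
have G0 m : 0 <= G m by exact: prodr_ge0.
have [N hN] := seq_in_box s.
apply: le_trans (_ : (\sum_(F : box d N) (G (boxpt F))%:E)%E <= _)%E; last first.
  rewrite sumEFin lee_fin.
  rewrite (eq_bigr (fun F : box d N => \prod_i f ((F i : nat)%:Z - N%:Z))) => [|F _].
    rewrite -(bigA_distr_bigA (fun i (j : 'I_N.*2) => f ((j : nat)%:Z - N%:Z)))/=.
    apply: le_trans (_ : \prod_(i < d) C <= _); last by rewrite prodr_const card_ord.
    by apply: ler_prod => i _; rewrite hC sumr_ge0.
  by apply: eq_bigr => i _; rewrite mxE.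
pose a (m : L) : \bar R := if `[< range (@boxpt d N) m >] then (G m)%:E else 0%E.
have a0 m : (0 <= a m)%E by rewrite /a; case: ifP; rewrite ?lee_fin.
have := esum_ge_fin us a0.
rewrite (@esum_finType _ _ _ (@boxpt d N) a (@boxpt_inj d N) a0); last first.
  by move=> x h; rewrite /a asboolF.
rewrite (eq_bigr (fun F => (G (boxpt F))%:E)); last first.
  by move=> F _; rewrite /a asboolT//; exists F.
apply: le_trans; rewrite le_eqVlt; apply/orP; left; apply/eqP.
rewrite [LHS]big_seq [RHS]big_seq; apply: eq_bigr => m ms.
by rewrite /a asboolT//; exact: hN.
Qed.

(** The norm dominates [max 1 |m_i|] for every [i] when [m != 0], so the power is at most a product
    over coordinates of one-dimensional powers of exponent [1 + e/d > 1]. *)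
Lemma fins_lnorm (e : R) : (0 < d)%N -> 0 < e ->
  fins (fun m : L => lnorm R m `^ (- (d%:R + e))).
Proof.
move=> d0 e0; have dR : 0 < d%:R :> R by rewrite ltr0n.
pose p := 1 + e / d%:R.
have p1 : 1 < p by rewrite ltrDl divr_gt0.
have [C C0 hC] := sum_powR_bounded p1.
pose f (n : int) : R := Num.max 1 `|n|%:~R `^ (- p).
have f0 n : 0 <= f n by exact: powR_ge0.
apply: (@fins_le _ _ _ (fun m : L => \prod_i f (m 0 i))) => [m|].
  have [->|m0] := eqVneq m 0.
    by rewrite lnorm_powR0 ?prodr_ge0// oppr_eq0 gt_eqF// addr_gt0.
  rewrite (_ : d%:R + e = p * d%:R); last by rewrite mulrDl divfK ?mul1r// gt_eqF.
  rewrite -mulNr powRrM powR_mulrn ?powR_ge0//.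
  rewrite -[X in _ ^+ X]card_ord -prodr_const.
  apply: ler_prod => i _; rewrite powR_ge0/=.
  apply: powRN_mono; first by apply: ltW; exact: lt_trans p1.
    by rewrite lt_max ltr01.
  by rewrite ge_max lnorm_ge1//= intr_norm lnorm_ge_coord.
apply: (@fins_sub_bound _ _ _ ((1 + C + C) ^+ d)).
apply: nnsum_prod_le => // N.
rewrite -addnn big_split_ord/=.
have h1 : \sum_(i < N) f (i%:Z - N%:Z) <= C.
  rewrite (reindex_inj rev_ord_inj)/=.
  apply: le_trans (hC N); rewrite big_mkord.
  apply: ler_sum => i _; rewrite le_eqVlt; apply/orP; left; apply/eqP.
  rewrite /f (_ : `|_ : int| = (i.+1)%:Z); last by have := ltn_ord i; lia.
  by rewrite max_r// ler1n.
have h2 : \sum_(i < N) f ((N + i)%N%:Z - N%:Z) <= 1 + C.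
  case: N {h1} => [|N]; first by rewrite big_ord0 addr_ge0// ltW.
  rewrite big_ord_recl; apply: lerD.
    by rewrite /f addn0 subrr normr0 max_l// powR1.
  apply: le_trans (hC N); rewrite big_mkord.
  apply: ler_sum => i _; rewrite le_eqVlt; apply/orP; left; apply/eqP.
  rewrite /f (_ : `|_ : int| = (i.+1)%:Z); last by rewrite lift0; lia.
  by rewrite max_r// ler1n.
by lra.
Qed.

(* A symmetrised second difference at x with step m vanishes unless one of x,
   x + m, x - m meets the (small) support carried by chi. *)
Lemma esum_schur1 (b chi : L -> R) (n S : R) :
  (forall m, 0 <= b m) -> (forall m, 0 <= chi m) ->
  (nnsum b <= S%:E)%E -> (nnsum chi <= n%:E)%E -> 0 <= n ->
  (\esum_(x in [set: L]) nnsum (fun m => b m * (chi x + chi (x + m) + chi (x - m))%R)%R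
   <= (3 * n * S)%:E)%E.
Proof.
move=> b0 c0 hS hn n0; rewrite /nnsum esum_exchange; last first.
  by move=> x m; rewrite lee_fin mulr_ge0// !addr_ge0.
apply: le_trans (_ : (\esum_(m in [set: L]) ((3 * n)%:E * (b m)%:E) <= _)%E).
  apply: le_esum => m _.
  have -> : (\esum_(i in [set: L])
      (b m * (chi i + chi (i + m)%R + chi (i - m)%R))%:E)%E =
      ((b m)%:E * nnsum (fun i => chi i + chi (i + m) + chi (i - m))%R)%E.
    by rewrite -nnsumZ// => i; rewrite !addr_ge0.
  rewrite !nnsumD// => [|i]; last by rewrite addr_ge0.
  rewrite /nnsum (esum_shift (fun i => (chi i)%:E) m) (esum_shift (fun i => (chi i)%:E) (- m)).
  rewrite muleC lee_wpmul2r ?lee_fin//.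
  apply: le_trans (leeD (leeD hn hn) hn) _.
  by rewrite -!EFinD lee_fin; lra.
rewrite esumZl ?mulr_ge0//.
by rewrite [leRHS]EFinM lee_wpmul2l// lee_fin mulr_ge0.
Qed.

(** Bounds a sum of squares by a supremum times a sum: each majorant is at most [3 S], and all of
    them together have mass at most [3 n S] by [esum_schur1]. *)
Lemma nnsum_schur2 (b chi F : L -> R) (n S : R) :
  (forall m, 0 <= b m) -> (forall m, 0 <= chi m <= 1) ->
  (nnsum b <= S%:E)%E -> (nnsum chi <= n%:E)%E -> 0 <= n ->
  (forall x, `|F x| <= fine (nnsum (fun m => b m * (chi x + chi (x + m) + chi (x - m))))) ->
  (nnsum (fun x => F x ^+ 2)%R <= (9 * n * S ^+ 2)%:E)%E.
Proof.
move=> b0 c01 hS hn n0 hF.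
have c0 m : 0 <= chi m by case/andP: (c01 m).
have c1 m : chi m <= 1 by case/andP: (c01 m).
have S0 : 0 <= S by rewrite -lee_fin; apply: le_trans hS; exact: nnsum_ge0.
pose B x m := b m * (chi x + chi (x + m) + chi (x - m)).
have B0 x m : 0 <= B x m by rewrite mulr_ge0// !addr_ge0.
have B3 x : (nnsum (B x) <= (3 * S)%:E)%E.
  apply: le_trans (_ : (nnsum (fun m => 3 * b m)%R <= _)%E).
    apply: le_nnsum => m; rewrite /B mulrC ler_wpM2r//.
    by have := c1 x; have := c1 (x + m); have := c1 (x - m); lra.
  by rewrite nnsumZ// EFinM lee_wpmul2l// lee_fin.
have Bfin x : fins (B x) by exact: fins_sub_bound (B3 x).
apply: le_trans (_ : (\esum_(x in [set: L]) ((3 * S)%:E * nnsum (B x)) <= _)%E).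
  apply: le_esum => x _.
  rewrite -(nnsumK (B0 x) (Bfin x)) -EFinM lee_fin.
  have h1 : fine (nnsum (B x)) <= 3 * S by exact: fine_nnsum_le (B3 x).
  have h0 : 0 <= fine (nnsum (B x)) by exact: fine_nnsum_ge0.
  have h2 := hF x; rewrite -/(B x) in h2.
  rewrite -real_normK ?num_real// expr2; apply: ler_pM => //.
  exact: le_trans h2 h1.
rewrite esumZl ?mulr_ge0// => [|x]; last exact: nnsum_ge0.
apply: le_trans (_ : ((3 * S)%:E * (3 * n * S)%:E <= _)%E).
  by rewrite lee_wpmul2l ?lee_fin ?mulr_ge0//; exact: esum_schur1.
by rewrite -EFinM lee_fin; lra.
Qed.

End lattice_sums.

(** * Square summable functions, point masses and geometric series *)

Definition l2 (R : realType) (T : choiceType) (u : T -> R) : bool :=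
  fins (fun x => u x ^+ 2).

Lemma finsDZ (R : realType) (T : choiceType) (f g : T -> R) (a b : R) :
  0 <= a -> 0 <= b -> (forall i, 0 <= f i) -> (forall i, 0 <= g i) ->
  fins f -> fins g -> fins (fun i => a * f i + b * g i).
Proof.
move=> a0 b0 f0 g0 ff fg; apply: finsD; [| |exact: finsZ|exact: finsZ] => i;
  exact: mulr_ge0.
Qed.

Lemma fine_nnsumDZ (R : realType) (T : choiceType) (f g : T -> R) (a b : R) :
  0 <= a -> 0 <= b -> (forall i, 0 <= f i) -> (forall i, 0 <= g i) ->
  fins f -> fins g ->
  fine (nnsum (fun i => a * f i + b * g i)) = a * fine (nnsum f) + b * fine (nnsum g).
Proof.
move=> a0 b0 f0 g0 ff fg; rewrite fine_nnsumD; first by congr (_ + _); exact: fine_nnsumZ.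
- by move=> i; exact: mulr_ge0.
- by move=> i; exact: mulr_ge0.
- exact: finsZ.
- exact: finsZ.
Qed.

Section sums_complements.
Variables (R : realType) (T : choiceType).

Lemma nnsum_delta (z : T) (x : R) : 0 <= x ->
  nnsum (fun z' => (z' == z)%:R * x) = x%:E.
Proof.
move=> x0; pose f := fun _ : 'I_1 => z.
rewrite /nnsum (@esum_finType _ _ _ f).
- by rewrite big_ord1/= eqxx mul1r.
- by move=> i j _; rewrite !ord1.
- by move=> i; rewrite lee_fin mulr_ge0.
- move=> y h; have [yz|] := eqVneq y z; last by rewrite mul0r.
  by exfalso; apply: h; exists ord0.
Qed.

Lemma le_rsum (f g : T -> R) : summableR f -> summableR g ->
  (forall i, f i <= g i) -> rsum f <= rsum g.
Proof.
move=> sf sg fg; rewrite -subr_ge0 -rsumB// rsum_nneg => [|i|].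
- by rewrite fine_nnsum_ge0// => i; rewrite subr_ge0.
- by rewrite subr_ge0.
- apply: fins_le (summableRD sg (summableRN sf)) => i; exact: ler_norm.
Qed.

End sums_complements.

Lemma sum_geometric_le (R : realType) (r : R) N : 0 <= r < 1 ->
  \sum_(i < N) r ^+ i <= (1 - r)^-1.
Proof.
case/andP=> r0 r1; rewrite -div1r ler_pdivlMr ?subr_gt0//.
have := subrX1 r N; have := exprn_ge0 N r0; nra.
Qed.

Lemma nnsum_geometric (R : realType) (r : R) : 0 <= r < 1 ->
  (nnsum (fun n : nat => (r ^+ n)%R) <= (1 - r)^-1%:E)%E.
Proof.
move=> /[dup] r01 /andP[r0 r1]; apply: esum_le_fin => s us.
have [N hN] : exists N, forall n, n \in s -> (n < N)%N.
  elim: s {us} => [|n s [N IH]]; first by exists 0%N.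
  exists (n.+1 + N)%N => m; rewrite inE => /orP[/eqP ->|/IH]; lia.
pose a (n : nat) : \bar R := if (n < N)%N then (r ^+ n)%:E else 0%E.
have a0 n : (0 <= a n)%E by rewrite /a; case: ifP; rewrite ?lee_fin ?exprn_ge0.
have := esum_ge_fin us a0.
rewrite (@esum_finType _ _ _ (@nat_of_ord N) a (@ord_inj N) a0); last first.
  move=> n h; rewrite /a; case: ifP => // nN.
  by exfalso; apply: h; exists (Ordinal nN).
rewrite (eq_bigr (fun i : 'I_N => (r ^+ i)%:E)) => [|i _]; last by rewrite /a ltn_ord.
rewrite [X in (X <= _)%E -> _](_ : _ = (\sum_(i <- s) (r ^+ i)%:E)%E); last first.
  by rewrite [LHS]big_seq [RHS]big_seq; apply: eq_bigr => n /hN h; rewrite /a h.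
move=> h; apply: le_trans h _; rewrite sumEFin lee_fin.
exact: sum_geometric_le.
Qed.

(** * Symmetric jump operators: energy estimate and resolvent *)

Section symmetric_jump_operator.
Variables (R : realType) (T : choiceType) (c : T -> T -> R) (Dm lam : R).
Hypothesis c0 : forall x y, 0 <= c x y.
Hypothesis csym : forall x y, c x y = c y x.
Hypothesis cDm : forall x, (nnsum (c x) <= Dm%:E)%E.
Hypothesis lam0 : 0 < lam.

Definition jump (u : T -> R) (x : T) : R := rsum (fun y => (u y - u x) * c x y).

Let D x := fine (nnsum (c x)).

Let fins_c x : fins (c x). Proof. exact: fins_sub_bound (cDm x). Qed.

Let D0 x : 0 <= D x. Proof. exact: fine_nnsum_ge0. Qed.

Let DDm x : D x <= Dm. Proof. exact: fine_nnsum_le (cDm x). Qed.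

Lemma l2_bounded (u : T -> R) : l2 u -> exists2 B : R, 0 <= B & forall x, `|u x| <= B.
Proof.
move=> lu; exists (Num.sqrt (fine (nnsum (fun x => u x ^+ 2)))) => [|x].
  exact: sqrtr_ge0.
rewrite -sqrtr_sqr ler_sqrt ?fine_nnsum_ge0// => [|y]; last exact: sqr_ge0.
rewrite -lee_fin nnsumK// => [|y]; last exact: sqr_ge0.
by apply: (@esum_ge_pt _ _ (fun x => (u x ^+ 2)%:E)) => y; rewrite lee_fin sqr_ge0.
Qed.

Lemma l2D (u v : T -> R) : l2 u -> l2 v -> l2 (fun x => u x + v x).
Proof.
move=> lu lv; apply: (@fins_le _ _ _ (fun x => 2 * u x ^+ 2 + 2 * v x ^+ 2)) => [x|].
  by have := sqr_ge0 (u x - v x); nra.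
by apply: finsDZ => // x; exact: sqr_ge0.
Qed.

Lemma l2N (u : T -> R) : l2 u -> l2 (fun x => - u x).
Proof. by apply: fins_le => x; rewrite sqrrN. Qed.

Lemma summable_bounded_jump u x B : (forall y, `|u y| <= B) ->
  summableR (fun y => u y * c x y).
Proof.
move=> uB; have B0 : 0 <= B by exact: le_trans (uB x).
apply: (@summable_le _ _ _ (fun y => B * c x y)) => [y|]; last exact: finsZ.
by rewrite normrM (ger0_norm (c0 _ _)) ler_wpM2r.
Qed.

Lemma summable_jump u x : l2 u -> summableR (fun y => (u y - u x) * c x y).
Proof.
move=> /l2_bounded[B B0 uB]; apply: (@summable_bounded_jump _ _ (B + B)) => y.
by apply: le_trans (ler_normB _ _) _; exact: lerD.
Qed.

Lemma jumpE u x : l2 u -> jump u x = rsum (fun y => u y * c x y) - D x * u x.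
Proof.
move=> /l2_bounded[B B0 uB].
rewrite /D -rsum_nneg// (mulrC _ (u x)) -rsumZ; last exact: nnsum_fin_summable.
rewrite -rsumB; [|exact: summable_bounded_jump uB|].
  by congr rsum; apply/funext => y; rewrite mulrBl.
by apply: summableRZ; exact: nnsum_fin_summable.
Qed.

Lemma jumpB u v x : l2 u -> l2 v -> jump (fun y => u y - v y) x = jump u x - jump v x.
Proof.
move=> lu lv; rewrite /jump -rsumB; try exact: summable_jump.
by congr rsum; apply/funext => y; ring.
Qed.

(** Pointwise, [2 v (jump v) = A - D v^2 - G], and symmetry gives [A] and [D v^2] the same sum, so
    that only the energy [G] survives. The source is split because its two parts are used
    differently: [hB], of finite support, keeps its pairing with [v], while [e] is absorbed by
    Young's inequality. *)
Lemma jump_energy (I : finType) (iota : I -> T) (v hB e : T -> R) :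
  injective iota -> l2 v -> l2 e -> (forall x, ~ range iota x -> hB x = 0) ->
  (forall x, lam * v x - jump v x = hB x + e x) ->
  lam * fine (nnsum (fun x => v x ^+ 2)) +
    \sum_i \sum_j c (iota i) (iota j) * (v (iota i) - v (iota j)) ^+ 2 <=
  2 * (\sum_i hB (iota i) * v (iota i)) + lam^-1 * fine (nnsum (fun x => e x ^+ 2)).
Proof.
move=> iinj lv le_ hsupp eqv.
have Dm0 : inhabited T -> 0 <= Dm by move=> [x]; exact: le_trans (D0 x) (DDm x).
have [B B0 vB] := l2_bounded lv.
have v2B y : v y ^+ 2 <= B ^+ 2.
  by rewrite -real_normK ?num_real// ler_sqr ?nnegrE// le_trans.
have fA x : fins (fun y => c x y * v y ^+ 2).
  apply: (@fins_le _ _ _ (fun y => B ^+ 2 * c x y)) => [y|].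
    by rewrite mulrC ler_wpM2r.
  by apply: finsZ => //; exact: sqr_ge0.
have A0 x y : 0 <= c x y * v y ^+ 2 by rewrite mulr_ge0// sqr_ge0.
pose A x := fine (nnsum (fun y => c x y * v y ^+ 2)).
have G0 x y : 0 <= c x y * (v x - v y) ^+ 2 by rewrite mulr_ge0// sqr_ge0.
have fG x : fins (fun y => c x y * (v x - v y) ^+ 2).
  apply: (@fins_le _ _ _ (fun y => 2 * v x ^+ 2 * c x y + 2 * (c x y * v y ^+ 2))) => [y|].
    rewrite (_ : _ + _ = c x y * (2 * v x ^+ 2 + 2 * v y ^+ 2)); last by ring.
    by rewrite ler_wpM2l//; have := sqr_ge0 (v x + v y); nra.
  by apply: finsDZ => //; rewrite mulr_ge0// sqr_ge0.
pose G x := fine (nnsum (fun y => c x y * (v x - v y) ^+ 2)).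
have key x : 2 * v x * jump v x = A x - D x * v x ^+ 2 - G x.
  rewrite /A /G /D /jump -!rsum_nneg// (mulrC _ (v x ^+ 2)).
  have sc : summableR (c x) by exact: nnsum_fin_summable.
  have sA : summableR (fun y => c x y * v y ^+ 2) by exact: nnsum_fin_summable.
  have sG : summableR (fun y => c x y * (v x - v y) ^+ 2) by exact: nnsum_fin_summable.
  rewrite -rsumZ; last exact: summable_jump.
  rewrite -rsumZ// -rsumB//; last exact: summableRZ.
  rewrite -rsumB//; last by apply: summableRD => //; apply: summableRN; exact: summableRZ.
  by congr rsum; apply/funext => y; ring.
(* Exchange of the two summations, then symmetry of [c]. *)
have nA : nnsum A = nnsum (fun x => D x * v x ^+ 2).
  transitivity (\esum_(x in [set: T]) \esum_(y in [set: T]) (c x y * v y ^+ 2)%:E)%E.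
    by apply: eq_esum => x _; rewrite nnsumK.
  rewrite esum_exchange => [|x y]; last by rewrite lee_fin.
  apply: eq_esum => y _.
  transitivity (nnsum (fun x => v y ^+ 2 * c y x)).
    by apply: eq_esum => x _; rewrite csym mulrC.
  by rewrite nnsumZ ?sqr_ge0// -(nnsumK (c0 y) (fins_c y)) -EFinM mulrC.
have fD : fins (fun x => D x * v x ^+ 2).
  apply: (@fins_le _ _ _ (fun x => Dm * v x ^+ 2)) => [x|].
    by rewrite ler_wpM2r ?sqr_ge0.
  have [x|T0] := pselect (inhabited T).
    by apply: finsZ => //; [exact: Dm0 x|move=> y; exact: sqr_ge0].
  rewrite /fins /nnsum (_ : [set: T] = set0) ?esum_set0//.
  by apply/seteqP; split => // x; exfalso; apply: T0; constructor.
have fAs : fins A by rewrite /fins nA.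
have As0 x : 0 <= A x by exact: fine_nnsum_ge0.
have Gs0 x : 0 <= G x by exact: fine_nnsum_ge0.
have Dv0 x : 0 <= D x * v x ^+ 2 by rewrite mulr_ge0// sqr_ge0.
have Gle x : G x <= 2 * (D x * v x ^+ 2) + 2 * A x.
  have vx0 : 0 <= 2 * v x ^+ 2 by rewrite mulr_ge0// sqr_ge0.
  have -> : 2 * (D x * v x ^+ 2) + 2 * A x =
      fine (nnsum (fun y => 2 * v x ^+ 2 * c x y + 2 * (c x y * v y ^+ 2))).
    by rewrite fine_nnsumDZ// /D /A; ring.
  apply: le_fine_nnsum => // [y|]; last exact: finsDZ.
  rewrite (_ : _ + _ = c x y * (2 * v x ^+ 2 + 2 * v y ^+ 2)); last by ring.
  by rewrite ler_wpM2l//; have := sqr_ge0 (v x + v y); nra.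
have fGs : fins G.
  by apply: fins_le Gle _; exact: finsDZ.
have v20 x : 0 <= v x ^+ 2 by exact: sqr_ge0.
have e20 x : 0 <= e x ^+ 2 by exact: sqr_ge0.
(* The terms of the equation multiplied by [2 v] are distributed so that [X] and [Y] are nonnegative
   and of finite sum; the sums of [D v^2] and [A] then cancel. *)
pose X x := lam * v x ^+ 2 + 1 * (G x + D x * v x ^+ 2).
pose Y x := 1 * A x + lam^-1 * e x ^+ 2.
have iv0 : 0 <= lam^-1 by rewrite invr_ge0 ltW.
have l0 : 0 <= lam by exact: ltW.
have pt x : X x - Y x <= 2 * (hB x * v x).
  have h1 : 2 * v x * (lam * v x - jump v x) = 2 * v x * (hB x + e x) by rewrite eqv.
  have h2 := key x.
  have h3 : 2 * v x * e x <= lam * v x ^+ 2 + lam^-1 * e x ^+ 2.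
    have : 0 <= lam * (v x - lam^-1 * e x) ^+ 2 by rewrite mulr_ge0// sqr_ge0.
    rewrite (_ : lam * _ = lam * v x ^+ 2 - 2 * v x * e x + lam^-1 * e x ^+ 2); last first.
      by field; rewrite gt_eqF.
    lra.
  rewrite /X /Y; nra.
have GD0 x : 0 <= G x + D x * v x ^+ 2 by exact: addr_ge0.
have fGD : fins (fun x => G x + D x * v x ^+ 2) by exact: finsD.
have X0 x : 0 <= X x by rewrite /X !addr_ge0// mulr_ge0.
have Y0 x : 0 <= Y x by rewrite /Y addr_ge0// mulr_ge0.
have fX : fins X by exact: finsDZ.
have fY : fins Y by exact: finsDZ.
have sXY : summableR (fun x => X x - Y x).
  by apply: summableRD; [|apply: summableRN]; exact: nnsum_fin_summable.
have hvsupp x : ~ range iota x -> 2 * (hB x * v x) = 0.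
  by move=> /hsupp ->; rewrite mul0r mulr0.
have shv : summableR (fun x => 2 * (hB x * v x)).
  rewrite /summableR /fins /nnsum (@esum_finType _ _ _ iota) //.
  - by rewrite sumEFin ltry.
  - by move=> x /hvsupp ->; rewrite normr0.
have := le_rsum sXY shv pt.
rewrite (rsum_fin iinj hvsupp) -mulr_sumr.
rewrite rsumB; [|exact: nnsum_fin_summable|exact: nnsum_fin_summable].
rewrite !rsum_nneg//.
have -> : fine (nnsum X) = lam * fine (nnsum (fun x => v x ^+ 2)) + fine (nnsum G) +
   fine (nnsum (fun x => D x * v x ^+ 2)).
  by rewrite (@fine_nnsumDZ _ _ _ _ lam 1)// (@fine_nnsumD _ _ G)// mul1r addrA.
have -> : fine (nnsum Y) = fine (nnsum (fun x => D x * v x ^+ 2)) +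
   lam^-1 * fine (nnsum (fun x => e x ^+ 2)).
  by rewrite fine_nnsumDZ// nA mul1r.
have : \sum_i \sum_j c (iota i) (iota j) * (v (iota i) - v (iota j)) ^+ 2 <= fine (nnsum G).
  rewrite -lee_fin nnsumK// -sumEFin.
  apply: le_trans (_ : (\sum_i (G (iota i))%:E <= _)%E).
    apply: lee_sum => i _; rewrite /G nnsumK// -sumEFin.
    by apply: (@esum_ge_fintype _ _ _ xpredT iota (fun y => (c (iota i) y * (v (iota i) - v y) ^+ 2)%:E)) => // y; rewrite lee_fin.
  by apply: (@esum_ge_fintype _ _ _ xpredT iota (fun y => (G y)%:E)) => // y; rewrite lee_fin.
lra.
Qed.

(* By a Neumann series; nonnegativity keeps all sums in [0, +oo]. *)
Lemma jump_resolvent_nneg (h : T -> R) : (forall x, 0 <= h x) -> l2 h ->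
  exists v : T -> R, l2 v /\ forall x, lam * v x - jump v x = h x.
Proof.
move=> h0 lh.
have [[x0]|T0] := pselect (inhabited T); last first.
  exists h; split => // x; exfalso; apply: T0; constructor; exact: x.
have Dm0 : 0 <= Dm by exact: le_trans (D0 x0) (DDm x0).
(* The equation is the fixed point problem [v = tau h + K v], where [K] adds the diagonal [e] to
   [tau c]. This [tau] is small enough for [e] to be nonnegative, and the rows of [K] sum to
   [q = 1 - tau lam < 1]. *)
pose tau := (lam + Dm + 1)^-1.
have den0 : 0 < lam + Dm + 1 by rewrite ltr_wpDl// addr_ge0// ltW.
have tau0 : 0 < tau by rewrite invr_gt0.
have tauE : tau * (lam + Dm + 1) = 1 by rewrite mulVf// gt_eqF.
pose e x := 1 - tau * lam - tau * D x.
have e0 x : 0 <= e x.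
  have : tau * D x <= tau * Dm by rewrite ler_pM2l.
  by rewrite /e; move: tauE; rewrite !mulrDr; lra.
pose K x y := tau * c x y + (y == x)%:R * e x.
have K0 x y : 0 <= K x y by rewrite addr_ge0// mulr_ge0// ltW.
have Ksym x y : K x y = K y x.
  rewrite /K csym; congr (_ + _); rewrite eq_sym.
  by have [->|] := eqVneq x y; rewrite ?mul0r.
pose q := 1 - tau * lam.
have q01 : 0 <= q < 1.
  have h1 := mulr_gt0 tau0 lam0.
  have h2 := mulr_ge0 (ltW tau0) Dm0.
  by rewrite /q; move: tauE; rewrite !mulrDr; lra.
have Kq x : nnsum (K x) = q%:E.
  rewrite nnsumD//; last 2 first.
  - by move=> y; rewrite mulr_ge0// ltW.
  - by move=> y; rewrite mulr_ge0.
  rewrite nnsum_delta// nnsumZ//; last exact: ltW.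
  by rewrite -(nnsumK (c0 x) (fins_c x)) -EFinM -EFinD /e -/(D x); congr EFin; rewrite /q; lra.
pose step (f : T -> R) x := fine (nnsum (fun y => K x y * f y)).
(* Jensen along the rows, then symmetry to sum the columns: one step multiplies the squared l2 norm
   by at most [q]. *)
have step_l2 (f : T -> R) H : 0 <= H -> (forall x, 0 <= f x) ->
    (nnsum (fun x => f x ^+ 2)%R <= H%:E)%E ->
    [/\ forall x, fins (fun y => K x y * f y), forall x, 0 <= step f x &
      (nnsum (fun x => step f x ^+ 2)%R <= (q * H)%:E)%E].
  move=> H0 f0 fH.
  have f20 x : 0 <= f x ^+ 2 by exact: sqr_ge0.
  have ff : fins (fun x => f x ^+ 2) by exact: fins_sub_bound fH.
  have Kf0 x y : 0 <= K x y * f y ^+ 2 by rewrite mulr_ge0.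
  have ex : (\esum_(x in [set: T]) nnsum (fun y => K x y * f y ^+ 2)%R <= (q * H)%:E)%E.
    rewrite /nnsum esum_exchange; last by move=> x y; rewrite lee_fin.
    apply: le_trans (_ : \esum_(y in [set: T]) (q%:E * (f y ^+ 2)%:E) <= _)%E.
      apply: le_esum => y _.
      rewrite (_ : (\esum_(i in _) _)%E = nnsum (fun x => f y ^+ 2 * K y x)); last first.
        by apply: eq_esum => x _; rewrite Ksym mulrC.
      by rewrite nnsumZ// Kq muleC.
    rewrite esumZl//; last by case/andP: q01.
    by rewrite EFinM lee_wpmul2l// lee_fin; case/andP: q01.
  have fK x : fins (fun y => K x y * f y ^+ 2).
    apply: le_lt_trans (ltry (q * H)); apply: le_trans ex.
    apply: (@esum_ge_pt _ _ (fun x => nnsum (fun y => K x y * f y ^+ 2))) => z.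
    exact: nnsum_ge0.
  have K1 x : (nnsum (K x) <= 1)%E by rewrite Kq lee_fin; case/andP: q01 => _ /ltW.
  split.
  - by move=> x; have [] := nnsum_jensen (K0 x) f0 (K1 x) (fK x).
  - by move=> x; apply: fine_nnsum_ge0 => y; rewrite mulr_ge0.
  - apply: le_trans ex; apply: le_esum => x _.
    rewrite -(nnsumK (Kf0 x) (fK x)) lee_fin.
    by have [] := nnsum_jensen (K0 x) f0 (K1 x) (fK x).
pose a n := iter n step (fun x => tau * h x).
pose H := fine (nnsum (fun x => (tau * h x) ^+ 2)).
have lth : fins (fun x => (tau * h x) ^+ 2).
  apply: (@fins_le _ _ _ (fun x => tau ^+ 2 * h x ^+ 2)) => [x|]; first by rewrite exprMn.
  by apply: finsZ => // [|x]; exact: sqr_ge0.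
have H0 : 0 <= H by apply: fine_nnsum_ge0 => x; exact: sqr_ge0.
have q0 : 0 <= q by case/andP: q01.
have q1 : q < 1 by case/andP: q01.
have aP n : (forall x, 0 <= a n x) /\
    (nnsum (fun x => a n x ^+ 2)%R <= (q ^+ n * H)%:E)%E.
  elim: n => [|n [an0 anH]].
    split=> [x|]; first by rewrite mulr_ge0// ltW.
    by rewrite expr0 mul1r nnsumK// => x; exact: sqr_ge0.
  have qH : 0 <= q ^+ n * H by rewrite mulr_ge0// exprn_ge0.
  by have [_ ? ?] := step_l2 _ _ qH an0 anH; split => //; rewrite exprS -mulrA.
have a0 n x : 0 <= a n x by have [] := aP n.
have aK n x : fins (fun y => K x y * a n y).
  have qH : 0 <= q ^+ n * H by rewrite mulr_ge0// exprn_ge0.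
  by have [+ _ _] := step_l2 _ _ qH (a0 n) (aP n).2.
(* the weights p_n = (1 - s) s^n with q < s < 1 turn the series into an average *)
have [s [s0 s1 q_s]] : exists s : R, [/\ 0 < s, s < 1 & q < s].
  by exists ((1 + q) / 2); split; lra.
have qs : 0 <= q / s < 1.
  by rewrite divr_ge0 ?(ltW s0)//= ltr_pdivrMr// mul1r.
pose p (n : nat) := (1 - s) * s ^+ n.
have p0 n : 0 < p n by rewrite mulr_gt0 ?subr_gt0// exprn_gt0.
have p1 : (nnsum p <= 1)%E.
  rewrite nnsumZ ?subr_ge0 ?(ltW s1)// => [|n]; last by rewrite exprn_ge0// ltW.
  apply: le_trans (_ : ((1 - s)%:E * (1 - s)^-1%:E <= _)%E).
    rewrite lee_wpmul2l ?lee_fin ?subr_ge0 ?(ltW s1)//.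
    by apply: nnsum_geometric; rewrite s1 ltW.
  by rewrite -EFinM mulfV// subr_eq0 gt_eqF.
pose b n x := a n x / p n.
have b0 n x : 0 <= b n x by rewrite divr_ge0// ltW.
have pb n x : p n * b n x = a n x by rewrite mulrC divfK// gt_eqF.
pose W := (1 - s)^-1 * H * (1 - q / s)^-1.
have exb : (\esum_(x in [set: T]) nnsum (fun n => p n * b n x ^+ 2)%R <= W%:E)%E.
  rewrite /nnsum esum_exchange; last first.
    by move=> x n; rewrite lee_fin mulr_ge0 ?sqr_ge0// ltW.
  apply: le_trans (_ : nnsum (fun n => (1 - s)^-1 * H * (q / s) ^+ n)%R <= _)%E.
    apply: le_esum => n _.
    have [_ anH] := aP n.
    rewrite (_ : (\esum_(i in _) _)%E = nnsum (fun x => (p n)^-1 * a n x ^+ 2)); last first.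
      apply: eq_esum => x _; congr EFin; rewrite /b; field.
      by rewrite gt_eqF.
    rewrite nnsumZ ?invr_ge0 ?(ltW (p0 n))// => [|x]; last exact: sqr_ge0.
    apply: le_trans (_ : ((p n)^-1%:E * (q ^+ n * H)%:E <= _)%E).
      by rewrite lee_wpmul2l// lee_fin invr_ge0 ltW.
    rewrite -EFinM lee_fin /p le_eqVlt; apply/orP; left; apply/eqP.
    rewrite invfM expr_div_n -!mulrA; congr (_ * _).
    by rewrite mulrC (mulrC (q ^+ n)) -mulrA.
  have Hs : 0 <= (1 - s)^-1 * H by rewrite mulr_ge0// invr_ge0 subr_ge0 ltW.
  rewrite nnsumZ// => [|n]; last by rewrite exprn_ge0//; case/andP: qs.
  by rewrite /W [leRHS]EFinM lee_wpmul2l ?lee_fin//; exact: nnsum_geometric.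
have pb0 x n : 0 <= p n * b n x ^+ 2 by rewrite mulr_ge0 ?sqr_ge0// ltW.
have fb x : fins (fun n => p n * b n x ^+ 2).
  apply: le_lt_trans (ltry W); apply: le_trans exb.
  apply: (@esum_ge_pt _ _ (fun x => nnsum (fun n => p n * b n x ^+ 2))) => z.
  exact: nnsum_ge0.
pose v x := fine (nnsum (fun n => a n x)).
have v0 x : 0 <= v x by apply: fine_nnsum_ge0 => n.
have fa x : fins (fun n => a n x).
  have [] := nnsum_jensen (fun n => ltW (p0 n)) (fun n => b0 n x) p1 (fb x).
  by rewrite (_ : (fun n => p n * b n x) = fun n => a n x)//; apply/funext => n.
have lv : l2 v.
  apply: le_lt_trans (ltry W); apply: le_trans exb; apply: le_esum => x _.
  rewrite -(nnsumK (pb0 x) (fb x)) lee_fin.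
  have [_] := nnsum_jensen (fun n => ltW (p0 n)) (fun n => b0 n x) p1 (fb x).
  by rewrite (_ : (fun n => p n * b n x) = fun n => a n x)//; apply/funext => n.
exists v; split => // x.
(* A shift of the index of the series; sums are exchanged freely since all terms are nonnegative. *)
have vE : v x = tau * h x + fine (nnsum (fun y => K x y * v y)).
  suff : (v x)%:E = ((tau * h x)%:E + nnsum (fun y => K x y * v y)%R)%E.
    have [->|] := eqVneq (nnsum (fun y => K x y * v y)%R) +oo%E; first by rewrite addey.
    move=> ny E; have fin : nnsum (fun y => K x y * v y) \is a fin_num.
      by rewrite ge0_fin_numE ?lt_neqAle ?ny ?leey// nnsum_ge0// => y; rewrite mulr_ge0.
    by move: E; rewrite -{1}(fineK fin) -EFinD => -[].
  have -> : nnsum (fun y => K x y * v y) = nnsum (fun n => a n.+1 x).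
    transitivity (\esum_(y in [set: T]) \esum_(n in [set: nat]) (K x y * a n y)%:E)%E.
      apply: eq_esum => y _; rewrite EFinM nnsumK// -nnsumZ//.
    rewrite esum_exchange => [|y n]; last by rewrite lee_fin mulr_ge0.
    by apply: eq_esum => n _; rewrite nnsumK// => y; rewrite mulr_ge0.
  rewrite nnsumK// -[(tau * h x)%:E](nnsum_delta 0%N); last by rewrite mulr_ge0// ltW.
  have -> : nnsum (fun n => a n.+1 x) = nnsum (fun n => (n != 0)%N%:R * a n x).
    rewrite /nnsum [RHS](esumID [set 0%N]) => [|n _]; last by rewrite lee_fin mulr_ge0.
    rewrite !setTI esum_set1 ?eqxx ?mul0r// add0e.
    rewrite [RHS](reindex_esum [set: nat] _ succn); last first.
      split => [n _ //|m n _ _ []//|[//|n _]]; last by exists n.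
      by move=> /(_ erefl).
    by apply: eq_esum => n _; rewrite mul1r.
  rewrite -nnsumD// => [|n|n].
  - apply: eq_nnsum => -[|n]; first by rewrite eqxx mul1r mul0r addr0.
    by rewrite mul0r mul1r add0r.
  - by rewrite mulr_ge0// mulr_ge0// ltW.
  - by rewrite mulr_ge0.
have [B B0 vB] := l2_bounded lv.
have cv0 y : 0 <= v y * c x y by rewrite mulr_ge0.
have fcv : fins (fun y => v y * c x y).
  apply: (@fins_le _ _ _ (fun y => B * c x y)) => [y|]; last exact: finsZ.
  by rewrite ler_wpM2r// -[v y]ger0_norm.
have KvE : fine (nnsum (fun y => K x y * v y)) =
    tau * fine (nnsum (fun y => v y * c x y)) + e x * v x.
  have -> : nnsum (fun y => K x y * v y) =
      nnsum (fun y => tau * (v y * c x y) + (y == x)%:R * (e x * v x)).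
    apply: eq_nnsum => y; rewrite /K mulrDl (mulrC (v y)) mulrA -mulrA.
    by congr (_ + _); have [->//|] := eqVneq y x; rewrite !mul0r.
  rewrite nnsumD//; last 2 first.
  - by move=> y; rewrite mulr_ge0// ltW.
  - by move=> y; rewrite mulr_ge0// mulr_ge0.
  by rewrite nnsum_delta ?mulr_ge0// nnsumZ ?(ltW tau0)// -(nnsumK cv0 fcv).
rewrite jumpE// (rsum_nneg cv0 fcv).
apply: (@mulfI _ tau); first by rewrite gt_eqF.
by move: vE; rewrite KvE /e; lra.
Qed.

Lemma jump_resolvent (h : T -> R) : l2 h ->
  exists v : T -> R, l2 v /\ forall x, lam * v x - jump v x = h x.
Proof.
move=> lh.
have hp x : 0 <= Num.max (h x) 0 by rewrite le_max lexx orbT.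
have hn x : 0 <= Num.max (- h x) 0 by rewrite le_max lexx orbT.
have lp : l2 (fun x => Num.max (h x) 0).
  by apply: fins_le lh => x; have [] := leP (h x) 0; have := sqr_ge0 (h x); nra.
have ln : l2 (fun x => Num.max (- h x) 0).
  by apply: fins_le lh => x; have [] := leP (- h x) 0; have := sqr_ge0 (h x); nra.
have [v [lv vE]] := jump_resolvent_nneg hp lp.
have [u [lu uE]] := jump_resolvent_nneg hn ln.
exists (fun x => v x - u x); split; first by apply: l2D => //; exact: l2N.
by move=> x; rewrite jumpB// (posnegE h x) -vE -uE; ring.
Qed.

End symmetric_jump_operator.

(** * Expectations of bounded random variables *)

Section bounded_random_variables.
Context {R : realType} {dO : measure_display} {Omega : measurableType dO}.
Variable P : probability Omega R.

Definition bmeas (f : Omega -> R) :=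
  measurable_fun [set: Omega] f /\ exists B : R, forall o, `|f o| <= B.

Definition Ex (f : Omega -> R) : R := Rintegral P [set: Omega] f.

Lemma bmeas_integrable f : bmeas f -> P.-integrable [set: Omega] (EFin \o f).
Proof.
move=> [mf [B hB]]; apply: measurable_bounded_integrable => //.
  by rewrite [X in (X < _)%E]probability_setT ltry.
exists B; split; first by rewrite num_real.
by move=> x Bx o _ /=; apply: le_trans (hB o) _; exact: ltW.
Qed.

Lemma bmeas_cst (r : R) : bmeas (fun=> r).
Proof. by split; [exact: measurable_cst|exists `|r|]. Qed.

Lemma bmeasD f g : bmeas f -> bmeas g -> bmeas (fun o => f o + g o).
Proof.
move=> [mf [B hB]] [mg [C hC]]; split; first exact: measurable_funD.
by exists (B + C) => o; apply: le_trans (ler_normD _ _) _; exact: lerD.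
Qed.

Lemma bmeasM f g : bmeas f -> bmeas g -> bmeas (fun o => f o * g o).
Proof.
move=> [mf [B hB]] [mg [C hC]]; split; first exact: measurable_funM.
by exists (B * C) => o; rewrite normrM; apply: ler_pM.
Qed.

Lemma bmeasN f : bmeas f -> bmeas (fun o => - f o).
Proof.
move=> mf; rewrite (_ : (fun _ => _) = fun o => (-1) * f o).
  by apply: bmeasM => //; exact: bmeas_cst.
by apply/funext => o; rewrite mulN1r.
Qed.

Lemma bmeas_sum (I : Type) (s : seq I) (f : I -> Omega -> R) :
  (forall i, bmeas (f i)) -> bmeas (fun o => \sum_(i <- s) f i o).
Proof.
move=> mf; elim: s => [|i s IH].
  rewrite (_ : (fun _ => _) = fun=> 0); first exact: bmeas_cst.
  by apply/funext => o; rewrite big_nil.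
rewrite (_ : (fun _ => _) = fun o => f i o + \sum_(i <- s) f i o).
  exact: bmeasD.
by apply/funext => o; rewrite big_cons.
Qed.

Lemma bmeas_sum_seq (I : eqType) (s : seq I) (f : I -> Omega -> R) :
  (forall i, i \in s -> bmeas (f i)) -> bmeas (fun o => \sum_(i <- s) f i o).
Proof.
elim: s => [|i s IH] mf.
  rewrite (_ : (fun _ => _) = fun=> 0); first exact: bmeas_cst.
  by apply/funext => o; rewrite big_nil.
rewrite (_ : (fun _ => _) = fun o => f i o + \sum_(i <- s) f i o).
  apply: bmeasD; first by apply: mf; rewrite mem_head.
  by apply: IH => j js; apply: mf; rewrite in_cons js orbT.
by apply/funext => o; rewrite big_cons.
Qed.

Lemma bmeas_prod (I : eqType) (s : seq I) (f : I -> Omega -> R) :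
  (forall i, i \in s -> bmeas (f i)) -> bmeas (fun o => \prod_(i <- s) f i o).
Proof.
elim: s => [|i s IH] mf.
  rewrite (_ : (fun _ => _) = fun=> 1); first exact: bmeas_cst.
  by apply/funext => o; rewrite big_nil.
rewrite (_ : (fun _ => _) = fun o => f i o * \prod_(i <- s) f i o).
  apply: bmeasM; first by apply: mf; rewrite mem_head.
  by apply: IH => j js; apply: mf; rewrite in_cons js orbT.
by apply/funext => o; rewrite big_cons.
Qed.

Lemma bmeas_indic (X : Omega -> R) (A : set R) : measurable A ->
  measurable_fun [set: Omega] X -> bmeas (fun o => \1_A (X o)).
Proof.
move=> mA mX; split.
  by apply: measurableT_comp => //; exact: measurable_indic.
by exists 1 => o; rewrite indicE; case: (_ \in _); rewrite ?normr1 ?normr0.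
Qed.

Lemma ExD f g : bmeas f -> bmeas g -> Ex (fun o => f o + g o) = Ex f + Ex g.
Proof. by move=> bf bg; apply: RintegralD => //; exact: bmeas_integrable. Qed.

Lemma ExZ r f : bmeas f -> Ex (fun o => r * f o) = r * Ex f.
Proof. by move=> bf; apply: RintegralZl => //; exact: bmeas_integrable. Qed.

Lemma ExB f g : bmeas f -> bmeas g -> Ex (fun o => f o - g o) = Ex f - Ex g.
Proof. by move=> bf bg; apply: RintegralB => //; exact: bmeas_integrable. Qed.

Lemma Ex_cst r : Ex (fun=> r) = r.
Proof.
by rewrite /Ex Rintegral_cst// [X in fine X]probability_setT mulr1.
Qed.

Lemma le_Ex f g : bmeas f -> bmeas g -> (forall o, f o <= g o) -> Ex f <= Ex g.
Proof. by move=> bf bg fg; apply: le_Rintegral => //; exact: bmeas_integrable. Qed.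

Lemma Ex_norm_le f (B : R) : bmeas f -> (forall o, `|f o| <= B) -> `|Ex f| <= B.
Proof.
move=> bf fB; rewrite ler_norml -{1}(Ex_cst (- B)) -{2}(Ex_cst B).
apply/andP; split; apply: le_Ex => //; try exact: bmeas_cst; move=> o.
  by have := fB o; rewrite ler_norml => /andP[].
by have := fB o; rewrite ler_norml => /andP[].
Qed.

Lemma Ex_sum (I : Type) (s : seq I) (f : I -> Omega -> R) :
  (forall i, bmeas (f i)) -> Ex (fun o => \sum_(i <- s) f i o) = \sum_(i <- s) Ex (f i).
Proof.
move=> mf; elim: s => [|i s IH].
  rewrite big_nil (_ : (fun _ => _) = fun=> 0); first exact: Ex_cst.
  by apply/funext => o; rewrite big_nil.
rewrite big_cons -IH -ExD//; last exact: bmeas_sum.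
by congr Ex; apply/funext => o; rewrite big_cons.
Qed.

Lemma Ex_EFin f : bmeas f -> (Ex f)%:E = (\int[P]_o (f o)%:E)%E.
Proof.
by move=> bf; rewrite /Ex /Rintegral fineK//; apply: integrable_fin_num => //; exact: bmeas_integrable.
Qed.

Lemma Ex_indic A : measurable A -> (Ex (\1_A))%:E = P A.
Proof.
move=> mA; rewrite Ex_EFin ?integral_indic ?setIT//.
split; first exact: measurable_indic.
by exists 1 => o; rewrite indicE; case: (_ \in _); rewrite ?normr1 ?normr0.
Qed.

(** The sum counts the positive integers below [y], that is, it computes the integer part of [y] as
    long as [y] does not exceed [N]. *)
Lemma floor_sum (N : nat) (y : R) : 0 <= y ->
  (y <= N%:R -> y - 1 <= \sum_(j < N) ((j.+1%:R <= y)%R : nat)%:R <= y) /\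
  (N%:R <= y -> \sum_(j < N) ((j.+1%:R <= y)%R : nat)%:R = N%:R :> R).
Proof.
move=> y0; elim: N => [|N [IH1 IH2]].
  by rewrite !big_ord0; split => // y0'; apply/andP; split; lra.
rewrite !big_ord_recr/=; split => h.
  have [h1|h1] := leP y N%:R.
    have -> : N.+1%:R <= y = false.
      by apply/negbTE; rewrite -ltNge -natr1; lra.
    by rewrite addr0; exact: IH1.
  rewrite IH2; last exact: ltW.
  have E1 : N.+1%:R = N%:R + 1 :> R by rewrite natr1.
  by case: (leP N.+1%:R y) => h2; rewrite ?mulr1n ?mulr0n; apply/andP; split; lra.
rewrite h IH2 ?natr1//; apply: le_trans h; by rewrite ler_nat.
Qed.

(** [H1] states independence for events only. Here [X] is within [1/n] of [1/n] times the number of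
    levels [j/n] it reaches, a finite sum of indicators; then [n] tends to infinity. *)
Lemma Ex_independent_step (G X : Omega -> R) (c M : R) : bmeas G ->
  measurable_fun [set: Omega] X -> (forall o, 0 <= X o <= M) ->
  (forall A, measurable A -> Ex (fun o => G o * \1_A (X o)) = c * Ex (fun o => \1_A (X o))) ->
  Ex (fun o => G o * X o) = c * Ex X.
Proof.
move=> bG mX X0M H.
have bX : bmeas X.
  split => //; exists M => o; have /andP[h1 h2] := X0M o.
  by rewrite ger0_norm.
have [_ [B hB]] := bG.
have [oO|oO] := pselect (inhabited Omega); last first.
  rewrite (_ : Ex X = 0) ?mulr0; last first.
    rewrite -[RHS](Ex_cst 0); congr Ex; apply/funext => o; exfalso; exact: oO (inhabits o).
  rewrite -[RHS](Ex_cst 0); congr Ex; apply/funext => o; exfalso; exact: oO (inhabits o).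
case: oO => o0.
have B0 : 0 <= B by exact: le_trans (hB o0).
suff h : forall n, (0 < n)%N -> `|Ex (fun o => G o * X o) - c * Ex X| <= (B + `|c|) / n%:R.
  apply/eqP; rewrite -subr_eq0 -normr_le0; apply/ler_addgt0Pr => e e0.
  rewrite add0r.
  have [n hn] : exists n : nat, (B + `|c|) / e < n%:R.
    exists (Num.truncn ((B + `|c|) / e)).+1.
    have : 0 <= (B + `|c|) / e by rewrite divr_ge0 ?addr_ge0// ltW.
    by move/truncn_itv => /andP[].
  have n0 : (0 < n)%N.
    rewrite -(ltr0n R); apply: le_lt_trans hn.
    by rewrite divr_ge0 ?addr_ge0// ltW.
  apply: le_trans (h n n0) _; rewrite ler_pdivrMr ?ltr0n// mulrC.
  by apply: ltW; rewrite -ltr_pdivrMr.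
move=> n n0; have nR : 0 < n%:R :> R by rewrite ltr0n.
have M0 : 0 <= M by have /andP[h1 h2] := X0M o0; exact: le_trans h1 h2.
(* Enough levels that none reached by [n X] is cut off. *)
have [N hN] : exists N : nat, n%:R * M <= N%:R.
  exists (Num.truncn (n%:R * M)).+1; apply: ltW.
  have : 0 <= n%:R * M by rewrite mulr_ge0.
  by move/truncn_itv => /andP[].
pose A (j : 'I_N) : set R := [set x | j.+1%:R <= n%:R * x].
have mA j : measurable (A j).
  rewrite (_ : A j = `[j.+1%:R / n%:R, +oo[%classic)//.
  by apply/seteqP; split => x /=; rewrite in_itv/= andbT /A/= ler_pdivrMr// mulrC.
pose Xn o := n%:R^-1 * \sum_j (\1_(A j) (X o) : R).
have bXn : bmeas Xn.
  apply: bmeasM; first exact: bmeas_cst.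
  by apply: bmeas_sum => j; exact: bmeas_indic.
have XnX o : `|X o - Xn o| <= n%:R^-1.
  have /andP[h1 h2] := X0M o.
  have [+ _] := @floor_sum N (n%:R * X o) (mulr_ge0 (ltW nR) h1).
  have nX : n%:R * X o <= N%:R.
    by apply: le_trans hN; rewrite ler_pM2l.
  move/(_ nX) => /andP[l u].
  have E : \sum_(j < N) ((j.+1%:R <= n%:R * X o)%R : nat)%:R = n%:R * Xn o.
    rewrite /Xn mulrA mulfV ?gt_eqF// mul1r; apply: eq_bigr => j _.
    by rewrite indicE; congr (_ %:R); congr nat_of_bool; apply/idP/idP; rewrite inE.
  rewrite E in l u.
  rewrite -(ler_pM2l nR) mulfV ?gt_eqF// -{1}(gtr0_norm nR) -normrM mulrBr ler_norml.
  apply/andP; split; lra.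
have HXn : Ex (fun o => G o * Xn o) = c * Ex Xn.
  rewrite /Xn ExZ; last by apply: bmeas_sum => j; exact: bmeas_indic.
  rewrite Ex_sum => [|j]; last exact: bmeas_indic.
  rewrite mulrCA mulr_sumr.
  transitivity (n%:R^-1 * Ex (fun o => \sum_j G o * \1_(A j) (X o))).
    rewrite -ExZ; last by apply: bmeas_sum => j; apply: bmeasM => //; exact: bmeas_indic.
    by congr Ex; apply/funext => o; rewrite -mulr_sumr mulrCA.
  rewrite Ex_sum => [|j]; last by apply: bmeasM => //; exact: bmeas_indic.
  by congr (_ * _); apply: eq_bigr => j _; exact: H.
have -> : Ex (fun o => G o * X o) - c * Ex X =
    Ex (fun o => G o * (X o - Xn o)) - c * Ex (fun o => X o - Xn o).
  rewrite (_ : (fun o => G o * (X o - Xn o)) = fun o => G o * X o - G o * Xn o); last first.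
    by apply/funext => o; rewrite mulrBr.
  rewrite !ExB//; try exact: bmeasM.
  by rewrite HXn; ring.
have bd : bmeas (fun o => X o - Xn o) by apply: bmeasD => //; exact: bmeasN.
apply: le_trans (ler_normB _ _) _; rewrite mulrDl; apply: lerD.
  apply: Ex_norm_le => [|o]; first exact: bmeasM.
  by rewrite normrM; apply: ler_pM.
by rewrite normrM ler_wpM2l//; exact: Ex_norm_le.
Qed.

End bounded_random_variables.

(** * Exponential moments of a bounded variable of mean one *)

Lemma expR_chord (R : realType) (M u x : R) : 0 < M -> 0 <= x <= M ->
  expR (u * (x - 1)) <= expR (- u) + (expR (u * (M - 1)) - expR (- u)) / M * x.
Proof.
move=> M0 /andP[x0 xM].
have t01 : 0 <= x / M <= 1 by rewrite divr_ge0 ?(ltW M0)//= ler_pdivrMr// mul1r.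
have := @convex_expR R (Itv01 (proj1 (andP t01)) (proj2 (andP t01))) (u * (M - 1)) (- u).
rewrite !convRE/= /unstable.onem => h.
rewrite (_ : u * (x - 1) = x / M * (u * (M - 1)) + (1 - x / M) * - u); last first.
  by field; rewrite gt_eqF.
apply: le_trans h _; rewrite le_eqVlt; apply/orP; left; apply/eqP.
by field; rewrite gt_eqF.
Qed.

(** The left side is the chord of [expR_chord] at [x = 1], a mean over the endpoints 0 and [M] with
    weights [1 - 1/M] and [1/M]. The linear terms that [expR_le_sqr] leaves at the two endpoints
    cancel. *)
Lemma subgaussian_mean (R : realType) (M u : R) : 1 <= M ->
  expR (- u) + (expR (u * (M - 1)) - expR (- u)) / M <= expR (2 * u ^+ 2 * M ^+ 2).
Proof.
move=> M1; have M0 : 0 < M by lra.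
have h1 := expR_le_sqr (- u); have h2 := expR_le_sqr (u * (M - 1)).
set K := expR (2 * u ^+ 2 * M ^+ 2).
have k1 : expR (2 * (- u) ^+ 2) <= K.
  rewrite ler_expR sqrrN ler_peMr//; first by rewrite mulr_ge0// sqr_ge0.
  by rewrite exprn_ege1.
have k2 : expR (2 * (u * (M - 1)) ^+ 2) <= K.
  rewrite ler_expR exprMn mulrA ler_wpM2l//; first by rewrite mulr_ge0// sqr_ge0.
  by rewrite ler_sqr ?nnegrE; lra.
rewrite -(ler_pM2l M0) mulrDr mulrCA mulfV ?gt_eqF// mulr1.
nra.
Qed.

(** * Concentration for independent conductances *)

Section independent_conductances.
Context {R : realType} {dO : measure_display} {Omega : measurableType dO}.
Variables (P : probability Omega R) (d : nat).
Variables (w : 'rV[int]_d -> 'rV[int]_d -> Omega -> R) (M : R).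
Hypothesis hw : H1 P w M.
Local Notation L := 'rV[int]_d.
Local Notation Ex := (Ex P).

(** Exactly the lists to which the independence clause of [H1] applies: no loop, and each unordered
    pair at most once. *)
Definition edges (s : seq (L * L)) : bool :=
  uniq s && all (fun e => (e.1 != e.2) && ((e.2, e.1) \notin s)) s.

Lemma edges_cons e s : edges (e :: s) ->
  [/\ e.1 != e.2, e \notin s & edges s].
Proof.
rewrite /edges /= => /andP[/andP[-> ->]] /andP[/andP[-> _]] /allP h; split => //=.
apply/allP => f fs; have := h f fs; rewrite in_cons negb_or.
by case/andP => -> /andP[_ ->].
Qed.

Lemma edges_catr s t : edges (s ++ t) -> edges t.
Proof. by elim: s => //= e s IH /edges_cons[_ _]. Qed.

Lemma edges_perm s t : perm_eq s t -> edges s = edges t.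
Proof.
move=> st; rewrite /edges (perm_uniq st); congr (_ && _).
rewrite (perm_all _ st); apply: eq_all => e.
by rewrite (perm_mem st).
Qed.

Let wP : [/\ (forall x y, x != y -> measurable_fun setT (w x y)),
   (forall x y o, x != y -> 0 <= w x y o <= M) &
   (forall x y, x != y -> Ex (w x y) = 1)].
Proof.
have [_ [mw _ _ w0 w1]] := hw; split => // x y xy.
apply/EFin_inj; rewrite Ex_EFin ?w1//.
split; first exact: mw.
by exists M => o; have /andP[h1 h2] := w0 x y o xy; rewrite ger0_norm.
Qed.

Local Notation we e := (w e.1 e.2).

Lemma bmeas_w (e : L * L) : e.1 != e.2 -> bmeas (we e).
Proof.
have [mw w0 _] := wP => ee; split; first exact: mw.
by exists M => o; have /andP[h1 h2] := w0 e.1 e.2 o ee; rewrite ger0_norm.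
Qed.

(** The mixed form carries the induction: the base case is [H1] for indicators, and each step turns
    one indicator into the weight itself by [Ex_independent_step], the induction hypothesis being
    applied with that edge on the indicator side. *)
Lemma Ex_prod_w_indic (s1 s2 : seq (L * L)) (A : L * L -> set R) :
  edges (s1 ++ s2) -> (forall e, measurable (A e)) ->
  Ex (fun o => (\prod_(e <- s1) we e o) * \prod_(e <- s2) \1_(A e) (we e o)) =
  \prod_(e <- s2) Ex (fun o => \1_(A e) (we e o)).
Proof.
have [mw w0 w1] := wP.
elim: s1 s2 A => [|e s1 IH] s2 A es mA.
  rewrite /= in es.
  have ne e : e \in s2 -> e.1 != e.2 by case/andP: es => _ /allP h /h /andP[].
  have m1 (e : L * L) : e.1 != e.2 -> measurable (w e.1 e.2 @^-1` A e).
    by move=> h; rewrite -[X in measurable X]setTI; exact: mw.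
  have E1 e : e.1 != e.2 -> (Ex (fun o => \1_(A e) (we e o)))%:E = P (w e.1 e.2 @^-1` A e).
    by move=> h; rewrite -(@Ex_indic _ _ _ P _ (m1 e h)).
  apply/EFin_inj.
  transitivity (P (\bigcap_(e in [set` s2]) (w e.1 e.2 @^-1` A e))).
    rewrite -Ex_indic; last first.
      apply: fin_bigcap_measurable; first exact: finite_seq.
      by move=> e /= /ne; exact: m1.
    congr EFin; congr Ex; apply/funext => o; rewrite big_nil mul1r indicE.
    rewrite (_ : (o \in _) = all (fun e => we e o \in A e) s2).
      by elim: (s2) => [|e t IHt]; rewrite ?big_nil// big_cons IHt indicE/= -natrM mulnb.
    apply/idP/allP; rewrite inE /bigcap/= => h.
      by move=> e es2; rewrite inE; exact: h.
    by move=> e es2; have := h e es2; rewrite inE.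
  have [_ [_ _ hind _ _]] := hw.
  rewrite (hind s2 A); last 3 first.
  - by case/andP: es.
  - by move=> e; case/andP: es => _ /allP h /h /andP[].
  - exact: mA.
  rewrite (big_morph EFin (@EFinM R) erefl).
  rewrite big_seq [RHS]big_seq; apply: eq_bigr => e /ne h.
  by rewrite E1.
have /edges_cons [e12 en es'] : edges (e :: (s1 ++ s2)) by [].
pose G o := (\prod_(e <- s1) we e o) * \prod_(e <- s2) \1_(A e) (we e o).
have bG : bmeas G.
  have ne f : f \in s1 ++ s2 -> f.1 != f.2 by case/andP: es' => _ /allP h /h /andP[].
  apply: bmeasM; apply: bmeas_prod => f fs.
    by apply: bmeas_w; apply: ne; rewrite mem_cat fs.
  by apply: bmeas_indic => //; apply: mw; apply: ne; rewrite mem_cat fs orbT.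
rewrite (_ : (fun o => _) = fun o => G o * we e o); last first.
  by apply/funext => o; rewrite big_cons /G; ring.
rewrite (@Ex_independent_step _ _ _ P G (we e) (\prod_(e <- s2) Ex (fun o => \1_(A e) (we e o))) M bG).
- by rewrite w1// mulr1.
- exact: mw.
- by move=> o; exact: w0.
move=> B mB.
pose A' f := if f == e then B else A f.
have esp : edges (s1 ++ e :: s2).
  by rewrite -(edges_perm (_ : perm_eq ([:: e] ++ s1 ++ s2) _))// perm_catCA.
have mA' f : measurable (A' f) by rewrite /A'; case: ifP.
have eq2 (F : (L * L) -> set R -> R) :
    \prod_(f <- s2) F f (A' f) = \prod_(f <- s2) F f (A f).
  rewrite big_seq [RHS]big_seq; apply: eq_bigr => f fs; rewrite /A'; case: eqP => // fe.
  by move: en; rewrite mem_cat -fe fs orbT.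
have := IH (e :: s2) A' esp mA'.
have Ae : A' e = B by rewrite /A' eqxx.
rewrite big_cons Ae (eq2 (fun f B => Ex (fun o => \1_B (we f o)))) mulrC => <-.
congr Ex; apply/funext => o; rewrite big_cons Ae.
by rewrite (eq2 (fun f B => \1_B (we f o))) /G; ring.
Qed.

Lemma Ex_prod_w (s : seq (L * L)) : edges s -> Ex (fun o => \prod_(e <- s) we e o) = 1.
Proof.
move=> es; have := @Ex_prod_w_indic s [::] (fun=> setT).
rewrite cats0 => /(_ es (fun=> measurableT)); rewrite big_nil => E.
rewrite -[RHS]E.
by congr Ex; apply/funext => o; rewrite big_nil mulr1.
Qed.

(** The triple [(a, b, s)] stands for [a + b * prod_s w]. One edge gives the chord of an exponential
    ([hoeffding_exp]), two edges a path between two points ([two_step_paths]). *)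
Definition block := (R * R * seq (L * L))%type.

(** Each block is expanded in turn, and its product of weights joins the prefix [p]; every resulting
    monomial has mean 1. *)
Lemma Ex_prod_affine (p : seq (L * L)) (l : seq block) :
  edges (p ++ flatten [seq b.2 | b <- l]) ->
  Ex (fun o => (\prod_(e <- p) we e o) *
               \prod_(b <- l) (b.1.1 + b.1.2 * \prod_(e <- b.2) we e o)) =
  \prod_(b <- l) (b.1.1 + b.1.2).
Proof.
elim: l p => [|[[a b] s] l IH] p /= es.
  rewrite cats0 in es; rewrite big_nil -[RHS](Ex_prod_w es).
  by congr Ex; apply/funext => o; rewrite big_nil mulr1.
have bw t : edges t -> bmeas (fun o => \prod_(e <- t) we e o).
  move=> et; apply: bmeas_prod => e ee; apply: bmeas_w.
  by case/andP: et => _ /allP /(_ e ee)/andP[].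
have es1 : edges (p ++ flatten [seq b.2 | b <- l]).
  apply: (@edges_catr s); rewrite -(edges_perm (_ : perm_eq (p ++ s ++ flatten [seq b.2 | b <- l]) _))//.
  by rewrite perm_catCA.
have es2 : edges ((p ++ s) ++ flatten [seq b.2 | b <- l]) by rewrite -catA.
have bl : bmeas (fun o => \prod_(b <- l) (b.1.1 + b.1.2 * \prod_(e <- b.2) we e o)).
  apply: bmeas_prod => c cl; apply: bmeasD; first exact: bmeas_cst.
  apply: bmeasM; first exact: bmeas_cst.
  apply: bmeas_prod => e ec; apply: bmeas_w.
  case/andP: es1 => _ /allP /(_ e) h; apply: (proj1 (andP (h _))).
  rewrite mem_cat; apply/orP; right; apply/flattenP; exists c.2 => //.
  exact: map_f.
have bp : bmeas (fun o => \prod_(e <- p) we e o).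
  apply: bmeas_prod => e ep; apply: bmeas_w.
  by case/andP: es => _ /allP /(_ e); rewrite mem_cat ep => /(_ isT)/andP[].
have bs : bmeas (fun o => \prod_(e <- s) we e o).
  apply: bmeas_prod => e ep; apply: bmeas_w.
  by case/andP: es => _ /allP /(_ e); rewrite !mem_cat ep orbT => /(_ isT)/andP[].
pose Q o := \prod_(b <- l) (b.1.1 + b.1.2 * \prod_(e <- b.2) we e o).
have b1 : bmeas (fun o => \prod_(e <- p) we e o * Q o) by exact: bmeasM.
have b2 : bmeas (fun o => \prod_(e <- p ++ s) we e o * Q o).
  rewrite (_ : (fun o => _) = fun o => ((\prod_(e <- p) we e o) * \prod_(e <- s) we e o) * Q o).
    by apply: bmeasM => //; exact: bmeasM.
  by apply/funext => o; rewrite big_cat.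
rewrite big_cons/= mulrDl -{1}(IH p es1) -(IH _ es2).
rewrite -(ExZ P a b1) -(ExZ P b b2) -ExD.
- by congr Ex; apply/funext => o; rewrite big_cons/= big_cat/= -/(Q o); ring.
- by apply: bmeasM => //; exact: bmeas_cst.
- by apply: bmeasM => //; exact: bmeas_cst.
Qed.

Lemma markov_exp (S : Omega -> R) (t K : R) : bmeas S ->
  Ex (fun o => expR (S o)) <= K -> (P [set o | (t <= S o)%R] <= (K * expR (- t))%:E)%E.
Proof.
move=> bS hK.
have [mS [B hB]] := bS.
have mA : measurable [set o | t <= S o].
  rewrite (_ : [set o | _] = S @^-1` `[t, +oo[%classic); last first.
    by apply/seteqP; split => o /=; rewrite in_itv/= andbT.
  by rewrite -[X in measurable X]setTI; apply: mS.
have be : bmeas (fun o => expR (S o)).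
  split; first exact: measurableT_comp.
  exists (expR B) => o; rewrite ger0_norm ?expR_ge0// ler_expR.
  by apply: le_trans (hB o); exact: ler_norm.
rewrite -Ex_indic// lee_fin mulrC.
apply: le_trans (_ : expR (- t) * Ex (fun o => expR (S o)) <= _); last first.
  by rewrite ler_pM2l ?expR_gt0.
rewrite -ExZ//; apply: le_Ex.
- split; first exact: measurable_indic.
  by exists 1 => o; rewrite indicE; case: (_ \in _); rewrite ?normr1 ?normr0.
- by apply: bmeasM => //; exact: bmeas_cst.
move=> o; rewrite indicE -expRD.
have [|_] := boolP (o \in _); last exact: expR_ge0.
rewrite inE/= => h; apply: le_trans (expR_ge1Dx _); lra.
Qed.

Hypothesis M1 : 1 <= M.

Let M0 : 0 < M. Proof. exact: lt_le_trans ltr01 M1. Qed.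

Lemma hoeffding_exp (s : seq (L * L)) (a : L * L -> R) : edges s ->
  Ex (fun o => expR (\sum_(e <- s) a e * (we e o - 1))) <=
  expR (2 * M ^+ 2 * \sum_(e <- s) a e ^+ 2).
Proof.
move=> es; have M1' := M1; have M0' := M0.
have ne e : e \in s -> e.1 != e.2 by case/andP: es => _ /allP h /h /andP[].
have [mw w0 w1] := wP.
pose B u := (expR (u * (M - 1)) - expR (- u)) / M.
pose l := [seq (expR (- a e), B (a e), [:: e]) : block | e <- s].
have := @Ex_prod_affine [::] l.
rewrite cat0s (_ : flatten _ = s); last first.
  by rewrite /l -map_comp /=; elim: (s) => //= e t ->.
move=> /(_ es).
rewrite (_ : (fun o => _) = fun o => \prod_(e <- s) (expR (- a e) + B (a e) * we e o)); last first.
  apply/funext => o; rewrite big_nil mul1r /l big_map.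
  by apply: eq_bigr => e _; rewrite big_seq1.
rewrite big_map/= => E.
have bS : bmeas (fun o => \sum_(e <- s) a e * (we e o - 1)).
  apply: bmeas_sum_seq => e ee; apply: bmeasM; first exact: bmeas_cst.
  by apply: bmeasD; [apply: bmeas_w; exact: ne|exact: bmeas_cst].
apply: le_trans (_ : Ex (fun o => \prod_(e <- s) (expR (- a e) + B (a e) * we e o)) <= _).
  apply: le_Ex.
  - have [mS [C hC]] := bS; split; first exact: measurableT_comp.
    exists (expR C) => o; rewrite ger0_norm ?expR_ge0// ler_expR.
    by apply: le_trans (hC o); exact: ler_norm.
  - apply: bmeas_prod => e ee; apply: bmeasD; first exact: bmeas_cst.
    by apply: bmeasM; [exact: bmeas_cst|apply: bmeas_w; exact: ne].
  move=> o; rewrite (big_morph expR (@expRD R) (@expR0 R)).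
  rewrite big_seq [leRHS]big_seq; apply: ler_prod => e ee; rewrite expR_ge0/=.
  by apply: expR_chord => //; exact: w0 (ne e ee).
rewrite E mulr_sumr (big_morph expR (@expRD R) (@expR0 R)).
apply: ler_prod => e _; apply/andP; split.
  have h : 0 <= M^-1 <= 1 by rewrite invr_ge0 (ltW M0)/= invf_le1.
  rewrite /B; have := expR_ge0 (- a e); have := expR_ge0 (a e * (M - 1)); nra.
by rewrite [leRHS](_ : _ = expR (2 * a e ^+ 2 * M ^+ 2)) ?subgaussian_mean//; congr expR; ring.
Qed.

Lemma hoeffding (s : seq (L * L)) (a : L * L -> R) (K : R) : edges s -> 0 < K ->
  (P [set o | 8 * M ^+ 2 * K * (\sum_(e <- s) a e ^+ 2) <
              (\sum_(e <- s) a e * (we e o - 1)) ^+ 2]%R <= (2 * expR (- K))%:E)%E.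
Proof.
move=> es K0; have M1' := M1; have M0' := M0.
have ne e : e \in s -> e.1 != e.2 by case/andP: es => _ /allP h /h /andP[].
set V := \sum_(e <- s) a e ^+ 2.
have V0 : 0 <= V by apply: sumr_ge0 => e _; exact: sqr_ge0.
pose S (c : R) o := \sum_(e <- s) c * a e * (we e o - 1).
have bS c : bmeas (S c).
  apply: bmeas_sum_seq => e ee; apply: bmeasM; first exact: bmeas_cst.
  by apply: bmeasD; [apply: bmeas_w; exact: ne|exact: bmeas_cst].
have Sc c o : S c o = c * \sum_(e <- s) a e * (we e o - 1).
  by rewrite mulr_sumr; apply: eq_bigr => e _; rewrite mulrA.
have [V00|Vp] := eqVneq V 0.
  rewrite (_ : [set o | _] = set0) ?measure0 ?lee_fin ?mulr_ge0 ?expR_ge0//.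
  apply/seteqP; split => // o /=; rewrite V00 mulr0.
  have a0 e : e \in s -> a e = 0.
    move=> es'; apply/eqP; rewrite -sqrf_eq0; apply/eqP; apply/le_anti.
    rewrite sqr_ge0 andbT -V00 /V (big_rem e)//= lerDl.
    by apply: sumr_ge0 => *; exact: sqr_ge0.
  by rewrite big_seq big1 ?expr0n ?ltxx// => e /a0 ->; rewrite mul0r.
have {}Vp : 0 < V by rewrite lt_neqAle eq_sym Vp.
(* With this parameter the exponential moment is at most [exp K], against the level [2 K];
   [(2 K / th)^2] is the threshold of the statement. *)
pose th := Num.sqrt (K / (2 * M ^+ 2 * V)).
have th2 : th ^+ 2 * (2 * M ^+ 2 * V) = K.
  rewrite sqr_sqrtr ?divfK// ?divr_ge0 ?mulr_ge0 ?(ltW K0) ?(ltW M0)// ?sqr_ge0//.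
  by rewrite mulf_neq0 ?mulf_neq0 ?sqrf_eq0 ?gt_eqF.
have th0 : 0 < th by rewrite sqrtr_gt0 divr_gt0// !mulr_gt0// exprn_gt0.
have tail (c : R) : c ^+ 2 = th ^+ 2 -> (P [set o | (2 * K <= S c o)%R] <= (expR (- K))%:E)%E.
  move=> c2; have := @markov_exp (S c) (2 * K) (expR K) (bS c) _.
  rewrite -expRD (_ : K + - (2 * K) = - K); last by ring.
  apply; apply: le_trans (hoeffding_exp (fun e => c * a e) es) _.
  rewrite ler_expR; under eq_bigr do rewrite exprMn.
  by rewrite -mulr_sumr -/V c2 -[leRHS]th2; lra.
have mS c : measurable [set o | (2 * K <= S c o)%R].
  rewrite (_ : [set o | _] = S c @^-1` `[2 * K, +oo[%classic); last first.
    by apply/seteqP; split => o /=; rewrite in_itv/= andbT.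
  by rewrite -[X in measurable X]setTI; apply: (bS c).1.
apply: le_trans (_ : P ([set o | (2 * K <= S th o)%R] `|` [set o | (2 * K <= S (- th) o)%R]) <= _)%E.
  apply: le_measure; rewrite ?inE; last 2 first.
  - exact: measurableU.
  - move=> o /=; rewrite !Sc => h.
    set X := \sum_(e <- s) _ in h *.
    have h2 : (2 * K) ^+ 2 < (th * X) ^+ 2.
      have h3 : th ^+ 2 * (8 * M ^+ 2 * K * V) < th ^+ 2 * X ^+ 2.
        by rewrite ltr_pM2l// exprn_gt0.
      rewrite [ltRHS]exprMn; apply: le_lt_trans h3.
      rewrite (_ : th ^+ 2 * _ = 4 * K * (th ^+ 2 * (2 * M ^+ 2 * V))); last by ring.
      by rewrite th2 le_eqVlt; apply/orP; left; apply/eqP; ring.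
    have [p|n] := leP 0 (th * X).
      left; apply: ltW; rewrite -ltr_sqr// nnegrE; lra.
    right; rewrite mulNr; apply: ltW; rewrite -ltr_sqr ?nnegrE ?sqrrN//; lra.
  - have mT : measurable_fun setT (fun o => (\sum_(e <- s) a e * (we e o - 1)) ^+ 2).
      have [+ _] := bS 1; rewrite (_ : S 1 = fun o => \sum_(e <- s) a e * (we e o - 1)).
        by move=> h; apply: measurable_funX.
      by apply/funext => o; rewrite Sc mul1r.
    rewrite (_ : [set o | _] = (fun o => (\sum_(e <- s) a e * (we e o - 1)) ^+ 2) @^-1`
       `]8 * M ^+ 2 * K * V, +oo[%classic); last first.
      by apply/seteqP; split => o /=; rewrite in_itv/= andbT.
    by rewrite -[X in measurable X]setTI; apply: mT.
apply: le_trans (measureU2 _ (mS _) (mS _)) _.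
rewrite (_ : 2 * expR (- K) = expR (- K) + expR (- K)); last by ring.
by rewrite EFinD; apply: leeD; apply: tail => //; rewrite sqrrN.
Qed.

(** Paths through distinct [z] share no edge, so the products [w x z * w y z] are independent, of
    mean 1 and at most [M^2]. On [[0, 1]], [exp (- u) <= 1 - u/2] makes the Laplace transform affine
    in each product and hence computable by [Ex_prod_affine]. *)
Lemma two_step_paths (x y : L) (s : seq L) : x != y -> uniq s -> x \notin s -> y \notin s ->
  (P [set o | \sum_(z <- s) w x z o * w y z o < (size s)%:R / 4]%R <=
   (expR (- ((size s)%:R / (4 * M ^+ 2))))%:E)%E.
Proof.
move=> xy us xs ys; have M1' := M1; have M0' := M0.
have [mw w0 w1] := wP.
have nx z : z \in s -> x != z by apply: contraTneq => <-.
have ny z : z \in s -> y != z by apply: contraTneq => <-.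
set n := size s.
pose l := [seq (1, - (2 * M ^+ 2)^-1, [:: (x, z); (y, z)]) : block | z <- s].
have fl : perm_eq (flatten [seq b.2 | b <- l]) ([seq (x, z) | z <- s] ++ [seq (y, z) | z <- s]).
  rewrite /l -map_comp /=; elim: (s) => //= z t IH.
  rewrite perm_cons; apply: perm_trans (_ : perm_eq ((y, z) :: _) _).
    by rewrite perm_cons; exact: IH.
  rewrite -cat1s perm_catCA; exact: perm_refl.
have es : edges (flatten [seq b.2 | b <- l]).
  rewrite (edges_perm fl) /edges cat_uniq !map_inj_uniq ?us//; last 2 first.
  - by move=> ? ? [].
  - by move=> ? ? [].
  rewrite andbT; apply/andP; split.
    apply/hasPn => e /mapP[z zs ->]; apply/negP => /mapP[z' zs' [yx _]].
    by rewrite yx eqxx in xy.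
  apply/allP => e; rewrite mem_cat => /orP[]/mapP[z zs ->] /=.
    rewrite nx//= mem_cat negb_or; apply/andP; split; apply/negP => /mapP[z' zs' [h1 h2]].
      by rewrite h2 zs' in xs.
    by rewrite h2 zs' in xs.
  rewrite ny//= mem_cat negb_or; apply/andP; split; apply/negP => /mapP[z' zs' [h1 h2]].
    by rewrite h2 zs' in ys.
  by rewrite h2 zs' in ys.
have := @Ex_prod_affine [::] l es.
rewrite (_ : (fun o => _) = fun o => \prod_(z <- s) (1 - (2 * M ^+ 2)^-1 * (w x z o * w y z o))); last first.
  apply/funext => o; rewrite big_nil mul1r /l big_map.
  by apply: eq_bigr => z _; rewrite big_cons big_seq1 mulNr.
rewrite big_map/= => E.
pose S o := \sum_(z <- s) - (M ^- 2 * (w x z o * w y z o)).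
have bz z : z \in s -> bmeas (fun o => w x z o * w y z o).
  by move=> zs; apply: bmeasM; [apply: (@bmeas_w (x, z))|apply: (@bmeas_w (y, z))]; [exact: nx|exact: ny].
have bS : bmeas S.
  apply: bmeas_sum_seq => z zs; apply: bmeasN.
  by apply: bmeasM; [exact: bmeas_cst|exact: bz].
have M2 : 0 < M ^+ 2 by rewrite exprn_gt0.
have prob : (P [set o | (- (n%:R / (4 * M ^+ 2)) <= S o)%R] <=
   (expR (- (n%:R / (4 * M ^+ 2))))%:E)%E.
  have := @markov_exp S (- (n%:R / (4 * M ^+ 2))) (expR (- (n%:R / (2 * M ^+ 2)))) bS.
  rewrite -expRD opprK (_ : _ + _ = - (n%:R / (4 * M ^+ 2))); last by field; rewrite gt_eqF.
  apply.
  apply: le_trans (_ : Ex (fun o => \prod_(z <- s) (1 - (2 * M ^+ 2)^-1 * (w x z o * w y z o))) <= _).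
    apply: le_Ex.
    - have [mS [C hC]] := bS; split; first exact: measurableT_comp.
      exists (expR C) => o; rewrite ger0_norm ?expR_ge0// ler_expR.
      by apply: le_trans (hC o); exact: ler_norm.
    - apply: bmeas_prod => z zs; apply: bmeasD; first exact: bmeas_cst.
      by apply: bmeasN; apply: bmeasM; [exact: bmeas_cst|exact: bz].
    move=> o; rewrite /S (big_morph expR (@expRD R) (@expR0 R)).
    rewrite big_seq [leRHS]big_seq; apply: ler_prod => z zs; rewrite expR_ge0/=.
    have /andP[a1 a2] := w0 x z o (nx z zs); have /andP[b1 b2] := w0 y z o (ny z zs).
    set u := M ^- 2 * _.
    have u01 : 0 <= u <= 1.
      rewrite /u mulr_ge0 ?invr_ge0 ?(ltW M2) ?mulr_ge0//= mulrC ler_pdivrMr// mul1r expr2.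
      exact: ler_pM.
    have -> : (2 * M ^+ 2)^-1 * (w x z o * w y z o) = u / 2 by rewrite /u; field; rewrite gt_eqF.
    case/andP: u01 => u0 u1.
    have h1 : 1 + u <= expR u by exact: expR_ge1Dx.
    have h2 : expR u * expR (- u) = 1 by rewrite -expRD subrr expR0.
    have h3 := expR_gt0 (- u); have h4 := expR_gt0 u.
    rewrite -(ler_pM2l h4) h2; nra.
  rewrite E; under eq_bigr do rewrite -/(1 - _).
  rewrite big_const_seq count_predT -/n iter_mulr mulr1.
  rewrite (_ : - (n%:R / (2 * M ^+ 2)) = - (2 * M ^+ 2)^-1 * n%:R); last by rewrite mulNr mulrC.
  rewrite expRM powR_mulrn ?expR_ge0//.
  have h : 1 - (2 * M ^+ 2)^-1 <= expR (- (2 * M ^+ 2)^-1) by exact: expR_ge1Dx.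
  apply: lerXn2r => //; rewrite nnegrE ?expR_ge0// subr_ge0 invf_le1//; last by lra.
  by have : 1 <= M ^+ 2; [rewrite expr_ge1//; lra|lra].
apply: le_trans prob; apply: le_measure; rewrite ?inE.
- have mT : measurable_fun setT (fun o => \sum_(z <- s) w x z o * w y z o).
    by have [] : bmeas (fun o => \sum_(z <- s) w x z o * w y z o) by exact: bmeas_sum_seq.
  rewrite (_ : [set o | _] = (fun o => \sum_(z <- s) w x z o * w y z o) @^-1`
     `]-oo, n%:R / 4[%classic); last by apply/seteqP; split => o /=; rewrite in_itv.
  by rewrite -[X in measurable X]setTI; apply: mT.
- rewrite (_ : [set o | _] = S @^-1` `[- (n%:R / (4 * M ^+ 2)), +oo[%classic); last first.
    by apply/seteqP; split => o /=; rewrite in_itv/= andbT.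
  by rewrite -[X in measurable X]setTI; apply: bS.1.
- move=> o /= h; rewrite /S sumrN lerN2 -mulr_sumr ler_pdivrMl//.
  rewrite (_ : M ^+ 2 * _ = n%:R / 4); last by field; rewrite gt_eqF.
  exact: ltW.
Qed.

End independent_conductances.

(** The threshold is [K0] plus the sum of [k] times the indicator of [Bad k]. It is visibly
    measurable, it is at least [k] on [Bad k], and it is finite wherever only finitely many bad
    events occur, which is almost surely the case by Borel-Cantelli. *)
Lemma random_threshold {R : realType} {dO : measure_display} {Omega : measurableType dO}
    (P : probability Omega R) (Bad : nat -> set Omega) (K0 C : R) :
  1 <= K0 -> (forall k, measurable (Bad k)) ->
  (forall k, (P (Bad k) <= (C * k.+1%:R `^ (-2))%:E)%E) ->
  exists k0 : Omega -> \bar R,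
    [/\ measurable_fun [set: Omega] k0, (forall o, (K0%:E <= k0 o)%E),
        P [set o | k0 o = +oo%E] = 0%E &
        forall o k, (k0 o < k%:R%:E)%E -> ~ Bad k o].
Proof.
move=> K1 mB PB.
pose f (k : nat) o : \bar R := (k%:R * \1_(Bad k) o)%:E.
have f0 k o : (0 <= f k o)%E by rewrite lee_fin mulr_ge0// indicE.
pose S o := (\sum_(0 <= k <oo) f k o)%E.
have SE o : S o = (\esum_(k in [set: nat]) f k o)%E by rewrite /S nneseries_esumT.
have S0 o : (0 <= S o)%E by rewrite SE; exact: esum_ge0.
have mS : measurable_fun [set: Omega] S.
  apply: (@ge0_emeasurable_sum _ _ _ _ f xpredT) => // k _.
  apply/measurable_EFinP; apply: measurable_funM; first exact: measurable_cst.
  exact: measurable_indic.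
have PS : P (lim_sup_set Bad) = 0%E.
  apply: lim_sup_set_cvg0 => //; rewrite nneseries_esumT//.
  have [D D0 hD] := @sum_powR_bounded R 2 ltac:(lra).
  apply: le_lt_trans (_ : (_ <= (`|C| * D)%:E)%E) (ltry _).
  apply: esum_le_fin => s us.
  have [N hN] : exists N, forall n, n \in s -> (n < N)%N.
    elim: s {us} => [|n s [N IH]]; first by exists 0%N.
    exists (n.+1 + N)%N => m; rewrite inE => /orP[/eqP ->|/IH]; lia.
  pose a (n : nat) : \bar R := if (n < N)%N then (`|C| * n.+1%:R `^ (-2))%:E else 0%E.
  have a0 n : (0 <= a n)%E by rewrite /a; case: ifP; rewrite ?lee_fin ?mulr_ge0 ?powR_ge0.
  apply: le_trans (_ : (\sum_(i <- s) a i <= _)%E).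
    rewrite big_seq [leRHS]big_seq; apply: lee_sum => n /hN nN; rewrite /a nN.
    apply: le_trans (PB n) _; rewrite lee_fin ler_wpM2r ?powR_ge0//.
    exact: ler_norm.
  apply: le_trans (esum_ge_fin us a0) _.
  rewrite (@esum_finType _ _ _ (@nat_of_ord N) a (@ord_inj N) a0); last first.
    move=> n h; rewrite /a; case: ifP => // nN.
    by exfalso; apply: h; exists (Ordinal nN).
  rewrite (eq_bigr (fun i : 'I_N => (`|C| * i.+1%:R `^ (-2))%:E)) => [|i _]; last first.
    by rewrite /a ltn_ord.
  rewrite sumEFin lee_fin -mulr_sumr ler_wpM2l//.
  by have := hD N; rewrite big_mkord.
exists (fun o => K0%:E + S o)%E; split.
- by apply: emeasurable_funD => //; exact: measurable_cst.
- by move=> o; rewrite leeDl.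
- have mI : measurable [set o | (K0%:E + S o = +oo)%E].
    rewrite (_ : [set o | _] = S @^-1` [set +oo%E]).
      by rewrite -[X in measurable X]setTI; apply: mS => //; exact: emeasurable_set1.
    apply/seteqP; split => o /=; last by move->; rewrite addey.
    by case: (S o) (S0 o) => //= r _; rewrite -EFinD.
  apply/eqP; rewrite eq_le measure_ge0 andbT -PS; apply: le_measure; rewrite ?inE//.
    apply: bigcapT_measurable => n; apply: bigcup_measurable => k _; exact: mB.
  move=> o /= Soo; apply: contrapT => /= hn.
  have [n hn2] : exists n, forall k, (n <= k)%N -> ~ Bad k o.
    move: hn => /existsNP[n] /not_implyP[_ hn]; exists n => k nk Bk; apply: hn.
    by exists k.
  have : (S o < +oo)%E.
    rewrite SE (@esum_finType _ _ _ (@nat_of_ord n) (fun k => f k o) (@ord_inj n)) //.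
      by rewrite sumEFin ltry.
    move=> k hk; rewrite /f indicE memNset ?mulr0//; apply: hn2; rewrite leqNgt.
    by apply/negP => kn; apply: hk; exists (Ordinal kn).
  by case: (S o) (S0 o) Soo => //= r _; rewrite -EFinD.
- move=> o k; apply: contraPnot => Bk; apply/negP; rewrite -leNgt.
  apply: le_trans (_ : (S o <= _)%E); last by rewrite leeDr// lee_fin; lra.
  rewrite SE; apply: le_trans (esum_ge_pt k (fun k => f0 k o)).
  by rewrite /f indicE mem_set// mulr1.
Qed.

(** * Block averages: multiscale decomposition and Poincare inequality *)

Section multiscale.
Variables (R : realType) (T : finType) (C : eqType) (q : nat -> T -> C) (nn : nat -> nat).
Variable J : nat.
Hypothesis qcard : forall j x, (j <= J)%N -> #|[pred y | q j y == q j x]| = nn j.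
Hypothesis nest : forall j x y, q j x = q j y -> q j.+1 x = q j.+1 y.
Implicit Types v h : T -> R.

Definition avg j v x : R := (nn j)%:R^-1 * \sum_(y | q j y == q j x) v y.

Lemma nn_gt0 j (x : T) : (j <= J)%N -> (0 < nn j)%N.
Proof.
move=> jJ; rewrite -(qcard x jJ); apply/card_gt0P; exists x.
by rewrite inE/= eqxx.
Qed.

Lemma avg_adj j h v : \sum_x avg j h x * v x = \sum_x h x * avg j v x.
Proof.
rewrite /avg.
under eq_bigr do rewrite -mulrA big_mkcond mulr_suml.
under [RHS]eq_bigr do rewrite mulrCA big_mkcond mulr_sumr.
rewrite -!mulr_sumr exchange_big/=; congr (_ * _).
apply: eq_bigr => x _; apply: eq_bigr => y _.
by rewrite eq_sym; case: ifP; rewrite ?mul0r ?mulr0.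
Qed.

Lemma avg_avg j v x : (j < J)%N -> avg j (avg j.+1 v) x = avg j.+1 v x.
Proof.
move=> jJ; rewrite [LHS]/avg (eq_bigr (fun=> avg j.+1 v x)) => [|y /eqP h].
  rewrite sumr_const (qcard x (ltnW jJ)) -[avg _ _ _ *+ _]mulr_natl mulrA mulVf ?mul1r//.
  by rewrite pnatr_eq0 -lt0n (nn_gt0 x)// ltnW.
by rewrite /avg (nest h).
Qed.

(** Averages are self-adjoint and nested, so averaging at scale [j] leaves the averages at scale
    [j+1] unchanged, and the pairing telescopes. In each term [h] is already averaged at scale [j],
    while [v] enters only through its oscillation at scale [j+1]. *)
Lemma multiscale_decomposition j0 h v : (j0 <= J)%N ->
  \sum_x h x * v x = \sum_x h x * (v x - avg j0 v x) +
    \sum_(j0 <= j < J) \sum_x avg j h x * (v x - avg j.+1 v x) +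
    \sum_x avg J h x * v x.
Proof.
have H n : (j0 + n <= J)%N ->
  \sum_x h x * v x = \sum_x h x * (v x - avg j0 v x) +
    \sum_(j0 <= j < j0 + n) \sum_x avg j h x * (v x - avg j.+1 v x) +
    \sum_x avg (j0 + n) h x * v x.
  elim: n => [|n IH] nJ.
    rewrite addn0 big_geq// addr0 avg_adj -big_split/=.
    by apply: eq_bigr => x _; rewrite -mulrDr subrK.
  rewrite IH; last by apply: leq_trans nJ; rewrite leq_add2l.
  rewrite addnS big_nat_recr ?leq_addr//= -!addrA; congr (_ + _); congr (_ + _).
  have -> : \sum_x avg (j0 + n).+1 h x * v x = \sum_x avg (j0 + n) h x * avg (j0 + n).+1 v x.
    rewrite !avg_adj; apply: eq_bigr => x _; rewrite avg_avg//.
    by rewrite -addnS.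
  rewrite -big_split/=; apply: eq_bigr => x _.
  by rewrite -mulrDr subrK.
by move=> j0J; have := H (J - j0)%N; rewrite subnKC//; apply.
Qed.

Lemma avg_variance j v : (j <= J)%N ->
  \sum_x (v x - avg j v x) ^+ 2 <=
  (nn j)%:R^-1 * \sum_x \sum_(y | q j y == q j x) (v x - v y) ^+ 2.
Proof.
move=> jJ; rewrite mulr_sumr; apply: ler_sum => x _.
have n0 : 0 < (nn j)%:R :> R by rewrite ltr0n (nn_gt0 x).
have -> : v x - avg j v x = (nn j)%:R^-1 * \sum_(y | q j y == q j x) 1 * (v x - v y).
  under eq_bigr do rewrite mul1r.
  rewrite sumrB sumr_const (qcard x jJ) -[v x *+ _]mulr_natl mulrBr mulrA mulVf ?mul1r//.
  by rewrite gt_eqF.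
rewrite exprMn [X in X * _]expr2 -mulrA ler_pM2l ?invr_gt0//.
rewrite ler_pdivrMl//; apply: le_trans (CauchySchwarz_sum _ _ _) _.
by under eq_bigr do rewrite expr1n; rewrite sumr_const (qcard x jJ).
Qed.

(** A single edge may have weight 0, so [x] and [y] are joined through all intermediate points at
    once. Along a path [x, z, y] one factor of [W x z * W y z] is bounded by [M] and the other one
    weights a squared increment of [v]. *)
Lemma poincare_two_steps j v (W : T -> T -> R) (M : R) : (j <= J)%N -> 0 < M ->
  (forall x y, x != y -> 0 <= W x y <= M) ->
  (forall x y, x != y -> q j x = q j y ->
    (nn j)%:R / 8 <= \sum_(z | [&& q j z == q j x, z != x & z != y]) W x z * W y z) ->
  \sum_x (v x - avg j v x) ^+ 2 <=
  32 * M / (nn j)%:R * \sum_x \sum_(z | (q j z == q j x) && (z != x)) W x z * (v x - v z) ^+ 2.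
Proof.
move=> jJ M0 W0 good.
pose g x := \sum_(z | (q j z == q j x) && (z != x)) W x z * (v x - v z) ^+ 2.
have g0 x : 0 <= g x.
  apply: sumr_ge0 => z /andP[_ zx]; rewrite mulr_ge0 ?sqr_ge0//.
  by have /andP[] := W0 x z ltac:(by rewrite eq_sym).
have [x0|T0] := pickP (fun x : T => true); last first.
  rewrite big1 => [|x]; last by have := T0 x.
  by rewrite [X in _ * X]big1 ?mulr0// => x; have := T0 x.
move=> _; have n0 : 0 < (nn j)%:R :> R by rewrite ltr0n (nn_gt0 x0).
have pt x y : q j y == q j x -> (nn j)%:R / 8 * (v x - v y) ^+ 2 <= 2 * M * (g x + g y).
  move=> /eqP xy; have [->|nxy] := eqVneq x y.
    by rewrite subrr expr0n mulr0 !mulr_ge0 ?addr_ge0// ltW.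
  apply: le_trans (_ : \sum_(z | [&& q j z == q j x, z != x & z != y]) W x z * W y z * (v x - v y) ^+ 2 <= _).
    by rewrite -mulr_suml ler_wpM2r ?sqr_ge0//; exact: good.
  have bound z : [&& q j z == q j x, z != x & z != y] ->
      W x z * W y z * (v x - v y) ^+ 2 <=
      2 * M * (W x z * (v x - v z) ^+ 2) + 2 * M * (W y z * (v y - v z) ^+ 2).
    move=> /and3P[_ zx zy].
    have /andP[a0 aM] := W0 x z ltac:(by rewrite eq_sym).
    have /andP[b0 bM] := W0 y z ltac:(by rewrite eq_sym).
    have h : (v x - v y) ^+ 2 <= 2 * (v x - v z) ^+ 2 + 2 * (v y - v z) ^+ 2.
      by have := sqr_ge0 (v x - v z + (v y - v z)); nra.
    apply: le_trans (ler_wpM2l (mulr_ge0 a0 b0) h) _.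
    rewrite mulrDr; apply: lerD.
      rewrite [leLHS](_ : _ = W y z * (2 * (W x z * (v x - v z) ^+ 2))); last by ring.
      rewrite [leRHS](_ : _ = M * (2 * (W x z * (v x - v z) ^+ 2))); last by ring.
      by rewrite ler_wpM2r// mulr_ge0// mulr_ge0// sqr_ge0.
    rewrite [leLHS](_ : _ = W x z * (2 * (W y z * (v y - v z) ^+ 2))); last by ring.
    rewrite [leRHS](_ : _ = M * (2 * (W y z * (v y - v z) ^+ 2))); last by ring.
    by rewrite ler_wpM2r// mulr_ge0// mulr_ge0// sqr_ge0.
  apply: le_trans (ler_sum _ bound) _.
  rewrite big_split/= -!mulr_sumr -mulrDr ler_wpM2l ?mulr_ge0 ?(ltW M0)//.
  apply: lerD; rewrite /g.
    rewrite [leRHS](bigID (fun z => z != y))/=.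
    rewrite (eq_bigl (fun z => ((q j z == q j x) && (z != x)) && (z != y))); last first.
      by move=> z; rewrite andbA.
    rewrite lerDl sumr_ge0// => z /andP[/andP[_ zx] _]; rewrite mulr_ge0 ?sqr_ge0//.
    by have /andP[] := W0 x z ltac:(by rewrite eq_sym).
  rewrite [leRHS](bigID (fun z => z != x))/=.
  rewrite (eq_bigl (fun z => ((q j z == q j y) && (z != y)) && (z != x))); last first.
    by move=> z; rewrite xy -andbA; congr (_ && _); rewrite andbC.
  rewrite lerDl sumr_ge0// => z /andP[/andP[_ zx] _]; rewrite mulr_ge0 ?sqr_ge0//.
  by have /andP[] := W0 y z ltac:(by rewrite eq_sym).
apply: le_trans (avg_variance v jJ) _.
(* Each [g x] is counted once for every point of its block, on either side of the pair. *)
have key : (nn j)%:R / 8 * \sum_x \sum_(y | q j y == q j x) (v x - v y) ^+ 2 <=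
    4 * M * (nn j)%:R * \sum_x g x.
  rewrite mulr_sumr.
  apply: le_trans (_ : \sum_x \sum_(y | q j y == q j x) 2 * M * (g x + g y) <= _).
    by apply: ler_sum => x _; rewrite mulr_sumr; apply: ler_sum => y xy; exact: pt.
  under eq_bigr do rewrite -mulr_sumr big_split/= sumr_const (qcard _ jJ).
  rewrite -mulr_sumr big_split/=.
  have -> : \sum_(i : T) g i *+ nn j = (nn j)%:R * \sum_i g i.
    by rewrite mulr_sumr; apply: eq_bigr => i _; rewrite mulr_natl.
  have -> : \sum_(x : T) \sum_(y | q j y == q j x) g y = (nn j)%:R * \sum_i g i.
    under eq_bigr do rewrite big_mkcond.
    rewrite exchange_big/= mulr_sumr; apply: eq_bigr => y _.
    rewrite -big_mkcond/= (eq_bigl (fun x => q j x == q j y)) => [|x]; last by rewrite eq_sym.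
    by rewrite sumr_const (qcard _ jJ) mulr_natl.
  by rewrite le_eqVlt; apply/orP; left; apply/eqP; ring.
rewrite -/g.
rewrite -(ler_pM2l (_ : 0 < (nn j)%:R * ((nn j)%:R / 8))); last by rewrite !mulr_gt0.
rewrite [leLHS](_ : _ = (nn j)%:R / 8 * \sum_x \sum_(y | q j y == q j x) (v x - v y) ^+ 2); last first.
  by field; rewrite gt_eqF.
apply: le_trans key _; rewrite le_eqVlt; apply/orP; left; apply/eqP.
by field; rewrite gt_eqF.
Qed.

Lemma multiscale_bound j0 h v (H0 E : R) (p eta : nat -> R) : (j0 <= J)%N ->
  0 <= H0 -> (forall j, 0 <= p j) -> (forall j, 0 <= eta j) -> 0 <= E ->
  \sum_x h x ^+ 2 <= H0 ^+ 2 ->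
  (forall j, (j0 <= j <= J)%N -> \sum_x (v x - avg j v x) ^+ 2 <= p j ^+ 2 * E) ->
  (forall j, (j0 <= j <= J)%N -> \sum_x avg j h x ^+ 2 <= eta j ^+ 2) ->
  \sum_x h x * v x <= (H0 * p j0 + \sum_(j0 <= j < J) eta j * p j.+1) * Num.sqrt E +
    eta J * Num.sqrt (\sum_x v x ^+ 2).
Proof.
move=> j0J H00 p0 eta0 E0 hH hp heta.
have cs (a b : T -> R) (A B : R) : 0 <= A -> 0 <= B -> \sum_x a x ^+ 2 <= A ^+ 2 ->
    \sum_x b x ^+ 2 <= B ^+ 2 * E -> \sum_x a x * b x <= A * B * Num.sqrt E.
  move=> A0 B0 hA hB; apply: le_trans (CauchySchwarz_sqrt _ _ _) _.
  rewrite -mulrA; apply: ler_pM; rewrite ?sqrtr_ge0//.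
    by rewrite -[leRHS](ger0_norm A0) -sqrtr_sqr ler_sqrt// sqr_ge0.
  rewrite -[X in X * _](ger0_norm B0) -sqrtr_sqr -sqrtrM ?sqr_ge0// ler_sqrt//.
  by rewrite mulr_ge0// sqr_ge0.
rewrite (multiscale_decomposition _ _ j0J) mulrDl; apply: lerD.
  apply: lerD; first by apply: cs => //; apply: hp; rewrite leqnn.
  rewrite mulr_suml big_nat [leRHS]big_nat; apply: ler_sum => j /andP[j1 j2].
  by apply: cs => //; [apply: heta|apply: hp]; lia.
apply: le_trans (CauchySchwarz_sqrt _ _ _) _; rewrite ler_wpM2r ?sqrtr_ge0//.
rewrite -[leRHS](ger0_norm (eta0 _)) -sqrtr_sqr ler_sqrt ?sqr_ge0//.
by apply: heta; rewrite j0J leqnn.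
Qed.

End multiscale.

(** * Dyadic cubes of a finite box *)

Section dyadic_cubes.
Variables (d J : nat).
Local Notation T := (box d (2 ^ J)).

Definition cube (j : nat) (F : T) : {ffun 'I_d -> nat} := [ffun i => (F i %/ 2 ^ j)%N].

Lemma cube_nest j (F G : T) : cube j F = cube j G -> cube j.+1 F = cube j.+1 G.
Proof.
move=> /ffunP h; apply/ffunP => i; have := h i; rewrite !ffunE => h'.
by rewrite expnSr !divnMA h'.
Qed.

(** Since [2^j] divides the side [2^(J+1)] of the box, no cube is cut by its boundary, and the count
    is a product over coordinates. *)
Lemma card_cube j (F : T) : (j <= J)%N -> #|[pred G | cube j G == cube j F]| = ((2 ^ j) ^ d)%N.
Proof.
move=> jJ.
rewrite (eq_card (B := family (fun i => [pred m : 'I_(2 ^ J).*2 | (m %/ 2 ^ j == F i %/ 2 ^ j)%N]))); last first.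
  move=> G; rewrite inE/=; apply/eqP/familyP => [/ffunP h i|h].
    by rewrite inE/=; have := h i; rewrite !ffunE => ->.
  by apply/ffunP => i; rewrite !ffunE; have := h i; rewrite inE/= => /eqP.
rewrite card_family.
have -> : [seq #|[pred m : 'I_(2 ^ J).*2 | (m %/ 2 ^ j == F i %/ 2 ^ j)%N]| | i : 'I_d] =
    nseq d (2 ^ j)%N.
  apply: (@eq_from_nth _ 0%N); first by rewrite size_map -cardT card_ord size_nseq.
  rewrite size_map -cardT card_ord => i id.
  rewrite nth_nseq id (nth_map (Ordinal id)) ?size_enum_ord//.
  set c := (F _ %/ _)%N.
  have cb : (c.+1 * 2 ^ j <= (2 ^ J).*2)%N.
    have -> : (2 ^ J).*2 = (2 ^ (J.+1 - j) * 2 ^ j)%N.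
      by rewrite -expnD subnK ?expnS ?mul2n// leqW.
    rewrite leq_mul2r; apply/orP; right; rewrite /c ltn_divLR ?expn_gt0//.
    by rewrite -expnD subnK ?expnS ?mul2n ?ltn_ord// leqW.
  have inj : injective (fun m : 'I_(2 ^ j) => inord (c * 2 ^ j + m) : 'I_((2 ^ J).*2.-1.+1)).
    move=> m m' /(congr1 (@nat_of_ord _)); rewrite !inordK.
    - by move/addnI/ord_inj.
    - apply: leq_trans (_ : c.+1 * 2 ^ j <= _)%N; first by rewrite mulSn addnC ltn_add2r.
      by rewrite prednK// double_gt0 expn_gt0.
    - apply: leq_trans (_ : c.+1 * 2 ^ j <= _)%N; first by rewrite mulSn addnC ltn_add2r.
      by rewrite prednK// double_gt0 expn_gt0.
  rewrite -[RHS]card_ord.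
  have e : (2 ^ J).*2.-1.+1 = (2 ^ J).*2 by rewrite prednK// double_gt0 expn_gt0.
  pose f (m : 'I_(2 ^ j)) : 'I_(2 ^ J).*2 := cast_ord e (inord (c * 2 ^ j + m)).
  have finj : injective f by move=> m m' /cast_ord_inj /inj.
  rewrite -(card_codom finj); apply: eq_card => m; rewrite inE/=.
  apply/eqP/codomP => [h|[m' ->]].
    have mm : (m %% 2 ^ j < 2 ^ j)%N by rewrite ltn_mod expn_gt0.
    exists (Ordinal mm); apply: val_inj; rewrite /f/= inordK; first by rewrite -h -divn_eq.
    by rewrite -h -divn_eq e.
  rewrite /f/= inordK; last first.
    rewrite e; apply: leq_trans cb; by rewrite mulSn addnC ltn_add2r.
  by rewrite divnMDl ?expn_gt0// divn_small ?addn0.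
by elim: (d) => //= n ->; rewrite expnS.
Qed.

Lemma cube_dist j (F G : T) i : cube j F = cube j G ->
  `|boxpt F 0 i - boxpt G 0 i| <= (2 ^ j)%N%:Z.
Proof.
move=> /ffunP/(_ i); rewrite !ffunE => h; rewrite !mxE.
have h1 := divn_eq (F i) (2 ^ j); have h2 := divn_eq (G i) (2 ^ j).
have := ltn_pmod (F i) (_ : 0 < 2 ^ j)%N; have := ltn_pmod (G i) (_ : 0 < 2 ^ j)%N.
rewrite expn_gt0 => /(_ isT) + /(_ isT).
rewrite h in h1; lia.
Qed.

Lemma cube_lnorm (R : realType) j (F G : T) : cube j F = cube j G ->
  lnorm R (boxpt F - boxpt G) <= Num.sqrt d%:R * (2 ^ j)%:R.
Proof.
move=> h; apply: eucl_le_max => // i; rewrite !mxE.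
have := cube_dist i h; rewrite !mxE -(ler_int R) intr_norm.
by [].
Qed.

End dyadic_cubes.

(** * Differences of smooth functions of compact support *)

Section smooth_functions.
Variables (R : realType) (d : nat).
Local Notation V := 'rV[R]_d.
Local Notation iterD := Defs.iterD.
Implicit Types (f g : V -> R) (x y a v : V).

Lemma is_derive_line f a v (t : R) : derivable f (a + t *: v) v ->
  is_derive t 1 (fun t : R => f (a + t *: v)) ('D_v f (a + t *: v)).
Proof.
move=> df.
have E : (fun h : R => h^-1 *: (((fun t : R => f (a + t *: v)) \o shift t) (h *: (1 : R)) -
     f (a + t *: v))) =
   (fun h => h^-1 *: ((f \o shift (a + t *: v)) (h *: v) - f (a + t *: v))).
  apply/funext => h /=; congr (_ *: (f _ - _)).
  by rewrite [h *: 1]mulr1 scalerDl addrCA.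
by apply: DeriveDef; rewrite /derivable /derive E.
Qed.

Lemma mvt_line f a v : (forall y, derivable f y v) ->
  exists2 th : R, 0 <= th <= 1 & f (a + v) - f a = 'D_v f (a + th *: v).
Proof.
move=> df.
have [||c c01] := @MVT_segment R (fun t => f (a + t *: v)) (fun t => 'D_v f (a + t *: v)) 0 1 ler01.
- by move=> t _; apply: is_derive_line.
- apply: derivable_within_continuous => t _.
  by have [] := @is_derive_line f a v t (df _).
- rewrite scale1r scale0r addr0 subr0 mulr1 => E; by exists c.
Qed.

Lemma derive_coord f y v : differentiable f y ->
  'D_v f y = \sum_i v 0 i * 'D_(delta_mx 0 i) f y.
Proof.
move=> df; rewrite (deriveE _ df) {1}(row_sum_delta v) linear_sum/=.
by apply: eq_bigr => i _; rewrite linearZ/= (deriveE _ df).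
Qed.

Lemma iterD_cat us vs g : iterD us (iterD vs g) = iterD (us ++ vs) g.
Proof. by elim: us => //= u us ->. Qed.

Lemma smooth_iterD vs g : smooth g -> smooth (iterD vs g).
Proof. by move=> sg us x; rewrite iterD_cat; exact: sg. Qed.

Lemma smooth_derivable g y v : smooth g -> derivable g y v.
Proof. by move=> sg; apply: diff_derivable; exact: (sg [::]). Qed.

Lemma mx_norm_le_eucl v : `|v| <= eucl v.
Proof.
rewrite /Num.norm/= mx_normrE; apply: bigmax_le => [|[i j] _ /=]; first exact: eucl_ge0.
by rewrite ord1; exact: eucl_coord.
Qed.

Lemma derive_supp f (r : R) v : (forall x, r < eucl x -> f x = 0) ->
  forall x, r < eucl x -> 'D_v f x = 0.
Proof.
move=> f0 x rx; rewrite /derive; apply: norm_lim_near_cst.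
have e0 : 0 < (eucl x - r) / (eucl v + 1).
  by rewrite divr_gt0 ?subr_gt0// ltr_wpDl ?eucl_ge0.
apply: filterS (dnbhs0_lt e0) => h hh /=.
rewrite !f0//; first by rewrite subrr scaler0.
have h1 : `|h| * eucl v < eucl x - r.
  apply: le_lt_trans (_ : `|h| * (eucl v + 1) < _).
    by rewrite ler_wpM2l// lerDl.
  by rewrite -ltr_pdivlMr// ltr_wpDl ?eucl_ge0.
have := euclD (h *: v + x) (- (h *: v)); rewrite addrAC subrr add0r euclN euclZ.
lra.
Qed.

Lemma iterD_supp g (r : R) vs : (forall x, r < eucl x -> g x = 0) ->
  forall x, r < eucl x -> iterD vs g x = 0.
Proof. by move=> g0; elim: vs => //= v vs IH; exact: derive_supp. Qed.

Lemma smooth_bounded g : smooth g -> compact_support g ->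
  exists2 B : R, 0 <= B & forall x, `|g x| <= B.
Proof.
move=> sg [r gr].
pose K : set V := closed_ball_ Num.norm 0 r.
have cK : compact K.
  apply: bounded_closed_compact; last exact: closed_closed_ball_.
  exists r; split; first by rewrite num_real.
  by move=> x rx y; rewrite /K /closed_ball_/= sub0r normrN => h; apply: le_trans h _; exact: ltW.
have cg : {within K, continuous g}.
  apply: continuous_subspaceT => x; apply: differentiable_continuous; exact: (sg [::]).
have [B [_ hB]] := compact_bounded (continuous_compact cg cK).
exists (`|B| + 1) => [|x]; first by rewrite addr_ge0.
have [xr|/gr ->] := leP (eucl x) r; last by rewrite normr0 addr_ge0.
apply: (hB (`|B| + 1)); first by apply: le_lt_trans (ler_norm _) _; rewrite ltrDl.
exists x => //; rewrite /K /closed_ball_/= sub0r normrN.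
exact: le_trans (mx_norm_le_eucl x) xr.
Qed.

Lemma compact_support_iterD vs g : compact_support g -> compact_support (iterD vs g).
Proof. by move=> [r gr]; exists r; exact: iterD_supp. Qed.

Lemma sum_coord_le (c : 'I_d -> R) v : (forall i, 0 <= c i) ->
  \sum_i `|v 0 i| * c i <= eucl v * \sum_i c i.
Proof.
move=> c0; rewrite mulr_sumr; apply: ler_sum => i _.
by rewrite ler_wpM2r// eucl_coord.
Qed.

Lemma derive_bound g : smooth g -> compact_support g ->
  exists2 C : R, 0 <= C & forall v y, `|'D_v g y| <= C * eucl v.
Proof.
move=> sg cg.
have hb i : exists B : R, 0 <= B /\ forall x, `|'D_(delta_mx 0 i) g x| <= B.
  have [B B0 hB] := smooth_bounded (smooth_iterD [:: delta_mx 0 i] sg)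
    (compact_support_iterD [:: delta_mx 0 i] cg).
  by exists B.
have [B hB] := choice hb.
exists (\sum_i B i) => [|v y]; first by apply: sumr_ge0 => i _; case: (hB i).
rewrite derive_coord; last exact: (sg [::]).
apply: le_trans (ler_norm_sum _ _ _) _; rewrite mulrC.
apply: le_trans (sum_coord_le _ (fun i => (hB i).1)).
by apply: ler_sum => i _; rewrite normrM ler_wpM2l//; exact: (hB i).2.
Qed.

Lemma smooth_lipschitz g : smooth g -> compact_support g ->
  exists2 C : R, 0 <= C & forall x y, `|g x - g y| <= C * eucl (x - y).
Proof.
move=> sg cg; have [C C0 hC] := derive_bound sg cg; exists C => // x y.
have [th _] := @mvt_line g y (x - y) (fun z => @smooth_derivable g z _ sg).
by rewrite (addrC y) subrK => ->; exact: hC.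
Qed.

Lemma derive_lipschitz g : smooth g -> compact_support g ->
  exists2 C : R, 0 <= C & forall v x y, `|'D_v g x - 'D_v g y| <= C * eucl v * eucl (x - y).
Proof.
move=> sg cg.
have hb i : exists B : R, 0 <= B /\
    forall x y, `|'D_(delta_mx 0 i) g x - 'D_(delta_mx 0 i) g y| <= B * eucl (x - y).
  have [B B0 hB] := smooth_lipschitz (smooth_iterD [:: delta_mx 0 i] sg)
    (compact_support_iterD [:: delta_mx 0 i] cg).
  by exists B.
have [B hB] := choice hb.
exists (\sum_i B i) => [|v x y]; first by apply: sumr_ge0 => i _; case: (hB i).
rewrite !derive_coord; try exact: (sg [::]).
rewrite -sumrB; apply: le_trans (ler_norm_sum _ _ _) _.
apply: le_trans (_ : (\sum_i `|v 0 i| * B i) * eucl (x - y) <= _); last first.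
  rewrite ler_wpM2r ?eucl_ge0// mulrC.
  exact: (sum_coord_le _ (fun i => (hB i).1)).
rewrite mulr_suml; apply: ler_sum => i _.
by rewrite -mulrBr normrM -mulrA ler_wpM2l//; exact: (hB i).2.
Qed.

Definition delta2 g x (s : V) : R := g (x + s) + g (x - s) - 2 * g x.

Lemma min1_powR (m p : R) : 0 <= m -> 0 < p <= 1 -> Num.min 1 m <= m `^ p.
Proof.
move=> m0 /andP[p0 p1]; have [h|h] := leP 1 m.
  by rewrite -[leLHS](powRr0 m) ler_powR// ltW.
have [->|mn0] := eqVneq m 0; first exact: powR_ge0.
by apply: ger1_powR => //; rewrite lt_neqAle eq_sym mn0 m0 ltW.
Qed.

(** Along a direction [v], the derivative of [delta2 g x] in [s] is [D_v g (x + s) - D_v g (x - s)].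
    It is bounded by a multiple of [|v|] and also of [|v| |s|], hence of [|v| |s|^p] for every [p]
    in [(0, 1]], with one constant for all [p]. *)
Lemma delta2_lipschitz g : smooth g -> compact_support g ->
  exists2 C : R, 0 <= C & forall (p : R) x s s', 0 < p <= 1 ->
    `|delta2 g x s - delta2 g x s'| <=
    C * eucl (s - s') * Num.max (eucl s) (eucl s') `^ p.
Proof.
move=> sg cg; have [C C0 hC] := derive_bound sg cg.
have [D D0 hD] := derive_lipschitz sg cg.
exists (2 * C + 2 * D) => [|p x s s' p01]; first by rewrite addr_ge0// mulr_ge0.
have [v vE] : exists v : V, v = s - s' by exists (s - s').
rewrite -vE; set m := Num.max _ _.
have m0 : 0 <= m by rewrite le_max eucl_ge0.
(* Segment from [s'] to [s], travelled symmetrically on both sides of [x]. *)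
pose phi (t : R) := g ((x + s') + t *: v) + g ((x - s') + t *: - v).
pose dphi (t : R) := 'D_v g ((x + s') + t *: v) + 'D_(- v) g ((x - s') + t *: - v).
have dP (t : R) : is_derive t (1 : R) phi (dphi t).
  by apply: is_deriveD; apply: is_derive_line; exact: smooth_derivable.
have [|c] := @MVT_segment R phi dphi 0 1 ler01.
  by apply: derivable_within_continuous => t _; have [] := dP t.
rewrite in_itv/= => /andP[c0 c1].
rewrite subr0 mulr1 /phi !scale1r !scale0r !addr0 => E.
have -> : delta2 g x s - delta2 g x s' = dphi c.
  rewrite -E /delta2 vE.
  have -> : x + s' + (s - s') = x + s by rewrite addrA addrAC addrK.
  have -> : x - s' - (s - s') = x - s by rewrite opprB addrA subrK.
  ring.
pose pp := s' + c *: v.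
have -> : dphi c = 'D_v g (x + pp) - 'D_v g (x - pp).
  have e1 : x + s' + c *: v = x + pp by rewrite /pp addrA.
  have e2 : x - s' + c *: - v = x - pp by rewrite /pp opprD scalerN addrA.
  rewrite /dphi e1 e2; congr (_ + _).
  rewrite (derive_coord (- v)); last exact: (sg [::]).
  rewrite (derive_coord v); last exact: (sg [::]).
  by rewrite -sumrN; apply: eq_bigr => i _; rewrite mxE mulNr.
have ppm : eucl pp <= m.
  have -> : pp = (1 - c) *: s' + c *: s.
    by rewrite /pp vE scalerBr scalerBl scale1r addrA addrAC.
  apply: le_trans (euclD _ _) _; rewrite !euclZ !ger0_norm ?subr_ge0//.
  have h1 : eucl s' <= m by rewrite le_max lexx orbT.
  have h2 : eucl s <= m by rewrite le_max lexx.
  by nra.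
have h1 : `|'D_v g (x + pp) - 'D_v g (x - pp)| <= 2 * C * eucl v.
  apply: le_trans (ler_normB _ _) _; have := hC v (x + pp); have := hC v (x - pp); lra.
have h2 : `|'D_v g (x + pp) - 'D_v g (x - pp)| <= 2 * D * eucl v * m.
  apply: le_trans (hD _ _ _) _.
  have -> : x + pp - (x - pp) = 2 *: pp by rewrite opprB addrC addrA subrK scalerDl scale1r.
  rewrite euclZ ger0_norm// mulrCA -!mulrA ler_wpM2l// ler_wpM2l// ler_wpM2l//.
  exact: eucl_ge0.
have v0 := eucl_ge0 v.
have hmin : Num.min 1 m <= m `^ p by exact: min1_powR.
apply: le_trans (_ : (2 * C + 2 * D) * eucl v * Num.min 1 m <= _); last first.
  by rewrite ler_wpM2l// mulr_ge0// addr_ge0// mulr_ge0.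
have [hm|hm] := leP 1 m.
  apply: le_trans h1 _; rewrite mulr1 ler_wpM2r// lerDl; by rewrite mulr_ge0.
apply: le_trans h2 _; rewrite ler_wpM2r// ler_wpM2r// lerDr; by rewrite mulr_ge0.
Qed.

Lemma delta2_0 g x : delta2 g x 0 = 0.
Proof. by rewrite /delta2 subr0 addr0; ring. Qed.

Lemma delta2_le g (B : R) : (forall x, `|g x| <= B) -> forall x s, `|delta2 g x s| <= 4 * B.
Proof.
move=> hB x s; rewrite /delta2.
have := hB (x + s); have := hB (x - s); have := hB x.
rewrite !ler_norml => /andP[? ?] /andP[? ?] /andP[? ?]; apply/andP; split; lra.
Qed.

Fixpoint diffs (vs : seq V) (f : V -> R) : V -> R :=
  if vs is v :: vs' then fun x => diffs vs' f x - diffs vs' f (x - v) else f.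

Lemma derivable_translate f a x v : derivable f (x - a) v ->
  derivable (fun y => f (y - a)) x v /\ 'D_v (fun y => f (y - a)) x = 'D_v f (x - a).
Proof.
move=> df.
have E : (fun h : R => h^-1 *: (((fun y => f (y - a)) \o shift x) (h *: v) - f (x - a))) =
   (fun h => h^-1 *: ((f \o shift (x - a)) (h *: v) - f (x - a))).
  by apply/funext => h /=; rewrite addrA.
by rewrite /derivable /derive E.
Qed.

Lemma derive_diffs vs f v : (forall x, derivable f x v) -> forall x,
  derivable (diffs vs f) x v /\ 'D_v (diffs vs f) x = diffs vs ('D_v f) x.
Proof.
move=> df; elim: vs => [//|a vs IH] x /=.
have [d1 e1] := IH x; have [d2 e2] := IH (x - a).
have [d3 e3] := derivable_translate d2.
split; first exact: (derivableB d1 d3).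
by rewrite (deriveB d1 d3) e1 e3 e2.
Qed.

(** Derivatives commute with translations, so the mean value theorem can trade the differences one
    by one for a factor [h] and a derivative of [g]. *)
Lemma diffs_bound (vs : seq V) g : smooth g -> compact_support g ->
  exists2 C : R, 0 <= C & forall (h : R) x, 0 <= h ->
    `|diffs [seq h *: v | v <- vs] g x| <= C * h ^+ size vs.
Proof.
elim: vs g => [|v vs IH] g sg cg.
  have [B B0 hB] := smooth_bounded sg cg.
  by exists B => // h x h0; rewrite mulr1.
have [C C0 hC] := IH _ (smooth_iterD [:: v] sg) (compact_support_iterD [:: v] cg).
exists C => // h x h0 /=.
set F := diffs _ g.
have dF y : derivable F y v /\ 'D_v F y = diffs [seq h *: v | v <- vs] ('D_v g) y.
  by apply: derive_diffs => z; exact: smooth_derivable.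
pose phi (t : R) := F ((x - h *: v) + t *: v).
have [||c] := @MVT_segment R phi (fun t => 'D_v F ((x - h *: v) + t *: v)) 0 h h0.
- by move=> t _; apply: is_derive_line; exact: (dF _).1.
- apply: derivable_within_continuous => t _.
  by have [] := @is_derive_line F (x - h *: v) v t (dF _).1.
rewrite /phi subrK scale0r addr0 subr0 => c01 ->.
rewrite (dF _).2 normrM (ger0_norm h0) exprSr mulrA ler_wpM2r//.
exact: hC.
Qed.

End smooth_functions.

(** * Summation by parts and a discrete Taylor formula *)

Section discrete_differences.
Variables (R : realType) (d : nat).
Local Notation L := 'rV[int]_d.
Implicit Types (f : L -> R) (x z s : L).

Definition nabla (i : 'I_d) f x : R := f x - f (x - delta_mx 0 i).

Definition nabla2 (l : seq 'I_d) f : L -> R := foldr (fun i f => nabla i (nabla i f)) f l.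

Definition boxed (a b : int) f := forall x i, ~~ (a <= x 0 i <= b) -> f x = 0.

Lemma boxed_nabla i a b f : boxed a b f -> boxed a (b + 1) (nabla i f).
Proof.
move=> hf x j hx; rewrite /nabla (hf x j) ?(hf (x - delta_mx 0 i) j) ?subrr//; last first.
  by move: hx; lia.
rewrite !mxE/=; move: hx; case: (j == i) => /=; lia.
Qed.

Lemma boxed_nabla2 l a b f : boxed a b f -> boxed a (b + (size l).*2%:Z) (nabla2 l f).
Proof.
elim: l => [|i l IH] hf /=; first by rewrite addr0.
have := boxed_nabla i (boxed_nabla i (IH hf)).
by rewrite (_ : _ + 1 + 1 = b + (size l).+1.*2%:Z)//; lia.
Qed.

Lemma boxed_range a b f (N : nat) : boxed a b f -> - N%:Z <= a -> b < N%:Z ->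
  forall x, ~ range (@boxpt d N) x -> f x = 0.
Proof.
move=> hf Na bN x; apply: contra_notP => fx; apply: boxptP => i.
have : a <= x 0 i <= b by apply: contrapT => /negP /hf.
lia.
Qed.

Lemma boxed_mul a b f (h : L -> R) : boxed a b f -> boxed a b (fun x => f x * h x).
Proof. by move=> hf x i /hf ->; rewrite mul0r. Qed.

Lemma boxed_bound a b f : boxed a b f -> exists N : nat,
  forall x, ~ range (@boxpt d N) x -> f x = 0.
Proof.
move=> hf; exists (absz a + absz b).+1; apply: (boxed_range hf); lia.
Qed.

Lemma boxed_summable a b f : boxed a b f -> summableR f.
Proof.
move=> /boxed_bound[N hN]; rewrite /summableR /fins /nnsum.
rewrite (@esum_finType _ _ _ (@boxpt d N)) ?sumEFin ?ltry//.
  exact: boxpt_inj.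
by move=> x /hN ->; rewrite normr0.
Qed.

Lemma rsum_shift f (m : L) : rsum (fun z => f (z + m)) = rsum f.
Proof.
rewrite /rsum /nnsum (esum_shift (fun z => (Num.max (f z) 0)%:E) m).
by rewrite (esum_shift (fun z => (Num.max (- f z) 0)%:E) m).
Qed.

(** No sign appears, because [T] is evaluated at the reflected point [z - s]. *)
Lemma nabla_parts i a b f (T : L -> R) z : boxed a b f ->
  rsum (fun s => nabla i f s * T (z - s)) = rsum (fun s => f s * nabla i T (z - s)).
Proof.
move=> hf.
have hT (h : L -> R) : summableR (fun s => f s * h s).
  exact: boxed_summable (boxed_mul _ hf).
have hT' (h : L -> R) : summableR (fun s => f (s - delta_mx 0 i) * h s).
  have bf : boxed a (b + 1) (fun s => f (s - delta_mx 0 i)).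
    move=> x j hx; apply: (hf _ j); move: hx; rewrite !mxE/=.
    by case: (j == i) => /=; lia.
  exact: boxed_summable (boxed_mul _ bf).
rewrite (_ : (fun s => nabla i f s * _) =
   fun s => f s * T (z - s) - f (s - delta_mx 0 i) * T (z - s)); last first.
  by apply/funext => s; rewrite /nabla mulrBl.
rewrite (_ : (fun s => f s * nabla i T _) =
   fun s => f s * T (z - s) - f s * T (z - s - delta_mx 0 i)); last first.
  by apply/funext => s; rewrite /nabla mulrBr.
rewrite !rsumB//; try exact: hT; try exact: (hT' (fun s => T (z - s))).
congr (_ - _).
rewrite -[LHS](rsum_shift _ (delta_mx 0 i)); congr rsum; apply/funext => s.
by rewrite addrK opprD addrA.
Qed.

(** Applies the directions in the order opposite to [nabla2], the order in which summation by parts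
    moves them onto the other factor. *)
Definition nabla2l (l : seq 'I_d) f : L -> R := foldl (fun f i => nabla i (nabla i f)) f l.

Lemma nabla2_parts l a b f (T : L -> R) z : boxed a b f ->
  rsum (fun s => nabla2 l f s * T (z - s)) = rsum (fun s => f s * nabla2l l T (z - s)).
Proof.
elim: l T => //= i l IH T hf.
have h2 := @boxed_nabla2 l a b f hf.
rewrite (@nabla_parts i _ _ _ T z (@boxed_nabla i _ _ _ h2)).
by rewrite (@nabla_parts i _ _ _ (nabla i T) z h2) IH.
Qed.

Definition sdiff2 (t : int -> R) (n : int) : R := t n - t (n - 1) - (t (n - 1) - t (n - 1 - 1)).

Lemma nabla2l_prod (l : seq 'I_d) (t : 'I_d -> int -> R) x : uniq l ->
  nabla2l l (fun x => \prod_i t i (x 0 i)) x =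
  \prod_i (if i \in l then sdiff2 (t i) else t i) (x 0 i).
Proof.
elim: l t x => [//|i l IH] t x /= /andP[il ul].
pose t' j := if j == i then sdiff2 (t i) else t j.
have -> : nabla i (nabla i (fun x => \prod_i t i (x 0 i))) = fun x => \prod_j t' j (x 0 j).
  apply/funext => y; rewrite /nabla [RHS](bigD1 i)//= {1}/t' eqxx.
  rewrite !(bigD1 i (P := predT))//=.
  have E u : (forall j, j != i -> u 0 j = y 0 j) ->
     \prod_(j < d | j != i) t j (u 0 j) = \prod_(j < d | j != i) t' j (y 0 j).
    by move=> hu; apply: eq_bigr => j ji; rewrite /t' (negbTE ji) hu.
  rewrite !E//; last first.
  - by move=> j ji; rewrite !mxE/= (negbTE ji) !subr0.
  - by move=> j ji; rewrite !mxE/= (negbTE ji) !subr0.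
  - by rewrite !mxE/= !eqxx/= /sdiff2; ring.
rewrite IH//; apply: eq_bigr => j _; rewrite /t' in_cons.
by have [->|_] := eqVneq j i; rewrite ?(negbTE il).
Qed.

(** Green function of the backward second difference [sdiff2]; the shift by one puts the unit mass
    at 0. *)
Definition ramp1 (n : int) : R := Num.max 0 (n + 1)%:~R.

Lemma sdiff2_ramp1 n : sdiff2 ramp1 n = (n == 0)%:R.
Proof.
have E m : ramp1 m = (Num.max 0 (m + 1))%:~R.
  by rewrite /ramp1 !maxEle -(ler_int R); case: ifP.
rewrite /sdiff2 !E -!intrB.
rewrite (_ : _ - _ - _ = (n == 0)%:Z); first by case: (n == 0).
by have [->|] := eqVneq n 0; lia.
Qed.

(** The product of ramps is the Green function of the second differences taken in all directions,
    and summation by parts moves these from [f] onto it. *)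
Lemma discrete_taylor a b f z : boxed a b f ->
  f z = rsum (fun s => nabla2 (enum 'I_d) f s * \prod_i ramp1 ((z - s) 0 i)).
Proof.
move=> hf.
rewrite (@nabla2_parts (enum 'I_d) a b f (fun x => \prod_i ramp1 (x 0 i)) z hf).
rewrite (_ : (fun s => _) = fun s => (s == z)%:R * f z).
  have [h|h] := leP 0 (f z).
    rewrite rsum_nneg ?nnsum_delta// => [i|]; first by rewrite mulr_ge0.
    by rewrite /fins nnsum_delta// ltry.
  rewrite (_ : (fun s => _) = fun s => - ((s == z)%:R * - f z)); last first.
    by apply/funext => s; rewrite mulrN opprK.
  have fz0 : 0 <= - f z by rewrite oppr_ge0 ltW.
  rewrite rsumN rsum_nneg ?nnsum_delta ?opprK// => [i|]; first by rewrite mulr_ge0.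
  by rewrite /fins nnsum_delta// ltry.
apply/funext => s; rewrite (nabla2l_prod (fun=> ramp1))// ?enum_uniq//.
under eq_bigr do rewrite mem_enum/= sdiff2_ramp1.
have [->|sz] := eqVneq s z.
  by rewrite big1 ?mulr1 ?mul1r// => i _; rewrite subrr mxE eqxx.
rewrite mul0r; have [i hi] : exists i, (z - s) 0 i != 0.
  apply: contrapT => /forallNP h; move/negP: sz; apply; rewrite eq_sym -subr_eq0.
  by apply/eqP/rowP => i; rewrite [RHS]mxE; apply/eqP; have := h i => /negP; rewrite negbK.
by rewrite (bigD1 i)//= (negbTE hi) mul0r mulr0.
Qed.

Lemma latpt_sub (k : nat) z i : latpt R k (z - delta_mx 0 i) =
  latpt R k z - (k%:R)^-1 *: delta_mx 0 i.
Proof.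
apply/rowP => j; rewrite !mxE intrB mulrBl; congr (_ - _).
by rewrite mulrC; case: (_ && _); rewrite ?mulr1z ?mulr0z.
Qed.

Lemma nabla2_diffs (l : seq 'I_d) (k : nat) (g : 'rV[R]_d -> R) :
  nabla2 l (fun z => g (latpt R k z)) =
  fun z => diffs [seq (k%:R)^-1 *: v | v <- flatten [seq [:: delta_mx 0 i; delta_mx 0 i] | i <- l]]
    g (latpt R k z).
Proof.
elim: l => //= i l ->; apply/funext => z.
by rewrite /nabla !latpt_sub.
Qed.

End discrete_differences.

(** * The family of truncated ramp products *)

Section test_functions.
Variables (R : realType) (d : nat).
Local Notation L := 'rV[int]_d.

Definition cutoff (m k : nat) (n : int) : R :=
  Num.max 0 (Num.min 1 (m.+1%:R - `|n|%:~R / k%:R)).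

Definition ramp (k : nat) (s n : int) : R := Num.max 0 ((n - s + 1)%:~R / k%:R).

(** A ramp neither vanishes at infinity nor stays bounded. The cutoff repairs both and keeps bounds
    in macroscopic units that do not depend on [k] and [s], which the concentration estimates
    require. *)
Definition tramp m k s n : R := ramp k s n * cutoff m k n.

Definition testf m k (S z : L) : R := \prod_i tramp m k (S 0 i) (z 0 i).

Lemma max0_lip (x y : R) : `|Num.max 0 x - Num.max 0 y| <= `|x - y|.
Proof.
have h1 := ler_norm (x - y); have h2 := ler_norm (y - x); rewrite distrC in h2.
rewrite ler_norml.
by case: (leP 0 x) => ?; case: (leP 0 y) => ?; apply/andP; split; lra.
Qed.

Lemma min1_lip (x y : R) : `|Num.min 1 x - Num.min 1 y| <= `|x - y|.
Proof.
have h1 := ler_norm (x - y); have h2 := ler_norm (y - x); rewrite distrC in h2.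
rewrite ler_norml.
by case: (leP 1 x) => ?; case: (leP 1 y) => ?; apply/andP; split; lra.
Qed.

Lemma cutoff_bounds m k n : 0 <= cutoff m k n <= 1.
Proof. by rewrite /cutoff le_max lexx ge_max ler01/= ge_min lexx. Qed.

Lemma cutoff_lip m k n n' : (0 < k)%N ->
  `|cutoff m k n - cutoff m k n'| <= `|n - n'|%:~R / k%:R.
Proof.
move=> k0; apply: le_trans (max0_lip _ _) _; apply: le_trans (min1_lip _ _) _.
rewrite opprD addrACA subrr add0r opprK addrC -mulrBl normrM.
rewrite [X in _ * X <= _]ger0_norm ?invr_ge0// ler_wpM2r ?invr_ge0//.
rewrite -intrB -intr_norm ler_int; lia.
Qed.

Lemma cutoff_supp m k n : (0 < k)%N -> (m.+1 * k)%N%:Z <= `|n| -> cutoff m k n = 0.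
Proof.
move=> k0 h; rewrite /cutoff; apply/max_idPl; rewrite ge_min; apply/orP; right.
rewrite subr_le0 ler_pdivlMr ?ltr0n// -natrM -[(_ * _)%:R]/((m.+1 * k)%N%:~R) ler_int.
exact: h.
Qed.

Lemma cutoff1 m k n : (0 < k)%N -> `|n| <= (m * k)%N%:Z -> cutoff m k n = 1.
Proof.
move=> k0 h; have : `|n|%:~R / k%:R <= m%:R :> R.
  rewrite ler_pdivrMr ?ltr0n// -natrM -[(_ * _)%:R]/((m * k)%N%:~R) ler_int.
  exact: h.
move=> h2; rewrite /cutoff min_l; first by rewrite max_r.
by rewrite -natr1; lra.
Qed.

Lemma ramp_ge0 k s n : 0 <= ramp k s n.
Proof. by rewrite /ramp le_max lexx. Qed.

Lemma ramp_lip k s n n' : `|ramp k s n - ramp k s n'| <= `|n - n'|%:~R / k%:R.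
Proof.
apply: le_trans (max0_lip _ _) _.
rewrite -mulrBl normrM [X in _ * X <= _]ger0_norm ?invr_ge0// ler_wpM2r ?invr_ge0//.
by rewrite -intrB -intr_norm ler_int; lia.
Qed.

Lemma ramp_le m k s n : (0 < k)%N -> - (m * k)%N%:Z <= s -> `|n| <= (m.+1 * k)%N%:Z ->
  ramp k s n <= (2 * m + 2)%:R.
Proof.
move=> k0 hs hn; rewrite /ramp ge_max ler0n/= ler_pdivrMr ?ltr0n//.
rewrite -natrM -[(_ * _)%:R]/((_ * _)%N%:~R) ler_int; nia.
Qed.

Lemma tramp_bounds m k s n : (0 < k)%N -> - (m * k)%N%:Z <= s ->
  0 <= tramp m k s n <= (2 * m + 3)%:R.
Proof.
move=> k0 hs; rewrite /tramp; have /andP[c0 c1] := cutoff_bounds m k n.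
rewrite mulr_ge0 ?ramp_ge0//=.
have [hn|hn] := leP `|n| (m.+1 * k)%N%:Z.
  have := ramp_le k0 hs hn; have := ramp_ge0 k s n; rewrite !natrD; nra.
by rewrite cutoff_supp ?mulr0 ?ler0n// ltW.
Qed.

Lemma tramp_lip m k s n n' : (0 < k)%N -> - (m * k)%N%:Z <= s ->
  `|tramp m k s n - tramp m k s n'| <= (2 * m + 3)%:R * (`|n - n'|%:~R / k%:R).
Proof.
move=> k0 hs.
have D0 : 0 <= `|n - n'|%:~R / k%:R :> R by rewrite divr_ge0 ?ler0z.
(* The difference of products is expanded so that the ramp is evaluated at [b], inside the range of
   the cutoff, where it is bounded. *)
have gen a b : `|b| <= (m.+1 * k)%N%:Z -> `|a - b| = `|n - n'| ->
    `|tramp m k s a - tramp m k s b| <= (2 * m + 3)%:R * (`|n - n'|%:~R / k%:R).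
  move=> hb <-.
  have -> : tramp m k s a - tramp m k s b =
      (ramp k s a - ramp k s b) * cutoff m k a + ramp k s b * (cutoff m k a - cutoff m k b).
    by rewrite /tramp; ring.
  apply: le_trans (ler_normD _ _) _; rewrite !normrM.
  have /andP[c0 c1] := cutoff_bounds m k a.
  have r0 := ramp_ge0 k s b; have r1 := ramp_le k0 hs hb.
  rewrite (ger0_norm c0) (ger0_norm r0).
  have l1 := ramp_lip k s a b; have l2 := @cutoff_lip m k a b k0.
  have x0 := normr_ge0 (ramp k s a - ramp k s b).
  have y0 := normr_ge0 (cutoff m k a - cutoff m k b).
  have -> : (2 * m + 3)%:R = (2 * m + 2)%:R + 1 :> R by rewrite natr1 addnS.
  by nra.
have [hn'|hn'] := leP `|n'| (m.+1 * k)%N%:Z; first exact: gen.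
have [hn|hn] := leP `|n| (m.+1 * k)%N%:Z.
  by rewrite distrC; apply: gen => //; rewrite distrC.
by rewrite /tramp !cutoff_supp ?mulr0 ?subrr ?normr0 ?mulr_ge0 ?ler0n// ltW.
Qed.

Lemma prod_dist (I : Type) (l : seq I) (a b : I -> R) (B : R) : 1 <= B ->
  (forall i, 0 <= a i <= B) -> (forall i, 0 <= b i <= B) ->
  `|\prod_(i <- l) a i - \prod_(i <- l) b i| <= B ^+ size l * \sum_(i <- l) `|a i - b i|.
Proof.
move=> B1 ha hb; elim: l => [|i l IH]; first by rewrite !big_nil subrr normr0 mulr0.
rewrite !big_cons /= exprS.
have Pb : 0 <= \prod_(j <- l) b j <= B ^+ size l.
  elim: l {IH} => [|j l /andP[h1 h2]]; first by rewrite big_nil ler01 lexx.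
  rewrite big_cons; have /andP[b0 bB] := hb j.
  by rewrite mulr_ge0//= exprS ler_pM.
have -> : a i * \prod_(j <- l) a j - b i * \prod_(j <- l) b j =
   a i * (\prod_(j <- l) a j - \prod_(j <- l) b j) + (a i - b i) * \prod_(j <- l) b j by ring.
have /andP[a0 aB] := ha i; case/andP: Pb => Pb0 PbB.
apply: le_trans (ler_normD _ _) _; rewrite !normrM (ger0_norm a0) (ger0_norm Pb0).
have S0 : 0 <= \sum_(j <- l) `|a j - b j| by exact: sumr_ge0.
have E0 : 0 <= B ^+ size l by rewrite exprn_ge0//; lra.
have h1 : a i * `|\prod_(j <- l) a j - \prod_(j <- l) b j| <= B * (B ^+ size l * \sum_(j <- l) `|a j - b j|).
  by apply: ler_pM.
have h2 : `|a i - b i| * \prod_(j <- l) b j <= `|a i - b i| * (B * B ^+ size l).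
  by rewrite ler_wpM2l//; apply: le_trans PbB _; rewrite ler_peMl.
by rewrite mulrDr; lra.
Qed.

Lemma testf_lip m k (S z z' : L) : (0 < k)%N -> (forall i, - (m * k)%N%:Z <= S 0 i) ->
  `|testf m k S z - testf m k S z'| <=
  d%:R * (2 * m + 3)%:R ^+ d.+1 * (lnorm R (z - z') / k%:R).
Proof.
move=> k0 hS.
have B1 : 1 <= (2 * m + 3)%:R :> R by rewrite ler1n addnS.
rewrite /testf.
have := @prod_dist 'I_d (index_enum 'I_d) (fun i => tramp m k (S 0 i) (z 0 i))
   (fun i => tramp m k (S 0 i) (z' 0 i)) (2 * m + 3)%:R B1
   (fun i => tramp_bounds (z 0 i) k0 (hS i)) (fun i => tramp_bounds (z' 0 i) k0 (hS i)).
rewrite [size _](_ : _ = d); last by rewrite /index_enum -enumT size_enum_ord.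
move=> h; apply: le_trans h _.
rewrite exprS; set E := _ ^+ d; set Q := lnorm _ _ / _.
rewrite [leRHS](_ : _ = E * (d%:R * ((2 * m + 3)%:R * Q))); last by ring.
rewrite ler_wpM2l ?exprn_ge0 ?ler0n//.
apply: le_trans (_ : \sum_(i < d) (2 * m + 3)%:R * Q <= _).
  apply: ler_sum => i _; apply: le_trans (tramp_lip _ _ k0 (hS i)) _.
  rewrite ler_wpM2l ?ler0n// ler_wpM2r ?invr_ge0//.
  by have := lnorm_ge_coord R (z - z') i; rewrite !mxE intr_norm.
by rewrite sumr_const card_ord [leRHS]mulr_natl.
Qed.

Lemma testf_bounds m k (S z : L) : (0 < k)%N -> (forall i, - (m * k)%N%:Z <= S 0 i) ->
  0 <= testf m k S z <= (2 * m + 3)%:R ^+ d.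
Proof.
move=> k0 hS; rewrite /testf; apply/andP; split.
  by apply: prodr_ge0 => i _; have /andP[] := tramp_bounds (z 0 i) k0 (hS i).
rewrite -[X in _ ^+ X]card_ord -prodr_const; apply: ler_prod => i _.
exact: tramp_bounds.
Qed.

Lemma testf_supp m k (S z : L) : (0 < k)%N -> ~ range (@boxpt d (m.+1 * k)) z ->
  testf m k S z = 0.
Proof.
move=> k0 /boxPn[i hi]; rewrite /testf (bigD1 i)//= /tramp cutoff_supp//.
by rewrite mulr0 mul0r.
Qed.

(** The coefficients are [k^d] times the second differences of [g] in all [d] directions. These are
    of size [k^(-2d)], and there are [(2 m k)^d] corners, so the total coefficient stays bounded in
    [k]. *)
Lemma smooth_representation (g : 'rV[R]_d -> R) : smooth g -> compact_support g ->
  exists m : nat, exists2 C : R, 0 <= C & forall k : nat, (0 < k)%N ->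
    exists2 c : box d (m * k) -> R, \sum_S `|c S| <= C &
      (forall z, g (latpt R k z) = \sum_S c S * testf m k (boxpt S) z) /\
      (forall z, ~ range (@boxpt d (m * k)) z -> g (latpt R k z) = 0).
Proof.
move=> sg [r gr].
pose ell := (Num.truncn `|r|).+1.
have rell : r < ell%:R.
  by apply: le_lt_trans (ler_norm _) _; have /truncn_itv/andP[] := normr_ge0 r.
(* The differences widen the support by at most [2 d] lattice steps, hence by at most [2 d] units;
   the last unit makes the inclusion strict. *)
pose m := (ell + d.*2).+1.
have [C C0 hC] := diffs_bound (flatten [seq [:: delta_mx 0 i; delta_mx 0 i] | i <- enum 'I_d])
  sg (ex_intro _ r gr).
exists m, ((2 * m)%:R ^+ d * C) => [|k k0]; first by rewrite mulr_ge0// exprn_ge0.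
have kR : 0 < k%:R :> R by rewrite ltr0n.
pose G (z : L) := g (latpt R k z).
have bG : boxed (- (ell * k)%N%:Z) (ell * k)%N%:Z G.
  move=> z i hz; apply: gr; apply: lt_le_trans rell _.
  apply: le_trans (eucl_coord _ i); rewrite mxE normrM [X in _ * X]ger0_norm ?invr_ge0//.
  rewrite ler_pdivlMr// -natrM -[(_ * _)%:R]/((ell * k)%N%:~R) -intr_norm ler_int.
  lia.
have bD := boxed_nabla2 (l := enum 'I_d) bG; rewrite size_enum_ord in bD.
have hmk : (ell * k)%N%:Z + (d.*2)%:Z < (m * k)%N%:Z.
  by rewrite /m; nia.
pose D := nabla2 (enum 'I_d) G.
have hD s : `|D s| <= C * (k%:R^-1) ^+ (d + d).
  rewrite /D nabla2_diffs; apply: le_trans (hC _ _ _) _; first by rewrite invr_ge0.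
  rewrite [size _](_ : _ = (d + d)%N)//.
  rewrite size_flatten /shape -map_comp (eq_map (g := fun=> 2%N))//.
  by rewrite sumnE big_map big_const_seq count_predT size_enum_ord iter_addn addn0 mul2n addnn.
exists (fun S => k%:R ^+ d * D (boxpt S)).
  apply: le_trans (_ : \sum_(S : box d (m * k)) C * (k%:R^-1) ^+ d <= _).
    apply: ler_sum => S _; rewrite normrM ger0_norm ?exprn_ge0//.
    apply: le_trans (ler_wpM2l (exprn_ge0 d (ltW kR)) (hD _)) _.
    rewrite exprD le_eqVlt; apply/orP; left; apply/eqP.
    rewrite mulrCA; congr (_ * _); rewrite mulrA exprVn mulfV ?mul1r//.
    by rewrite expf_neq0// gt_eqF.
  rewrite sumr_const card_box -[leLHS]mulr_natl.
  have -> : ((m * k).*2 ^ d)%:R = (2 * m)%:R ^+ d * k%:R ^+ d :> R.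
    by rewrite -exprMn -natrM -natrX -mulnA mul2n.
  have kd : k%:R ^+ d * k%:R^-1 ^+ d = 1 :> R.
    by rewrite -exprMn mulfV ?expr1n// gt_eqF.
  by rewrite -mulrA (mulrCA (k%:R ^+ d)) kd mulr1.
have Gsupp z : ~ range (@boxpt d (m * k)) z -> G z = 0.
  by apply: (boxed_range bG); lia.
split => // z.
pose eta (z : L) := \prod_i cutoff m k (z 0 i).
(* The cutoff is 1 on the support of [g], so multiplying the Taylor formula by it truncates every
   ramp at no cost. *)
have Geta : G z = G z * eta z.
  have [h|/Gsupp ->] := pselect (range (@boxpt d (m * k)) z); last by rewrite mul0r.
  rewrite /eta big1 ?mulr1// => i _; apply: cutoff1 => //.
  by case: h => F _ <-; have := boxpt_bound F i; lia.
rewrite -/(G z) Geta (discrete_taylor z bG).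
rewrite (@rsum_fin _ _ _ (@boxpt d (m * k)) _ (@boxpt_inj d _)); last first.
  move=> s hs; rewrite (boxed_range bD _ _ hs) ?mul0r//; lia.
rewrite mulr_suml; apply: eq_bigr => S _.
rewrite -/(D (boxpt S)) {1}/testf /tramp big_split/= -/(eta z).
have -> : \prod_i ramp1 R ((z - boxpt S) 0 i) = k%:R ^+ d * \prod_i ramp k (boxpt S 0 i) (z 0 i).
  rewrite -[X in _ ^+ X * _]card_ord -prodr_const -big_split/=.
  apply: eq_bigr => i _; rewrite /ramp1 /ramp !mxE maxr_pMr ?(ltW kR)//.
  by rewrite mulr0 mulrCA mulfV ?mulr1// gt_eqF.
set X := k%:R ^+ d; set Y := \prod_i ramp _ _ _.
ring.
Qed.

End test_functions.

(** * Lebesgue measure on tuples: symmetries and cells *)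

Section lebesgue_on_tuples.
Context {R : realType} {d : nat}.
Implicit Types a b t x : d.-tuple R.

Definition hbox a b : set (d.-tuple R) := [set t | forall i, tnth a i < tnth t i <= tnth b i].

Lemma measurable_hbox a b : measurable (hbox a b).
Proof.
have -> : hbox a b = \bigcap_(i in [set: 'I_d]) ((fun t => tnth t i) @^-1` `]tnth a i, tnth b i]%classic).
  apply/seteqP; split=> t /=.
    by move=> h i _; rewrite /= in_itv /=; exact: h.
  by move=> h i; have := h i I; rewrite /= in_itv.
apply: fin_bigcap_measurable => // i _.
by rewrite -[X in measurable X]setTI; exact: measurable_tnth.
Qed.

Definition hboxes : set (set (d.-tuple R)) := [set A | exists a b, A = hbox a b].

Lemma hboxes_setI : setI_closed hboxes.
Proof.
move=> _ _ [a [b ->]] [a' [b' ->]].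
exists [tuple Num.max (tnth a i) (tnth a' i) | i < d], [tuple Num.min (tnth b i) (tnth b' i) | i < d].
apply/seteqP; split=> t /=.
  move=> [h h'] i; rewrite !tnth_mktuple gt_max le_min.
  by move: (h i) (h' i) => /andP[-> ->] /andP[-> ->].
move=> h; split=> i; move: (h i); rewrite !tnth_mktuple gt_max le_min;
 by move=> /andP[/andP[h1 h2] /andP[h3 h4]]; apply/andP.
Qed.

Definition cube_seq (n : nat) : set (d.-tuple R) :=
  hbox [tuple - n%:R | i < d] [tuple n%:R | i < d].

Lemma in_cube_seq t n : (forall i, `|tnth t i| < n%:R) -> cube_seq n t.
Proof.
move=> h i; rewrite !tnth_mktuple; have := h i; rewrite ltr_norml => /andP[-> /ltW ->].
by [].
Qed.

Lemma cube_seq_cover : \bigcup_n cube_seq n = setT.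
Proof.
apply/seteqP; split=> // t _.
exists (\max_(i < d) (Num.truncn `|tnth t i|).+1)%N => //.
apply: in_cube_seq => i.
apply: (@lt_le_trans _ _ (Num.truncn `|tnth t i|).+1%:R); first exact: truncnS_gt.
by rewrite ler_nat; apply: (leq_bigmax (F := fun i => (Num.truncn `|tnth t i|).+1)).
Qed.

Lemma measurable_tuple_hboxes : @measurable _ (d.-tuple R) = <<s hboxes >>.
Proof.
apply/seteqP; split.
  apply: smallest_sub; first exact: smallest_sigma_algebra.
  move=> A; rewrite -bigcup_seq => -[i _] [B mB <-]; rewrite setTI.
  have mS : sigma_algebra setT <<s hboxes >> by exact: smallest_sigma_algebra.
  pose T' : measurableType _ := g_sigma_algebraType hboxes.
  pose f : T' -> R := fun t => tnth (t : d.-tuple R) i.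
  have mf : measurable_fun [set: T'] f.
    apply: (@measurability _ _ T' R setT f (@ocitv R) erefl) => _ [_ [[u v] _ <-] <-]; rewrite setTI /=.
    have -> : f @^-1` `]u, v]%classic = \bigcup_n
       hbox [tuple if j == i then u else - n%:R | j < d] [tuple if j == i then v else n%:R | j < d].
      apply/seteqP; split=> t /=.
        rewrite in_itv /= => tuv.
        have : (\bigcup_n cube_seq n) t by rewrite cube_seq_cover.
        move=> [n _ hn]; exists n => // j; rewrite !tnth_mktuple.
        have := hn j; rewrite !tnth_mktuple.
        by case: eqP => // ->.
      by move=> [n _ /(_ i)]; rewrite !tnth_mktuple eqxx in_itv.
    apply: bigcupT_measurable => n; apply: sub_sigma_algebra.
    by eexists; eexists.
  by have := mf measurableT B mB; rewrite setTI.
by apply: smallest_sub; [exact: sigma_algebra_measurable|move=> _ [a [b ->]]; exact: measurable_hbox].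
Qed.

Definition affmap x (s : bool) t : d.-tuple R := [tuple tnth x i + (-1) ^+ s * tnth t i | i < d].

Lemma measurable_affmap x s : measurable_fun setT (affmap x s).
Proof.
apply/measurable_fun_tnthP => i.
rewrite (_ : _ \o _ = fun t => tnth x i + (-1) ^+ s * tnth t i); last first.
  by apply/funext => t /=; rewrite tnth_mktuple.
apply: measurable_funD => //; apply: measurable_funM => //; exact: measurable_tnth.
Qed.

Variable leb : {measure set (d.-tuple R) -> \bar R}.
Hypothesis hleb : is_lebesgue_tuple leb.

Lemma leb_hbox a b : leb (hbox a b) = (\prod_i Num.max (tnth b i - tnth a i) 0)%:E.
Proof. exact: hleb. Qed.

Lemma max0_dist (u v : R) : `|Num.max u 0 - Num.max v 0| <= `|u - v|.
Proof.
by rewrite ler_norml; have := ler_norm (u - v); have := ler_norm (- (u - v)); rewrite normrN => h1 h2;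
  rewrite !maxEle; case: ifP => h3; case: ifP => h4; lra.
Qed.

(** A reflection turns boxes open on the left into boxes open on the right. Both kinds have the same
    measure because moving a face by [dl] changes the volume by [O(dl)]. *)
Lemma leb_leftclosed a b :
  leb [set t | forall i, tnth a i <= tnth t i < tnth b i] = leb (hbox a b).
Proof.
set A := [set t | _].
have mA : measurable A.
  have -> : A = \bigcap_(i in [set: 'I_d]) ((fun t => tnth t i) @^-1` `[tnth a i, tnth b i[%classic).
    apply/seteqP; split=> t /=.
      by move=> h i _; rewrite /= in_itv /=; exact: h.
    by move=> h i; have := h i I; rewrite /= in_itv.
  apply: fin_bigcap_measurable => // i _.
  by rewrite -[X in measurable X]setTI; exact: measurable_tnth.
have [B [B1 hB]] : exists B : R, 1 <= B /\ forall i, `|tnth b i - tnth a i| + 1 <= B.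
  exists (1 + \sum_i `|tnth b i - tnth a i|); split.
    by rewrite lerDl; apply: sumr_ge0.
  by move=> i; rewrite addrC lerD2l (bigD1 i) //= lerDl; apply: sumr_ge0.
have [E [E0 hE]] : exists E : R, 0 <= E /\ forall c : 'I_d -> R, forall dl, 0 <= dl <= 1 ->
    (forall i, `|c i - (tnth b i - tnth a i)| <= dl) ->
    `|\prod_i Num.max (c i) 0 - \prod_i Num.max (tnth b i - tnth a i) 0| <= E * dl.
  exists (B ^+ size (index_enum 'I_d) * d%:R); split; first by rewrite mulr_ge0 // exprn_ge0 //; lra.
  move=> c dl dl01 hc.
  have := @prod_dist _ _ (index_enum 'I_d) (fun i => Num.max (c i) 0)
    (fun i => Num.max (tnth b i - tnth a i) 0) B B1.
  case/(_ _ _)/Wrap => [i|i|].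
  - have := hc i; have := hB i; rewrite le_max lexx orbT /= ge_max => h1 h2.
    apply/andP; split; last by lra.
    have := ler_norm (tnth b i - tnth a i); have := ler_norm (c i - (tnth b i - tnth a i)).
    by case/andP: dl01 => *; lra.
  - have := hB i; rewrite le_max lexx orbT /= ge_max => h1.
    by apply/andP; split; last lra; have := ler_norm (tnth b i - tnth a i); lra.
  move=> h; apply: le_trans h _; rewrite -mulrA ler_wpM2l ?exprn_ge0 //; first lra.
  rewrite mulr_natl -[X in _ *+ X](card_ord d) -sumr_const.
  by apply: ler_sum => i _; apply: le_trans (max0_dist _ _) (hc i).
rewrite leb_hbox; set V := \prod_i _ in hE *.
apply/eqP; rewrite eq_le; apply/andP; split; last first.
  apply/lee_addgt0Pr => e e0.
  pose dl := Num.min 1 (e / (E + 1)).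
  have dl0 : 0 < dl by rewrite lt_min ltr01 divr_gt0 //; lra.
  have dl1 : dl <= 1 by rewrite ge_min lexx.
  have Edl : E * dl <= e.
    apply: (@le_trans _ _ ((E + 1) * dl)); first by nra.
    by rewrite -ler_pdivlMl; [rewrite mulrC ge_min lexx orbT|lra].
  pose b' := [tuple tnth b i - dl | i < d].
  have h : (leb (hbox a b') <= leb A)%E.
    apply: le_measure; rewrite ?inE //; first exact: measurable_hbox.
    move=> t ht i; have := ht i; rewrite tnth_mktuple => /andP[h1 h2].
    by apply/andP; split; lra.
  rewrite leb_hbox in h.
  apply: (@le_trans _ _ ((\prod_i Num.max (tnth b' i - tnth a i) 0)%R%:E + e%:E)%E); last first.
    by rewrite leeD2r.
  rewrite -EFinD lee_fin.
  have := hE (fun i => tnth b' i - tnth a i) dl.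
  rewrite (ltW dl0) dl1 => /(_ isT) /(_ _)/Wrap[].
    move=> i; rewrite tnth_mktuple [_ - _ - _](_ : _ = - dl); last by ring.
    by rewrite normrN gtr0_norm.
  by rewrite distrC => /ler_normlP[_]; lra.
apply/lee_addgt0Pr => e e0.
pose dl := Num.min 1 (e / (E + 1)).
have dl0 : 0 < dl by rewrite lt_min ltr01 divr_gt0 //; lra.
have dl1 : dl <= 1 by rewrite ge_min lexx.
have Edl : E * dl <= e.
  apply: (@le_trans _ _ ((E + 1) * dl)); first by nra.
  by rewrite -ler_pdivlMl; [rewrite mulrC ge_min lexx orbT|lra].
pose a' := [tuple tnth a i - dl | i < d].
have h : (leb A <= leb (hbox a' b))%E.
  apply: le_measure; rewrite ?inE //; first exact: measurable_hbox.
  move=> t ht i; have := ht i; rewrite tnth_mktuple => /andP[h1 h2].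
  by apply/andP; split; lra.
apply: (le_trans h).
rewrite leb_hbox -EFinD lee_fin.
have := hE (fun i => tnth b i - tnth a' i) dl.
rewrite (ltW dl0) dl1 => /(_ isT) /(_ _)/Wrap[].
  move=> i; rewrite tnth_mktuple [_ - _ - _](_ : _ = dl); last by ring.
  by rewrite gtr0_norm.
by move=> /ler_normlP[_]; lra.
Qed.

Lemma leb_affmap_hbox x s a b : leb (affmap x s @^-1` hbox a b) = leb (hbox a b).
Proof.
case: s; last first.
  transitivity (leb (hbox [tuple tnth a i - tnth x i | i < d] [tuple tnth b i - tnth x i | i < d])).
    congr (leb _); apply/seteqP; split=> t /= h i; have := h i; rewrite !tnth_mktuple expr0 mul1r;
    by move=> /andP[h1 h2]; apply/andP; split; lra.
  rewrite !leb_hbox; congr (_%:E); apply: eq_bigr => i _; rewrite !tnth_mktuple; congr (Num.max _ _); ring.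
transitivity (leb (hbox [tuple tnth x i - tnth b i | i < d] [tuple tnth x i - tnth a i | i < d])).
  rewrite -leb_leftclosed.
  congr (leb _); apply/seteqP; split=> t /= h i; have := h i; rewrite !tnth_mktuple expr1;
  by move=> /andP[h1 h2]; apply/andP; split; lra.
rewrite !leb_hbox; congr (_%:E); apply: eq_bigr => i _; rewrite !tnth_mktuple; congr (Num.max _ _); ring.
Qed.

Lemma leb_affmap x s A : measurable A -> leb (affmap x s @^-1` A) = leb A.
Proof.
move=> mA.
have hm := measurable_affmap x s.
apply/esym.
pose m2 : {measure set (d.-tuple R) -> \bar R} :=
  measure_function_pushforward__canonical__measure_function_Measure leb hm.
apply: (@measure_unique _ R _ hboxes cube_seq measurable_tuple_hboxes hboxes_setI _ cube_seq_cover leb m2) => //.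
- by move=> i; eexists; eexists.
- by move=> _ [a [b ->]]; rewrite -[RHS]/(leb (affmap x s @^-1` hbox a b)) leb_affmap_hbox.
- by move=> k; rewrite leb_hbox ltry.
Qed.

Lemma ge0_integral_affmap x s (D : set (d.-tuple R)) (f : d.-tuple R -> \bar R) :
  measurable D -> measurable_fun D f -> (forall t, D t -> 0 <= f t)%E ->
  (\int[leb]_(t in affmap x s @^-1` D) f (affmap x s t) = \int[leb]_(t in D) f t)%E.
Proof.
move=> mD mf f0.
have := @ge0_integral_pushforward _ _ _ _ R _ (measurable_affmap x s) leb D f mD mf.
case/(_ _)/Wrap; first by move=> t; rewrite inE => /f0.
move=> <-; pose m2 : {measure set (d.-tuple R) -> \bar R} :=
  measure_function_pushforward__canonical__measure_function_Measure leb (measurable_affmap x s).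
by apply: (@eq_measure_integral _ _ _ D leb m2) => A mA _; exact: leb_affmap.
Qed.

Lemma integral_affmap x s (D : set (d.-tuple R)) (f : d.-tuple R -> \bar R) :
  measurable D -> measurable_fun D f ->
  (\int[leb]_(t in affmap x s @^-1` D) f (affmap x s t) = \int[leb]_(t in D) f t)%E.
Proof.
move=> mD mf; rewrite integralE [RHS]integralE.
rewrite -(@ge0_integral_affmap x s D (f^\+)%E) //; last exact: measurable_funepos.
rewrite -(@ge0_integral_affmap x s D (f^\-)%E) //; last exact: measurable_funeneg.
by congr (_ - _)%E; apply: eq_integral => t _; rewrite ?funeposE ?funenegE.
Qed.

(** In each coordinate this is the ceiling of [k t] minus 1, as required by cells open on the left;
    it is the index used in [ext_lat]. *)
Definition lidx (k : nat) t : 'rV[int]_d := \row_i (- Num.floor (- (k%:R * tnth t i)) - 1).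

Lemma ext_latE k (u : 'rV[int]_d -> R) t : ext_lat k u t = u (lidx k t).
Proof. by []. Qed.

Definition lcell (k : nat) (z : 'rV[int]_d) : set (d.-tuple R) :=
  hbox [tuple (z 0 i)%:~R / k%:R | i < d] [tuple ((z 0 i)%:~R + 1) / k%:R | i < d].

Lemma lcellP k z t : (0 < k)%N -> lcell k z t <-> lidx k t = z.
Proof.
move=> k0; have k0' : 0 < k%:R :> R by rewrite ltr0n.
split=> [h|<-].
  apply/rowP => i; rewrite mxE.
  have := h i; rewrite !tnth_mktuple ltr_pdivrMr // ler_pdivlMr // => /andP[h1 h2].
  suff -> : Num.floor (- (k%:R * tnth t i)) = - z 0 i - 1 by ring.
  apply: floor_def; rewrite subrK rmorphB /= rmorphN /= mulr1z.
  by apply/andP; split; lra.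
move=> i; rewrite !tnth_mktuple mxE ltr_pdivrMr // ler_pdivlMr //.
have := floor_itv (- (k%:R * tnth t i)) => /andP[h1 h2].
rewrite rmorphD /= in h2.
rewrite rmorphB /= rmorphN /= mulr1z.
by apply/andP; split; lra.
Qed.

Lemma measurable_lcell k z : measurable (lcell k z).
Proof. exact: measurable_hbox. Qed.

Lemma leb_lcell k z : (0 < k)%N -> leb (lcell k z) = (k%:R ^- d)%:E.
Proof.
move=> k0; rewrite leb_hbox; congr (_%:E).
rewrite (eq_bigr (fun=> (k%:R)^-1)); last first.
  move=> i _; rewrite !tnth_mktuple mulrDl mul1r addrAC subrr add0r.
  by apply/max_idPl; rewrite invr_ge0.
by rewrite prodr_const card_ord exprVn.
Qed.

Lemma measurable_lidx k (d' : measure_display) (T : measurableType d') (u : 'rV[int]_d -> T) :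
  (0 < k)%N -> measurable_fun setT (fun t => u (lidx k t)).
Proof.
move=> k0 _ B mB; rewrite setTI.
have -> : (fun t => u (lidx k t)) @^-1` B = \bigcup_z (if `[< B (u z) >] then lcell k z else set0).
  apply/seteqP; split=> t /=.
    by move=> h; exists (lidx k t) => //; case: asboolP => // _; apply/lcellP.
  by move=> [z _]; case: asboolP => // Bz /lcellP ->.
apply: countable_bigcupT_measurable; first exact: countableP.
by move=> z; case: asboolP => // _; exact: measurable_lcell.
Qed.

Lemma integral_lidx k (u : 'rV[int]_d -> R) : (0 < k)%N -> (forall z, 0 <= u z) ->
  (\int[leb]_t (u (lidx k t))%:E = (k%:R ^- d)%:E * nnsum u)%E.
Proof.
move=> k0 u0.
pose F n : set (d.-tuple R) := if pickle_inv n is Some z then lcell k z else set0.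
have FT : \bigcup_n F n = setT.
  apply/seteqP; split=> // t _; exists (pickle (lidx k t)) => //.
  by rewrite /F pickleK_inv; apply/lcellP.
rewrite -FT ge0_integral_bigcup; first last.
- apply/trivIsetP => i j _ _ ij; rewrite /F -subset0 => t.
  case Ei : pickle_inv => [z|]; last by case.
  case Ej : pickle_inv => [z'|]; last by case.
  move=> [/lcellP - /(_ k0) h1 /lcellP - /(_ k0) h2].
  have := @pickle_invK 'rV[int]_d i; have := @pickle_invK 'rV[int]_d j; rewrite /oapp Ei Ej -h1 -h2 => e1 e2.
  by move: ij; rewrite -e1 -e2 eqxx.
- by move=> t _; rewrite lee_fin.
- by rewrite FT; exact: (@measurable_lidx k _ _ (fun z => (u z)%:E) k0).
- by move=> n; rewrite /F; case: pickle_inv => // z; exact: measurable_lcell.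
rewrite (eq_eseriesr (g := fun n => if @pickle_inv 'rV[int]_d n is Some z then (u z * k%:R ^- d)%:E else 0%E)); last first.
  move=> n _; rewrite /F; case: pickle_inv => [z|]; last by rewrite integral_set0.
  under eq_integral.
    move=> t; rewrite inE => /lcellP - /(_ k0) ->; over.
  by rewrite integral_cst ?leb_lcell //; exact: measurable_lcell.
rewrite nneseries_esumT; last first.
  by move=> n; case: pickle_inv => // z; rewrite lee_fin mulr_ge0.
transitivity (\esum_(n in range (@pickle 'rV[int]_d))
   (if @pickle_inv 'rV[int]_d n is Some z then (u z * k%:R ^- d)%:E else 0%E))%E.
  rewrite [RHS]esum_mkcond; apply: eq_esum => n _.
  case: ifPn => // /negP h; case E : pickle_inv => [z|] //; exfalso; apply: h; rewrite inE.
  by exists z => //; have := @pickle_invK 'rV[int]_d n; rewrite /oapp E.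
rewrite (@reindex_esum R _ _ setT (range (@pickle 'rV[int]_d)) (@pickle 'rV[int]_d)); last first.
  by split=> //; move=> z z' _ _ h; apply: (pcan_inj (@pickleK_inv _)).
under eq_esum do rewrite pickleK_inv EFinM muleC.
by rewrite esumZl.
Qed.

End lebesgue_on_tuples.

(** * Comparing an integral with a lattice sum, cell by cell *)

Section lattice_approximation.
Context {R : realType} {d : nat}.
Implicit Types (t : d.-tuple R) (z : 'rV[int]_d).

Lemma toRow_affmap x s t : toRow (affmap x s t) = toRow x + (-1) ^+ s *: toRow t.
Proof. by apply/rowP => i; rewrite !mxE tnth_mktuple. Qed.

Lemma eucl_dist (u v : 'rV[R]_d) : `|eucl u - eucl v| <= eucl (u - v).
Proof.
rewrite ler_norml; apply/andP; split.
  by have := euclD (v - u) u; rewrite subrK -(euclN (v - u)) opprB; lra.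
by have := euclD (u - v) v; rewrite subrK; lra.
Qed.

Lemma latpt0 k : latpt R k (0 : 'rV[int]_d) = 0.
Proof. by apply/rowP => i; rewrite !mxE mul0r. Qed.

Lemma eucl_latpt0 k z : eucl (latpt R k z) = lnorm R z / k%:R.
Proof. by have := eucl_latpt R k z 0; rewrite latpt0 !subr0. Qed.

Lemma latptD k z z' : latpt R k (z + z') = latpt R k z + latpt R k z'.
Proof. by apply/rowP => i; rewrite !mxE intrD mulrDl. Qed.

Lemma latptB k z z' : latpt R k (z - z') = latpt R k z - latpt R k z'.
Proof. by apply/rowP => i; rewrite !mxE intrB mulrBl. Qed.

Lemma lidx_coord k t i : (0 < k)%N ->
  ((lidx k t 0 i)%:~R) / k%:R < tnth t i <= (((lidx k t 0 i)%:~R) + 1) / k%:R.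
Proof.
move=> k0; have /lcellP := erefl (lidx k t) => /(_ k0) /(_ i).
by rewrite !tnth_mktuple.
Qed.

Lemma lidx_close k t : (0 < k)%N ->
  eucl (toRow t - latpt R k (lidx k t)) <= Num.sqrt d%:R / k%:R.
Proof.
move=> k0; apply: eucl_le_max => [|i]; first by rewrite invr_ge0.
rewrite !mxE -/(lidx k t) ; have := lidx_coord t i k0.
rewrite !mxE mulrDl mul1r => /andP[h1 h2].
have k1 : 0 <= (k%:R : R)^-1 by rewrite invr_ge0.
by rewrite ler_norml; apply/andP; split; lra.
Qed.

(** Step functions on the cells of mesh [1/n] converge pointwise. This transports measurability to
    tuples for functions defined on row vectors. *)
Lemma measurable_lipschitz (g : 'rV[R]_d -> R) (C : R) :
  (forall x y, `|g x - g y| <= C * eucl (x - y)) -> measurable_fun setT (fun t => g (toRow t)).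
Proof.
move=> gC; apply: (@measurable_fun_cvg _ _ _ _ (fun n t => g (latpt R n.+1 (lidx n.+1 t)))).
  by move=> n; exact: (@measurable_lidx R d n.+1 _ _ (fun z => g (latpt R n.+1 z))).
move=> t _; apply/cvgrPdist_le => e e0.
have [N hN] : exists N : nat, `|C| * Num.sqrt d%:R / e < N%:R.
  exists (Num.truncn (`|C| * Num.sqrt d%:R / e)).+1.
  exact: truncnS_gt.
exists N => // n /= Nn.
apply: le_trans (gC _ _) _.
apply: le_trans (_ : `|C| * (Num.sqrt d%:R / n.+1%:R) <= _).
  apply: le_trans (_ : `|C| * eucl (toRow t - latpt R n.+1 (lidx n.+1 t)) <= _).
    by rewrite ler_wpM2r ?eucl_ge0 // ler_norm.
  by rewrite ler_wpM2l // lidx_close.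
rewrite mulrA ler_pdivrMr ?ltr0n // [leRHS]mulrC -ler_pdivrMr //.
apply: le_trans (ltW hN) _; rewrite ler_nat; lia.
Qed.

Lemma measurable_eucl_powR (x : 'rV[R]_d) (p : R) :
  measurable_fun setT (fun t => eucl (toRow t - x) `^ p).
Proof.
apply: (@measurableT_comp _ _ _ _ _ _ (@powR R ^~ p)); first exact: measurable_powR.
apply: (@measurable_lipschitz (fun y => eucl (y - x)) 1) => u v.
rewrite mul1r; apply: le_trans (eucl_dist _ _) _.
by rewrite [_ - _ - _](_ : _ = u - v) //; rewrite opprB addrA subrK.
Qed.

Definition hcube (h : R) : set (d.-tuple R) := hbox [tuple - h | i < d] [tuple h | i < d].

Lemma measurable_hcube h : measurable (hcube h).
Proof. exact: measurable_hbox. Qed.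

Lemma hcubePn h t : ~ hcube h t -> exists i, h <= `|tnth t i|.
Proof.
move=> H; apply: contrapT => /forallNP h2; apply: H => i.
rewrite !tnth_mktuple; have /negP := h2 i; rewrite -ltNge ltr_norml => /andP[-> /ltW ->].
by [].
Qed.

Variable leb : {measure set (d.-tuple R) -> \bar R}.
Hypothesis hleb : is_lebesgue_tuple leb.

Lemma leb_hcube h : 0 <= h -> leb (hcube h) = ((2 * h) ^+ d)%:E.
Proof.
move=> h0; rewrite leb_hbox //; congr (_%:E).
rewrite (eq_bigr (fun=> 2 * h)); first by rewrite prodr_const card_ord.
by move=> i _; rewrite !tnth_mktuple opprK [h + h](_ : _ = 2 * h); [apply/max_idPl; lra|ring].
Qed.

(** With [a j = h 2^(-j)], the integrand on the shell between [hcube (a j)] and [hcube (a (j+1))] is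
    at most [(a (j+1))^(th - d)], and the volume is at most [(4 a (j+1))^d]: a geometric series of
    ratio [2^(-th)]. *)
Lemma integral_riesz (th : R) : 0 < th -> th < d%:R -> exists2 C, 0 <= C & forall h, 0 < h ->
  (\int[leb]_(t in hcube h) (eucl (toRow t) `^ (th - d%:R))%:E <= (C * h `^ th)%:E)%E.
Proof.
move=> th0 thd; pose r : R := 2^-1 `^ th.
have r0 : 0 <= r by exact: powR_ge0.
have r1 : r < 1.
  have -> : 1 = 1 `^ th :> R by rewrite powR1.
  by apply: gt0_ltr_powR => //; rewrite ?nnegrE //; lra.
have r01 : 0 <= r < 1 by rewrite r0.
exists (4 ^+ d * (r * (1 - r)^-1)).
  by rewrite !mulr_ge0 ?exprn_ge0 // invr_ge0; lra.
move=> h h0.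
pose a (j : nat) : R := h * 2^-1 ^+ j.
have a0 j : 0 < a j by rewrite mulr_gt0 // exprn_gt0.
pose f (j : nat) (t : d.-tuple R) : \bar R := ((a j.+1 `^ (th - d%:R)) * \1_(hcube (a j)) t)%:E.
have f0 j t : (0 <= f j t)%E by rewrite lee_fin mulr_ge0 ?powR_ge0.
have mf j : measurable_fun (hcube h) (f j).
  apply/measurable_EFinP; apply: measurable_funM => //.
  by apply: measurable_funTS; apply: measurable_indic; exact: measurable_hcube.
apply: (@le_trans _ _ (\int[leb]_(t in hcube h) (\sum_(j <oo) f j t))%E).
  apply: ge0_le_integral => //; first exact: measurable_hcube.
  - by move=> t _; rewrite lee_fin powR_ge0.
  - apply/measurable_EFinP; apply: measurable_funTS.
    by have := @measurable_eucl_powR 0 (th - d%:R); under eq_fun do rewrite subr0.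
  - apply: ge0_emeasurable_sum => //.
  - move=> t ht.
    (* The origin belongs to no shell, but there [powR] gives the integrand the value 0. *)
    have [t0|t0] := eqVneq (toRow t) 0.
      rewrite t0 eucl0 powR0; first exact: nneseries_ge0.
      by rewrite subr_eq0 lt_eqF.
    have [i ti] : exists i, tnth t i != 0.
      apply: contrapT => /forallNP H; move/negP: t0; apply; apply/eqP/rowP => i.
      by rewrite !mxE; have /negP := H i; rewrite negbK => /eqP.
    have ex : exists n, `[< ~ hcube (a n) t >].
      have [n hn] : exists n : nat, h / `|tnth t i| < n%:R.
        by exists (Num.truncn (h / `|tnth t i|)).+1; exact: truncnS_gt.
      exists n; apply/asboolP => H; have := H i; rewrite !tnth_mktuple => /andP[h1 h2].
      have : `|tnth t i| <= a n by rewrite ler_norml h2 ltW.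
      rewrite leNgt => /negP; apply.
      rewrite /a exprVn ltr_pdivrMr ?exprn_gt0 //.
      rewrite ltr_pdivrMr ?normr_gt0 // in hn.
      apply: lt_le_trans hn _; rewrite mulrC ler_wpM2l //.
      by rewrite -natrX ler_nat ltnW // ltn_expl.
    have := ex_minnP ex => -[[|n] /asboolP hn nmin].
      by exfalso; apply: hn; rewrite /a expr0 mulr1.
    have hn' : hcube (a n) t.
      by apply: contrapT => H; have := nmin n (asboolT H); rewrite ltnn.
    apply: (@le_trans _ _ (f n t)).
      rewrite /f lee_fin indicE mem_set // mulr1.
      rewrite -opprB; apply: powRN_mono => //; first lra.
      have [j hj] := hcubePn hn; apply: le_trans hj _.
      by have := eucl_coord (toRow t) j; rewrite mxE.
    rewrite (nneseries_esumT (a := f ^~ t)) //; exact: (@esum_ge_pt _ _ (f ^~ t) n).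
rewrite integral_nneseries //; last exact: measurable_hcube.
rewrite nneseries_esumT; last by move=> n; apply: integral_ge0.
apply: (@le_trans _ _ (\esum_(j in [set: nat]) ((4 ^+ d * h `^ th * r)%:E * (r ^+ j)%:E))%E).
  apply: le_esum => j _.
  rewrite /f; under eq_integral do rewrite EFinM.
  rewrite ge0_integralZl_EFin //; first last.
  - exact: powR_ge0.
  - by apply/measurable_EFinP; apply: measurable_funTS; apply: measurable_indic; exact: measurable_hcube.
  - exact: measurable_hcube.
  rewrite integral_indic //; [|exact: measurable_hcube..].
  apply: (@le_trans _ _ ((a j.+1 `^ (th - d%:R))%:E * leb (hcube (a j)))%E).
    rewrite lee_wpmul2l ?lee_fin ?powR_ge0 //.
    apply: le_measure; rewrite ?inE; [apply: measurableI|..]; try exact: measurable_hcube.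
    exact: subIsetl.
  rewrite leb_hcube ?(ltW (a0 j)) // -!EFinM lee_fin.
  have -> : 2 * a j = 4 * a j.+1 by rewrite /a exprS; field.
  rewrite exprMn mulrCA.
  rewrite -(powR_mulrn _ (ltW (a0 j.+1))) -powRD; last by rewrite (gt_eqF (a0 _)) implybT.
  rewrite subrK /a powRM ?(ltW h0) ?exprn_ge0 //.
  have -> : (2^-1 ^+ j.+1) `^ th = r * r ^+ j.
    rewrite -exprS -(@powR_mulrn _ (2^-1 : R)); last by rewrite invr_ge0.
    by rewrite powRAC powR_mulrn.
  by rewrite le_eqVlt; apply/orP; left; apply/eqP; ring.
rewrite esumZl //; first last.
- by move=> i; rewrite lee_fin exprn_ge0.
- by rewrite !mulr_ge0 ?exprn_ge0 ?powR_ge0.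
apply: (@le_trans _ _ ((4 ^+ d * h `^ th * r)%:E * ((1 - r)^-1)%:E)%E).
  apply: lee_wpmul2l; last exact: nnsum_geometric.
  by rewrite lee_fin !mulr_ge0 ?exprn_ge0 ?powR_ge0.
by rewrite -EFinM lee_fin le_eqVlt; apply/orP; left; apply/eqP; ring.
Qed.

(** Cells centred at the lattice points. With cells anchored at a corner, the origin would lie on
    the boundary of cells of nonzero index; here [|t|] is comparable to the norm of the centre on
    every cell but the central one. *)
Definition lidxc (k : nat) t := lidx k (affmap [tuple (2 * k%:R)^-1 | i < d] false t).

Lemma lidxc_coord k t i : (0 < k)%N ->
  ((lidxc k t 0 i)%:~R) / k%:R - (2 * k%:R)^-1 < tnth t i
    <= ((lidxc k t 0 i)%:~R) / k%:R + (2 * k%:R)^-1.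
Proof.
move=> k0; rewrite /lidxc.
have := lidx_coord (affmap [tuple (2 * k%:R)^-1 | i < d] false t) i k0.
set n := lidx _ _ 0 i; rewrite /affmap !tnth_mktuple expr0 mul1r [(_ + 1) / _]mulrDl mul1r.
have [e eE] : exists e : R, e = (2 * k%:R)^-1 by eexists.
have -> : (k%:R)^-1 = e + e :> R.
  by rewrite eE; field; rewrite pnatr_eq0; lia.
by rewrite -eE; case/andP => h1 h2; apply/andP; split; lra.
Qed.

Lemma lidxc_close k t : (0 < k)%N ->
  eucl (toRow t - latpt R k (lidxc k t)) <= Num.sqrt d%:R / k%:R.
Proof.
move=> k0; apply: eucl_le_max => [|i]; first by rewrite invr_ge0.
rewrite [_ 0 i](_ : _ = tnth t i - (lidxc k t 0 i)%:~R / k%:R); last by rewrite !mxE.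
have := lidxc_coord t i k0.
have -> : (k%:R)^-1 = (2 * k%:R)^-1 + (2 * k%:R)^-1 :> R.
  by field; rewrite pnatr_eq0; lia.
have h0 : 0 <= (2 * k%:R)^-1 :> R by rewrite invr_ge0 mulr_ge0.
by case/andP => h1 h2; rewrite ler_norml; apply/andP; split; lra.
Qed.

Lemma lidxc_eq0 k t : (0 < k)%N -> lidxc k t = 0 -> hcube (2 * k%:R)^-1 t.
Proof.
move=> k0 e i; have := lidxc_coord t i k0; rewrite e !mxE mul0r sub0r add0r.
by rewrite !tnth_mktuple.
Qed.

Lemma measurable_lidxc k (d' : measure_display) (T : measurableType d') (u : 'rV[int]_d -> T) :
  (0 < k)%N -> measurable_fun setT (fun t => u (lidxc k t)).
Proof.
move=> k0; apply: (@measurableT_comp _ _ _ _ _ _ (fun t => u (lidx k t))).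
  exact: measurable_lidx.
exact: measurable_affmap.
Qed.

Lemma integral_lidxc k (u : 'rV[int]_d -> R) : (0 < k)%N -> (forall z, 0 <= u z) ->
  (\int[leb]_t (u (lidxc k t))%:E = (k%:R ^- d)%:E * nnsum u)%E.
Proof.
move=> k0 u0; rewrite -(integral_lidx hleb) //.
have := @ge0_integral_affmap R d leb hleb [tuple (2 * k%:R)^-1 | i < d] false setT
  (fun t => (u (lidx k t))%:E).
rewrite preimage_setT => <- //; last by move=> t _; rewrite lee_fin.
exact: (@measurable_lidx R d k _ _ (fun z => (u z)%:E)).
Qed.

Hypothesis d0 : (0 < d)%N.

Lemma lidxc_lower k t : (0 < k)%N -> lidxc k t != 0 ->
  lnorm R (lidxc k t) / k%:R / (2 * Num.sqrt d%:R) <= eucl (toRow t).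
Proof.
move=> k0 m0; set m := lidxc k t in m0 *.
have [|i hi] := @bigop.eq_bigmax 'I_d (fun i => absz (m 0 i)); first by rewrite card_ord.
have ilt j : (absz (m 0%R j) <= absz (m 0%R i))%N.
  by rewrite -hi; exact: (@bigop.leq_bigmax _ (fun i => absz (m 0 i))).
have mi1 : (1 <= absz (m 0%R i))%N.
  rewrite lt0n; apply: contra m0 => /eqP e; apply/eqP/rowP => j.
  by rewrite [RHS]mxE; have := ilt j; rewrite e leqn0 absz_eq0 => /eqP.
have [sd sdE] : exists sd : R, sd = Num.sqrt d%:R by eexists.
have sd0 : 0 < sd by rewrite sdE sqrtr_gt0 ltr0n.
have k0' : 0 < k%:R :> R by rewrite ltr0n.
have [N NE] : exists N : R, N = (absz (m 0%R i))%:R by eexists.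
have N1 : 1 <= N by rewrite NE ler1n.
have hm : lnorm R m <= sd * N.
  rewrite sdE NE; apply: eucl_le_max => // j; rewrite [_ 0 j]mxE.
  by rewrite -intr_norm -abszE -pmulrn ler_nat.
have h3 : `|(m 0 i)%:~R / k%:R| = N / k%:R :> R.
  by rewrite normrM -intr_norm -abszE -pmulrn -NE (ger0_norm (_ : 0 <= k%:R^-1)) // invr_ge0.
rewrite -sdE; move: {hi ilt mi1 NE sdE} N1 hm h3 => N1 hm h3.
apply: le_trans (_ : N / (2 * k%:R) <= _).
  rewrite ler_pdivrMr ?mulr_gt0 // mulrAC ler_pdivrMr //.
  by rewrite [leRHS](_ : _ = sd * N) //; field; lra.
apply: le_trans (_ : `|tnth t i| <= _); last by have := eucl_coord (toRow t) i; rewrite mxE.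
have := lidxc_coord t i k0; rewrite -/m => /andP[h1 h2].
have h4 : `|(m 0 i)%:~R / k%:R| <= `|tnth t i| + (2 * k%:R)^-1.
  have hc : `|(m 0 i)%:~R / k%:R - tnth t i| <= (2 * k%:R)^-1.
    by rewrite ler_norml; apply/andP; split; lra.
  have := ler_normD ((m 0 i)%:~R / k%:R - tnth t i) (tnth t i); rewrite subrK; lra.
rewrite h3 in h4.
have h5 : (2 * k%:R)^-1 <= N / (2 * k%:R) :> R.
  by rewrite -[leLHS]mul1r ler_wpM2r ?invr_ge0 ?mulr_ge0.
have h6 : N / k%:R = N / (2 * k%:R) + N / (2 * k%:R) by field; lra.
lra.
Qed.

(** Product rule on a cell of diameter [O(1/k)]: one term varies [D], the other one varies the power
    of the norm. All norms are comparable to that of the centre, so both terms have the same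
    order. *)
Lemma kernel_cell_bound (Cd q p : R) : 0 <= Cd -> 0 < p -> 0 < q ->
  exists2 C, 0 <= C & forall D : 'rV[R]_d -> R,
    (forall s s', `|D s - D s'| <= Cd * eucl (s - s') * Num.max (eucl s) (eucl s') `^ p) ->
    D 0 = 0 -> forall k t, (0 < k)%N -> lidxc k t != 0 ->
    `|D (toRow t) * eucl (toRow t) `^ (- q) -
      D (latpt R k (lidxc k t)) * eucl (latpt R k (lidxc k t)) `^ (- q)| <=
    C / k%:R * (lnorm R (lidxc k t) / k%:R) `^ (p - q).
Proof.
move=> Cd0 p0 q0.
have [sd sdE] : exists sd : R, sd = Num.sqrt d%:R by exists (Num.sqrt d%:R).
have sd1 : 1 <= sd by rewrite sdE -[leLHS]sqrtr1 ler_sqrt // ler1n.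
have [A1 A1E] : exists A1, A1 = ((2 * sd)^-1) `^ (- q) by eexists.
have [A2 A2E] : exists A2, A2 = ((2 * sd)^-1) `^ (- (q + 1)) by eexists.
have [B1 B1E] : exists B1, B1 = (1 + sd) `^ p by eexists.
have A10 : 0 <= A1 by rewrite A1E powR_ge0.
have A20 : 0 <= A2 by rewrite A2E powR_ge0.
have B10 : 0 <= B1 by rewrite B1E powR_ge0.
exists (Cd * sd * (B1 * A1 + q * A2)).
  by rewrite !mulr_ge0 ?addr_ge0 ?mulr_ge0 //; lra.
move=> D hD D0 k t k0 m0.
have [m mE] : exists m, m = lidxc k t by eexists.
have [s sE] : exists s, s = toRow t by eexists.
have [sg sgE] : exists sg, sg = latpt R k m by eexists.
have [rho rhoE] : exists rho, rho = lnorm R m / k%:R by eexists.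
have k0' : 0 < k%:R :> R by rewrite ltr0n.
have rhok : k%:R^-1 <= rho.
  by rewrite rhoE -[leLHS]mul1r ler_wpM2r ?invr_ge0 // lnorm_ge1 // mE.
have ki0 : 0 < k%:R^-1 :> R by rewrite invr_gt0.
have rho0 : 0 < rho by lra.
have E1 : eucl (s - sg) <= sd / k%:R by rewrite sdE sE sgE mE; exact: lidxc_close.
have Esg : eucl sg = rho by rewrite sgE rhoE eucl_latpt0.
have E2 : rho * (2 * sd)^-1 <= eucl s by rewrite rhoE sE mE sdE; exact: lidxc_lower.
have c1 : 0 < (2 * sd)^-1 <= 1.
  by rewrite invr_gt0 mulr_gt0 ?ltr0n //=; [rewrite invf_le1 ?mulr_gt0|]; lra.
case/andP: c1 => c0 c1.
have E3 : eucl s <= (1 + sd) * rho.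
  have := eucl_dist s sg; rewrite Esg => /ler_normlP[_ h]; nra.
have E4 : Num.max (eucl s) (eucl sg) `^ p <= B1 * rho `^ p.
  rewrite B1E -powRM; [|lra|lra]; apply: ge0_ler_powR; rewrite ?nnegrE.
  - exact: ltW.
  - by rewrite le_max eucl_ge0.
  - by rewrite mulr_ge0; lra.
  - by rewrite ge_max E3 Esg; nra.
have r0' : 0 < rho * (2 * sd)^-1 by rewrite mulr_gt0.
have E5 : eucl s `^ (- q) <= rho `^ (- q) * A1.
  by rewrite A1E -powRM; [|lra|lra]; apply: powRN_mono => //; exact: ltW.
have E6 : `|eucl s `^ (- q) - rho `^ (- q)| <= q * (sd / k%:R) * (rho `^ (- (q + 1)) * A2).
  rewrite A2E -powRM; [|lra|lra]; apply: le_trans (powR_dist_le q0 r0' E2 _) _; first by nra.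
  rewrite ler_wpM2r ?powR_ge0 // ler_wpM2l ?(ltW q0) //.
  by apply: le_trans E1; rewrite -Esg; exact: eucl_dist.
have E7 : `|D sg| <= Cd * rho * rho `^ p.
  by have := hD sg 0; rewrite D0 !subr0 eucl0 Esg max_l ?(ltW rho0).
rewrite -sE -mE -sgE -rhoE Esg.
have -> : D s * eucl s `^ (- q) - D sg * rho `^ (- q) =
  (D s - D sg) * eucl s `^ (- q) + D sg * (eucl s `^ (- q) - rho `^ (- q)) by ring.
apply: le_trans (ler_normD _ _) _; rewrite !normrM (ger0_norm (powR_ge0 _ _)).
have -> : rho `^ (p - q) = rho `^ p * rho `^ (- q).
  by rewrite powRD // (gt_eqF rho0) implybT.
have P1 : rho * rho `^ (- (q + 1)) = rho `^ (- q).
  rewrite -{1}(powRr1 (ltW rho0)) -powRD; last by rewrite (gt_eqF rho0) implybT.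
  by congr (_ `^ _); ring.
have -> : Cd * sd * (B1 * A1 + q * A2) / k%:R * (rho `^ p * rho `^ (- q)) =
   (Cd * (sd / k%:R) * (B1 * rho `^ p)) * (rho `^ (- q) * A1) +
   (Cd * rho * rho `^ p) * (q * (sd / k%:R) * (rho `^ (- (q + 1)) * A2)).
  by rewrite -P1; ring.
apply: lerD; apply: ler_pM; rewrite ?powR_ge0 ?normr_ge0 //.
apply: le_trans (hD s sg) _.
apply: ler_pM; rewrite ?mulr_ge0 ?eucl_ge0 ?powR_ge0 //.
by rewrite ler_wpM2l.
Qed.

End lattice_approximation.

(** * The limit generator as a symmetrised integral *)

Section generator_limit.
Context {R : realType} {d : nat}.
Variable leb : {measure set (d.-tuple R) -> \bar R}.
Hypothesis hleb : is_lebesgue_tuple leb.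
Hypothesis d0 : (0 < d)%N.
Variable alpha : R.
Hypothesis alpha02 : 0 < alpha < 2.
Implicit Types (t : d.-tuple R) (z m : 'rV[int]_d).

Let q := d%:R + alpha.
(** Two constraints bear on [p]: integrability near 0 needs [1 + p > alpha], and summability over
    the cells needs [p < alpha]. The value [alpha/2] meets both for [alpha < 2], and
    [th = 1 + p - alpha] becomes the exponent of the consistency error. *)
Let p := alpha / 2.
Let th := 1 - alpha / 2.

Let q0 : 0 < q. Proof. by case/andP: alpha02 => a0 _; rewrite ltr_wpDl. Qed.
Let p01 : 0 < p <= 1. Proof. by case/andP: alpha02 => a0 a2; rewrite /p; apply/andP; split; lra. Qed.
Let th0 : 0 < th. Proof. by case/andP: alpha02 => a0 a2; rewrite /th; lra. Qed.
Let thd : th < d%:R.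
Proof.
case/andP: alpha02 => a0 a2; rewrite /th.
have : 1 <= d%:R :> R by rewrite ler1n.
lra.
Qed.

Lemma measurable_eucl0_powR (r : R) : measurable_fun setT (fun t => eucl (toRow t) `^ r).
Proof. by have := measurable_eucl_powR (0 : 'rV[R]_d) r; under eq_fun do rewrite subr0. Qed.

Lemma integrable_lidxc k (u : 'rV[int]_d -> R) : (0 < k)%N -> summableR u ->
  leb.-integrable setT (EFin \o (fun t => u (lidxc k t))).
Proof.
move=> k0 su; apply/integrableP; split.
  by apply/measurable_EFinP; exact: measurable_lidxc.
rewrite /= (@integral_lidxc _ _ leb hleb k (fun z => `|u z|)) //.
by rewrite lte_mul_pinfty // lee_fin ?invr_ge0 ?exprn_ge0.
Qed.

Lemma Rintegral_lidxc k (u : 'rV[int]_d -> R) : (0 < k)%N -> summableR u ->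
  Rintegral leb setT (fun t => u (lidxc k t)) = k%:R ^- d * rsum u.
Proof.
move=> k0 su; rewrite /Rintegral integralE /rsum mulrBr.
have e1 : (\int[leb]_t ((fun t => (u (lidxc k t))%:E)^\+ t) =
   (k%:R ^- d)%:E * nnsum (fun z => Num.max (u z) 0%R))%E.
  rewrite -(integral_lidxc hleb k0) => [|z]; last by rewrite le_max lexx orbT.
  by apply: eq_integral => t _; rewrite funeposE /= EFin_max.
have e2 : (\int[leb]_t ((fun t => (u (lidxc k t))%:E)^\- t) =
   (k%:R ^- d)%:E * nnsum (fun z => Num.max (- u z)%R 0%R))%E.
  rewrite -(integral_lidxc hleb k0) => [|z]; last by rewrite le_max lexx orbT.
  by apply: eq_integral => t _; rewrite funenegE /= EFin_max EFinN.
rewrite e1 e2.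
have f1 : nnsum (fun z => Num.max (u z) 0) \is a fin_num.
  rewrite ge0_fin_numE; last first.
    by apply: nnsum_ge0 => z; rewrite le_max lexx orbT.
  apply: le_lt_trans su; apply: le_nnsum => z; rewrite ge_max normr_ge0 ler_norm //.
have f2 : nnsum (fun z => Num.max (- u z) 0) \is a fin_num.
  rewrite ge0_fin_numE; last first.
    by apply: nnsum_ge0 => z; rewrite le_max lexx orbT.
  apply: le_lt_trans su; apply: le_nnsum => z; rewrite ge_max normr_ge0 andbT -normrN ler_norm //.
by rewrite fineB ?fin_numM // !fineM.
Qed.

Definition far (eps : R) (x : 'rV[R]_d) : set (d.-tuple R) := [set t | eps <= eucl (toRow t - x)].

Lemma measurable_far eps x : measurable (far eps x).
Proof.
have := measurable_eucl_powR x 1 => /(_ measurableT `[eps, +oo[%classic).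
rewrite setTI => h.
rewrite [X in measurable X](_ : _ = (fun t => eucl (toRow t - x) `^ 1) @^-1` `[eps, +oo[%classic).
  exact: h.
by apply/seteqP; split => t /=; rewrite in_itv /= andbT powRr1 ?eucl_ge0.
Qed.

Lemma integrable_kernel (eps : R) : 0 < eps ->
  leb.-integrable (far eps 0) (EFin \o (fun t => eucl (toRow t) `^ (- q))).
Proof.
move=> eps0.
have mD := measurable_far eps 0.
(* Majorant constant on unit cells; the last term serves the central cell, where the kernel is at
   most [eps^(-q)]. *)
pose u (m : 'rV[int]_d) : R := (2 * Num.sqrt d%:R)^-1 `^ (- q) * lnorm R m `^ (- q) + (m == 0)%:R * eps `^ (- q).
have u0 m : 0 <= u m by rewrite addr_ge0 ?mulr_ge0 ?powR_ge0.
have su : summableR u.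
  apply: nnsum_fin_summable => //.
  apply: finsD => [m|m||]; rewrite ?mulr_ge0 ?powR_ge0 //.
    apply: finsZ => [|m|]; rewrite ?powR_ge0 //.
    by apply: fins_lnorm => //; case/andP: alpha02.
  by rewrite /fins nnsum_delta ?powR_ge0 ?ltry.
apply: (@le_integrable _ _ _ leb _ mD _ (EFin \o (fun t => u (lidxc 1 t)))).
- by apply/measurable_EFinP; apply: measurable_funTS; exact: measurable_eucl0_powR.
- move=> t /=; rewrite /far /= subr0 => et; rewrite lee_fin !ger0_norm ?powR_ge0 //.
  rewrite /u; have [m0|m0] := eqVneq (lidxc 1 t) 0.
    rewrite m0 lnorm_powR0 ?oppr_eq0 ?(gt_eqF q0) // mulr0 add0r mul1r.
    by apply: powRN_mono => //; exact: ltW.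
  rewrite mul0r addr0 -powRM ?invr_ge0 ?mulr_ge0 ?sqrtr_ge0 ?lnorm_ge0 //.
  apply: powRN_mono; [exact: ltW| |].
    by rewrite mulr_gt0 ?lnorm_gt0 // invr_gt0 mulr_gt0 // sqrtr_gt0 ltr0n.
  by have := @lidxc_lower R d d0 1 t isT m0; rewrite divr1 mulrC.
apply: integrableS (integrable_lidxc _ su) => //.
Qed.

Definition kdelta (g : 'rV[R]_d -> R) (x : 'rV[R]_d) (t : d.-tuple R) : R :=
  delta2 g x (toRow t) * eucl (toRow t) `^ (- q).

Variable g : 'rV[R]_d -> R.
Hypotheses (sg : smooth g) (cg : compact_support g).

Lemma measurable_kdelta x : measurable_fun setT (kdelta g x).
Proof.
have [C C0 hC] := smooth_lipschitz sg cg.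
apply: measurable_funM; last exact: measurable_eucl0_powR.
apply: (@measurable_lipschitz _ _ (delta2 g x) (2 * C)) => u v; rewrite /delta2.
rewrite [X in `|X|](_ : _ = (g (x + u) - g (x + v)) + (g (x - u) - g (x - v))); last by ring.
apply: le_trans (ler_normD _ _) _.
have := hC (x + u) (x + v); have := hC (x - u) (x - v).
rewrite [x + u - (x + v)](_ : _ = u - v); last by rewrite opprD addrACA subrr add0r.
rewrite [x - u - (x - v)](_ : _ = - (u - v)); last by rewrite !opprD opprK addrACA subrr add0r.
rewrite euclN; lra.
Qed.

(** The substitutions [x + t] and [x - t] both send the far region of 0 onto that of [x]; the mean
    of the two integrals contains the second difference. *)
Lemma far_integral (eps : R) (x : 'rV[R]_d) : 0 < eps ->
  Rintegral leb (far eps x) (fun t => (g (toRow t) - g x) * eucl (toRow t - x) `^ (- q)) =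
  2^-1 * Rintegral leb (far eps 0) (kdelta g x).
Proof.
move=> eps0.
have [C C0 hC] := smooth_lipschitz sg cg.
have [B B0 hB] := smooth_bounded sg cg.
pose xt : d.-tuple R := [tuple x 0 i | i < d].
have xtE : toRow xt = x by apply/rowP => i; rewrite mxE tnth_mktuple.
pose F t := (g (toRow t) - g x) * eucl (toRow t - x) `^ (- q).
have mF : measurable_fun setT F.
  apply: measurable_funM; last exact: measurable_eucl_powR.
  by apply: measurable_funB => //; exact: measurable_lipschitz hC.
pose G (s : bool) t := (g (x + (-1) ^+ s *: toRow t) - g x) * eucl (toRow t) `^ (- q).
have FG s t : F (affmap xt s t) = G s t.
  rewrite /F /G toRow_affmap xtE [x + _ - x]addrC addrA addNr add0r euclZ normrX normrN1 expr1n mul1r.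
  by [].
have IG s : Rintegral leb (far eps x) F = Rintegral leb (far eps 0) (G s).
  rewrite /Rintegral -(@integral_affmap _ _ leb hleb xt s (far eps x) (EFin \o F)); first last.
  - by apply: measurable_funTS; exact/measurable_EFinP.
  - exact: measurable_far.
  rewrite [affmap xt s @^-1` _](_ : _ = far eps 0).
    by apply: (congr1 fine); apply: eq_integral => t _; rewrite -FG.
  apply/seteqP; split => t; rewrite /far /= toRow_affmap xtE subr0 [x + _ - x]addrC addrA addNr add0r;
    by rewrite euclZ normrX normrN1 expr1n mul1r.
have intG s : leb.-integrable (far eps 0) (EFin \o G s).
  apply: (@le_integrable _ _ _ leb _ (measurable_far eps 0) _
     (EFin \o (fun t => 2 * B * eucl (toRow t) `^ (- q)))).
  - apply/measurable_EFinP; apply: measurable_funTS.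
    rewrite (_ : G s = F \o affmap xt s); last by apply/funext => t /=; rewrite FG.
    by apply: measurableT_comp => //; exact: measurable_affmap.
  - move=> t _ /=; rewrite lee_fin !normrM ler_wpM2r //.
    rewrite (ger0_norm B0) normr_nat.
    apply: le_trans (ler_normB _ _) _.
    by have := hB (x + (-1) ^+ s *: toRow t); have := hB x; lra.
  rewrite (_ : _ \o _ = fun t => ((2 * B)%:E * (EFin \o (fun t => (eucl (toRow t) `^ (- q))%R)) t)%E).
    by apply: integrableZl; [exact: measurable_far|exact: integrable_kernel].
  by apply/funext => t; rewrite /= EFinM.
have -> : Rintegral leb (far eps 0) (kdelta g x) =
    Rintegral leb (far eps 0) (G false) + Rintegral leb (far eps 0) (G true).
  rewrite -(RintegralD (measurable_far eps 0) (intG false) (intG true)).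
  apply: eq_Rintegral => t _; rewrite /kdelta /G /delta2 expr0 expr1 scale1r scaleN1r; ring.
rewrite -!IG -/F; lra.
Qed.

Lemma kdelta_near (C : R) x : (forall s, `|delta2 g x s| <= C * eucl s * eucl s `^ p) ->
  forall t, `|kdelta g x t| <= C * eucl (toRow t) `^ (th - d%:R).
Proof.
move=> hC t; rewrite /kdelta normrM (ger0_norm (powR_ge0 _ _)).
have [e0|e0] := eqVneq (eucl (toRow t)) 0.
  by rewrite e0 !powR0 ?mulr0 // ?oppr_eq0 ?(gt_eqF q0) // subr_eq0 lt_eqF.
apply: le_trans (ler_wpM2r (powR_ge0 _ _) (hC (toRow t))) _.
have e0' : 0 < eucl (toRow t) by rewrite lt_neqAle eq_sym e0 eucl_ge0.
rewrite -!mulrA -{1}(powRr1 (ltW e0')) -!powRD ?(negbTE e0) ?implybT //.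
by rewrite [_ + (_ - _)](_ : _ = th - d%:R) // /th /p /q; field.
Qed.

(** After symmetrisation the integrand is [O(|t|^(th - d))] near 0, so the removed ball contributes
    [O(eps^th)] and the principal value is an ordinary integral. *)
Lemma Lbar_kdelta x : leb.-integrable setT (EFin \o kdelta g x) ->
  Lbar leb alpha g x = 2^-1 * Rintegral leb setT (kdelta g x).
Proof.
move=> ik; rewrite /Lbar; apply: cvg_lim => //.
have [Cd Cd0 hCd] := delta2_lipschitz sg cg.
have hk := @kdelta_near Cd x _.
have {}hk : forall t, `|kdelta g x t| <= Cd * eucl (toRow t) `^ (th - d%:R).
  apply: hk => s; have := hCd p x s 0 p01.
  by rewrite delta2_0 !subr0 eucl0 max_l // eucl_ge0.
have [Cr Cr0 hCr] := integral_riesz hleb th0 thd.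
have bd eps : 0 < eps -> `|Rintegral leb setT (kdelta g x) - Rintegral leb (far eps 0) (kdelta g x)| <= Cd * Cr * eps `^ th.
  move=> eps0.
  have mN : measurable (~` far eps 0) by apply: measurableC; exact: measurable_far.
  have -> : Rintegral leb setT (kdelta g x) = Rintegral leb (far eps 0) (kdelta g x) + Rintegral leb (~` far eps 0) (kdelta g x).
    rewrite -(setUv (far eps 0)) Rintegral_setU //; first exact: measurable_far.
      by rewrite setUv.
    by apply/disj_set2P; rewrite setICr.
  rewrite addrAC subrr add0r.
  have iN : leb.-integrable (~` far eps 0) (EFin \o kdelta g x) by apply: integrableS ik.
  apply: le_trans (le_normr_Rintegral mN iN) _.
  rewrite -lee_fin fineK; last first.
    have := integrable_fin_num mN (integrable_norm iN) => //.
  apply: (@le_trans _ _ (\int[leb]_(t in hcube eps) (Cd * eucl (toRow t) `^ (th - d%:R))%:E)%E).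
    apply: (@le_trans _ _ (\int[leb]_(t in hcube eps) `|kdelta g x t|%:E)%E).
      apply: ge0_subset_integral => //; first exact: measurable_hcube.
        apply/measurable_EFinP; apply: measurableT_comp => //.
        by apply: measurable_funTS; exact: measurable_kdelta.
      move=> t; rewrite /far /= subr0 => /negP; rewrite -ltNge => h i.
      have := eucl_coord (toRow t) i; rewrite mxE !tnth_mktuple => h2.
      have : `|tnth t i| < eps by lra.
      by rewrite ltr_norml => /andP[-> /ltW ->].
    apply: ge0_le_integral => //; first exact: measurable_hcube.
    - apply/measurable_EFinP; apply: measurableT_comp => //.
      by apply: measurable_funTS; exact: measurable_kdelta.
    - apply/measurable_EFinP; apply: measurable_funM => //.
      by apply: measurable_funTS; exact: measurable_eucl0_powR.
    - by move=> t _; rewrite lee_fin.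
  under eq_integral do rewrite EFinM.
  rewrite ge0_integralZl_EFin //; first last.
  - by apply/measurable_EFinP; apply: measurable_funTS; exact: measurable_eucl0_powR.
  - by move=> t _; rewrite lee_fin powR_ge0.
  - exact: measurable_hcube.
  rewrite -mulrA EFinM lee_wpmul2l ?lee_fin //; exact: hCr.
apply/cvgrPdist_le => e e0.
have [K K0 hK] : exists2 K, 0 < K & Cd * Cr <= K.
  by exists (Cd * Cr + 1) => //; have := mulr_ge0 Cd0 Cr0; lra.
near=> eps.
have eps0 : 0 < eps by near: eps; exact: nbhs_right_gt.
rewrite far_integral // -mulrBr normrM ger0_norm ?invr_ge0 //.
have h1 := bd eps eps0.
have h2 : eps `^ th <= e / K.
  have -> : e / K = ((e / K) `^ th^-1) `^ th.
    by rewrite -powRrM mulVf ?(gt_eqF th0) // powRr1 // divr_ge0 ?ltW.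
  apply: ge0_ler_powR; rewrite ?nnegrE ?powR_ge0 ?(ltW eps0) ?(ltW th0) //.
  near: eps; apply: nbhs_right_le; apply: powR_gt0; exact: divr_gt0.
have h3 : Cd * Cr * eps `^ th <= e.
  apply: le_trans (_ : K * (e / K) <= _).
    by apply: ler_pM; rewrite ?mulr_ge0 ?powR_ge0.
  by rewrite mulrC divfK // gt_eqF.
have := normr_ge0 (Rintegral leb setT (kdelta g x) - Rintegral leb (far eps 0) (kdelta g x)).
lra.
Unshelve. all: by end_near.
Qed.

(** Size of the quadrature error on cell [m]; the unit at 0 is for the central cell, where the power
    is 0 by convention. *)
Definition cellweight (m : 'rV[int]_d) : R := lnorm R m `^ (- (d%:R + alpha / 2)) + (m == 0)%:R.

Lemma cellweight_ge0 m : 0 <= cellweight m.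
Proof. by rewrite addr_ge0 ?powR_ge0. Qed.

Lemma fins_cellweight : fins cellweight.
Proof.
apply: finsD => [m|m||]; rewrite ?powR_ge0 //.
  by apply: fins_lnorm => //; case/andP: p01.
rewrite (_ : (fun i => _) = fun m : 'rV[int]_d => (m == 0)%:R * 1).
  by rewrite /fins nnsum_delta ?ltry.
by apply/funext => m; rewrite mulr1.
Qed.

Let psi k x (m : 'rV[int]_d) := delta2 g x (latpt R k m) * eucl (latpt R k m) `^ (- q).

Lemma summable_psi k x : (0 < k)%N -> summableR (psi k x).
Proof.
move=> k0; have [B B0 hB] := smooth_bounded sg cg.
apply: (@summable_le _ _ _ (fun m => 4 * B * (k%:R^-1 `^ (- q)) * lnorm R m `^ (- q))).
  move=> m; rewrite /psi normrM eucl_latpt0 (ger0_norm (powR_ge0 _ _)).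
  rewrite powRM ?lnorm_ge0 ?invr_ge0 // -[leRHS]mulrA [_ `^ _ * _ `^ _]mulrC.
  by rewrite ler_wpM2r ?mulr_ge0 ?powR_ge0 // delta2_le.
apply: finsZ => [|m|]; rewrite ?mulr_ge0 ?powR_ge0 //.
by apply: fins_lnorm => //; case/andP: alpha02.
Qed.

(** [T] records which cells can contribute. It will be [chi z + chi (z + m) + chi (z - m)] with
    [chi] the indicator of a box around the support, and keeping it in the bound makes the total
    error summable over [z] by [nnsum_schur2]. *)
Lemma kdelta_cells : exists2 C, 0 <= C & forall (k : nat) x (T : 'rV[int]_d -> R), (0 < k)%N ->
  (forall m, 0 <= T m <= 3) -> (forall m, T m = 0 \/ 1 <= T m) ->
  (forall t, T (lidxc k t) = 0 -> delta2 g x (toRow t) = 0) ->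
  (forall m, T m = 0 -> delta2 g x (latpt R k m) = 0) ->
  leb.-integrable setT (EFin \o kdelta g x) /\
  `|Rintegral leb setT (kdelta g x) - k%:R ^- d * rsum (psi k x)| <=
    fine (nnsum (fun m => C * k%:R `^ (- th) * cellweight m * T m)).
Proof.
have [Cd Cd0 hCd] := delta2_lipschitz sg cg.
have [Cc Cc0 hCc] := kernel_cell_bound d0 Cd0 (proj1 (andP p01)) q0.
have [Cr Cr0 hCr] := integral_riesz hleb th0 thd.
exists (Cc + Cd * Cr); first by rewrite addr_ge0 ?mulr_ge0.
move=> k x T k0 T03 T01 T0t T0m.
have T0 m : 0 <= T m by case/andP: (T03 m).
have k0' : 0 < k%:R :> R by rewrite ltr0n.
have near t : `|kdelta g x t| <= Cd * eucl (toRow t) `^ (th - d%:R).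
  apply: kdelta_near => s; have := hCd p x s 0 p01.
  by rewrite delta2_0 !subr0 eucl0 max_l // eucl_ge0.
have [kth kthE] : exists kth : R, kth = k%:R `^ (- th) by eexists.
have kth0 : 0 <= kth by rewrite kthE powR_ge0.
(* Error on the cells away from 0; after multiplication by the cell volume its power of [k] is
   [k^(- th)]. *)
pose W m := Cc / k%:R * (lnorm R m / k%:R) `^ (p - q) * T m.
have W0 m : 0 <= W m by rewrite !mulr_ge0 ?powR_ge0 ?invr_ge0 //.
have WE m : k%:R ^- d * W m = Cc * kth * lnorm R m `^ (- (d%:R + alpha / 2)) * T m.
  rewrite /W powRM ?lnorm_ge0 ?invr_ge0 ?(ltW k0') //.
  rewrite [p - q](_ : _ = - (d%:R + alpha / 2)); last by rewrite /p /q; field.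
  have -> : kth = k%:R ^- d * k%:R^-1 * k%:R^-1 `^ (- (d%:R + alpha / 2)).
    rewrite kthE -(powR_inv1 (ltW k0')) -powRrM -(powR_mulrn _ (ltW k0')) -powRN.
    rewrite -!powRD ?(gt_eqF k0') ?implybT //.
    by congr (_ `^ _); rewrite /th; field.
  by ring.
pose h : R := (2 * k%:R)^-1.
have h0 : 0 < h by rewrite invr_gt0 mulr_gt0.
pose f t : R := eucl (toRow t) `^ (th - d%:R).
have mf : measurable_fun setT f by exact: measurable_eucl0_powR.
(* Error on the central cell, where the lattice term is 0 and the integrand itself must be
   bounded. *)
pose V t : R := (Cd * T 0) * (f \_ (hcube h)) t.
have V0 t : 0 <= V t.
  by rewrite !mulr_ge0 // /patch; case: ifP => // _; exact: powR_ge0.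
have mV : measurable_fun setT V.
  apply: measurable_funM => //.
  by apply/(measurable_restrictT _ _).1; [exact: measurable_hcube|exact: measurable_funTS].
have hpsi0 : psi k x 0 = 0 by rewrite /psi latpt0 delta2_0 mul0r.
pose Er t := kdelta g x t - psi k x (lidxc k t).
have mEr : measurable_fun setT Er.
  by apply: measurable_funB; [exact: measurable_kdelta|exact: measurable_lidxc].
have Er_le t : `|Er t| <= W (lidxc k t) + V t.
  rewrite /Er; have [m0|m0] := eqVneq (lidxc k t) 0.
    rewrite m0 hpsi0 subr0; apply: (@le_trans _ _ (V t)); last by rewrite lerDr.
    rewrite /V /patch mem_set; last exact: lidxc_eq0.
    have [TT|TT] := T01 0.
      by rewrite /kdelta T0t ?m0 // mul0r normr0 TT mulr0 mul0r.
    apply: le_trans (near t) _; rewrite mulrAC -[leLHS]mulr1 ler_wpM2l // mulr_ge0 // powR_ge0 //.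
  apply: (@le_trans _ _ (W (lidxc k t))); last by rewrite lerDl.
  have [TT|TT] := T01 (lidxc k t).
    by rewrite /kdelta T0t // /psi T0m // !mul0r subrr normr0 W0.
  have := hCc (delta2 g x) (fun s s' => hCd p x s s' p01) (delta2_0 g x) k t k0 m0 => H.
  apply: le_trans H _; rewrite /W -[leLHS]mulr1 ler_wpM2l //.
  by rewrite mulr_ge0 ?powR_ge0 // divr_ge0.
have intV : (\int[leb]_t (V t)%:E <= (T 0 * (Cd * Cr * kth))%:E)%E.
  under eq_integral do rewrite EFinM.
  rewrite ge0_integralZl_EFin //; first last.
  - by rewrite mulr_ge0.
  - apply/measurable_EFinP; apply/(measurable_restrictT _ _).1; [exact: measurable_hcube|exact: measurable_funTS].
  - by move=> t _; rewrite lee_fin /patch; case: ifP => // _; exact: powR_ge0.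
  rewrite (_ : (\int[leb]_t ((f \_ (hcube h))%R t)%:E)%E = (\int[leb]_(t in hcube h) (f t)%:E)%E); last first.
    by rewrite [RHS]integral_mkcond; apply: eq_integral => t _; rewrite restrict_EFin.
  apply: (@le_trans _ _ ((Cd * T 0)%:E * (Cr * h `^ th)%:E)%E).
    by apply: lee_wpmul2l; [rewrite lee_fin mulr_ge0|exact: hCr].
  rewrite -EFinM lee_fin.
  have hk : h `^ th <= kth.
    rewrite kthE powRN -powR_inv1 ?powR_ge0 // -powRrM mulrC powRrM powR_inv1 ?(ltW k0') //.
    apply: ge0_ler_powR; rewrite ?nnegrE ?invr_ge0 ?(ltW th0) ?(ltW h0) ?(ltW k0') //.
    by rewrite /h lef_pV2 ?posrE ?mulr_gt0 //; lra.
  have := mulr_ge0 (mulr_ge0 Cd0 (T0 0)) Cr0.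
  by have := hk; nra.
pose bT m := (Cc + Cd * Cr) * kth * cellweight m * T m.
have C1 : 0 <= Cc + Cd * Cr by rewrite addr_ge0 ?mulr_ge0.
have bT0 m : 0 <= bT m by rewrite /bT; have := cellweight_ge0 m => ?; rewrite !mulr_ge0.
have intdom : (\int[leb]_t (W (lidxc k t) + V t)%:E <= nnsum bT)%E.
  under eq_integral do rewrite EFinD.
  rewrite ge0_integralD //; first last.
  - exact/measurable_EFinP.
  - by move=> t _; rewrite lee_fin.
  - by apply/measurable_EFinP; exact: measurable_lidxc.
  - by move=> t _; rewrite lee_fin.
  rewrite (integral_lidxc hleb) //.
  apply: (@le_trans _ _ (nnsum (fun m => k%:R ^- d * W m)%R +
      nnsum (fun m : 'rV[int]_d => ((m == 0)%:R * (T 0%R * (Cd * Cr * kth)))%R))%E).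
    rewrite nnsumZ ?invr_ge0 ?exprn_ge0 ?(ltW k0') // leeD2l // nnsum_delta ?mulr_ge0 //.
  rewrite -nnsumD; first last.
  - by move=> m; rewrite !mulr_ge0.
  - by move=> m; rewrite mulr_ge0 // invr_ge0 exprn_ge0 // ltW.
  apply: le_nnsum => m; rewrite WE /bT /cellweight.
  have A : 0 <= lnorm R m `^ (- (d%:R + alpha / 2)) by exact: powR_ge0.
  have -> : (m == 0)%:R * (T 0 * (Cd * Cr * kth)) = (m == 0)%:R * (T m * (Cd * Cr * kth)).
    by case: eqP => [->|_] //; rewrite !mul0r.
  have B1 : 0 <= ((m == 0)%:R : R) by [].
  have B2 := mulr_ge0 Cd0 Cr0.
  set A1 := _ `^ _ in A *; set A2 := (_ == _)%:R in B1 *.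
  have E1 : 0 <= Cd * Cr * kth * A1 * T m by rewrite !mulr_ge0.
  have E2 : 0 <= Cc * kth * A2 * T m by rewrite !mulr_ge0.
  have -> : (Cc + Cd * Cr) * kth * (A1 + A2) * T m =
    Cc * kth * A1 * T m + A2 * (T m * (Cd * Cr * kth)) + (Cd * Cr * kth * A1 * T m + Cc * kth * A2 * T m) by ring.
  lra.
have fbT : fins bT.
  apply: (@fins_le _ _ _ (fun m => (Cc + Cd * Cr) * kth * 3 * cellweight m)).
    move=> m; rewrite /bT -!mulrA ler_wpM2l // ler_wpM2l // [3 * _]mulrC.
    by rewrite ler_wpM2l ?cellweight_ge0 //; case/andP: (T03 m).
  apply: finsZ => [|m|]; rewrite ?cellweight_ge0 ?fins_cellweight //.
  by rewrite !mulr_ge0.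
have intEr : (\int[leb]_t `|Er t|%:E <= nnsum bT)%E.
  apply: le_trans intdom; apply: ge0_le_integral => //.
  - by apply/measurable_EFinP; apply: measurableT_comp.
  - apply/measurable_EFinP; apply: measurable_funD => //; exact: measurable_lidxc.
  - by move=> t _; rewrite lee_fin.
have iEr : leb.-integrable setT (EFin \o Er).
  apply/integrableP; split; first exact/measurable_EFinP.
  by apply: le_lt_trans intEr _.
have ipsi := @integrable_lidxc k _ k0 (@summable_psi k x k0).
have ik : leb.-integrable setT (EFin \o kdelta g x).
  have := integrableD measurableT iEr ipsi.
  by congr (_.-integrable _ _); apply/funext => t /=; rewrite -EFinD subrK.
split => //.
rewrite -(Rintegral_lidxc k0 (@summable_psi k x k0)) -RintegralB //.
apply: le_trans (le_normr_Rintegral measurableT iEr) _.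
rewrite -lee_fin fineK; last exact: (integrable_fin_num measurableT (integrable_norm iEr)).
rewrite -kthE nnsumK //.
Qed.

End generator_limit.

(** * Consistency of the averaged lattice generator and of the extension *)

Section lattice_consistency.
Context {R : realType} {d : nat}.
Variable leb : {measure set (d.-tuple R) -> \bar R}.
Hypothesis hleb : is_lebesgue_tuple leb.
Hypothesis d0 : (0 < d)%N.
Implicit Types (t : d.-tuple R) (z m : 'rV[int]_d).

Definition inbox (N : nat) z : R := `[< range (@boxpt d N) z >]%:R.

Lemma inbox01 N z : 0 <= inbox N z <= 1.
Proof. by rewrite /inbox; case: asboolP => _; rewrite ?lexx ?ler01. Qed.

Lemma nnsum_inbox N : nnsum (inbox N) = ((N.*2 ^ d)%:R)%:E.
Proof.
rewrite /nnsum (@esum_finType _ _ _ (@boxpt d N)); first last.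
- by move=> z h; rewrite /inbox asboolF.
- by move=> z; rewrite lee_fin; case/andP: (inbox01 N z).
- exact: boxpt_inj.
rewrite (eq_bigr (fun=> 1%:E)) => [|F _]; last by rewrite /inbox asboolT //; exists F.
by rewrite sumEFin sumr_const card_box.
Qed.

Lemma outside_box_eucl (ell k : nat) z (y : 'rV[R]_d) : (0 < k)%N ->
  ~ range (@boxpt d (ell.+1 * k)) z ->
  (forall i, `|y 0 i - (z 0 i)%:~R / k%:R| <= k%:R^-1) -> ell%:R <= eucl y.
Proof.
move=> k0 /boxPn[i hi] hy.
have k0' : 0 < k%:R :> R by rewrite ltr0n.
have h1 : ell.+1%:R <= `|(z 0 i)%:~R / k%:R| :> R.
  rewrite normrM (ger0_norm (_ : 0 <= k%:R^-1)) ?invr_ge0 // ler_pdivlMr // -natrM.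
  rewrite -intr_norm.
  have : ((ell.+1 * k)%:Z)%:~R <= (`|z 0 i| : int)%:~R :> R by rewrite ler_int.
  by rewrite -pmulrn.
have h2 := hy i; have h3 := eucl_coord y i.
have h4 := ler_normD (y 0 i - (z 0 i)%:~R / k%:R) ((z 0 i)%:~R / k%:R - y 0 i).
have h5 : `|(z 0 i)%:~R / k%:R| <= `|y 0 i| + `|y 0 i - (z 0 i)%:~R / k%:R|.
  by have := ler_normB (y 0 i) (y 0 i - (z 0 i)%:~R / k%:R); rewrite opprB addrC subrK.
have h6 : k%:R^-1 <= 1 :> R by rewrite invf_le1 // ler1n.
by move: h1; rewrite -natr1; lra.
Qed.

Variable g : 'rV[R]_d -> R.
Hypotheses (sg : smooth g) (cg : compact_support g).

(** The tolerance of one mesh lets [z] stand for all points of its cell. *)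
Lemma vanish_outside_box : exists ell : nat, forall k z (y : 'rV[R]_d), (0 < k)%N ->
  inbox (ell.+1 * k) z = 0 ->
  (forall i, `|y 0 i - (z 0 i)%:~R / k%:R| <= k%:R^-1) -> g y = 0.
Proof.
case: cg => r hr; exists (Num.truncn `|r|).+1 => k z y k0.
rewrite /inbox; case: asboolP => [_ /eqP|hz _ hy]; first by rewrite oner_eq0.
apply: hr; apply: lt_le_trans (outside_box_eucl k0 hz hy).
by apply: le_lt_trans (ler_norm _) _; exact: truncnS_gt.
Qed.

Lemma latpt_coord k z i : latpt R k z 0 i = (z 0 i)%:~R / k%:R.
Proof. by rewrite mxE. Qed.

Lemma rsum_reflect (f : 'rV[int]_d -> R) z : rsum (fun m => f (z - m)) = rsum f.
Proof.
have -> : rsum f = rsum (fun m => f (m + z)) by rewrite rsum_shift.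
rewrite /rsum /nnsum.
rewrite -(esum_opp (fun m => (Num.max (f (z - m)) 0)%:E)).
rewrite -(esum_opp (fun m => (Num.max (- f (z - m)) 0)%:E)).
by congr (fine _ - fine _); apply: eq_esum => m _; rewrite opprK addrC.
Qed.

Variable alpha : R.
Hypothesis alpha02 : 0 < alpha < 2.

(** The lattice generator with each weight replaced by its mean 1; the prefactor is what remains of
    [k^(-d)] after rescaling the distances. *)
Definition ldelta k z := k%:R `^ alpha *
  rsum (fun z' => (g (latpt R k z') - g (latpt R k z)) * lnorm R (z - z') `^ (- (d%:R + alpha))).

Lemma summable_lattice_kernel k z : (0 < k)%N ->
  summableR (fun z' => (g (latpt R k z') - g (latpt R k z)) * lnorm R (z - z') `^ (- (d%:R + alpha))).
Proof.
move=> k0; have [B B0 hB] := smooth_bounded sg cg.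
apply: (@summable_le _ _ _ (fun z' => 2 * B * lnorm R (z - z') `^ (- (d%:R + alpha)))).
  move=> z'; rewrite normrM (ger0_norm (powR_ge0 _ _)) ler_wpM2r ?powR_ge0 //.
  apply: le_trans (ler_normB _ _) _.
  by have := hB (latpt R k z'); have := hB (latpt R k z); lra.
apply: finsZ => [|m|]; rewrite ?mulr_ge0 ?powR_ge0 //.
have := @fins_lnorm R d alpha d0 _ => /(_ _)/Wrap[]; first by case/andP: alpha02.
rewrite /fins /nnsum => h.
rewrite -(esum_shift (fun z' => (lnorm R (z - z') `^ (- (d%:R + alpha)))%:E) z).
have e m : lnorm R (z - (m + z)) = lnorm R m by rewrite opprD addrCA subrr addr0 lnormN.
by under eq_esum do rewrite e.
Qed.

Lemma ldelta_psi k z : (0 < k)%N -> ldelta k z = 2^-1 * (k%:R ^- d *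
  rsum (fun m => delta2 g (latpt R k z) (latpt R k m) * eucl (latpt R k m) `^ (- (d%:R + alpha)))).
Proof.
move=> k0; have k0' : 0 < k%:R :> R by rewrite ltr0n.
pose f z' := (g (latpt R k z') - g (latpt R k z)) * lnorm R (z - z') `^ (- (d%:R + alpha)).
have sf : summableR f by exact: summable_lattice_kernel.
have sf1 : summableR (fun m => f (m + z)).
  by rewrite /summableR /fins /nnsum (esum_shift (fun z => `|f z|%:E)).
have sf2 : summableR (fun m => f (z - m)).
  rewrite /summableR /fins /nnsum -(esum_opp (fun m => `|f (z - m)|%:E)).
  by under eq_esum do rewrite opprK addrC.
have -> : (fun m => delta2 g (latpt R k z) (latpt R k m) * eucl (latpt R k m) `^ (- (d%:R + alpha))) =
   (fun m => k%:R `^ (d%:R + alpha) * (f (m + z) + f (z - m))).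
  have e1 m : lnorm R (z - (m + z)) = lnorm R m by rewrite opprD addrCA subrr addr0 lnormN.
  have e2 m : lnorm R (z - (z - m)) = lnorm R m by rewrite opprB addrC subrK.
  apply/funext => m; rewrite /f e1 e2.
  rewrite eucl_latpt0 powRM ?lnorm_ge0 ?invr_ge0 ?(ltW k0') //.
  rewrite -(powR_inv1 (ltW k0')) -powRrM mulN1r opprK /delta2 latptD latptB [latpt R k m + _]addrC.
  by ring.
have E0 : ldelta k z = k%:R `^ alpha * rsum f by [].
have E1 : rsum (fun m => f (m + z)) = rsum f by exact: rsum_shift.
have E2 : rsum (fun m => f (z - m)) = rsum f by exact: rsum_reflect.
rewrite E0; move: {E0} f {sf} sf1 sf2 E1 E2 => f sf1 sf2 E1 E2.
have E3 := rsumZ (k%:R `^ (d%:R + alpha)) (summableRD sf1 sf2).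
have E4 := rsumD sf1 sf2.
rewrite E3 E4 E1 E2.
have -> : k%:R `^ (d%:R + alpha) = k%:R ^+ d * k%:R `^ alpha.
  by rewrite powRD ?(gt_eqF k0') ?implybT // powR_mulrn ?(ltW k0').
by field; rewrite gt_eqF // exprn_gt0.
Qed.

(** Both generators are half the symmetrised integral or sum, so [kdelta_cells] bounds their
    difference pointwise; [nnsum_schur2] sums its square over a support of order [k^d] points. *)
Lemma generator_consistency : exists2 C, 0 <= C & forall k, (0 < k)%N ->
  (nnsum (fun z => (Lbar leb alpha g (latpt R k z) - ldelta k z) ^+ 2)%R <=
     (C * k%:R ^+ d * (k%:R `^ (- (1 - alpha / 2))) ^+ 2)%:E)%E.
Proof.
have [C C0 hC] := kdelta_cells hleb d0 alpha02 sg cg.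
have [ell hell] := vanish_outside_box.
have cwf := fins_cellweight (d := d) d0 alpha02.
have [S SE] : exists S, S = fine (nnsum (cellweight (d := d) alpha)) by eexists.
exists (9 * (ell.+1.*2 ^ d)%:R * (C * S) ^+ 2).
  by rewrite mulr_ge0 ?sqr_ge0 // mulr_ge0.
move=> k k0; have k0' : 0 < k%:R :> R by rewrite ltr0n.
have [kth kthE] : exists kth : R, kth = k%:R `^ (- (1 - alpha / 2)) by eexists.
have kth0 : 0 <= kth by rewrite kthE powR_ge0.
pose chi := inbox (ell.+1 * k).
have chi01 z : 0 <= chi z <= 1 := inbox01 _ z.
have chi00 z : 0 <= chi z by case/andP: (chi01 z).
have chi11 z : chi z <= 1 by case/andP: (chi01 z).
have chi0 z : chi z = 0 \/ chi z = 1 by rewrite /chi /inbox; case: asboolP; [right|left].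
have hS : (nnsum (fun m => (C * kth * cellweight alpha m)%R) <= (C * kth * S)%:E)%E.
  rewrite nnsumZ ?mulr_ge0 //; last by move=> m; exact: cellweight_ge0.
  by rewrite SE [leRHS]EFinM nnsumK //; move=> m; exact: cellweight_ge0.
have := @nnsum_schur2 R d (fun m => C * kth * cellweight alpha m) chi
  (fun z => Lbar leb alpha g (latpt R k z) - ldelta k z) ((ell.+1 * k).*2 ^ d)%:R (C * kth * S).
case/(_ _ _ _ _ _ _)/Wrap => //.
- by move=> m; rewrite !mulr_ge0 ?cellweight_ge0.
- by rewrite nnsum_inbox.
- move=> z; pose T m := chi z + chi (z + m) + chi (z - m).
  have T0 m : T m = 0 -> [/\ chi z = 0, chi (z + m) = 0 & chi (z - m) = 0].
    rewrite /T; have := chi00 z; have := chi00 (z + m); have := chi00 (z - m) => ? ? ? ?.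
    by split; lra.
  have [] := hC k (latpt R k z) T k0.
  + move=> m; rewrite /T; have := chi00 z; have := chi00 (z + m); have := chi00 (z - m) => ? ? ?.
    by have := chi11 z; have := chi11 (z + m); have := chi11 (z - m) => ? ? ?; apply/andP; split; lra.
  + move=> m; rewrite /T; have := chi00 z; have := chi00 (z + m); have := chi00 (z - m) => ? ? ?.
    by case: (chi0 z); case: (chi0 (z + m)); case: (chi0 (z - m)) => ? ? ?; (try by right; lra); left; lra.
  + move=> t /T0[c1 c2 c3]; rewrite /delta2.
    have hki : (2 * k%:R)^-1 <= k%:R^-1 :> R by rewrite lef_pV2 ?posrE ?mulr_gt0 //; lra.
    have hi0 : 0 < (k%:R)^-1 :> R by rewrite invr_gt0.
    rewrite (hell k _ (latpt R k z) k0 c1); last by move=> i; rewrite latpt_coord subrr normr0 invr_ge0.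
    rewrite (hell k _ (latpt R k z + toRow t) k0 c2); last first.
      move=> i; have := lidxc_coord t i k0 => /andP[h1 h2].
      rewrite [(latpt R k z + toRow t) 0 i](_ : _ = (z 0 i)%:~R / k%:R + tnth t i); last by rewrite !mxE.
      rewrite [(z + lidxc k t) 0 i](_ : _ = z 0 i + lidxc k t 0 i); last by rewrite mxE.
      by rewrite intrD mulrDl ler_norml; apply/andP; split; lra.
    rewrite (hell k _ (latpt R k z - toRow t) k0 c3); last first.
      move=> i; have := lidxc_coord t i k0 => /andP[h1 h2].
      rewrite [(latpt R k z - toRow t) 0 i](_ : _ = (z 0 i)%:~R / k%:R - tnth t i); last by rewrite !mxE.
      rewrite [(z - lidxc k t) 0 i](_ : _ = z 0 i - lidxc k t 0 i); last by rewrite !mxE.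
      by rewrite intrB mulrBl ler_norml; apply/andP; split; lra.
    by rewrite addr0 mulr0 subr0.
  + move=> m /T0[c1 c2 c3]; rewrite /delta2 -latptD -latptB.
    rewrite (hell k _ (latpt R k z) k0 c1); last by move=> i; rewrite latpt_coord subrr normr0 invr_ge0.
    rewrite (hell k _ (latpt R k (z + m)) k0 c2); last by move=> i; rewrite latpt_coord subrr normr0 invr_ge0.
    rewrite (hell k _ (latpt R k (z - m)) k0 c3); last by move=> i; rewrite latpt_coord subrr normr0 invr_ge0.
    by rewrite addr0 mulr0 subr0.
  move=> ik; rewrite (Lbar_kdelta hleb d0 alpha02 sg cg ik) ldelta_psi // -mulrBr normrM.
  rewrite [`|2^-1|]ger0_norm ?invr_ge0 // => H; rewrite kthE.
  apply: le_trans H; rewrite -[leRHS]mul1r ler_wpM2r //; lra.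
move=> H; apply: le_trans H _; rewrite lee_fin -kthE.
rewrite doubleMl expnMn natrM [k%:R ^+ d](_ : _ = (k ^ d)%:R) ?natrX //.
by rewrite le_eqVlt; apply/orP; left; apply/eqP; ring.
Qed.

Lemma extension_error : exists2 C, 0 <= C & forall k, (0 < k)%N ->
  (\int[leb]_t ((ext_lat k (fun z => g (latpt R k z)) t - g (toRow t)) ^+ 2)%:E <= (C / k%:R ^+ 2)%:E)%E.
Proof.
have [Cl Cl0 hCl] := smooth_lipschitz sg cg.
have [ell hell] := vanish_outside_box.
exists ((Cl * Num.sqrt d%:R) ^+ 2 * (ell.+1.*2 ^ d)%:R).
  by rewrite mulr_ge0 // sqr_ge0.
move=> k k0; have k0' : 0 < k%:R :> R by rewrite ltr0n.
pose u z := (Cl * (Num.sqrt d%:R / k%:R)) ^+ 2 * inbox (ell.+1 * k) z.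
have u0 z : 0 <= u z by rewrite mulr_ge0 ?sqr_ge0 //; case/andP: (inbox01 (ell.+1 * k) z).
apply: (@le_trans _ _ (\int[leb]_t (u (lidx k t))%:E)%E).
  apply: ge0_le_integral => //.
  - by move=> t _; rewrite lee_fin sqr_ge0.
  - apply/measurable_EFinP; apply: measurable_funX; apply: measurable_funB.
      exact: (@measurable_lidx R d k _ _ (fun z => g (latpt R k z))).
    exact: measurable_lipschitz hCl.
  - by apply/measurable_EFinP; exact: measurable_lidx.
  - move=> t _; rewrite lee_fin ext_latE /u.
    rewrite /inbox; case: asboolP => [_|hz].
      rewrite mulr1 -[leLHS]real_normK ?num_real // ler_sqr ?nnegrE ?mulr_ge0 ?invr_ge0 ?sqrtr_ge0 //.
      rewrite distrC; apply: le_trans (hCl _ _) _; rewrite ler_wpM2l //.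
      exact: lidx_close.
    have hz' : inbox (ell.+1 * k) (lidx k t) = 0 by rewrite /inbox asboolF.
    rewrite (hell k _ (latpt R k (lidx k t)) k0 hz'); last by move=> i; rewrite latpt_coord subrr normr0 invr_ge0.
    rewrite (hell k _ (toRow t) k0 hz').
      by rewrite subrr expr0n mulr0.
    move=> i; have := lidx_coord t i k0 => /andP[h1 h2].
    rewrite [toRow t 0 i]mxE.
    have hi0 : 0 < (k%:R)^-1 :> R by rewrite invr_gt0.
    by rewrite mulrDl mul1r in h2; rewrite ler_norml; apply/andP; split; lra.
rewrite (integral_lidx hleb) // nnsumZ ?sqr_ge0 //.
rewrite nnsum_inbox -!EFinM lee_fin doubleMl expnMn natrM [(k ^ d)%:R]natrX.
rewrite le_eqVlt; apply/orP; left; apply/eqP; field.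
by rewrite ?expf_neq0 // gt_eqF.
Qed.

Lemma Lnorm_extension : exists2 C, 0 <= C & forall k (u : 'rV[int]_d -> R) (A : R), (0 < k)%N -> 0 <= A ->
  (nnsum (fun z => (u z - g (latpt R k z)) ^+ 2)%R <= (A * k%:R ^+ d)%:E)%E ->
  (Lnorm leb 2%:E (fun t => (ext_lat k u t - g (toRow t))%:E) <= (Num.sqrt (2 * A) + C / k%:R)%:E)%E.
Proof.
have [C C0 hC] := extension_error; exists (Num.sqrt (2 * C)); first exact: sqrtr_ge0.
move=> k u A k0 A0 hA; have k0' : 0 < k%:R :> R by rewrite ltr0n.
have [Cl Cl0 hCl] := smooth_lipschitz sg cg.
have mg := measurable_lipschitz hCl.
have [X XE] : exists X : R, X = Num.sqrt (2 * A) + Num.sqrt (2 * C) / k%:R by eexists.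
have X0 : 0 <= X by rewrite XE addr_ge0 ?divr_ge0 ?sqrtr_ge0.
have HX : 2 * A + 2 * (C / k%:R ^+ 2) <= X ^+ 2.
  rewrite XE sqrrD exprMn !sqr_sqrtr ?mulr_ge0 // exprVn.
  have : 0 <= Num.sqrt (2 * A) * (Num.sqrt (2 * C) / k%:R) by rewrite !mulr_ge0 ?invr_ge0 ?sqrtr_ge0.
  by rewrite mulr2n; lra.
have HI : (\int[leb]_t ((ext_lat k u t - g (toRow t)) ^+ 2)%:E <= (X ^+ 2)%:E)%E.
  pose v z := u z - g (latpt R k z).
  apply: (@le_trans _ _ (\int[leb]_t ((2 * v (lidx k t) ^+ 2)%:E +
     (2 * (ext_lat k (fun z => g (latpt R k z)) t - g (toRow t)) ^+ 2)%:E))%E).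
    apply: ge0_le_integral => //.
    - by move=> t _; rewrite lee_fin sqr_ge0.
    - apply/measurable_EFinP; apply: measurable_funX; apply: measurable_funB => //.
      exact: (@measurable_lidx R d k _ _ u).
    - under eq_fun do rewrite -EFinD.
      apply/measurable_EFinP; apply: measurable_funD.
        exact: (@measurable_lidx R d k _ _ (fun z => 2 * v z ^+ 2)).
      apply: measurable_funM => //; apply: measurable_funX; apply: measurable_funB => //.
      exact: (@measurable_lidx R d k _ _ (fun z => g (latpt R k z))).
    - move=> t _; rewrite -EFinD lee_fin !ext_latE /v.
      set a := u _; set b := g _; set c := g _.
      by have := sqr_ge0 ((a - c) - (c - b)); rewrite !expr2; lra.
  rewrite ge0_integralD //; first last.
  - apply/measurable_EFinP; apply: measurable_funM => //; apply: measurable_funX; apply: measurable_funB => //.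
    exact: (@measurable_lidx R d k _ _ (fun z => g (latpt R k z))).
  - by move=> t _; rewrite lee_fin mulr_ge0 ?sqr_ge0.
  - by apply/measurable_EFinP; exact: (@measurable_lidx R d k _ _ (fun z => 2 * v z ^+ 2)).
  - by move=> t _; rewrite lee_fin mulr_ge0 ?sqr_ge0.
  rewrite (@integral_lidx R d leb hleb k (fun z => 2 * v z ^+ 2) k0); last first.
    by move=> z; rewrite mulr_ge0 ?sqr_ge0.
  rewrite nnsumZ //; last by move=> z; exact: sqr_ge0.
  under eq_integral do rewrite EFinM.
  rewrite ge0_integralZl_EFin //; first last.
  - apply/measurable_EFinP; apply: measurable_funX; apply: measurable_funB => //.
    exact: (@measurable_lidx R d k _ _ (fun z => g (latpt R k z))).
  - by move=> t _; rewrite lee_fin sqr_ge0.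
  apply: (@le_trans _ _ ((k%:R ^- d)%:E * (2%:E * (A * k%:R ^+ d)%:E) + 2%:E * (C / k%:R ^+ 2)%:E)%E).
    apply: leeD; last by apply: lee_wpmul2l => //; exact: hC.
    apply: lee_wpmul2l; first by rewrite lee_fin invr_ge0 exprn_ge0 // ltW.
    by apply: lee_wpmul2l.
  rewrite -!EFinM -EFinD lee_fin; apply: le_trans HX.
  rewrite le_eqVlt; apply/orP; left; apply/eqP; field.
  by rewrite ?expf_neq0 // gt_eqF.
rewrite -XE unlock /=.
have -> : X%:E = ((X ^+ 2)%:E `^ 2^-1)%E.
  by rewrite poweR_EFin -powR_mulrn // -powRrM mulfV // powRr1.
apply: gt0_ler_poweR; rewrite ?in_itv /= ?leey ?andbT //.
- by apply: integral_ge0 => t _; rewrite lee_fin powR_ge0.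
- by rewrite lee_fin sqr_ge0.
under eq_integral do rewrite powR_mulrn ?normr_ge0 // real_normK ?num_real //.
exact: HI.
Qed.

End lattice_consistency.

(** * Bad events for one cut and for one pair of points *)

Section finite_events.
Context {R : realType} {dO : measure_display} {Omega : measurableType dO}.
Variables (P : probability Omega R) (d : nat).
Local Notation L := 'rV[int]_d.
Variables (w : L -> L -> Omega -> R) (M : R).
Hypothesis hw : H1 P w M.
Hypothesis M1 : 1 <= M.
Variables (I : finType) (iota : I -> L).
Hypothesis iinj : injective iota.

(** Only pairs across the boundary of [A] occur: the noise is antisymmetric in its two ends, so
    pairs inside a block cancel. Each unordered pair then appears once, as independence requires. *)
Definition cutsum (A : pred I) (a : L -> L -> R) (o : Omega) : R :=
  \sum_(y | A y) \sum_(y' | ~~ A y') a (iota y) (iota y') * (w (iota y) (iota y') o - 1).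

Definition cutvar (A : pred I) (a : L -> L -> R) : R :=
  \sum_(y | A y) \sum_(y' | ~~ A y') a (iota y) (iota y') ^+ 2.

Definition bad_cut (A : pred I) (a : L -> L -> R) (K : R) : set Omega :=
  [set o | 8 * M ^+ 2 * K * cutvar A a < cutsum A a o ^+ 2].

Definition bad_two (A : pred I) (n : R) (x y : I) : set Omega :=
  [set o | \sum_(z | [&& A z, z != x & z != y])
     w (iota x) (iota z) o * w (iota y) (iota z) o < n / 8].

Let iota_neq x y : x != y -> iota x != iota y.
Proof. by rewrite (inj_eq iinj). Qed.

Let bw x y : iota x != iota y -> bmeas (w (iota x) (iota y)).
Proof. by move=> h; exact: (@bmeas_w _ _ _ _ _ _ _ hw (iota x, iota y)). Qed.

Lemma measurable_bad_cut A a K : measurable (bad_cut A a K).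
Proof.
have mS : measurable_fun setT (cutsum A a).
  have [] // : bmeas (cutsum A a).
  rewrite /cutsum; under eq_fun do rewrite big_mkcond.
  apply: bmeas_sum => y; case: (boolP (A y)) => [Ay|_]; last exact: bmeas_cst.
  under eq_fun do rewrite big_mkcond.
  apply: bmeas_sum => y'; case: (boolP (~~ A y')) => [Ay'|_]; last exact: bmeas_cst.
  apply: bmeasM; first exact: bmeas_cst.
  apply: bmeasD; last exact: bmeas_cst.
  by apply: bw; apply: iota_neq; apply: contraTneq Ay => ->.
rewrite (_ : bad_cut A a K = (fun o => cutsum A a o ^+ 2) @^-1`
   `]8 * M ^+ 2 * K * cutvar A a, +oo[%classic); last first.
  by apply/seteqP; split => o /=; rewrite in_itv/= andbT.
rewrite -[X in measurable X]setTI; apply: measurable_funX => //.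
Qed.

Lemma bad_cut_le A a K : 0 < K -> (P (bad_cut A a K) <= (2 * expR (- K))%:E)%E.
Proof.
move=> K0.
pose Q : pred (I * I) := fun p => A p.1 && ~~ A p.2.
pose s := [seq (iota p.1, iota p.2) | p <- enum Q].
have es : edges s.
  apply/andP; split.
    rewrite map_inj_uniq ?enum_uniq // => -[x y] [x' y'] /= [h1 h2].
    by rewrite (iinj h1) (iinj h2).
  apply/allP => e /mapP[[x y]]; rewrite mem_enum /Q unfold_in /= => /andP[Ax Ay] -> /=.
  apply/andP; split; first by apply: iota_neq; apply: contraTneq Ax => ->.
  apply/negP => /mapP[[x' y']]; rewrite mem_enum unfold_in /= => /andP[Ax' _] [/iinj e1 _].
  by move: Ay; rewrite e1 Ax'.
have E (f : L -> L -> R) : \sum_(y | A y) \sum_(y' | ~~ A y') f (iota y) (iota y') =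
    \sum_(e <- s) f e.1 e.2.
  by rewrite big_map big_enum /= pair_big_dep.
have := hoeffding hw M1 (fun e => a e.1 e.2) es K0.
apply: le_trans; rewrite /bad_cut /cutsum /cutvar.
rewrite (E (fun x y => a x y ^+ 2)) (_ : [set o | _] =
  [set o | 8 * M ^+ 2 * K * (\sum_(e <- s) a e.1 e.2 ^+ 2) <
              (\sum_(e <- s) a e.1 e.2 * (w e.1 e.2 o - 1)) ^+ 2]) //.
by apply/seteqP; split => o /=; rewrite (E (fun x y => a x y * (w x y o - 1))).
Qed.

Lemma measurable_bad_two A n x y : measurable (bad_two A n x y).
Proof.
pose S o := \sum_(z | [&& A z, z != x & z != y]) w (iota x) (iota z) o * w (iota y) (iota z) o.
have mS : measurable_fun setT S.
  have [] // : bmeas S.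
  rewrite /S; under eq_fun do rewrite big_mkcond.
  apply: bmeas_sum => z; case: (boolP [&& A z, z != x & z != y]) => [/and3P[_ zx zy]|_]; last exact: bmeas_cst.
  by apply: bmeasM; apply: bw; apply: iota_neq; rewrite eq_sym.
rewrite (_ : bad_two A n x y = S @^-1` `]-oo, n / 8[%classic); last first.
  by apply/seteqP; split => o /=; rewrite in_itv.
by rewrite -[X in measurable X]setTI; exact: mS.
Qed.

(** Removing [x] and [y] from [n >= 4] points leaves at least [n/2], which turns the constants 1/4
    and [4 M^2] of [two_step_paths] into 1/8 and [8 M^2]. *)
Lemma bad_two_le (A : pred I) x y : x != y -> A x -> A y -> (4 <= #|A|)%N ->
  (P (bad_two A #|A|%:R x y) <= (expR (- (#|A|%:R / (8 * M ^+ 2))))%:E)%E.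
Proof.
move=> xy Ax Ay A4.
pose Q : pred I := fun z => [&& A z, z != x & z != y].
pose s := [seq iota z | z <- enum Q].
have us : uniq s by rewrite map_inj_uniq ?enum_uniq.
have xs : iota x \notin s.
  by apply/negP => /mapP[z]; rewrite mem_enum unfold_in => /and3P[_ zx _] /iinj e; rewrite e eqxx in zx.
have ys : iota y \notin s.
  by apply/negP => /mapP[z]; rewrite mem_enum unfold_in => /and3P[_ _ zy] /iinj e; rewrite e eqxx in zy.
have ss : (size s + 2 = #|A|)%N.
  rewrite size_map -cardE (cardD1 x A) (cardD1 y [predD1 A & x]).
  have -> : (x \in A) = true by exact: Ax.
  have -> : (y \in [predD1 A & x]) = true by rewrite inE /= eq_sym xy; exact: Ay.
  rewrite addnA addnC; congr (_ + _)%N.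
  apply: eq_card => z; rewrite -[RHS]/((z != y) && ((z != x) && A z)) -[LHS]/([&& A z, z != x & z != y]).
  by case: (A z); case: (z == x); case: (z == y).
have sR : (size s)%:R = #|A|%:R - 2 :> R by rewrite -ss natrD addrK.
have A4' : 4 <= #|A|%:R :> R by rewrite (ler_nat R 4).
have M0 : 0 < M by exact: lt_le_trans ltr01 M1.
have M2 : 0 < M ^+ 2 by rewrite exprn_gt0.
have := two_step_paths hw M1 (iota_neq xy) us xs ys.
have E o : \sum_(z <- s) w (iota x) z o * w (iota y) z o =
    \sum_(z | [&& A z, z != x & z != y]) w (iota x) (iota z) o * w (iota y) (iota z) o.
  by rewrite big_map big_enum.
move=> H; apply: (@le_trans _ _ (expR (- ((size s)%:R / (4 * M ^+ 2))))%:E); last first.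
  rewrite lee_fin ler_expR lerN2 sR ler_pdivlMr ?mulr_gt0 //.
  rewrite mulrAC ler_pdivrMr ?mulr_gt0 //.
  by nra.
apply: le_trans H.
apply: (@le_trans _ _ (P (bad_two A (2 * (size s)%:R) x y))); last first.
  rewrite (_ : bad_two _ _ _ _ = [set o | \sum_(z <- s) w (iota x) z o * w (iota y) z o < (size s)%:R / 4]) //.
  by apply/seteqP; split => o; rewrite /bad_two /= E; rewrite [2 * _ / 8](_ : _ = (size s)%:R / 4) //; field.
apply: le_measure; rewrite ?inE; [exact: measurable_bad_two|exact: measurable_bad_two|].
move=> o; rewrite /bad_two /= => h; apply: lt_le_trans h _.
by rewrite sR; lra.
Qed.

End finite_events.

Lemma measure_finite_union (R : realType) (dO : measure_display) (Omega : measurableType dO)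
    (P : {measure set Omega -> \bar R}) (I : finType) (E : I -> set Omega) (Q : pred I) (p : R) :
  0 <= p -> (forall i, Q i -> measurable (E i)) -> (forall i, Q i -> (P (E i) <= p%:E)%E) ->
  measurable (\bigcup_(i in [set i | Q i]) E i) /\
  (P (\bigcup_(i in [set i | Q i]) E i) <= (#|I|%:R * p)%:E)%E.
Proof.
move=> p0 mE PE.
have -> : \bigcup_(i in [set i | Q i]) E i = \big[setU/set0]_(i <- enum I | Q i) E i.
  by rewrite -bigcup_seq_cond; apply: eq_bigcupl; split => i /=; rewrite mem_enum.
split; first exact: bigsetU_measurable.
apply: (@le_trans _ _ (\sum_(i <- enum I | Q i) P (E i))%E).
  elim: (enum I) => [|i s IH]; first by rewrite !big_nil measure0.
  rewrite !big_cons; case: ifPn => [Qi|//]; apply: le_trans (measureU2 _ _ _) _.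
  - exact: mE.
  - exact: bigsetU_measurable.
  - by rewrite leeD2l.
apply: (@le_trans _ _ (\sum_(i <- enum I | Q i) p%:E)%E); first exact: lee_sum.
rewrite sumEFin lee_fin big_const_seq iter_addr addr0 -[X in X <= _]mulr_natl ler_wpM2r //.
by rewrite ler_nat cardE count_size.
Qed.

Lemma leq_expW (m n e : nat) : (m <= n)%N -> (m ^ e <= n ^ e)%N.
Proof. by case: e => [|e] mn; rewrite ?expn0 // leq_exp2r. Qed.

Lemma eventually_log (R : realType) (p r B T : R) : 0 <= p -> 0 < r ->
  exists ks : nat, forall k, (ks <= k)%N ->
    [/\ (2 <= k)%N, B <= ln k%:R, ln k%:R `^ p <= k%:R & T <= ln (k%:R : R) `^ r].
Proof.
move=> p0 r0.
have [C C0 hC] := @ln_powR_le R p 2^-1 p0 ltac:(lra).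
pose Y := Num.max `|B| (`|T| `^ r^-1).
pose X := Num.max (C ^+ 2) (expR Y).
exists (maxn 2 (Num.truncn X).+1) => k; rewrite geq_max => /andP[k2 kX].
have hX : X <= k%:R.
  by apply: le_trans (ltW (truncnS_gt X)) _; rewrite ler_nat.
have k0 : 0 < k%:R :> R by rewrite ltr0n; lia.
have hC2 : C ^+ 2 <= k%:R by apply: le_trans hX; rewrite le_max lexx.
have hY : expR Y <= k%:R by apply: le_trans hX; rewrite le_max lexx orbT.
have hL : Y <= ln k%:R by rewrite -(expRK Y) ler_ln ?posrE ?expR_gt0.
split => //.
- by apply: le_trans (ler_norm B) _; apply: le_trans hL; rewrite le_max lexx.
- apply: le_trans (hC k%:R _) _; first by rewrite ler1n; lia.
  have -> : k%:R `^ 2^-1 = Num.sqrt k%:R :> R by rewrite powR12_sqrt ?ltW.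
  have s0 := sqrtr_ge0 (k%:R : R); have s2 := sqr_sqrtr (ltW k0).
  have : C <= Num.sqrt k%:R.
    by rewrite -(ger0_norm (ltW C0)) -sqrtr_sqr ler_sqrt // ltW.
  by move: s2; rewrite expr2; nra.
apply: le_trans (ler_norm T) _.
have -> : `|T| = (`|T| `^ r^-1) `^ r by rewrite -powRrM mulVf ?gt_eqF // powRr1.
have hTY : `|T| `^ r^-1 <= Y by rewrite le_max lexx orbT.
apply: ge0_ler_powR; rewrite ?nnegrE ?powR_ge0 ?(ltW r0) //.
  by apply: le_trans hL; apply: le_trans hTY; exact: powR_ge0.
exact: le_trans hTY hL.
Qed.

Lemma le_four_mul (R : realType) (a b c : R) : c <= 2 * (b + 1) -> b <= a -> 1 <= a -> c <= 4 * a.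
Proof. by lra. Qed.

(** * Good environments and the random threshold *)

Section environment.
Context {R : realType} {dO : measure_display} {Omega : measurableType dO}.
Variables (P : probability Omega R) (d : nat).
Local Notation L := 'rV[int]_d.
Variables (w : L -> L -> Omega -> R) (M gamma q : R) (A : nat).
Hypothesis hw : H1 P w M.
Hypothesis M1 : 1 <= M.
Hypothesis d0 : (0 < d)%N.
Hypothesis gamma0 : 0 < gamma.

Definition atest (m k : nat) (S z z' : L) : R :=
  lnorm R (z - z') `^ (- q) * (testf R m k S z' - testf R m k S z).

(** Side of a block of volume [ln^(1+gamma) k], the volume at which the failure probability of
    [two_step_paths] drops below every power of [k]. *)
Definition logscale (k : nat) : R := ln k%:R `^ ((1 + gamma) / d%:R).

(** Nothing here refers to [g]: the radius [m] goes up to [k] and the corner [S] ranges over a box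
    that contains the one of size [m * k], so a fixed [g] is covered for large [k]. Cuts are
    controlled at all scales down to single points, paths only from [j0] on. *)
Definition good_environment (T : R) (k : nat) (o : Omega) := exists j0 J : nat,
  [/\ (j0 <= J)%N, logscale k <= (2 ^ j0)%:R <= 4 * logscale k, (k ^ A <= 2 ^ J)%N /\ (4 <= ln (k%:R : R)),
    (forall (m : nat) (S : L) (j : nat) (F : box d (2 ^ J)), (m <= k)%N -> range (@boxpt d (k * k)) S ->
      (j <= J)%N ->
      cutsum w (@boxpt d (2 ^ J)) (fun y => cube j y == cube j F) (atest m k S) o ^+ 2 <=
      8 * M ^+ 2 * (T * ln k%:R) *
        cutvar (@boxpt d (2 ^ J)) (fun y => cube j y == cube j F) (atest m k S)) &
    (forall (j : nat) (F F' : box d (2 ^ J)), (j0 <= j <= J)%N -> F != F' -> cube j F = cube j F' ->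
      ((2 ^ j) ^ d)%:R / 8 <= \sum_(z | [&& cube j z == cube j F, z != F & z != F'])
         w (boxpt F) (boxpt z) o * w (boxpt F') (boxpt z) o)].

(** Union bound: polynomially many cuts and pairs, each failing with probability at most [2 k^(-T)];
    [T] is chosen after counting them. *)
Lemma random_environment : exists (T : R) (k0 : Omega -> \bar R),
  [/\ 0 < T, measurable_fun [set: Omega] k0, (forall o, (3%:E <= k0 o)%E),
      P [set o | k0 o = +oo%E] = 0%E &
      forall o k, (k0 o < k%:R%:E)%E -> good_environment T k o].
Proof.
have dR : 0 < d%:R :> R by rewrite ltr0n.
(* For large [k], [2^(j0 k) <= 4 k <= k^3] and [2^(up_log 2 k) <= 2 k <= k^2], so [2^(J k) <= k^B].
   The exponents [n1] and [n2] count the tuples [(m, S, j, F)] and [(j, F, F')]. *)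
have [B BE] : exists B, B = (2 * A + 3)%N by eexists.
pose n1 := (2 + 3 * d + B + B.+1 * d)%N.
pose n2 := (B + B.+1 * d + B.+1 * d)%N.
(* This exponent beats both counts and leaves [k^(-4)], which is below [(k+1)^(-2)]. *)
pose Tn := (n1 + n2 + 4)%N.
have [T TE] : exists T : R, T = Tn%:R by eexists.
have T0 : 0 < T by rewrite TE ltr0n /Tn addn_gt0 orbT.
have M0 : 0 < M by exact: lt_le_trans ltr01 M1.
have p0 : 0 <= (1 + gamma) / d%:R by rewrite divr_ge0 ?(ltW dR) //; have := gamma0; lra.
(* This uses [gamma > 0]: once [ln^gamma k >= 8 M^2 T], a block of volume [ln^(1+gamma) k] has
   failure probability at most [k^(-T)]. *)
have [ks hks] := @eventually_log R _ gamma 4 (8 * M ^+ 2 * T) p0 gamma0.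
pose j0 k := up_log 2 (Num.truncn (logscale k)).+1.
pose J k := (j0 k + A * up_log 2 k)%N.
have hj0 k : (ks <= k)%N -> logscale k <= (2 ^ j0 k)%:R <= 4 * logscale k.
  move=> /hks[k2 L4 xk _].
  have x1 : 1 <= logscale k.
    by rewrite -(powRr0 (ln k%:R)) /logscale ler_powR //; lra.
  have t1 : (1 <= Num.truncn (logscale k))%N by rewrite truncn_ge_nat // (le_trans ler01 x1).
  apply/andP; split.
    apply: le_trans (ltW (truncnS_gt _)) _; rewrite ler_nat; exact: up_logP.
  have /andP[] := @up_log_bounds 2 (Num.truncn (logscale k)).+1 isT ltac:(lia).
  rewrite -/(j0 k) => h1 _.
  have h2 : (2 ^ j0 k <= 2 * (Num.truncn (logscale k)).+1)%N.
    by case: (j0 k) h1 => [|j] h1; [rewrite expn0; lia|rewrite expnS; move: h1 => /=; lia].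
  have h3 : (2 ^ j0 k)%:R <= 2 * ((Num.truncn (logscale k))%:R + 1) :> R.
    by rewrite natr1 -natrM ler_nat.
  have h4 : (Num.truncn (logscale k))%:R <= logscale k by rewrite truncn_le // (le_trans ler01 x1).
  move: h3 h4 x1; move: (2 ^ j0 k)%:R => c; move: (Num.truncn (logscale k))%:R => b; move: (logscale k) => a.
  by move=> h3 h4 x1; exact: le_four_mul h3 h4 x1.
have hN k : (ks <= k)%N -> (2 ^ J k <= k ^ B)%N.
  move=> kk; have [k2 L4 xk _] := hks k kk; have /andP[_ hj] := hj0 k kk.
  have hj' : (2 ^ j0 k <= 4 * k)%N.
    by rewrite -(ler_nat R); apply: le_trans hj _; rewrite natrM ler_wpM2l.
  have /andP[h1 _] := @up_log_bounds 2 k isT k2.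
  have h2 : (2 ^ up_log 2 k <= 2 * k)%N.
    by case: (up_log 2 k) h1 => [|j] h1; [rewrite expn0; lia|rewrite expnS; move: h1 => /=; lia].
  rewrite /J expnD [(A * _)%N]mulnC expnM BE addnC expnD; apply: leq_mul.
    by apply: leq_trans hj' _; rewrite !expnS expn0 muln1; nia.
  rewrite expnM; apply: leq_expW; apply: leq_trans h2 _.
  by rewrite expnS expn1 leq_mul2r k2 orbT.
pose I1 k := ('I_k.+1 * box d (k * k) * 'I_(J k).+1 * box d (2 ^ J k))%type.
pose I2 k := ('I_(J k).+1 * box d (2 ^ J k) * box d (2 ^ J k))%type.
have cI1 k : (ks <= k)%N -> (#|{: I1 k}| <= k ^ n1)%N.
  move=> kk; have [k2 _ _ _] := hks k kk; have hNk := hN k kk.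
  rewrite !card_prod !card_ord !card_box /n1 (expnD k (2 + 3 * d + B)) (expnD k (2 + 3 * d)) (expnD k 2).
  apply: leq_mul; [apply: leq_mul; [apply: leq_mul|]|].
  - by rewrite -mulnn; nia.
  - rewrite (expnM k 3); apply: leq_expW; rewrite -mul2n expnS; exact: leq_mul.
  - by apply: leq_trans hNk; apply: ltn_expl.
  - rewrite (expnM k B.+1); apply: leq_expW; rewrite (expnS k B) -mul2n; exact: leq_mul.
have cI2 k : (ks <= k)%N -> (#|{: I2 k}| <= k ^ n2)%N.
  move=> kk; have [k2 _ _ _] := hks k kk; have hNk := hN k kk.
  rewrite !card_prod !card_ord !card_box /n2 (expnD k (B + B.+1 * d)) (expnD k B).
  have hb : ((2 ^ J k).*2 ^ d <= k ^ (B.+1 * d))%N.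
    rewrite (expnM k B.+1); apply: leq_expW; rewrite (expnS k B) -mul2n; exact: leq_mul.
  apply: leq_mul => //; apply: leq_mul => //.
  by apply: leq_trans hNk; apply: ltn_expl.
pose E1 k (i : I1 k) := bad_cut w M (@boxpt d (2 ^ J k))
   (fun y => cube i.1.2 y == cube i.1.2 i.2) (atest i.1.1.1 k (boxpt i.1.1.2)) (T * ln k%:R).
pose E2 k (i : I2 k) := bad_two w (@boxpt d (2 ^ J k))
   (fun y => cube i.1.1 y == cube i.1.1 i.1.2) ((2 ^ i.1.1) ^ d)%:R i.1.2 i.2.
pose Q2 k (i : I2 k) := [&& (j0 k <= i.1.1)%N, i.1.2 != i.2 & cube i.1.1 i.1.2 == cube i.1.1 i.2].
pose Bad k := if (ks <= k)%N then
  (\bigcup_(i in [set i : I1 k | xpredT i]) E1 k i) `|` (\bigcup_(i in [set i : I2 k | Q2 k i]) E2 k i) else set0.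
have pk k : (ks <= k)%N -> expR (- (T * ln k%:R)) = (k%:R ^+ Tn)^-1 :> R.
  move=> /hks[k2 _ _ _]; rewrite TE expRN -(powR_mulrn _ (ler0n R k)) /powR pnatr_eq0.
  by have -> : (k == 0)%N = false by lia.
have B1 k : (ks <= k)%N -> measurable (\bigcup_(i in [set i : I1 k | xpredT i]) E1 k i) /\
    (P (\bigcup_(i in [set i : I1 k | xpredT i]) E1 k i) <= (#|{: I1 k}|%:R * (2 * (k%:R ^+ Tn)^-1))%:E)%E.
  move=> kk; have [k2 L4 _ _] := hks k kk.
  apply: measure_finite_union => [|i _|i _].
  - by rewrite mulr_ge0 // invr_ge0 exprn_ge0.
  - by apply: (measurable_bad_cut hw); exact: boxpt_inj.
  - rewrite -pk //; apply: (bad_cut_le hw M1); first exact: boxpt_inj.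
    by rewrite mulr_gt0 //; lra.
have B2 k : (ks <= k)%N -> measurable (\bigcup_(i in [set i : I2 k | Q2 k i]) E2 k i) /\
    (P (\bigcup_(i in [set i : I2 k | Q2 k i]) E2 k i) <= (#|{: I2 k}|%:R * (k%:R ^+ Tn)^-1)%:E)%E.
  move=> kk; have [k2 L4 _ hT] := hks k kk.
  apply: measure_finite_union => [|i _|i].
  - by rewrite invr_ge0 exprn_ge0.
  - by apply: (measurable_bad_two hw); exact: boxpt_inj.
  - case: i => [[j F] F']; rewrite /Q2 /E2 /= => /and3P[jj FF' /eqP cF].
    have jJ : (j <= J k)%N by rewrite -ltnS.
    have := card_cube F jJ => cc.
    have nn : ln k%:R `^ (1 + gamma) <= ((2 ^ j) ^ d)%:R :> R.
      have /andP[h _] := hj0 k kk.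
      have h2 : logscale k <= (2 ^ j)%:R.
        by apply: le_trans h _; rewrite ler_nat leq_exp2l.
      have -> : ln k%:R `^ (1 + gamma) = logscale k ^+ d :> R.
        by rewrite -powR_mulrn ?powR_ge0 // -powRrM divfK ?gt_eqF.
      by rewrite natrX lerXn2r ?nnegrE ?powR_ge0.
    have nn2 : 8 * M ^+ 2 * (T * ln k%:R) <= ((2 ^ j) ^ d)%:R :> R.
      have L0 : 0 < ln (k%:R : R) by lra.
      apply: le_trans nn; rewrite powRD; last by rewrite (gt_eqF L0) implybT.
      rewrite powRr1; last by lra.
      by rewrite mulrA mulrC ler_wpM2l //; lra.
    have n4 : (4 <= (2 ^ j) ^ d)%N.
      have L0 : 0 <= ln (k%:R : R) by lra.
      have L1 : 1 <= ln (k%:R : R) by lra.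
      rewrite -(ler_nat R); apply: le_trans nn; apply: le_trans L4 _.
      by rewrite -{1}(powRr1 L0); apply: ler_powR => //; have := gamma0; lra.
    have cc' : #|(fun y : box d (2 ^ J k) => cube j y == cube j F) : pred _| = ((2 ^ j) ^ d)%N.
      by rewrite -cc; apply: eq_card.
    rewrite -cc' in n4 *.
    apply: le_trans (bad_two_le hw M1 (@boxpt_inj d (2 ^ J k)) FF' _ _ n4) _ => //.
      by rewrite -cF.
    rewrite cc' -pk // lee_fin ler_expR lerN2 ler_pdivlMr; last by rewrite mulr_gt0 // exprn_gt0.
    by rewrite mulrC.
have mBad k : measurable (Bad k).
  rewrite /Bad; case: ifPn => // kk; apply: measurableU; [exact: (B1 k kk).1|exact: (B2 k kk).1].
have PBad k : (P (Bad k) <= (3 * k.+1%:R `^ (- 2))%:E)%E.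
  rewrite /Bad; case: ifPn => [kk|_]; last by rewrite measure0 lee_fin mulr_ge0 ?powR_ge0.
  apply: le_trans (measureU2 _ (B1 k kk).1 (B2 k kk).1) _.
  apply: le_trans (leeD (B1 k kk).2 (B2 k kk).2) _.
  have [k2 _ _ _] := hks k kk.
  have k0 : 0 < k%:R :> R by rewrite ltr0n; lia.
  have c1 : #|{: I1 k}|%:R <= k%:R ^+ n1 :> R by rewrite -natrX ler_nat cI1.
  have c2 : #|{: I2 k}|%:R <= k%:R ^+ n2 :> R by rewrite -natrX ler_nat cI2.
  have k1 : 1 <= k%:R :> R by rewrite ler1n; lia.
  have e1 : 1 <= k%:R ^+ n1 :> R by rewrite exprn_ege1.
  have e2 : 1 <= k%:R ^+ n2 :> R by rewrite exprn_ege1.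
  have e4 : 0 < k%:R ^+ 4 :> R by rewrite exprn_gt0.
  rewrite -EFinD lee_fin.
  have -> : (k.+1)%:R `^ (- 2) = (k.+1%:R ^+ 2)^-1 :> R by rewrite powRN powR_mulrn.
  apply: (@le_trans _ _ (3 * (k%:R ^+ 4)^-1)); last first.
    rewrite ler_wpM2l // lef_pV2 ?posrE ?exprn_gt0 //.
    have kk2 : (k.+1 <= k ^ 2)%N.
      rewrite -mulnn; apply: leq_trans (leq_mul k2 (leqnn k)).
      by rewrite mul2n -addnn -addn1 leq_add2l; exact: ltnW.
    by rewrite -!natrX ler_nat (expnM k 2 2); exact: leq_expW.
  rewrite /Tn (exprD _ (n1 + n2)) (exprD _ n1).
  set x := k%:R ^+ n1 in c1 e1 *; set y := k%:R ^+ n2 in c2 e2 *; set z := k%:R ^+ 4 in e4 *.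
  have xi : 0 < x * y by rewrite mulr_gt0; lra.
  have [t tE] : exists t, t = (x * y * z)^-1 by eexists.
  have t0 : 0 < t by rewrite tE invr_gt0 mulr_gt0.
  have -> : z^-1 = x * y * t by rewrite tE; field; rewrite !gt_eqF //; lra.
  rewrite -tE; move: #|{: I1 k}|%:R #|{: I2 k}|%:R c1 c2 => a b c1 c2.
  rewrite (_ : _ + _ = (2 * a + b) * t); last by ring.
  by rewrite mulrA ler_pM2r //; nra.
have [K0 [K03 K0s]] : exists K0 : R, 3 <= K0 /\ ks%:R <= K0.
  by exists (3 + ks%:R); split; [rewrite lerDl|rewrite lerDr].
have [k0 [mk0 k0ge k0oo k0good]] := @random_threshold R _ _ P Bad K0 3 ltac:(lra) mBad PBad.
exists T, k0; split => //.
  by move=> o; apply: le_trans (k0ge o); rewrite lee_fin.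
move=> o k ok.
have kk : (ks <= k)%N.
  have : (K0%:E < k%:R%:E)%E by apply: le_lt_trans ok.
  by rewrite lte_fin => h; rewrite -(ler_nat R); lra.
have := k0good o k ok; rewrite /Bad kk => /not_orP[nb1 nb2].
have [k2 L4 _ _] := hks k kk.
exists (j0 k), (J k); split.
- exact: leq_addr.
- exact: hj0.
- split => //; rewrite /J expnD.
  apply: (@leq_trans ((2 ^ up_log 2 k) ^ A)); first by apply: leq_expW; exact: up_logP.
  by rewrite -expnM [(up_log 2 k * A)%N]mulnC leq_pmull // expn_gt0.
- move=> m S j F mk [S' _ <-] jJ; rewrite leNgt; apply/negP => h; apply: nb1.
  have mk' : (m < k.+1)%N by [].
  have jJ' : (j < (J k).+1)%N by [].
  by exists (Ordinal mk', S', Ordinal jJ', F).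
- move=> j F F' /andP[jj jJ] FF' cF; rewrite leNgt; apply/negP => h; apply: nb2.
  have jJ' : (j < (J k).+1)%N by [].
  exists (Ordinal jJ', F, F') => //=.
  by apply/and3P; split => //; apply/eqP.
Qed.

End environment.

Lemma fineZ (R : realType) (c : R) (x : \bar R) : 0 < c -> fine (c%:E * x) = c * fine x.
Proof. by move=> c0; case: x => [r||] //=; rewrite ?(gt0_mulye, gt0_mulNye) ?gt0_muley ?gt0_muleNy ?lte_fin //= mulr0. Qed.

(** A positive factor passes through [fine] even at [+oo], so this holds for every [f] and [Lk_jump]
    for every [u]. *)
Lemma rsumZ_gt0 (R : realType) (T : choiceType) (c : R) (f : T -> R) : 0 < c ->
  rsum (fun i => c * f i) = c * rsum f.
Proof.
move=> c0; rewrite /rsum mulrBr -!(fineZ _ c0) -!nnsumZ ?(ltW c0) //; last first.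
- by move=> i; rewrite le_max lexx orbT.
- by move=> i; rewrite le_max lexx orbT.
congr (fine _ - fine _); apply: eq_nnsum => i; rewrite maxr_pMr ?(ltW c0) // mulr0 ?mulrN //.
Qed.

Lemma weighted_CauchySchwarz (R : realType) (I : finType) (p x : I -> R) : (forall i, 0 <= p i) ->
  (\sum_i p i * x i) ^+ 2 <= (\sum_i p i) * (\sum_i p i * x i ^+ 2).
Proof.
move=> p0.
have h i j : p i * p j * (x i * x j) <= p i * p j * ((x i ^+ 2 + x j ^+ 2) / 2).
  by rewrite ler_wpM2l ?mulr_ge0 //; have := sqr_ge0 (x i - x j); rewrite !expr2; lra.
rewrite expr2 !mulr_suml.
apply: (@le_trans _ _ (\sum_i \sum_j p i * p j * ((x i ^+ 2 + x j ^+ 2) / 2))).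
  apply: ler_sum => i _; rewrite mulr_sumr; apply: ler_sum => j _.
  by apply: le_trans (h i j); rewrite le_eqVlt; apply/orP; left; apply/eqP; ring.
set A := \sum_i p i * \sum_j _.
have E : A = \sum_i \sum_j p i * p j * x j ^+ 2.
  by apply: eq_bigr => i _; rewrite mulr_sumr; apply: eq_bigr => j _; rewrite mulrA.
have E' : A = \sum_i \sum_j p i * p j * x i ^+ 2.
  rewrite E exchange_big /=; apply: eq_bigr => i _; apply: eq_bigr => j _; ring.
have -> : \sum_i \sum_j p i * p j * ((x i ^+ 2 + x j ^+ 2) / 2) = 2^-1 * (A + A).
  rewrite {1}E' E -big_split mulr_sumr; apply: eq_bigr => i _.
  rewrite -big_split mulr_sumr; apply: eq_bigr => j _ /=; ring.
lra.
Qed.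

(** * The random generator as a jump operator; block averages of its noise *)

Section lattice_operator.
Variables (R : realType) (d : nat) (alpha M : R) (k : nat).
Local Notation L := 'rV[int]_d.
Hypothesis d0 : (0 < d)%N.
Hypothesis alpha0 : 0 < alpha.
Hypothesis M1 : 1 <= M.
Hypothesis k0 : (0 < k)%N.
Variable W : L -> L -> R.
Hypothesis Wsym : forall x y, W x y = W y x.
Hypothesis W0 : forall x y, x != y -> 0 <= W x y <= M.

Let q := d%:R + alpha.
Let q0 : 0 < q. Proof. by rewrite ltr_wpDl. Qed.
Let k0' : 0 < k%:R :> R. Proof. by rewrite ltr0n. Qed.

Definition kern (z z' : L) : R := lnorm R (z - z') `^ (- q).

Lemma kern_ge0 z z' : 0 <= kern z z'. Proof. exact: powR_ge0. Qed.

Lemma kern_diag z : kern z z = 0.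
Proof. by rewrite /kern subrr lnorm_powR0 // oppr_eq0 gt_eqF. Qed.

Lemma kernC z z' : kern z z' = kern z' z.
Proof. by rewrite /kern -lnormN opprB. Qed.

(** The diagonal weights are unconstrained, but [kern] vanishes there and keeps the conductance
    nonnegative. *)
Definition cond (z z' : L) : R := k%:R `^ alpha * (W z z' * kern z z').

Lemma cond_ge0 z z' : 0 <= cond z z'.
Proof.
rewrite mulr_ge0 ?powR_ge0 //; have [->|h] := eqVneq z z'; first by rewrite kern_diag mulr0.
by rewrite mulr_ge0 ?kern_ge0 //; case/andP: (W0 h).
Qed.

Lemma condC z z' : cond z z' = cond z' z.
Proof. by rewrite /cond Wsym kernC. Qed.

Lemma nnsum_kern z : nnsum (kern z) = nnsum (fun m : L => lnorm R m `^ (- q)).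
Proof.
rewrite /nnsum -(esum_shift (fun z' => (kern z z')%:E) z).
by apply: eq_esum => m _; rewrite /kern opprD addrCA subrr addr0 lnormN.
Qed.

Lemma cond_bounded : exists Dm, forall z, (nnsum (cond z) <= Dm%:E)%E.
Proof.
have fk := fins_lnorm d0 alpha0 (R := R).
exists (k%:R `^ alpha * M * fine (nnsum (fun m : L => lnorm R m `^ (- q)))) => z.
apply: (@le_trans _ _ (nnsum (fun z' => k%:R `^ alpha * M * kern z z'))).
  apply: le_nnsum => z'; rewrite /cond -mulrA ler_wpM2l ?powR_ge0 //.
  have [->|h] := eqVneq z z'; first by rewrite kern_diag !mulr0.
  by rewrite ler_wpM2r ?kern_ge0 //; case/andP: (W0 h).
rewrite nnsumZ ?mulr_ge0 ?powR_ge0 //; [|exact: le_trans ler01 M1|by move=> z'; exact: kern_ge0].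
by rewrite nnsum_kern [leRHS]EFinM nnsumK // => m; exact: powR_ge0.
Qed.

Lemma Lk_jump u z : Lk alpha W k u z = jump cond u z.
Proof.
rewrite /Lk /jump.
pose F z' := (u z' - u z) * W z z' / eucl (latpt R k z - latpt R k z') `^ (d%:R + alpha).
have -> : (fun y => (u y - u z) * cond z y) = (fun y => k%:R ^- d * (if y != z then F y else 0)).
  apply/funext => y; have [->|yz] := eqVneq y z; first by rewrite /cond kern_diag !mulr0.
  rewrite /F /cond /kern eucl_latpt powRM ?lnorm_ge0 ?invr_ge0 ?(ltW k0') //.
  rewrite -(powR_inv1 (ltW k0')) -powRrM mulN1r powRN.
  have l0 : 0 < lnorm R (z - y) by rewrite lnorm_gt0 // subr_eq0 eq_sym.
  have -> : k%:R `^ (- (d%:R + alpha)) = k%:R ^- d * k%:R `^ (- alpha) :> R.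
    by rewrite powRN powRD ?(gt_eqF k0') ?implybT // powR_mulrn ?(ltW k0') // invfM powRN.
  rewrite /= -/q [k%:R `^ (- alpha)]powRN; field.
  by rewrite !gt_eqF ?powR_gt0 ?exprn_gt0.
rewrite rsumZ_gt0; last by rewrite invr_gt0 exprn_gt0.
congr (_ * _); rewrite /lsum /rsum /nnsum; congr (fine _ - fine _).
  rewrite esum_mkcond; apply: eq_esum => y _.
  have -> : (y \in [set z' | z' != z]) = (y != z) by apply/idP/idP; rewrite inE.
  by case: ifP => //; rewrite maxxx.
rewrite esum_mkcond; apply: eq_esum => y _.
have -> : (y \in [set z' | z' != z]) = (y != z) by apply/idP/idP; rewrite inE.
by case: ifP => //; rewrite oppr0 maxxx.
Qed.

(** Deterministic route: differences growing like [|z - z'|^bt] are summable against the kernel as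
    long as [bt < alpha]. *)
Lemma schur_kernel (D : L -> L -> R) (chi F : L -> R) (A0 B1 bt n : R) :
  0 <= A0 -> 0 <= B1 -> 0 <= bt < alpha -> 0 <= n ->
  (forall z z', 0 <= D z z' <= B1 * lnorm R (z - z') `^ bt * (chi z + chi z')) ->
  (forall z, 0 <= chi z <= 1) -> (nnsum chi <= n%:E)%E ->
  (forall z, `|F z| <= fine (nnsum (fun z' => A0 * (D z z' * kern z z')))) ->
  (nnsum (fun z => F z ^+ 2)%R <= (9 * n *
     (A0 * B1 * fine (nnsum (fun m : L => lnorm R m `^ (- (d%:R + (alpha - bt)))))) ^+ 2)%:E)%E.
Proof.
move=> A00 B10 /andP[bt0 bta] n0 hD chi01 hn hF.
have fb : fins (fun m : L => lnorm R m `^ (- (d%:R + (alpha - bt)))).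
  by apply: fins_lnorm => //; rewrite subr_gt0.
set S := fine _.
have c0 z : 0 <= chi z by case/andP: (chi01 z).
pose b (m : L) : R := A0 * B1 * lnorm R m `^ (- (d%:R + (alpha - bt))).
have AB0 : 0 <= A0 * B1 by rewrite mulr_ge0.
have b0 m : 0 <= b m by rewrite mulr_ge0 ?powR_ge0.
have hS : (nnsum b <= (A0 * B1 * S)%:E)%E.
  rewrite nnsumZ // => [|m]; last exact: powR_ge0.
  by rewrite [leRHS]EFinM nnsumK // => m; exact: powR_ge0.
apply: (nnsum_schur2 b0 chi01 hS hn n0) => z.
apply: le_trans (hF z) _.
rewrite {1}/nnsum -(esum_shift (fun z' => (A0 * (D z z' * kern z z'))%:E) z).
apply: le_fine_nnsum => [m|m|].
- by rewrite !mulr_ge0 ?kern_ge0 //; case/andP: (hD z (m + z)).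
- have -> : kern z (m + z) = lnorm R m `^ (- q).
    by rewrite /kern opprD addrCA subrr addr0 lnormN.
  have [->|m0] := eqVneq m 0.
    rewrite lnorm_powR0 ?oppr_eq0 ?(gt_eqF q0) // !mulr0 mulr_ge0 // addr0 subr0 !addr_ge0 //.
  have l0 : 0 < lnorm R m by exact: lnorm_gt0.
  rewrite /b -!mulrA ler_wpM2l //.
  have /andP[_ h] := hD z (m + z).
  rewrite opprD addrCA subrr addr0 lnormN in h.
  apply: le_trans (ler_wpM2r (powR_ge0 _ _) h) _.
  rewrite [- (d%:R + (alpha - bt))](_ : _ = bt + - q); last by rewrite /q; ring.
  rewrite powRD ?(gt_eqF l0) ?implybT //.
  rewrite [leLHS](_ : _ = B1 * (lnorm R m `^ bt * lnorm R m `^ (- q) * (chi z + chi (m + z)))); last by ring.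
  rewrite !ler_wpM2l ?mulr_ge0 ?powR_ge0 // [m + z]addrC lerDl //.
apply: (@fins_le _ _ _ (fun m => 3 * b m)).
  move=> m; rewrite mulrC ler_wpM2r //.
  by have /andP[_ ?] := chi01 z; have /andP[_ ?] := chi01 (z + m); have /andP[_ ?] := chi01 (z - m); lra.
apply: finsZ => //; exact: fins_sub_bound hS.
Qed.

(** In a variance the kernel enters squared, with decay [2 (d + alpha)], so growth up to
    [bt < d/2 + alpha] is allowed. This is the gain of concentration over [schur_kernel]. *)
Lemma kern_sqr_sum (I : finType) (iota : I -> L) (D : L -> L -> R) (C0 bt n : R) (c1 : L -> R) :
  injective iota -> 0 <= C0 -> bt < d%:R / 2 + alpha -> 0 <= n ->
  (forall z, 0 <= c1 z) -> (nnsum c1 <= n%:E)%E ->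
  (forall z z', D z z' ^+ 2 <= C0 * lnorm R (z - z') `^ (2 * bt) * (c1 z + c1 z')) ->
  \sum_y \sum_y' (kern (iota y) (iota y') * D (iota y) (iota y')) ^+ 2 <=
    3 * n * (C0 * fine (nnsum (fun m : L => lnorm R m `^ (- (d%:R + (d%:R + 2 * alpha - 2 * bt)))))).
Proof.
move=> iinj C00 btd n0 c10 hn hD.
have fb : fins (fun m : L => lnorm R m `^ (- (d%:R + (d%:R + 2 * alpha - 2 * bt)))).
  by apply: fins_lnorm => //; lra.
set S := fine _.
pose b (m : L) : R := C0 * lnorm R m `^ (- (d%:R + (d%:R + 2 * alpha - 2 * bt))).
have b0 m : 0 <= b m by rewrite mulr_ge0 ?powR_ge0.
have hS : (nnsum b <= (C0 * S)%:E)%E.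
  rewrite nnsumZ // => [|m]; last exact: powR_ge0.
  by rewrite [leRHS]EFinM nnsumK // => m; exact: powR_ge0.
rewrite -lee_fin; apply: le_trans (esum_schur1 b0 c10 hS hn n0).
pose H z := nnsum (fun m => b m * (c1 z + c1 (z + m) + c1 (z - m))).
have H0 z : (0 <= H z)%E by apply: nnsum_ge0 => m; rewrite mulr_ge0 // !addr_ge0.
apply: (@le_trans _ _ (\sum_y H (iota y))%E); last first.
  exact: esum_ge_fintype.
rewrite -sumEFin; apply: lee_sum => y _.
pose f z' := (kern (iota y) z' * D (iota y) z') ^+ 2.
apply: (@le_trans _ _ (nnsum f)).
  rewrite -sumEFin; apply: (@esum_ge_fintype _ _ _ xpredT iota (fun z' => (f z')%:E)) => // z'.
  by rewrite lee_fin sqr_ge0.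
rewrite /nnsum -(esum_shift (fun z' => (f z')%:E) (iota y)).
apply: le_esum => m _; rewrite lee_fin /f.
have e : iota y - (m + iota y) = - m by rewrite opprD addrCA subrr addr0.
have -> : kern (iota y) (m + iota y) = lnorm R m `^ (- q) by rewrite /kern e lnormN.
have [->|m0] := eqVneq m 0.
  rewrite lnorm_powR0 ?oppr_eq0 ?(gt_eqF q0) // mul0r expr0n /= mulr_ge0 // !addr_ge0 //.
have l0 : 0 < lnorm R m by exact: lnorm_gt0.
have h := hD (iota y) (m + iota y); rewrite e lnormN in h.
rewrite exprMn; apply: le_trans (ler_wpM2l (sqr_ge0 _) h) _.
rewrite /b [- (d%:R + (d%:R + 2 * alpha - 2 * bt))](_ : _ = - q + - q + 2 * bt); last by rewrite /q; ring.
rewrite !powRD ?(gt_eqF l0) ?implybT //.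
rewrite [leLHS](_ : _ = C0 * (lnorm R m `^ (- q) * lnorm R m `^ (- q) * lnorm R m `^ (2 * bt)) * (c1 (iota y) + c1 (m + iota y))); last by ring.
by rewrite ler_wpM2l ?mulr_ge0 ?powR_ge0 // [m + _]addrC lerDl.
Qed.

Section block_averages.
Variables (g : L -> R) (J : nat).
Local Notation T := (box d (2 ^ J)).
Local Notation iota := (@boxpt d (2 ^ J)).
Let nn j := ((2 ^ j) ^ d)%N.

Definition hbox_noise (F : T) : R :=
  k%:R `^ alpha * \sum_F' (W (iota F) (iota F') - 1) * (kern (iota F) (iota F') * (g (iota F') - g (iota F))).

Variables (I : finType) (c : I -> R) (tst : I -> L -> R) (Cc K V : R).
Hypothesis gE : forall z, g z = \sum_S c S * tst S z.
Hypothesis cC : \sum_S `|c S| <= Cc.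

Definition cutsumW (A : pred T) (a : L -> L -> R) : R :=
  \sum_(y | A y) \sum_(y' | ~~ A y') a (iota y) (iota y') * (W (iota y) (iota y') - 1).

Definition cutvarW (A : pred T) (a : L -> L -> R) : R :=
  \sum_(y | A y) \sum_(y' | ~~ A y') a (iota y) (iota y') ^+ 2.

Let a S z z' := kern z z' * (tst S z' - tst S z).

Hypothesis K0 : 0 <= K.
Hypothesis cutK : forall S j (F : T), (j <= J)%N ->
  cutsumW (fun y => cube j y == cube j F) (a S) ^+ 2 <= K * cutvarW (fun y => cube j y == cube j F) (a S).
Hypothesis V0 : 0 <= V.
Hypothesis varV : forall S, \sum_y \sum_y' a S (iota y) (iota y') ^+ 2 <= V.

(** Symmetry of [W] and of the kernel makes the summand antisymmetric in its two ends, so pairs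
    inside the cube cancel. What crosses the boundary is linear in [g], hence a combination of the
    cuts of the test functions. *)
Lemma block_sum_noise j (F : T) : \sum_(y | cube j y == cube j F) hbox_noise y =
  k%:R `^ alpha * \sum_S c S * cutsumW (fun y => cube j y == cube j F) (a S).
Proof.
rewrite /hbox_noise -mulr_sumr; congr (_ * _).
pose Q (y : T) := cube j y == cube j F.
pose e (y y' : T) := (W (iota y) (iota y') - 1) * (kern (iota y) (iota y') * (g (iota y') - g (iota y))).
have anti y y' : e y y' = - e y' y by rewrite /e Wsym kernC; ring.
transitivity (\sum_(y | Q y) (\sum_(y' | Q y') e y y' + \sum_(y' | ~~ Q y') e y y')).
  by apply: eq_bigr => y _; rewrite (bigID Q).
rewrite big_split /=.
have -> : \sum_(y | Q y) \sum_(y' | Q y') e y y' = 0.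
  set X := \sum_(y | Q y) _.
  have : X = - X.
    rewrite {1}/X exchange_big /= /X -sumrN; apply: eq_bigr => y _.
    by rewrite -sumrN; apply: eq_bigr => y' _; rewrite anti.
  by move=> h; lra.
rewrite add0r /cutsumW.
under [RHS]eq_bigr do rewrite mulr_sumr.
rewrite [RHS]exchange_big /=; apply: eq_bigr => y _.
under [RHS]eq_bigr do rewrite mulr_sumr.
rewrite [RHS]exchange_big /=; apply: eq_bigr => y' _.
rewrite /e !gE -sumrB !mulr_sumr; apply: eq_bigr => S _.
by rewrite /a; ring.
Qed.

(** Squaring the average gives two factors [1/nn j], and summing over [F] counts each cube [nn j]
    times. One factor is left: the averages decay like the square root of the volume. *)
Lemma block_average_bound j : (j <= J)%N ->
  \sum_F avg (@cube d J) nn j hbox_noise F ^+ 2 <=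
  (k%:R `^ alpha) ^+ 2 * (nn j)%:R^-1 * (Cc ^+ 2 * (K * V)).
Proof.
move=> jJ.
have nn0 : 0 < (nn j)%:R :> R by rewrite ltr0n expn_gt0 expn_gt0.
have Cc0 : 0 <= Cc by apply: le_trans cC; apply: sumr_ge0.
pose X S (F : T) := cutsumW (fun y => cube j y == cube j F) (a S).
pose Y S (F : T) := cutvarW (fun y => cube j y == cube j F) (a S).
have sumY S : \sum_F Y S F <= (nn j)%:R * V.
  apply: (@le_trans _ _ (\sum_F \sum_(y | cube j y == cube j F) \sum_y' a S (iota y) (iota y') ^+ 2)).
    apply: ler_sum => F _; apply: ler_sum => y _.
    rewrite [leRHS](bigID (fun y' => ~~ (cube j y' == cube j F))) /= lerDl.
    by apply: sumr_ge0 => y' _; exact: sqr_ge0.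
  rewrite (exchange_big_dep xpredT) //.
  apply: (@le_trans _ _ (\sum_y (nn j)%:R * \sum_y' a S (iota y) (iota y') ^+ 2)).
    apply: ler_sum => y _; rewrite sumr_const -[leLHS]mulr_natl.
    rewrite ler_wpM2r //; first by apply: sumr_ge0 => y' _; exact: sqr_ge0.
    rewrite /nn ler_nat -(card_cube y jJ); apply: eq_leq; apply: eq_card => F.
    rewrite -[LHS]/(cube j y == cube j F) -[RHS]/(cube j F == cube j y); exact: eq_sym.
  by rewrite -mulr_sumr ler_wpM2l // ltW.
have avgE F : avg (@cube d J) nn j hbox_noise F ^+ 2 =
    (k%:R `^ alpha) ^+ 2 * (nn j)%:R ^- 2 * (\sum_S c S * X S F) ^+ 2.
  by rewrite /avg block_sum_noise !exprMn exprVn mulrA [_ ^- 2 * _]mulrC.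
(* Cauchy-Schwarz with weights [|c S|], so that only the total coefficient counts and not the number
   of test functions. *)
have CS F : (\sum_S c S * X S F) ^+ 2 <= Cc * \sum_S `|c S| * (K * Y S F).
  have h1 : `|\sum_S c S * X S F| <= \sum_S `|c S| * `|X S F|.
    by apply: le_trans (ler_norm_sum _ _ _) _; under eq_bigr do rewrite normrM.
  have h2 : (\sum_S `|c S| * `|X S F|) ^+ 2 <= (\sum_S `|c S|) * (\sum_S `|c S| * `|X S F| ^+ 2).
    exact: weighted_CauchySchwarz.
  rewrite -real_normK ?num_real //.
  apply: (@le_trans _ _ ((\sum_S `|c S| * `|X S F|) ^+ 2)).
    by rewrite ler_sqr ?nnegrE // sumr_ge0 // => S _; rewrite mulr_ge0.
  apply: le_trans h2 _; apply: ler_pM => //.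
  - by apply: sumr_ge0.
  - by apply: sumr_ge0 => S _; rewrite mulr_ge0 ?sqr_ge0.
  - apply: ler_sum => S _; rewrite ler_wpM2l // real_normK ?num_real //.
    exact: cutK.
under eq_bigr do rewrite avgE.
rewrite -mulr_sumr.
apply: (@le_trans _ _ ((k%:R `^ alpha) ^+ 2 * (nn j)%:R ^- 2 * (Cc * \sum_S `|c S| * (K * ((nn j)%:R * V))))).
  apply: ler_wpM2l; first by rewrite mulr_ge0 ?sqr_ge0 // invr_ge0 sqr_ge0.
  apply: (@le_trans _ _ (\sum_F Cc * \sum_S `|c S| * (K * Y S F))); first exact: ler_sum.
  rewrite -mulr_sumr ler_wpM2l // exchange_big /=; apply: ler_sum => S _.
  by rewrite -mulr_sumr ler_wpM2l // -mulr_sumr ler_wpM2l.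
rewrite -mulr_suml.
have -> : (k%:R `^ alpha) ^+ 2 * (nn j)%:R ^- 2 * (Cc * ((\sum_S `|c S|) * (K * ((nn j)%:R * V)))) =
   (k%:R `^ alpha) ^+ 2 * (nn j)%:R^-1 * (Cc * (\sum_S `|c S|) * (K * V)).
  by field; rewrite gt_eqF.
apply: ler_wpM2l; first by rewrite mulr_ge0 ?sqr_ge0 // invr_ge0 ltW.
by rewrite expr2 ler_wpM2r ?mulr_ge0 // ler_wpM2l.
Qed.

End block_averages.

End lattice_operator.

(** * Pairing the noise with the error *)

Section multiscale_pairing.
Variables (R : realType) (d : nat) (alpha M gamma beta : R) (k : nat).
Local Notation L := 'rV[int]_d.
Hypothesis d0 : (0 < d)%N.
Hypothesis alpha0 : 0 < alpha.
Hypothesis alphad : alpha < d%:R.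
Hypothesis gamma0 : 0 < gamma.
Hypothesis M1 : 1 <= M.
Hypothesis k0 : (0 < k)%N.
Variable W : L -> L -> R.
Hypothesis W0 : forall x y, x != y -> 0 <= W x y <= M.
Variables (j0 J A : nat).
Local Notation T := (box d (2 ^ J)).
Local Notation iota := (@boxpt d (2 ^ J)).
Local Notation nn := (fun j => ((2 ^ j) ^ d)%N).
(** Here [Lk] is a logarithm, not the operator. The finest block side is [x] up to a factor 4, [Lam]
    is [x^(alpha/2)], and [Z] is the noise size [k^(d/2 + alpha - beta)] times the factor
    [k^(-alpha/2)] of the Poincare inequality. *)
Let Lk := ln (k%:R : R).
Let x := Lk `^ ((1 + gamma) / d%:R).
Let Lam := Lk `^ ((1 + gamma) * alpha / (2 * d%:R)).
Let Z := k%:R `^ (d%:R / 2 + alpha / 2 - beta).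
Hypothesis L4 : 4 <= Lk.
Hypothesis j0J : (j0 <= J)%N.
Hypothesis hx : x <= (2 ^ j0)%:R <= 4 * x.
Hypothesis A1 : (0 < A)%N.
Hypothesis hA : (k ^ A <= 2 ^ J)%N.
Hypothesis good : forall (j : nat) (F F' : T), (j0 <= j <= J)%N -> F != F' -> cube j F = cube j F' ->
  ((2 ^ j) ^ d)%:R / 8 <= \sum_(z | [&& cube j z == cube j F, z != F & z != F'])
     W (iota F) (iota z) * W (iota F') (iota z).
Variables (h v : T -> R) (E0 Hc sL : R).
Hypothesis E00 : 0 <= E0.
Hypothesis Hc0 : 0 <= Hc.
Hypothesis sL1 : 1 <= sL.
Hypothesis hH0 : \sum_F h F ^+ 2 <= (Hc * k%:R `^ (d%:R / 2 + alpha - beta) * sL) ^+ 2.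
Hypothesis hav : forall j, (j <= J)%N -> \sum_F avg (@cube d J) nn j h F ^+ 2 <=
   (nn j)%:R^-1 * (E0 * k%:R `^ (d%:R / 2 + alpha - beta) * Lk `^ 2^-1) ^+ 2.
Let E := \sum_F \sum_F' cond alpha k W (iota F) (iota F') * (v F - v F') ^+ 2.

(** One summand each for the finest scale, the geometric series of ratio [r < 1] over the
    intermediate scales, and the coarsest average. *)
Definition pairing_constant : R :=
  let P0 := Num.sqrt (32 * M * (Num.sqrt d%:R) `^ (d%:R + alpha)) in
  let r := 2 `^ (- ((d%:R - alpha) / 2)) in
  Hc * P0 * 4 `^ (alpha / 2) + E0 * P0 * 2 `^ (alpha / 2) * (1 - r)^-1 + E0.

Lemma noise_pairing : \sum_F h F * v F <=
  pairing_constant * (sL * (Z * Lam)) * (Num.sqrt E + Num.sqrt (\sum_F v F ^+ 2)).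
Proof.
have dR : 0 < d%:R :> R by rewrite ltr0n.
have k0' : 0 < k%:R :> R by rewrite ltr0n.
have M0 : 0 < M by exact: lt_le_trans ltr01 M1.
have L0 : 0 < Lk by exact: lt_le_trans L4.
have Ll : 1 <= Lk by apply: le_trans L4; rewrite ler1n.
have x0 : 0 < x by exact: powR_gt0.
have two0 j : 0 < (2 ^ j)%:R :> R by rewrite ltr0n expn_gt0.
pose dl := (d%:R - alpha) / 2.
have dl0 : 0 < dl by rewrite divr_gt0 // subr_gt0.
have [P0 P0E] : exists P0, P0 = Num.sqrt (32 * M * (Num.sqrt d%:R) `^ (d%:R + alpha)) by eexists.
have P00 : 0 <= P0 by rewrite P0E sqrtr_ge0.
have [r rE] : exists r : R, r = 2 `^ (- dl) by eexists.
have r0 : 0 < r by rewrite rE powR_gt0.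
have r1 : r < 1.
  have := @gt0_ltr_powR R dl dl0 1 2; rewrite powR1 => /(_ _ _ _)/Wrap[]; rewrite ?nnegrE ?ltr1n //.
  by rewrite rE powRN invf_lt1 ?powR_gt0.
have Lam0 : 0 < Lam by exact: powR_gt0.
have Z0 : 0 < Z by exact: powR_gt0.
have E_ge0 : 0 <= E.
  apply: sumr_ge0 => F _; apply: sumr_ge0 => F' _; rewrite mulr_ge0 ?sqr_ge0 //.
  exact: (cond_ge0 k alpha0 W0).
(* In a cube of side [2^j] distances are at most [sqrt d * 2^j], so a weight is at most
   [k^(-alpha) (sqrt d * 2^j)^(d + alpha)] times the conductance. The factor [32 M / 2^(j d)] of
   [poincare_two_steps] turns this into [(p j)^2]. *)
pose p j := P0 * k%:R `^ (- (alpha / 2)) * (2 ^ j)%:R `^ (alpha / 2).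
pose eta j := E0 * k%:R `^ (d%:R / 2 + alpha - beta) * Lk `^ 2^-1 * (2 ^ j)%:R `^ (- (d%:R / 2)).
have p_ge0 j : 0 <= p j by rewrite !mulr_ge0 ?powR_ge0.
have eta_ge0 j : 0 <= eta j by rewrite !mulr_ge0 ?powR_ge0.
have hp j : (j0 <= j <= J)%N -> \sum_F (v F - avg (@cube d J) nn j v F) ^+ 2 <= p j ^+ 2 * E.
  move=> /[dup] jj /andP[jj0 jJ].
  have WT (F F' : T) : F != F' -> 0 <= W (iota F) (iota F') <= M.
    by move=> FF'; apply: W0; rewrite (inj_eq (@boxpt_inj d _)).
  have := @poincare_two_steps R T _ (@cube d J) nn J (fun j F jJ => card_cube F jJ) j v
     (fun F F' => W (iota F) (iota F')) M jJ M0 WT (fun F F' FF' cF => good jj FF' cF).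
  move=> H; apply: le_trans H _.
  pose Q := (Num.sqrt d%:R * (2 ^ j)%:R) `^ (d%:R + alpha).
  have Q0 : 0 < Q by apply: powR_gt0; rewrite mulr_gt0 // sqrtr_gt0.
  have ka0 : 0 < k%:R `^ alpha by exact: powR_gt0.
  have term : \sum_F \sum_(z | (cube j z == cube j F) && (z != F)) W (iota F) (iota z) * (v F - v z) ^+ 2
      <= (k%:R `^ alpha)^-1 * Q * E.
    rewrite mulr_sumr; apply: ler_sum => F _; rewrite mulr_sumr.
    rewrite [leRHS](bigID (fun z => (cube j z == cube j F) && (z != F))) /= -[leLHS]addr0.
    apply: lerD; last first.
      apply: sumr_ge0 => z _; apply: mulr_ge0; first by rewrite mulr_ge0 ?(ltW Q0) // invr_ge0 ltW.
      by rewrite mulr_ge0 ?sqr_ge0 //; exact: (cond_ge0 k alpha0 W0).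
    apply: ler_sum => z /andP[/eqP cz zF]; rewrite [leRHS]mulrA; apply: ler_wpM2r; first exact: sqr_ge0.
    rewrite /cond /kern [leRHS](_ : _ = W (iota F) (iota z) * (Q * lnorm R (iota F - iota z) `^ (- (d%:R + alpha)))); last first.
      by field; rewrite gt_eqF.
    have Fz : F != z by rewrite eq_sym.
    have l0 : 0 < lnorm R (iota F - iota z).
      by rewrite lnorm_gt0 // subr_eq0 (inj_eq (@boxpt_inj d _)).
    rewrite -[leLHS]mulr1 ler_wpM2l //; first by case/andP: (WT F z Fz).
    rewrite powRN ler_pdivlMr ?powR_gt0 // mul1r.
    apply: ge0_ler_powR; rewrite ?nnegrE ?lnorm_ge0 ?mulr_ge0 ?sqrtr_ge0 ?addr_ge0 ?(ltW alpha0) //.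
    exact/cube_lnorm/esym.
  apply: le_trans (ler_wpM2l _ term) _; first by rewrite divr_ge0 ?mulr_ge0 ?(ltW M0).
  rewrite le_eqVlt; apply/orP; left; apply/eqP.
  rewrite !exprMn P0E sqr_sqrtr ?mulr_ge0 ?powR_ge0 ?(ltW M0) //.
  have s1 : (k%:R `^ (- (alpha / 2))) ^+ 2 = (k%:R `^ alpha)^-1.
    by rewrite -powR_mulrn ?powR_ge0 // -powRrM -powRN; congr (_ `^ _); field.
  have s2 : ((2 ^ j)%:R `^ (alpha / 2)) ^+ 2 = (2 ^ j)%:R `^ alpha.
    by rewrite -powR_mulrn ?powR_ge0 // -powRrM; congr (_ `^ _); field.
  have s3 : Q = (Num.sqrt d%:R) `^ (d%:R + alpha) * ((2 ^ j)%:R ^+ d * (2 ^ j)%:R `^ alpha).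
    have gen (t : R) : 0 < t -> t `^ (d%:R + alpha) = t ^+ d * t `^ alpha.
      by move=> t0; rewrite powRD ?(gt_eqF t0) ?implybT // powR_mulrn ?(ltW t0).
    by rewrite /Q powRM ?sqrtr_ge0 ?(ltW (two0 j)) // (gen _ (two0 j)).
  rewrite s1 s2 s3 natrX; have t0 := two0 j; move: (2 ^ j)%:R t0 => t t0.
  by field; rewrite !gt_eqF ?exprn_gt0.
have heta j : (j0 <= j <= J)%N -> \sum_F avg (@cube d J) nn j h F ^+ 2 <= eta j ^+ 2.
  move=> /andP[_ jJ]; apply: le_trans (hav jJ) _.
  rewrite [eta j ^+ 2]exprMn mulrC; apply: ler_wpM2l; first exact: sqr_ge0.
  rewrite le_eqVlt; apply/orP; left; apply/eqP.
  rewrite -powR_mulrn ?powR_ge0 // -powRrM natrX -(powR_mulrn d (ltW (two0 j))) -powRN.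
  by congr (_ `^ _); field.
have HH0 : 0 <= Hc * k%:R `^ (d%:R / 2 + alpha - beta) * sL.
  by rewrite !mulr_ge0 ?powR_ge0 //; apply: le_trans sL1.
have := @multiscale_bound R T _ (@cube d J) nn J (fun j F jJ => card_cube F jJ)
  (fun j F F' => @cube_nest d J j F F') j0 h v _ E p eta j0J HH0 p_ge0 eta_ge0 E_ge0 hH0 hp heta.
move=> H; apply: le_trans H _.
have [x1 x2] : x <= (2 ^ j0)%:R /\ (2 ^ j0)%:R <= 4 * x by case/andP: hx.
have xa : x `^ (alpha / 2) = Lam.
  by rewrite /x /Lam -powRrM; congr (_ `^ _); field; rewrite gt_eqF.
(* The square root of the logarithm due to the union bound is absorbed by the block volume, with a
   factor [ln^(gamma/2) k] to spare. *)
have xd : Lk `^ 2^-1 * x `^ (- dl) <= Lam.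
  rewrite /x /Lam -powRrM -powRD ?(gt_eqF L0) ?implybT //.
  apply: ler_powR => //.
  rewrite [leRHS](_ : _ = 2^-1 + (1 + gamma) / d%:R * - dl + gamma / 2); last first.
    by rewrite /dl; field; rewrite gt_eqF.
  by rewrite lerDl divr_ge0 ?(ltW gamma0).
have kk : k%:R `^ (d%:R / 2 + alpha - beta) * k%:R `^ (- (alpha / 2)) = Z.
  by rewrite -powRD ?(gt_eqF k0') ?implybT //; congr (_ `^ _); field.
have b1 : Hc * k%:R `^ (d%:R / 2 + alpha - beta) * sL * p j0 <= Hc * P0 * 4 `^ (alpha / 2) * (sL * (Z * Lam)).
  rewrite /p -kk -xa.
  have : (2 ^ j0)%:R `^ (alpha / 2) <= 4 `^ (alpha / 2) * x `^ (alpha / 2).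
    rewrite -powRM ?(ltW x0) //; apply: ge0_ler_powR; rewrite ?nnegrE ?mulr_ge0 ?(ltW x0) ?divr_ge0 ?(ltW alpha0) //.
  move=> h1.
  rewrite [leLHS](_ : _ = (Hc * k%:R `^ (d%:R / 2 + alpha - beta) * sL * (P0 * k%:R `^ (- (alpha / 2)))) * (2 ^ j0)%:R `^ (alpha / 2)); last by ring.
  rewrite [leRHS](_ : _ = (Hc * k%:R `^ (d%:R / 2 + alpha - beta) * sL * (P0 * k%:R `^ (- (alpha / 2)))) * (4 `^ (alpha / 2) * x `^ (alpha / 2))); last by ring.
  by apply: ler_wpM2l => //; rewrite mulr_ge0 // mulr_ge0 ?powR_ge0.
have rj j : r ^+ j = (2 ^ j)%:R `^ (- dl).
  by rewrite rE natrX -(powR_mulrn j (_ : 0 <= 2)) // -(powR_mulrn j (powR_ge0 _ _)) powRAC.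
have rx : r ^+ j0 <= x `^ (- dl) by rewrite rj; apply: powRN_mono => //; exact: ltW.
have term2 j : eta j * p j.+1 = E0 * P0 * 2 `^ (alpha / 2) * (Z * Lk `^ 2^-1) * r ^+ j.
  rewrite /eta /p rj -kk expnS natrM powRM //.
  have -> : (2 ^ j)%:R `^ (- dl) = (2 ^ j)%:R `^ (- (d%:R / 2)) * (2 ^ j)%:R `^ (alpha / 2).
    by rewrite -powRD ?(gt_eqF (two0 j)) ?implybT //; congr (_ `^ _); rewrite /dl; field.
  by ring.
have sumr : \sum_(j0 <= j < J) r ^+ j <= x `^ (- dl) * (1 - r)^-1.
  rewrite -{1}[j0]add0n big_addn big_mkord.
  under eq_bigr do rewrite addnC exprD.
  rewrite -mulr_sumr; apply: ler_pM => //; first exact: exprn_ge0 (ltW r0).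
    by apply: sumr_ge0 => i _; exact: exprn_ge0 (ltW r0).
  by apply: sum_geometric_le; rewrite (ltW r0).
have b2 : \sum_(j0 <= j < J) eta j * p j.+1 <= E0 * P0 * 2 `^ (alpha / 2) * (1 - r)^-1 * (sL * (Z * Lam)).
  under eq_bigr do rewrite term2.
  rewrite -mulr_sumr.
  have c0 : 0 <= E0 * P0 * 2 `^ (alpha / 2) * Z by rewrite !mulr_ge0 ?powR_ge0 ?(ltW Z0).
  have ri : 0 < (1 - r)^-1 by rewrite invr_gt0 subr_gt0.
  apply: (@le_trans _ _ (E0 * P0 * 2 `^ (alpha / 2) * (Z * Lk `^ 2^-1) * (x `^ (- dl) * (1 - r)^-1))).
    by apply: ler_wpM2l => //; rewrite !mulr_ge0 ?powR_ge0 ?(ltW Z0).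
  rewrite [leLHS](_ : _ = (E0 * P0 * 2 `^ (alpha / 2) * Z * (1 - r)^-1) * (Lk `^ 2^-1 * x `^ (- dl))); last by ring.
  rewrite [leRHS](_ : _ = (E0 * P0 * 2 `^ (alpha / 2) * Z * (1 - r)^-1) * (sL * Lam)); last by ring.
  apply: ler_wpM2l; first by rewrite mulr_ge0 // ltW.
  by apply: le_trans xd _; rewrite ler_peMl // ltW.
(* No Poincare inequality is applied at the top scale; [2^J >= k] supplies the missing factor
   [k^(-alpha/2)]. *)
have b3 : eta J <= E0 * (sL * (Z * Lam)).
  rewrite /eta -[E0 * _ * _ * _]mulrA -mulrA; apply: ler_wpM2l => //.
  have -> : (2 ^ J)%:R `^ (- (d%:R / 2)) = (2 ^ J)%:R `^ (- (alpha / 2)) * (2 ^ J)%:R `^ (- dl).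
    by rewrite -powRD ?(gt_eqF (two0 J)) ?implybT //; congr (_ `^ _); rewrite /dl; field.
  have h1 : (2 ^ J)%:R `^ (- (alpha / 2)) <= k%:R `^ (- (alpha / 2)).
    apply: powRN_mono => //; first by rewrite divr_ge0 // ltW.
    rewrite ler_nat; apply: leq_trans hA.
    by rewrite -{1}(expn1 k) leq_pexp2l.
  have h2 : (2 ^ J)%:R `^ (- dl) <= x `^ (- dl).
    apply: powRN_mono => //; first exact: ltW.
    by apply: le_trans x1 _; rewrite ler_nat leq_exp2l.
  rewrite -kk.
  apply: (@le_trans _ _ (k%:R `^ (d%:R / 2 + alpha - beta) * (Lk `^ 2^-1 * (k%:R `^ (- (alpha / 2)) * x `^ (- dl))))).
    apply: ler_wpM2l; first exact: powR_ge0.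
    apply: ler_wpM2l; first exact: powR_ge0.
    by apply: ler_pM; rewrite ?powR_ge0.
  rewrite [leLHS](_ : _ = (k%:R `^ (d%:R / 2 + alpha - beta) * k%:R `^ (- (alpha / 2))) * (Lk `^ 2^-1 * x `^ (- dl))); last by ring.
  rewrite [leRHS](_ : _ = (k%:R `^ (d%:R / 2 + alpha - beta) * k%:R `^ (- (alpha / 2))) * (sL * Lam)); last by ring.
  apply: ler_wpM2l; first by rewrite mulr_ge0 ?powR_ge0.
  by apply: le_trans xd _; rewrite ler_peMl // ltW.
rewrite /pairing_constant -P0E -/dl -rE.
have ri : 0 < (1 - r)^-1 by rewrite invr_gt0 subr_gt0.
set Y := sL * (Z * Lam) in b1 b2 b3 *.
have Y0 : 0 <= Y by rewrite mulr_ge0 ?mulr_ge0 ?(ltW Z0) ?(ltW Lam0) //; apply: le_trans sL1.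
set a1 := Hc * P0 * _ in b1 *; set a2 := E0 * P0 * _ * _ in b2 *.
have a10 : 0 <= a1 by rewrite !mulr_ge0 ?powR_ge0.
have a20 : 0 <= a2 by rewrite !mulr_ge0 ?powR_ge0 // ltW.
rewrite mulrDr; apply: lerD; apply: ler_wpM2r; rewrite ?sqrtr_ge0 //.
  apply: le_trans (lerD b1 b2) _; rewrite -mulrDl; apply: ler_wpM2r => //.
  by rewrite lerDl.
apply: le_trans b3 _; apply: ler_wpM2r => //; rewrite lerDr addr_ge0 //.
Qed.

End multiscale_pairing.

Lemma box_mono (d N N' : nat) (z : 'rV[int]_d) : (N <= N')%N ->
  range (@boxpt d N) z -> range (@boxpt d N') z.
Proof. by move=> NN' [F _ <-]; apply: boxptP => i; have := boxpt_bound F i; lia. Qed.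

(** * Splitting the source: noise inside and outside a large box *)

Section defect.
Variables (R : realType) (d : nat) (alpha M : R) (k : nat).
Local Notation L := 'rV[int]_d.
Hypothesis d0 : (0 < d)%N.
Hypothesis alpha02 : 0 < alpha < 2.
Hypothesis M1 : 1 <= M.
Hypothesis k0 : (0 < k)%N.
Variable W : L -> L -> R.
Hypothesis W0 : forall x y, x != y -> 0 <= W x y <= M.
Variables (G : L -> R) (B Cl : R) (mk : nat).
Hypothesis B0 : 0 <= B.
Hypothesis Cl0 : 0 <= Cl.
Hypothesis GB : forall z, `|G z| <= B.
Hypothesis GL : forall z z', `|G z' - G z| <= Cl / k%:R * lnorm R (z - z').
Hypothesis Gsupp : forall z, ~ range (@boxpt d mk) z -> G z = 0.

Let alpha0 : 0 < alpha. Proof. by case/andP: alpha02. Qed.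
Let k0' : 0 < k%:R :> R. Proof. by rewrite ltr0n. Qed.
Let M0 : 0 <= M. Proof. exact: le_trans ler01 M1. Qed.
Let chi : L -> R := inbox mk.
Let n : R := (mk.*2 ^ d)%:R.
Local Notation Dg z z' := `|G z' - G z|.

Definition lnsum (bt : R) : R := fine (nnsum (fun m : L => lnorm R m `^ (- (d%:R + (alpha - bt))))).

(** The coefficient [c] will be the weight, its mean 1, the noise [W - 1] or a restriction of it to
    a box, so that one Schur bound serves all cases. *)
Definition kterm (c : L -> L -> R) (z z' : L) : R :=
  k%:R `^ alpha * (c z z' * (kern alpha z z' * (G z' - G z))).

Lemma fins_kern (z : L) : fins (kern (R := R) alpha z).
Proof. by rewrite /fins nnsum_kern; exact: fins_lnorm. Qed.

Lemma kterm_bound (c D : L -> L -> R) (C' : R) z :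
  (forall z', 0 <= D z z' <= C') -> (forall z', z != z' -> `|c z z'| * Dg z z' <= M * D z z') ->
  summableR (kterm c z) /\
  `|rsum (kterm c z)| <= fine (nnsum (fun z' => k%:R `^ alpha * M * (D z z' * kern alpha z z'))).
Proof.
move=> hD hc.
have C0 : 0 <= C' by case/andP: (hD z) => h1 h2; exact: le_trans h2.
have AM : 0 <= k%:R `^ alpha * M by rewrite mulr_ge0 ?powR_ge0.
have f : fins (fun z' => k%:R `^ alpha * M * (D z z' * kern alpha z z')).
  apply: (@fins_le _ _ _ (fun z' => k%:R `^ alpha * M * C' * kern alpha z z')).
    move=> z'; rewrite -[leRHS]mulrA; apply: ler_wpM2l => //; apply: ler_wpM2r; first exact: kern_ge0.
    by case/andP: (hD z').
  apply: finsZ; [by rewrite mulr_ge0|by move=> z'; exact: kern_ge0|exact: fins_kern].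
have h z' : `|kterm c z z'| <= k%:R `^ alpha * M * (D z z' * kern alpha z z').
  rewrite /kterm; have [<-|zz'] := eqVneq z z'.
    by rewrite subrr !mulr0 normr0 kern_diag // !mulr0.
  rewrite !normrM (ger0_norm (powR_ge0 _ _)) (ger0_norm (kern_ge0 _ _ _)) -[leRHS]mulrA.
  apply: ler_wpM2l; first exact: powR_ge0.
  rewrite mulrCA mulrA [leRHS]mulrA [leRHS]mulrC -mulrA; apply: ler_wpM2l; first exact: kern_ge0.
  exact: hc.
split; first exact: summable_le h f.
exact: rsum_norm_bound.
Qed.

Lemma kterm_schur (c D : L -> L -> R) (C' B1 bt : R) : 0 <= B1 -> 0 <= bt < alpha ->
  (forall z z', 0 <= D z z' <= C') ->
  (forall z z', D z z' <= B1 * lnorm R (z - z') `^ bt * (chi z + chi z')) ->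
  (forall z z', z != z' -> `|c z z'| * Dg z z' <= M * D z z') ->
  (nnsum (fun z => rsum (kterm c z) ^+ 2)%R <= (9 * n * (k%:R `^ alpha * M * B1 * lnsum bt) ^+ 2)%:E)%E.
Proof.
move=> B10 btb hD hD2 hc.
apply: (@schur_kernel R d alpha d0 alpha0 D chi (fun z => rsum (kterm c z)) (k%:R `^ alpha * M) B1 bt n) => //.
- by rewrite mulr_ge0 ?powR_ge0.
- by move=> z z'; rewrite hD2 andbT; case/andP: (hD z z').
- by move=> z; exact: inbox01.
- by rewrite nnsum_inbox.
- by move=> z; have [_] := @kterm_bound c D C' z (hD z) (hc z).
Qed.

Lemma chiE z : chi z = 0 -> G z = 0.
Proof. by rewrite /chi /inbox; case: asboolP => [_ /eqP|h _]; [rewrite oner_eq0|exact: Gsupp]. Qed.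

Lemma chi_or z z' : Dg z z' = 0 \/ 1 <= chi z + chi z'.
Proof.
have h y : chi y = 0 \/ chi y = 1 by rewrite /chi /inbox; case: asboolP; [right|left].
case: (h z) => hz; case: (h z') => hz'; rewrite ?hz ?hz'; last 3 first.
- by right; lra.
- by right; lra.
- by right; lra.
by left; rewrite (chiE hz) (chiE hz') subrr normr0.
Qed.

Lemma Dg_le z z' : 0 <= Dg z z' <= 2 * B.
Proof.
rewrite normr_ge0 /=; apply: le_trans (ler_normB _ _) _.
by have := GB z; have := GB z'; lra.
Qed.

Lemma Dg_crude z z' : Dg z z' <= 2 * B * lnorm R (z - z') `^ 0 * (chi z + chi z').
Proof.
rewrite powRr0 mulr1; case: (chi_or z z') => [->|h].
  by rewrite mulr_ge0 ?mulr_ge0 // addr_ge0 //; case/andP: (inbox01 (R := R) mk z); case/andP: (inbox01 (R := R) mk z').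
by have /andP[_ h2] := Dg_le z z'; apply: le_trans h2 _; rewrite ler_peMr // mulr_ge0.
Qed.

Lemma Dg_lip z z' : Dg z z' <= Cl / k%:R * lnorm R (z - z') `^ 1 * (chi z + chi z').
Proof.
have c0 : 0 <= Cl / k%:R * lnorm R (z - z') `^ 1 by rewrite mulr_ge0 ?powR_ge0 // divr_ge0.
case: (chi_or z z') => [->|h].
  by rewrite mulr_ge0 // addr_ge0 //; case/andP: (inbox01 (R := R) mk z); case/andP: (inbox01 (R := R) mk z').
by apply: le_trans (GL z z') _; rewrite -{1}(powRr1 (lnorm_ge0 R (z - z'))) ler_peMr.
Qed.

Let noisec z z' := W z z' - 1.

Lemma noisec_le z z' : z != z' -> `|noisec z z'| <= M.
Proof. by move=> h; have /andP[h1 h2] := W0 h; have M1' := M1; rewrite ler_norml /noisec; apply/andP; split; lra. Qed.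

Lemma noise_jump z : jump (cond alpha k W) G z -
  k%:R `^ alpha * rsum (fun z' => (G z' - G z) * lnorm R (z - z') `^ (- (d%:R + alpha))) =
  rsum (kterm noisec z).
Proof.
have M1' := M1.
have hD z' := Dg_le z z'.
have [s1 _] := @kterm_bound W (fun z z' => Dg z z') (2 * B) z hD ltac:(by move=> z' h;
  apply: ler_wpM2r => //; have /andP[h1 h2] := W0 h; rewrite ger0_norm).
have [s2 _] := @kterm_bound (fun _ _ => 1) (fun z z' => Dg z z') (2 * B) z hD ltac:(by move=> z' h;
  rewrite normr1; apply: ler_wpM2r).
rewrite -rsumZ_gt0 ?powR_gt0 //.
have -> : jump (cond alpha k W) G z = rsum (kterm W z).
  by rewrite /jump; congr rsum; apply/funext => z'; rewrite /cond /kterm; ring.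
have -> : (fun i => k%:R `^ alpha * ((G i - G z) * lnorm R (z - i) `^ (- (d%:R + alpha)))) = kterm (fun _ _ => 1) z.
  by apply/funext => z'; rewrite /kterm /kern; ring.
rewrite -rsumB //; congr rsum; apply/funext => z'; rewrite /kterm /noisec; ring.
Qed.

(** Uses only that [g] is bounded and of compact support. It does not decay in [k], but it gives
    square summability of the source and handles the finitely many small [k]. *)
Lemma noise_crude : (nnsum (fun z => rsum (kterm noisec z) ^+ 2)%R <=
  (9 * n * (k%:R `^ alpha * M * (2 * B) * lnsum 0) ^+ 2)%:E)%E.
Proof.
apply: (@kterm_schur noisec (fun z z' => Dg z z') (2 * B)) => //.
- by rewrite mulr_ge0.
- by rewrite lexx alpha0.
- exact: Dg_le.
- exact: Dg_crude.
- by move=> z z' h; apply: ler_wpM2r => //; exact: noisec_le.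
Qed.

Variable J : nat.
Hypothesis mkJ : (2 * mk <= 2 ^ J)%N.
Local Notation iota := (@boxpt d (2 ^ J)).
Let bx : L -> R := inbox (2 ^ J).

(** Pairs with both ends in the box form finite sums, to which cubes and concentration apply; the
    remaining pairs are handled by the decay of the kernel. *)
Definition inc z z' := noisec z z' * (bx z * bx z').
Definition outc z z' := noisec z z' * (1 - bx z * bx z').

Let bx01 z : bx z = 0 \/ bx z = 1.
Proof. by rewrite /bx /inbox; case: asboolP; [right|left]. Qed.

Lemma inc_iota F : rsum (kterm inc (iota F)) = hbox_noise alpha k W G F.
Proof.
rewrite (@rsum_fin _ _ _ iota); [|exact: boxpt_inj|]; last first.
  by move=> z hz; rewrite /kterm /inc /bx /inbox (asboolF hz) !mulr0 mul0r mulr0.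
rewrite /hbox_noise mulr_sumr; apply: eq_bigr => F' _.
have h (F1 : box d (2 ^ J)) : bx (iota F1) = 1 by rewrite /bx /inbox asboolT //; exists F1.
by rewrite /kterm /inc !h !mulr1.
Qed.

Lemma inc_out z : ~ range iota z -> rsum (kterm inc z) = 0.
Proof.
move=> hz; have -> : kterm inc z = (fun _ => 0).
  by apply/funext => z'; rewrite /kterm /inc /bx /inbox (asboolF hz) mul0r mulr0 mul0r mulr0.
rewrite /rsum (_ : (fun i => Num.max (- 0) 0) = (fun=> Num.max 0 0)) ?subrr //.
by apply/funext => i; rewrite oppr0.
Qed.

Lemma inc_le z z' : z != z' -> `|inc z z'| <= M.
Proof.
move=> h; rewrite /inc normrM; have := noisec_le h.
by case: (bx01 z) => ->; case: (bx01 z') => ->; rewrite ?mulr0 ?mul0r ?mulr1 ?normr0 ?normr1 ?mulr0 ?mulr1.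
Qed.

Lemma outc_le z z' : z != z' -> `|outc z z'| <= M * (1 - bx z * bx z').
Proof.
move=> h; rewrite /outc normrM; have := noisec_le h.
by case: (bx01 z) => ->; case: (bx01 z') => ->; rewrite ?mulr0 ?mul0r ?mulr1 ?subrr ?subr0 ?normr0 ?normr1 ?mulr0 ?mulr1.
Qed.

Lemma noise_split z : rsum (kterm noisec z) = rsum (kterm inc z) + rsum (kterm outc z).
Proof.
have hD z' := Dg_le z z'.
have [s1 _] := @kterm_bound inc (fun z z' => Dg z z') (2 * B) z hD ltac:(by move=> z' h;
  apply: ler_wpM2r => //; exact: inc_le).
have [s2 _] := @kterm_bound outc (fun z z' => Dg z z') (2 * B) z hD ltac:(by move=> z' h;
  apply: ler_wpM2r => //; apply: le_trans (outc_le h) _; rewrite ler_piMr //;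
  case: (bx01 z) => ->; case: (bx01 z') => ->; lra).
rewrite -rsumD //; congr rsum; apply/funext => z'; rewrite /kterm /inc /outc; ring.
Qed.

Lemma far_lnorm z z' : range (@boxpt d mk) z -> ~ range iota z' ->
  (2 ^ J)%:R / 2 <= lnorm R (z - z').
Proof.
move=> [F _ <-] /boxPn[i hi].
have h1 := boxpt_bound F i.
have h2 : (((2 ^ J)%:Z : int) <= 2 * `|(boxpt F - z') 0 i|).
  by rewrite !mxE; rewrite !mxE in h1; move: (z' 0 i) hi h1 => a; move: ((F i : nat)%:Z - mk%:Z) => b; lia.
apply: le_trans (lnorm_ge_coord R _ i).
rewrite ler_pdivrMr // -intr_norm.
have := h2; rewrite -(ler_int R) => h3.
by rewrite mulrC; move: h3; rewrite intrM.
Qed.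

(** A contributing pair has one end in the support of [G] and the other one outside the box, at
    distance at least [2^J / 2]. Half of the decay exponent [alpha] is traded for the factor
    [(2^J / 2)^(-alpha/2)]; the other half keeps the sum finite. *)
Lemma outc_schur : (nnsum (fun z => rsum (kterm outc z) ^+ 2)%R <=
  (9 * n * (k%:R `^ alpha * M * (2 * B * ((2 ^ J)%:R / 2) `^ (- (alpha / 2))) * lnsum (alpha / 2)) ^+ 2)%:E)%E.
Proof.
have N0 : 0 < (2 ^ J)%:R / 2 :> R by rewrite divr_gt0 // ltr0n expn_gt0.
have mkN : (mk <= 2 ^ J)%N by apply: leq_trans mkJ; rewrite leq_pmull.
pose D z z' := Dg z z' * (1 - bx z * bx z').
have bb z z' : 0 <= 1 - bx z * bx z' <= 1.
  by case: (bx01 z) => ->; case: (bx01 z') => ->; apply/andP; split; lra.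
have chi0 z : 0 <= chi z by case/andP: (inbox01 (R := R) mk z).
apply: (@kterm_schur outc D (2 * B)).
- by rewrite mulr_ge0 ?powR_ge0 ?mulr_ge0.
- by apply/andP; split; have := alpha0; lra.
- move=> z z'; have /andP[h1 h2] := Dg_le z z'; have /andP[h3 h4] := bb z z'.
  by rewrite /D mulr_ge0 //= -[leRHS]mulr1 ler_pM.
- move=> z z'; rewrite /D.
  have rhs0 : 0 <= 2 * B * ((2 ^ J)%:R / 2) `^ (- (alpha / 2)) * lnorm R (z - z') `^ (alpha / 2) * (chi z + chi z').
    by rewrite !mulr_ge0 ?powR_ge0 // addr_ge0.
  have [e|c1] := chi_or z z'; first by rewrite e mul0r.
  have main : (2 ^ J)%:R / 2 <= lnorm R (z - z') ->
      Dg z z' <= 2 * B * ((2 ^ J)%:R / 2) `^ (- (alpha / 2)) * lnorm R (z - z') `^ (alpha / 2) * (chi z + chi z').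
    move=> hl; have /andP[_ h2] := Dg_le z z'; apply: le_trans h2 _.
    set X := _ `^ (- (alpha / 2)); set Y := _ `^ (alpha / 2); set c := chi z + chi z'.
    rewrite [leRHS](_ : _ = 2 * B * ((X * Y) * c)); last by ring.
    apply: ler_peMr; first by rewrite mulr_ge0.
    apply: mulr_ege1 => //; rewrite /X powRN mulrC ler_pdivlMr ?powR_gt0 // mul1r.
    apply: ge0_ler_powR; rewrite ?nnegrE ?lnorm_ge0 ?(ltW N0) //; have := alpha0; lra.
  have [bz|bz] := bx01 z.
    rewrite bz mul0r subr0 mulr1.
    have zN : ~ range iota z by move=> h; move: bz; rewrite /bx /inbox asboolT // => /eqP; rewrite oner_eq0.
    have [cz'|cz'] := pselect (range (@boxpt d mk) z').
      by apply: main; rewrite -lnormN opprB; exact: far_lnorm.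
    have [cz|cz] := pselect (range (@boxpt d mk) z); last by rewrite (Gsupp cz) (Gsupp cz') subrr normr0.
    by exfalso; apply: zN; exact: box_mono cz.
  have [bz'|bz'] := bx01 z'; last by rewrite bz bz' mulr1 subrr mulr0.
  rewrite bz' mulr0 subr0 mulr1.
  have zN : ~ range iota z' by move=> h; move: bz'; rewrite /bx /inbox asboolT // => /eqP; rewrite oner_eq0.
  have [cz|cz] := pselect (range (@boxpt d mk) z); first by apply: main; exact: far_lnorm.
  have [cz'|cz'] := pselect (range (@boxpt d mk) z'); last by rewrite (Gsupp cz) (Gsupp cz') subrr normr0.
  by exfalso; apply: zN; exact: box_mono cz'.
- move=> z z' h; rewrite /D [leRHS](_ : _ = M * (1 - bx z * bx z') * Dg z z'); last by ring.
  by apply: ler_wpM2r => //; exact: outc_le.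
Qed.

(** For [alpha > 1] Lipschitz differences are summable against the kernel, so the norm of the noise
    is bounded without probability and without a logarithm. *)
Lemma inc_lip : 1 < alpha -> (nnsum (fun z => rsum (kterm inc z) ^+ 2)%R <=
  (9 * n * (k%:R `^ alpha * M * (Cl / k%:R) * lnsum 1) ^+ 2)%:E)%E.
Proof.
move=> a1; apply: (@kterm_schur inc (fun z z' => Dg z z') (2 * B)) => //.
- by rewrite divr_ge0.
- by rewrite ler01.
- exact: Dg_le.
- exact: Dg_lip.
- by move=> z z' h; apply: ler_wpM2r => //; exact: inc_le.
Qed.

End defect.

(** Young's inequality twice: the pairing is absorbed by [E] and by half of [lam * V]. *)
Lemma energy_absorption (R : realType) (lam V E a b De S : R) : 0 < lam -> 0 <= V -> 0 <= E -> 0 <= a -> 0 <= b <= V ->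
  S <= a * (Num.sqrt E + Num.sqrt b) -> lam * V + E <= 2 * S + lam^-1 * De ->
  V <= 2 / lam * (a ^+ 2 * (1 + 2 / lam) + De / lam).
Proof.
move=> l0 V0 E0 a0 /andP[b0 bV] hS h.
have l1 : 0 < lam^-1 by rewrite invr_gt0.
have sE := sqr_sqrtr E0; have sV := sqr_sqrtr V0.
have sb : Num.sqrt b <= Num.sqrt V by rewrite ler_sqrt.
have sE0 := sqrtr_ge0 E; have sV0 := sqrtr_ge0 V; have sb0 := sqrtr_ge0 b.
have h1 : 2 * (a * Num.sqrt E) <= E + a ^+ 2.
  move: sE; move: (Num.sqrt E) => t; rewrite !expr2 => sE.
  by have := sqr_ge0 (t - a); rewrite expr2; lra.
have h2 : 2 * (a * Num.sqrt V) <= lam / 2 * V + 2 / lam * a ^+ 2.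
  move: sV; move: (Num.sqrt V) => t sV.
  have h4 : 0 <= 2 / lam * (lam / 2 * t - a) ^+ 2 by rewrite mulr_ge0 ?sqr_ge0 // divr_ge0 // ltW.
  have h5 : 2 / lam * (lam / 2 * t - a) ^+ 2 = lam / 2 * V - 2 * (a * t) + 2 / lam * a ^+ 2.
    by rewrite -sV; field; rewrite gt_eqF.
  lra.
have h6 : a * Num.sqrt b <= a * Num.sqrt V by rewrite ler_wpM2l.
have h7 : lam / 2 * V <= a ^+ 2 * (1 + 2 / lam) + De / lam.
  have -> : a ^+ 2 * (1 + 2 / lam) + De / lam = a ^+ 2 + 2 / lam * a ^+ 2 + lam^-1 * De by ring.
  move: hS; rewrite mulrDr => hS; lra.
have h8 := ler_wpM2l (_ : 0 <= 2 / lam) h7.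
apply: le_trans (h8 _); last by rewrite divr_ge0 // ltW.
by rewrite le_eqVlt; apply/orP; left; apply/eqP; field; rewrite gt_eqF.
Qed.

Lemma sqr_powR (R : realType) (x p : R) : (x `^ p) ^+ 2 = x `^ (2 * p).
Proof. by rewrite -powR_mulrn ?powR_ge0 // -powRrM mulrC. Qed.

(** * Variance of the noise of a test function *)

Section test_function_variance.
Variables (R : realType) (d : nat) (alpha beta : R) (m k : nat).
Local Notation L := 'rV[int]_d.
Hypothesis d0 : (0 < d)%N.
Hypothesis alpha0 : 0 < alpha.
Hypothesis k0 : (0 < k)%N.
Hypothesis beta01 : 0 < beta <= 1.
Hypothesis betad : beta < d%:R / 2 + alpha.

Let Ct : R := (2 * m + 3)%:R ^+ d + d%:R * (2 * m + 3)%:R ^+ d.+1.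

Definition variance_constant : R := 3 * (m.+1.*2 ^ d)%:R * (Ct ^+ 2 *
  fine (nnsum (fun z : L => lnorm R z `^ (- (d%:R + (d%:R + 2 * alpha - 2 * beta)))))).

Lemma variance_constant_ge0 : 0 <= variance_constant.
Proof.
apply: mulr_ge0; first by rewrite mulr_ge0.
apply: mulr_ge0; first exact: sqr_ge0.
by apply: fine_nnsum_ge0 => z; exact: powR_ge0.
Qed.

(** Test functions are bounded and Lipschitz with constants free of [k] and [S]; interpolation gives
    the Holder bound [Ct (|z - z'| / k)^beta], and [kern_sqr_sum] applies. *)
Lemma testf_variance (I : finType) (iota : I -> L) (S : L) : injective iota ->
  (forall i, - (m * k)%N%:Z <= S 0 i) ->
  \sum_y \sum_y' (kern alpha (iota y) (iota y') * (testf R m k S (iota y') - testf R m k S (iota y))) ^+ 2 <=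
  variance_constant * k%:R ^+ d * k%:R `^ (- (2 * beta)).
Proof.
move=> iinj hS.
have k0' : 0 < k%:R :> R by rewrite ltr0n.
have Ct0 : 0 <= Ct by rewrite addr_ge0 ?mulr_ge0 ?exprn_ge0.
have := @kern_sqr_sum R d alpha d0 alpha0 I iota (fun z z' => testf R m k S z' - testf R m k S z)
  (Ct ^+ 2 * k%:R `^ (- (2 * beta))) beta ((m.+1 * k).*2 ^ d)%:R (inbox (m.+1 * k)) iinj.
case/(_ _ _ _ _ _ _)/Wrap => //.
- by rewrite mulr_ge0 ?sqr_ge0 ?powR_ge0.
- by rewrite nnsum_inbox.
- move=> z z'.
  have i0 y : 0 <= inbox (R := R) (m.+1 * k) y by case/andP: (inbox01 (R := R) (m.+1 * k) y).
  have rhs0 : 0 <= Ct ^+ 2 * k%:R `^ (- (2 * beta)) * lnorm R (z - z') `^ (2 * beta).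
    by rewrite !mulr_ge0 ?sqr_ge0 ?powR_ge0.
  have core : (testf R m k S z' - testf R m k S z) ^+ 2 <= Ct ^+ 2 * k%:R `^ (- (2 * beta)) * lnorm R (z - z') `^ (2 * beta).
    pose r := lnorm R (z - z') / k%:R.
    have r0 : 0 <= r by rewrite divr_ge0 ?lnorm_ge0.
    have h1 : `|testf R m k S z' - testf R m k S z| <= (2 * m + 3)%:R ^+ d.
      have /andP[a1 a2] := @testf_bounds R d m k S z k0 hS; have /andP[a3 a4] := @testf_bounds R d m k S z' k0 hS.
      by move: a1 a2 a3 a4; move: ((2 * m + 3)%:R ^+ d) => q; rewrite ler_norml => *; apply/andP; split; lra.
    have h2 : `|testf R m k S z' - testf R m k S z| <= d%:R * (2 * m + 3)%:R ^+ d.+1 * r.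
      by have := @testf_lip R d m k S z' z k0 hS; rewrite -lnormN opprB.
    have h3 : `|testf R m k S z' - testf R m k S z| <= Ct * r `^ beta.
      apply: le_trans (_ : Ct * Num.min 1 r <= _); last by rewrite ler_wpM2l // min1_powR.
      have [r1|r1] := leP 1 r.
        rewrite mulr1; apply: le_trans h1 _; rewrite lerDl mulr_ge0 ?exprn_ge0 //.
      apply: le_trans h2 _; rewrite ler_wpM2r // lerDr exprn_ge0 //.
    rewrite -real_normK ?num_real //.
    apply: (@le_trans _ _ ((Ct * r `^ beta) ^+ 2)).
      by rewrite ler_sqr ?nnegrE ?mulr_ge0 ?powR_ge0.
    rewrite exprMn sqr_powR /r powRM ?lnorm_ge0 ?invr_ge0 ?(ltW k0') //.
    rewrite -(powR_inv1 (ltW k0')) -powRrM mulN1r.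
    by rewrite le_eqVlt; apply/orP; left; apply/eqP; ring.
  have [cz|cz] := pselect (range (@boxpt d (m.+1 * k)) z).
    apply: le_trans core _; rewrite ler_peMr // {1}/inbox (asboolT cz) lerDl //.
  have [cz'|cz'] := pselect (range (@boxpt d (m.+1 * k)) z').
    apply: le_trans core _; rewrite ler_peMr // {2}/inbox (asboolT cz') lerDr //.
  by rewrite (testf_supp _ _ k0 cz) (testf_supp _ _ k0 cz') subrr expr0n /= mulr_ge0 // addr_ge0.
move=> H; apply: le_trans H _.
rewrite /variance_constant doubleMl expnMn natrM [(k ^ d)%:R]natrX.
by rewrite le_eqVlt; apply/orP; left; apply/eqP; ring.
Qed.

End test_function_variance.

(** For [alpha < 1], put [mu = min (1 - alpha) (d/2)] and let [beta] be this exponent. Then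
    [beta - alpha/2] exceeds [alpha/2] by [(1 - alpha/2) mu] and exceeds [mu] by
    [(alpha/2) (1 - mu)]. Both gaps are positive, so each rate of the minimum is beaten by a power
    of [k] that absorbs the stray logarithms. *)
Definition hoelder_exponent (R : realType) (d : nat) (alpha : R) : R :=
  if 1 <= alpha then 1 else alpha + (1 - alpha / 2) * Num.min (1 - alpha) (d%:R / 2).

Lemma hoelder_exponent_bounds (R : realType) (d : nat) (alpha : R) : (0 < d)%N -> 0 < alpha < 2 ->
  0 < hoelder_exponent d alpha <= 1 /\ hoelder_exponent d alpha < d%:R / 2 + alpha.
Proof.
move=> d0 /andP[a0 a2]; have dR : 0 < d%:R :> R by rewrite ltr0n.
rewrite /hoelder_exponent; case: (leP 1 alpha) => a1.
  by rewrite ltr01 lexx; split => //; lra.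
set mu := Num.min _ _.
have mu0 : 0 < mu by rewrite lt_min; apply/andP; split; lra.
have mu1 : mu <= 1 - alpha by rewrite ge_min lexx.
have mu2 : mu <= d%:R / 2 by rewrite ge_min lexx orbT.
by split; [apply/andP; split|]; nra.
Qed.

(** * The l2 bound on the error *)

Section solution.
Context {R : realType} {d : nat} {dO : measure_display} {Omega : measurableType dO}.
Variables (alpha gamma lam M T : R) (A : nat).
Local Notation L := 'rV[int]_d.
Hypothesis d0 : (0 < d)%N.
Hypothesis alpha02 : 0 < alpha < 2.
Hypothesis alphad : alpha < d%:R.
Hypothesis gamma0 : 0 < gamma.
Hypothesis lam0 : 0 < lam.
Hypothesis M1 : 1 <= M.
Hypothesis T0 : 0 < T.
Hypothesis hA : (2 + alpha) / alpha <= A%:R.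
Variable leb : {measure set (d.-tuple R) -> \bar R}.
Hypothesis hleb : is_lebesgue_tuple leb.
Variable g : 'rV[R]_d -> R.
Hypotheses (sg : smooth g) (cg : compact_support g).

Let beta := hoelder_exponent d alpha.
Let alpha0 : 0 < alpha. Proof. by case/andP: alpha02. Qed.

Definition amplitude (k : nat) : R :=
  (if 1 < alpha then 1 else ln k%:R `^ 2^-1) *
  (k%:R `^ (d%:R / 2 + alpha / 2 - beta) * ln k%:R `^ ((1 + gamma) * alpha / (2 * d%:R))).

Definition lattice_error k (W : L -> L -> R) (z : L) : R :=
  jump (cond alpha k W) (fun z => g (latpt R k z)) z - Lbar leb alpha g (latpt R k z).

(** The constants are fixed before the environment, so they depend only on [g] and the parameters;
    this is what lets [C0] be deterministic. *)
Lemma solution_bound : exists (Hcr : nat -> R) (Cf : R) (k1 : nat),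
  [/\ (forall k, 0 <= Hcr k), 0 <= Cf &
  forall (k : nat) (w : L -> L -> Omega -> R) (o : Omega), (0 < k)%N ->
   (forall x y, w x y o = w y x o) -> (forall x y, x != y -> 0 <= w x y o <= M) ->
   let W := fun x y => w x y o in
   l2 (lattice_error k W) /\
   forall v : L -> R, l2 v -> (forall z, lam * v z - jump (cond alpha k W) v z = lattice_error k W z) ->
     (nnsum (fun z => v z ^+ 2)%R <= (Hcr k)%:E)%E /\
     ((k1 <= k)%N -> good_environment w M gamma (d%:R + alpha) A T k o ->
      (nnsum (fun z => v z ^+ 2)%R <=
        (Cf * (amplitude k ^+ 2 + k%:R ^+ d * (k%:R `^ (- (1 - alpha / 2))) ^+ 2))%:E)%E)].
Proof.
have [m [Cc Cc0 rep]] := smooth_representation sg cg.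
have [B B0 hB] := smooth_bounded sg cg.
have [Cl Cl0 hCl] := smooth_lipschitz sg cg.
have [Cg Cg0 hCg] := generator_consistency hleb d0 sg cg alpha02.
have [beta01 betad] := hoelder_exponent_bounds d0 alpha02.
rewrite -/beta in beta01 betad.
have M0 : 0 < M by exact: lt_le_trans ltr01 M1.
have M0' := ltW M0; have T0' := ltW T0; have l0' := ltW lam0.
have [Vc VcE] : exists Vc, Vc = variance_constant d alpha beta m by eexists.
have Vc0 : 0 <= Vc by rewrite VcE variance_constant_ge0.
have [E0 E0E] : exists E0, E0 = Num.sqrt (Cc ^+ 2 * (8 * M ^+ 2 * T * Vc)) by eexists.
have E00 : 0 <= E0 by rewrite E0E sqrtr_ge0.
have E02 : E0 ^+ 2 = Cc ^+ 2 * (8 * M ^+ 2 * T * Vc).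
  by rewrite E0E sqr_sqrtr // !mulr_ge0.
have [n0 n0E] : exists n0 : R, n0 = (m.*2 ^ d)%:R by eexists.
have n00 : 0 <= n0 by rewrite n0E.
have S0 bt : 0 <= lnsum d alpha bt by apply: fine_nnsum_ge0 => z; exact: powR_ge0.
have [Hc1 Hc1E] : exists Hc1, Hc1 = 3 * Num.sqrt n0 * (M * Cl * lnsum d alpha 1) by eexists.
have Hc10 : 0 <= Hc1 by rewrite Hc1E !mulr_ge0 ?sqrtr_ge0 ?(ltW M0).
(* [Hc1] bounds the noise for [alpha > 1] by [inc_lip], [E0] bounds it for [alpha <= 1] by
   concentration on single points. *)
pose Hc := Hc1 + E0.
have Hc0 : 0 <= Hc by rewrite addr_ge0.
pose Cp := pairing_constant d alpha M E0 Hc.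
pose De := 2 * (9 * n0 * (M * (2 * B) * 2 `^ (alpha / 2) * lnsum d alpha (alpha / 2)) ^+ 2) + 2 * Cg.
have De0 : 0 <= De by rewrite addr_ge0 ?mulr_ge0 ?sqr_ge0.
pose rho k : R := k%:R `^ (- (1 - alpha / 2)).
pose Hh k := 2 * (9 * (n0 * k%:R ^+ d) * (k%:R `^ alpha * M * (2 * B) * lnsum d alpha 0) ^+ 2) + 2 * (Cg * k%:R ^+ d * rho k ^+ 2).
have rho0 k : 0 <= rho k by exact: powR_ge0.
have kd0 k : 0 <= k%:R ^+ d :> R by exact: exprn_ge0.
have Hh0 k : 0 <= Hh k by rewrite addr_ge0 // !mulr_ge0 // ?powR_ge0 ?S0.
(* The last witness ensures [2 m <= k]: the radius is then admissible in a good environment, and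
   twice the support fits in the box. *)
exists (fun k => 2 / lam * (Hh k / lam)), (2 / lam * (Cp ^+ 2 * (1 + 2 / lam) + De / lam)), (2 * m + 3)%N.
have li : 0 < lam^-1 by rewrite invr_gt0.
split.
- by move=> k; rewrite !mulr_ge0 // ltW.
- apply: mulr_ge0; first by rewrite divr_ge0.
  apply: addr_ge0; last by rewrite divr_ge0.
  by rewrite mulr_ge0 ?sqr_ge0 // addr_ge0 // divr_ge0.
move=> k w o k0 ws w0 W.
have k0' : 0 < k%:R :> R by rewrite ltr0n.
have [c rc [gE gsupp]] := rep k k0.
pose G z := g (latpt R k z).
have GB z : `|G z| <= B by exact: hB.
have GL z z' : `|G z' - G z| <= Cl / k%:R * lnorm R (z - z').
  by apply: le_trans (hCl _ _) _; rewrite eucl_latpt -lnormN opprB mulrA mulrAC.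
have nE : ((m * k).*2 ^ d)%:R = n0 * k%:R ^+ d by rewrite n0E doubleMl expnMn natrM [(k ^ d)%:R]natrX.
pose le z := Lbar leb alpha g (latpt R k z) - ldelta g alpha k z.
have le2 : (nnsum (fun z => le z ^+ 2)%R <= (Cg * k%:R ^+ d * rho k ^+ 2)%:E)%E by exact: hCg.
have hE z : lattice_error k W z = rsum (kterm alpha k G (fun z z' => W z z' - 1) z) - le z.
  by rewrite -(@noise_jump R d alpha M k d0 alpha02 M1 k0 W w0 G B GB z) /lattice_error /le /ldelta; ring.
have sqr2 (a b : L -> R) (x y : R) : (nnsum (fun z => a z ^+ 2)%R <= x%:E)%E -> (nnsum (fun z => b z ^+ 2)%R <= y%:E)%E ->
    (nnsum (fun z => (a z - b z) ^+ 2)%R <= (2 * x + 2 * y)%:E)%E.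
  move=> ha hb; apply: (@le_trans _ _ (nnsum (fun z => 2 * a z ^+ 2 + 2 * b z ^+ 2)%R)).
    by apply: le_nnsum => z; have := sqr_ge0 (a z + b z); rewrite !expr2; lra.
  rewrite nnsumD; [|by move=> z; rewrite mulr_ge0 ?sqr_ge0..].
  rewrite !nnsumZ //; try by move=> z; exact: sqr_ge0.
  apply: (@le_trans _ _ (2%:E * x%:E + 2%:E * y%:E)%E); last by rewrite -!EFinM -EFinD.
  by apply: leeD; apply: lee_wpmul2l.
have hh : (nnsum (fun z => lattice_error k W z ^+ 2)%R <= (Hh k)%:E)%E.
  rewrite (eq_nnsum (g := fun z => (rsum (kterm alpha k G (fun z z' => W z z' - 1) z) - le z) ^+ 2)); last first.
    by move=> z; rewrite hE.
  apply: sqr2 => //; rewrite -nE.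
  exact: (@noise_crude R d alpha M k d0 alpha02 M1 W w0 G B (m * k) B0 GB gsupp).
have lh : l2 (lattice_error k W) by exact: fins_sub_bound hh.
split => // v lv vE.
have [Dm hDm] := @cond_bounded R d alpha M k d0 alpha0 M1 W w0.
have cge := cond_ge0 k alpha0 w0.
have csy := @condC R d alpha k W ws.
have V0 : 0 <= fine (nnsum (fun z => v z ^+ 2)) by apply: fine_nnsum_ge0 => z; exact: sqr_ge0.
have VK : (fine (nnsum (fun z => v z ^+ 2)))%:E = nnsum (fun z => v z ^+ 2).
  by apply: nnsumK => // z; exact: sqr_ge0.
rewrite -VK; split.
  rewrite lee_fin.
  (* With an empty index type nothing is paired and the whole source counts as remainder. *)
  have := @jump_energy R _ (cond alpha k W) Dm lam cge csy hDm lam0 'I_0 (fun=> 0) v (fun=> 0) (lattice_error k W).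
  case/(_ _ lv lh _ _)/Wrap => //.
  - by move=> [].
  - by move=> z; rewrite add0r vE.
  rewrite !big_ord0 mulr0 addr0 add0r => H.
  have hf : fine (nnsum (fun z => lattice_error k W z ^+ 2)) <= Hh k.
    by apply: fine_nnsum_le => // z; exact: sqr_ge0.
  have := ler_wpM2l (ltW li) hf => h2.
  rewrite mulrA -[leRHS]mulrA [leRHS]mulrC -ler_pdivrMr; last by rewrite divr_gt0.
  rewrite invf_div; move: h2; have := Hh0 k; move: (Hh k) => hk hk0 h2.
  have : 0 <= lam * fine (nnsum (fun z => v z ^+ 2)) by rewrite mulr_ge0 // ltW.
  by rewrite mulrC [hk / lam]mulrC; lra.
move=> kk [j0 [J [j0J hx [hAJ L4] good1 good2]]].
have mk2 : (2 * m <= k)%N by apply: leq_trans kk; exact: leq_addr.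
have mk : (m <= k)%N by apply: leq_trans mk2; exact: leq_pmull.
have A2 : (2 <= A)%N.
  rewrite -(ler_nat R); apply: le_trans hA; rewrite ler_pdivlMr //; case/andP: alpha02 => *; lra.
have mkJ : (2 * (m * k) <= 2 ^ J)%N.
  apply: leq_trans hAJ; apply: (@leq_trans (k ^ 2)); last by rewrite leq_pexp2l.
  by rewrite -mulnn mulnA leq_mul2r mk2 orbT.
pose inz := fun z => rsum (kterm alpha k G (inc W J) z).
pose e := fun z => lattice_error k W z - inz z.
have eE z : e z = rsum (kterm alpha k G (outc W J) z) - le z.
  rewrite /e hE (@noise_split R d alpha M k d0 alpha02 M1 W w0 G B GB J z) /inz; ring.
have he : (nnsum (fun z => e z ^+ 2)%R <= (De * (k%:R ^+ d * rho k ^+ 2))%:E)%E.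
  rewrite (eq_nnsum (g := fun z => (rsum (kterm alpha k G (outc W J) z) - le z) ^+ 2)); last first.
    by move=> z; rewrite eE.
  have hout := @outc_schur R d alpha M k d0 alpha02 M1 k0 W w0 G B Cl (m * k) B0 Cl0 GB gsupp J mkJ.
  apply: le_trans (sqr2 _ _ _ _ hout le2) _.
  rewrite lee_fin nE /De [leRHS]mulrDl; apply: lerD; last first.
    by rewrite le_eqVlt; apply/orP; left; apply/eqP; ring.
  (* Origin of the bound on [A]: with [2^J >= k^A], the exponent [alpha - A alpha / 2] must not
     exceed [-(1 - alpha/2)]. *)
  have key : k%:R `^ alpha * ((2 ^ J)%:R / 2) `^ (- (alpha / 2)) <= 2 `^ (alpha / 2) * rho k.
    have kA : 0 < k%:R ^+ A :> R by rewrite exprn_gt0.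
    apply: (@le_trans _ _ (k%:R `^ alpha * (k%:R ^+ A / 2) `^ (- (alpha / 2)))).
      apply: ler_wpM2l; first exact: powR_ge0.
      apply: powRN_mono; [by rewrite divr_ge0 // ltW|by rewrite divr_gt0|].
      by rewrite ler_wpM2r // -natrX ler_nat.
    rewrite powRM ?(ltW kA) // -(@powR_inv1 _ 2) // -powRrM mulN1r opprK -powR_mulrn ?(ltW k0') // -powRrM.
    rewrite mulrA mulrC; apply: ler_wpM2l; first exact: powR_ge0.
    rewrite -powRD ?(gt_eqF k0') ?implybT //; apply: ler_powR; first by rewrite ler1n.
    by rewrite powR_inv1 //; move: hA; rewrite ler_pdivrMr // => hA'; lra.
  rewrite [leLHS](_ : _ = 2 * (9 * (n0 * k%:R ^+ d) * (M * (2 * B) * lnsum d alpha (alpha / 2)) ^+ 2) *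
     (k%:R `^ alpha * ((2 ^ J)%:R / 2) `^ (- (alpha / 2))) ^+ 2); last by ring.
  rewrite [leRHS](_ : _ = 2 * (9 * (n0 * k%:R ^+ d) * (M * (2 * B) * lnsum d alpha (alpha / 2)) ^+ 2) *
     (2 `^ (alpha / 2) * rho k) ^+ 2); last by ring.
  apply: ler_wpM2l; first by rewrite !mulr_ge0 ?sqr_ge0 ?exprn_ge0 ?(ltW k0') ?(ltW M0).
  by rewrite ler_sqr ?nnegrE ?mulr_ge0 ?powR_ge0.
have le_ : l2 e by exact: fins_sub_bound he.
have := @jump_energy R _ (cond alpha k W) Dm lam cge csy hDm lam0 (box d (2 ^ J)) (@boxpt d (2 ^ J)) v inz e (@boxpt_inj d _) lv le_.
case/(_ _ _)/Wrap => //.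
- by move=> z; exact: inc_out.
- by move=> z; rewrite vE /e; ring.
move=> energy.
have inzE (F : box d (2 ^ J)) : inz (boxpt F) = hbox_noise alpha k W G F := @inc_iota R d alpha k W G J F.
have L0 : 0 < ln (k%:R : R) by exact: lt_le_trans L4.
have block j : (j <= J)%N -> \sum_F avg (@cube d J) (fun j => ((2 ^ j) ^ d)%N) j (@hbox_noise R d alpha k W G J) F ^+ 2 <=
   ((2 ^ j) ^ d)%:R^-1 * (E0 * k%:R `^ (d%:R / 2 + alpha - beta) * ln k%:R `^ 2^-1) ^+ 2.
  move=> jJ.
  have := @block_average_bound R d alpha k W ws G J (box d (m * k)) c (fun S => testf R m k (boxpt S)) Cc
    (8 * M ^+ 2 * (T * ln k%:R)) (Vc * k%:R ^+ d * k%:R `^ (- (2 * beta))) gE rc.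
  case/(_ _ _ _ _ j jJ)/Wrap.
  - by rewrite !mulr_ge0 // ltW.
  - move=> S j' F j'J; apply: good1 => //; apply: box_mono (_ : range (@boxpt d (m * k)) _); last by exists S.
    by rewrite leq_mul2r mk orbT.
  - by rewrite !mulr_ge0 ?powR_ge0 ?exprn_ge0.
  - move=> S; rewrite VcE; apply: testf_variance => //; first exact: boxpt_inj.
    by move=> i; have /andP[] := boxpt_bound S i.
  move=> H; apply: le_trans H _.
  rewrite le_eqVlt; apply/orP; left; apply/eqP.
  rewrite 2!exprMn E02 !sqr_powR mulfV // powRr1 ?(ltW L0) //.
  have -> : k%:R `^ (2 * (d%:R / 2 + alpha - beta)) = k%:R ^+ d * k%:R `^ (2 * alpha) * k%:R `^ (- (2 * beta)).
    rewrite -powR_mulrn ?(ltW k0') // -!powRD ?(gt_eqF k0') ?implybT //.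
    by congr (_ `^ _); field.
  by ring.
pose sL : R := if 1 < alpha then 1 else ln k%:R `^ 2^-1.
have sL1 : 1 <= sL.
  rewrite /sL; case: ifP => // _; rewrite -[leLHS](powRr0 (ln k%:R)); apply: ler_powR => //.
  by apply: le_trans L4; rewrite ler1n.
have hH0 : \sum_F @hbox_noise R d alpha k W G J F ^+ 2 <= (Hc * k%:R `^ (d%:R / 2 + alpha - beta) * sL) ^+ 2.
  rewrite /sL; case: ifPn => a1.
    have := @inc_lip R d alpha M k d0 alpha02 M1 W w0 G B Cl (m * k) Cl0 GB GL gsupp J a1 => hi.
    have h1 : ((\sum_F @hbox_noise R d alpha k W G J F ^+ 2)%R%:E <= nnsum (fun z => inz z ^+ 2)%R)%E.
      rewrite -sumEFin; under eq_bigr do rewrite -inzE.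
      apply: (@esum_ge_fintype _ _ _ xpredT (@boxpt d (2 ^ J)) (fun z => (inz z ^+ 2)%:E)); first exact: boxpt_inj.
      by move=> z; rewrite lee_fin sqr_ge0.
    have := le_trans h1 hi; rewrite lee_fin => h2; apply: le_trans h2 _.
    have be : beta = 1 by rewrite /beta /hoelder_exponent (ltW a1).
    rewrite mulr1 nE be.
    apply: (@le_trans _ _ ((Hc1 * k%:R `^ (d%:R / 2 + alpha - 1)) ^+ 2)); last first.
      rewrite ler_sqr ?nnegrE ?mulr_ge0 ?powR_ge0 //; apply: ler_wpM2r; first exact: powR_ge0.
      by rewrite lerDl.
    rewrite [leRHS]exprMn sqr_powR Hc1E !exprMn sqr_sqrtr // sqr_powR.
    have -> : k%:R `^ (2 * (d%:R / 2 + alpha - 1)) = k%:R ^+ d * k%:R `^ (2 * alpha) * (k%:R^-1) ^+ 2.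
      rewrite -(powR_inv1 (ltW k0')) sqr_powR -powR_mulrn ?(ltW k0') // -!powRD ?(gt_eqF k0') ?implybT //.
      by congr (_ `^ _); field.
    by rewrite le_eqVlt; apply/orP; left; apply/eqP; ring.
  (* Cubes of scale 0 are single points, so the block estimate at [j = 0] is the l2 bound on the
     noise, at the price of [ln^(1/2) k]. *)
  have := block 0%N (leq0n J).
  have -> : \sum_F avg (@cube d J) (fun j => ((2 ^ j) ^ d)%N) 0 (@hbox_noise R d alpha k W G J) F ^+ 2 =
     \sum_F @hbox_noise R d alpha k W G J F ^+ 2.
    apply: eq_bigr => F _; congr (_ ^+ 2); rewrite /avg expn0 exp1n invr1 mul1r (big_pred1 F) // => y.
    apply/eqP/eqP => [/ffunP h|->//]; apply/ffunP => i; have := h i; rewrite !ffunE expn0 !divn1 => /val_inj; exact.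
  rewrite expn0 exp1n invr1 mul1r => H; apply: le_trans H _.
  rewrite ler_sqr ?nnegrE ?mulr_ge0 ?powR_ge0 //; apply: ler_wpM2r; first exact: powR_ge0.
  by apply: ler_wpM2r; [exact: powR_ge0|rewrite lerDr].
have A1 : (0 < A)%N by exact: leq_trans A2.
have := @noise_pairing R d alpha M gamma beta k d0 alpha0 alphad gamma0 M1 k0 W w0 j0 J A L4 j0J hx A1 hAJ good2
  (@hbox_noise R d alpha k W G J) (fun F => v (boxpt F)) E0 Hc sL E00 Hc0 sL1 hH0 block.
rewrite -/Cp => pairing.
have Cp0 : 0 <= Cp.
  rewrite /Cp /pairing_constant !addr_ge0 ?mulr_ge0 ?sqrtr_ge0 ?powR_ge0 // invr_ge0 subr_ge0.
  rewrite powRN invf_le1 ?powR_gt0 // -[leLHS](powRr0 2); apply: ler_powR; first by rewrite ler1n.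
  by rewrite divr_ge0 // subr_ge0 ltW.
have amp : sL * (k%:R `^ (d%:R / 2 + alpha / 2 - beta) * ln k%:R `^ ((1 + gamma) * alpha / (2 * d%:R))) = amplitude k by [].
rewrite amp in pairing.
have amp0 : 0 <= amplitude k by rewrite -amp mulr_ge0 ?mulr_ge0 ?powR_ge0 //; exact: le_trans ler01 sL1.
set E := \sum_i \sum_j _ in energy pairing.
have E_ge0 : 0 <= E.
  by apply: sumr_ge0 => F _; apply: sumr_ge0 => F' _; rewrite mulr_ge0 ?sqr_ge0.
have bV : 0 <= \sum_F v (boxpt (F : box d (2 ^ J))) ^+ 2 <= fine (nnsum (fun z => v z ^+ 2)).
  rewrite sumr_ge0 => [|F _]; last exact: sqr_ge0.
  rewrite /= -lee_fin VK -sumEFin.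
  apply: (@esum_ge_fintype _ _ _ xpredT (@boxpt d (2 ^ J)) (fun z => (v z ^+ 2)%:E)); first exact: boxpt_inj.
  by move=> z; rewrite lee_fin sqr_ge0.
have hfe : fine (nnsum (fun z => e z ^+ 2)) <= De * (k%:R ^+ d * rho k ^+ 2).
  by apply: fine_nnsum_le => // z; exact: sqr_ge0.
have energy2 : lam * fine (nnsum (fun z => v z ^+ 2)) + E <=
   2 * (\sum_F @hbox_noise R d alpha k W G J F * v (boxpt F)) + lam^-1 * (De * (k%:R ^+ d * rho k ^+ 2)).
  apply: le_trans energy _; apply: lerD; last by apply: ler_wpM2l => //; exact: ltW.
  rewrite ler_wpM2l // le_eqVlt; apply/orP; left; apply/eqP.
  by apply: eq_bigr => F _; rewrite inzE.
have a0 : 0 <= Cp * amplitude k by rewrite mulr_ge0.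
have := energy_absorption lam0 V0 E_ge0 a0 bV pairing energy2 => final.
rewrite lee_fin; apply: le_trans final _.
rewrite -[leRHS]mulrA; apply: ler_wpM2l; first by rewrite divr_ge0 // ltW.
rewrite [leRHS]mulrDl; apply: lerD.
  rewrite exprMn; set X := amplitude k ^+ 2; set Y := k%:R ^+ d * _.
  have X0 : 0 <= X by exact: sqr_ge0.
  have Y0 : 0 <= Y by rewrite mulr_ge0 ?sqr_ge0 ?exprn_ge0 // ltW.
  have c0 : 0 <= Cp ^+ 2 * (1 + 2 / lam) by rewrite mulr_ge0 ?sqr_ge0 ?addr_ge0 ?divr_ge0 // ltW.
  rewrite mulrAC; apply: ler_wpM2l => //; by rewrite lerDl.
set X := amplitude k ^+ 2; set Y := k%:R ^+ d * _.
have X0 : 0 <= X by exact: sqr_ge0.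
by rewrite mulrAC; apply: ler_wpM2l; [rewrite mulr_ge0 // ltW|rewrite lerDr].
Qed.

End solution.

(** The estimate carries [2 d] in the exponent of the logarithm; the minimum [mn] in [rate] is at
    most [2 d], so the claimed power is at least as large. At [alpha = 1] the extra [ln^(1/2) k] is
    covered by the additional 1 in the exponent. *)
Lemma rate_comparison (R : realType) (d : nat) (alpha gamma : R) :
  (0 < d)%N -> 0 < alpha < 2 -> alpha < d%:R -> 0 < gamma ->
  exists2 C : R, 0 < C & forall k : nat, (0 < k)%N -> 1 <= ln (k%:R : R) ->
    [/\ 0 < rate d alpha gamma k,
      (if 1 < alpha then 1 else ln k%:R `^ 2^-1) *
        (k%:R `^ (alpha / 2 - hoelder_exponent d alpha) * ln k%:R `^ ((1 + gamma) * alpha / (2 * d%:R)))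
        <= C * rate d alpha gamma k &
      k%:R `^ (- (1 - alpha / 2)) <= C * rate d alpha gamma k].
Proof.
move=> d0 /andP[a0 a2] ad g0.
have dR : 0 < d%:R :> R by rewrite ltr0n.
pose mn : R := Num.min (4 * (d%:R - alpha)) (2 * d%:R).
have mn0 : 0 < mn by rewrite lt_min; apply/andP; split; lra.
have mn2 : mn <= 2 * d%:R by rewrite ge_min lexx orbT.
have ee : (1 + gamma) * alpha / (2 * d%:R) <= alpha * (1 + gamma) / mn.
  rewrite [(1 + gamma) * alpha]mulrC ler_wpM2l //; first by rewrite mulr_ge0; lra.
  by rewrite lef_pV2 ?posrE //; lra.
have e0 : 0 <= (1 + gamma) * alpha / (2 * d%:R) by rewrite divr_ge0 ?mulr_ge0; lra.
have [alt|age] := ltP alpha 1.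
  pose mu : R := Num.min (1 - alpha) (d%:R / 2).
  have mu0 : 0 < mu by rewrite lt_min; apply/andP; split; lra.
  have mu1 : mu <= 1 - alpha by rewrite ge_min lexx.
  (* The two gaps built into [hoelder_exponent]: the first absorbs [ln^(1/2) k], the second the
     power of the logarithm due to the finest scale. *)
  have s1 : 0 < (1 - alpha / 2) * mu by rewrite mulr_gt0 //; lra.
  have s2 : 0 < alpha / 2 * (1 - mu) by rewrite mulr_gt0; lra.
  have [C1 C10 hC1] := @ln_powR_le R 2^-1 _ ltac:(lra) s1.
  have [C2 C20 hC2] := @ln_powR_le R _ _ e0 s2.
  exists (C1 + C2 + 1); first by lra.
  move=> k k0 L1.
  have k1 : 1 <= k%:R :> R by rewrite ler1n.
  have k0' : 0 < k%:R :> R by lra.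
  have L0 : 0 < ln (k%:R : R) by lra.
  have bE : hoelder_exponent d alpha = alpha + (1 - alpha / 2) * mu by rewrite /hoelder_exponent leNgt alt.
  have anl : (1 < alpha) = false by rewrite ltNge (ltW alt).
  rewrite /rate alt bE anl -/mn -/mu /=.
  have h1 := hC1 _ k1; have h2 := hC2 _ k1.
  have Le : ln k%:R `^ ((1 + gamma) * alpha / (2 * d%:R)) <= ln (k%:R : R) `^ (alpha * (1 + gamma) / mn) by apply: ler_powR.
  have Le1 : 1 <= ln (k%:R : R) `^ (alpha * (1 + gamma) / mn).
    by rewrite -[leLHS](powRr0 (ln k%:R)); apply: ler_powR => //; apply: le_trans ee.
  have Lh1 : 1 <= ln (k%:R : R) `^ (1 / 2).
    by rewrite -[leLHS](powRr0 (ln k%:R)); apply: ler_powR => //; lra.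
  set r1 := k%:R `^ (- (alpha / 2)) * _; set r2 := k%:R `^ (- mu) * _.
  have r10 : 0 < r1 by rewrite mulr_gt0 ?powR_gt0.
  have r20 : 0 < r2 by rewrite mulr_gt0 ?powR_gt0.
  have C0 : 0 <= C1 + C2 + 1 by lra.
  have minr x : x <= (C1 + C2 + 1) * r1 -> x <= (C1 + C2 + 1) * r2 -> x <= (C1 + C2 + 1) * Num.min r1 r2.
    by move=> x1 x2; rewrite minr_pMr // le_min x1.
  split; first by rewrite lt_min r10.
    set Lh := ln k%:R `^ 2^-1 in h1 *; set La := ln k%:R `^ _ in h2 Le *.
    have Lh0 : 0 <= Lh by exact: powR_ge0.
    have La0 : 0 <= La by exact: powR_ge0.
    apply: minr.
      have -> : k%:R `^ (alpha / 2 - (alpha + (1 - alpha / 2) * mu)) = k%:R `^ (- (alpha / 2)) * k%:R `^ (- ((1 - alpha / 2) * mu)) :> R.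
        by rewrite -powRD ?(gt_eqF k0') ?implybT //; congr (_ `^ _); field.
      apply: (@le_trans _ _ (C1 * r1)); last by rewrite ler_wpM2r ?(ltW r10) //; lra.
      have h3 : Lh * k%:R `^ (- ((1 - alpha / 2) * mu)) <= C1.
        by rewrite powRN ler_pdivrMr ?powR_gt0.
      rewrite [leLHS](_ : _ = (Lh * k%:R `^ (- ((1 - alpha / 2) * mu))) * (k%:R `^ (- (alpha / 2)) * La)); last by ring.
      apply: ler_pM => //; rewrite ?mulr_ge0 ?powR_ge0 //.
      by apply: ler_wpM2l; first exact: powR_ge0.
    have -> : k%:R `^ (alpha / 2 - (alpha + (1 - alpha / 2) * mu)) = k%:R `^ (- mu) * k%:R `^ (- (alpha / 2 * (1 - mu))) :> R.
      by rewrite -powRD ?(gt_eqF k0') ?implybT //; congr (_ `^ _); field.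
    apply: (@le_trans _ _ (C2 * r2)); last by rewrite ler_wpM2r ?(ltW r20) //; lra.
    have h3 : La * k%:R `^ (- (alpha / 2 * (1 - mu))) <= C2.
      by rewrite powRN ler_pdivrMr ?powR_gt0.
    rewrite [leLHS](_ : _ = (La * k%:R `^ (- (alpha / 2 * (1 - mu)))) * (k%:R `^ (- mu) * Lh)); last by ring.
    apply: ler_pM => //; rewrite ?mulr_ge0 ?powR_ge0 //.
    by rewrite /r2 div1r.
  apply: minr.
    apply: (@le_trans _ _ (1 * r1)); last by rewrite ler_wpM2r ?(ltW r10) //; lra.
    rewrite mul1r -[leLHS]mulr1; apply: ler_pM => //; rewrite ?powR_ge0 //.
    by apply: ler_powR => //; lra.
  apply: (@le_trans _ _ (1 * r2)); last by rewrite ler_wpM2r ?(ltW r20) //; lra.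
  rewrite mul1r -[leLHS]mulr1; apply: ler_pM => //; rewrite ?powR_ge0 //.
  by apply: ler_powR => //; lra.
exists 1 => // k k0 L1.
have k1 : 1 <= k%:R :> R by rewrite ler1n.
have k0' : 0 < k%:R :> R by lra.
have L0 : 0 < ln (k%:R : R) by lra.
have bE : hoelder_exponent d alpha = 1 by rewrite /hoelder_exponent age.
have anl : (alpha < 1) = false by rewrite ltNge age.
rewrite !mul1r /rate anl bE -/mn; case: eqP => [aE|/eqP an1].
  have -> : (1 < alpha) = false by rewrite aE ltxx.
  rewrite aE; have mE : Num.min (4 * (d%:R - 1)) (2 * d%:R) = mn by rewrite /mn aE.
  rewrite mE; rewrite aE !mulr1 mul1r in ee.
  split; first by rewrite mulr_gt0 ?powR_gt0.
    rewrite mulrCA [1 / 2 - 1](_ : _ = - (1 / 2)); last by field.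
    apply: ler_wpM2l; first exact: powR_ge0.
    rewrite -powRD ?(gt_eqF L0) ?implybT // mulr1; apply: ler_powR => //.
    by lra.
  rewrite [- (1 - 1 / 2)](_ : _ = - (1 / 2)); last by field.
  rewrite ler_peMr ?powR_ge0 // -[leLHS](powRr0 (ln k%:R)); apply: ler_powR => //.
  by rewrite addr_ge0 // divr_ge0 ?(ltW mn0) //; lra.
have agt : 1 < alpha by rewrite lt_neqAle eq_sym an1.
rewrite agt mul1r; split; first by rewrite mulr_gt0 ?powR_gt0.
  rewrite [alpha / 2 - 1](_ : _ = - ((2 - alpha) / 2)); last by field.
  by apply: ler_wpM2l; [exact: powR_ge0|apply: ler_powR].
rewrite [1 - alpha / 2](_ : _ = (2 - alpha) / 2); last by field.
rewrite ler_peMr ?powR_ge0 // -[leLHS](powRr0 (ln k%:R)); apply: ler_powR => //.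
exact: le_trans ee.
Qed.

Lemma conductance_bound_ge1 (R : realType) (dO : measure_display) (Omega : measurableType dO)
    (P : probability Omega R) (d : nat) (w : 'rV[int]_d -> 'rV[int]_d -> Omega -> R) (M : R) :
  (0 < d)%N -> H1 P w M -> 1 <= M.
Proof.
move=> d0 [_ [mw _ _ w0 w1]].
have xy : (0 : 'rV[int]_d) != const_mx 1.
  by apply/eqP => /rowP/(_ (Ordinal d0)); rewrite !mxE.
rewrite -lee_fin -(w1 _ _ xy).
apply: (@le_trans _ _ (\int[P]_o M%:E)%E).
  apply: ge0_le_integral => //.
  - by move=> o _; rewrite lee_fin; case/andP: (w0 _ _ o xy).
  - exact/measurable_EFinP/mw.
  - by move=> o _; rewrite lee_fin; case/andP: (w0 _ _ o xy).
have -> : (\int[P]_o M%:E)%E = M%:E; last by [].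
apply: etrans (@integral_cst _ Omega R P setT measurableT M%:E) _.
by transitivity (M%:E * 1)%E; [congr (_ * _)%E; exact: probability_setT|exact: mule1].
Qed.

Theorem theorem1p1 (R : realType) (d : nat) (alpha : R)
    (dO : measure_display) (Omega : measurableType dO) (P : probability Omega R)
    (w : 'rV[int]_d -> 'rV[int]_d -> Omega -> R) (M : R)
    (leb : {measure set (d.-tuple R) -> \bar R}) (lam gamma : R) :
  (0 < d)%N -> 0 < alpha < 2 -> alpha < d%:R ->
  0 < M -> H1 P w M ->
  is_lebesgue_tuple leb ->
  0 < lam -> 0 < gamma ->
  exists k0 : Omega -> \bar R,
    [/\ measurable_fun [set: Omega] (k0 : Omega -> \bar R),
        forall o, (1 <= k0 o)%E,
        P [set o | k0 o = +oo%E] = 0%E &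
        forall g : 'rV[R]_d -> R, smooth g -> compact_support g ->
        (* f := (lam - \bar L) g  ranges over S_0^lam, and \bar R_lam f = g *)
        let f := fun x => lam * g x - Lbar leb alpha g x in
        exists C0 : R, 0 < C0 /\
          {ae P, forall o, forall k : nat, (k0 o < (k%:R)%:E)%E ->
             (Lnorm leb 2%:E
                (fun t => (ext_lat k (resolvent_k alpha lam (fun x y => w x y o) k f) t
                           - g (toRow t))%:E)
              <= (C0 * rate d alpha gamma k)%:E)%E}].
Proof.
move=> d0 alpha02 alphad _ hw hleb lam0 gamma0.
have M1 := conductance_bound_ge1 d0 hw.
have alpha0 : 0 < alpha by case/andP: alpha02.
have [ws [_ _ _ w0 _]] := hw.
pose A := (Num.truncn ((2 + alpha) / alpha)).+1.
have hA : (2 + alpha) / alpha <= A%:R by apply: ltW; exact: truncnS_gt.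
have [T [k0 [T0 mk0 k03 k0oo k0good]]] := random_environment (d%:R + alpha) A hw M1 d0 gamma0.
exists k0; split => //.
  by move=> o; apply: le_trans (k03 o); rewrite lee_fin ler1n.
move=> g sg cg f.
have [Hcr [Cf [k1 [Hcr0 Cf0 hsol]]]] :=
  @solution_bound R d dO Omega alpha gamma lam M T A d0 alpha02 alphad gamma0 lam0 M1 T0 hA leb hleb g sg cg.
have [Cx Cx0 hCx] := Lnorm_extension hleb sg cg.
have [Cr Cr0 hCr] := rate_comparison d0 alpha02 alphad gamma0.
pose crude i := Num.sqrt (2 * (Hcr i / i%:R ^+ d)) + Cx / i%:R.
(* The sum pays for the [k < k1]: [k1] depends on [g] and cannot enter [k0], but finitely many crude
   bounds fit into a constant. The first summand serves [k >= k1], the last one makes [C0]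
   positive. *)
pose C0 := (2 * Num.sqrt (2 * Cf) + Cx) * Cr + \sum_(i < k1) `|crude i / rate d alpha gamma i| + 1.
have Ca0 : 0 <= (2 * Num.sqrt (2 * Cf) + Cx) * Cr.
  by rewrite mulr_ge0 ?(ltW Cr0) // addr_ge0 // mulr_ge0 ?sqrtr_ge0.
have Cb0 : 0 <= \sum_(i < k1) `|crude i / rate d alpha gamma i| by apply: sumr_ge0.
exists C0; split; first by rewrite ltr_wpDl // addr_ge0.
apply: aeW => o k hk.
have good := k0good o k hk.
have kpos : (0 < k)%N.
  rewrite lt0n; apply/eqP => kE; move: hk; rewrite kE => hk.
  by have := le_lt_trans (k03 o) hk; rewrite lte_fin ltr_nat.
have k0' : 0 < k%:R :> R by rewrite ltr0n.
have L1 : 1 <= ln (k%:R : R).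
  by have [j0 [J [_ _ [_ L4] _ _]]] := good; apply: le_trans L4; rewrite ler1n.
pose W := fun x y => w x y o.
have Wsym x y : W x y = W y x by rewrite /W ws.
have W0 x y : x != y -> 0 <= W x y <= M by move=> xy; exact: w0.
have [lh hv] := hsol k w o kpos Wsym W0.
pose G z := g (latpt R k z).
have lG : l2 G.
  have [m [Cc _ rep]] := smooth_representation sg cg; have [c _ [_ gsupp]] := rep k kpos.
  have [B B0 hB] := smooth_bounded sg cg.
  apply: (@fins_le _ _ _ (fun z => B ^+ 2 * inbox (m * k) z)).
    move=> z; have [cz|cz] := pselect (range (@boxpt d (m * k)) z); last first.
      by rewrite /G gsupp // expr0n /= mulr_ge0 ?sqr_ge0 //; case/andP: (inbox01 (R := R) (m * k) z).
    rewrite /inbox asboolT // mulr1 -real_normK ?num_real // ler_sqr ?nnegrE //.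
    exact: hB.
  by apply: finsZ; rewrite ?sqr_ge0 // /fins nnsum_inbox ltry.
have [Dm hDm] := @cond_bounded R d alpha M k d0 alpha0 M1 W W0.
have cge := cond_ge0 k alpha0 W0.
have csy := @condC R d alpha k W Wsym.
have jB u v z := @jumpB R _ (cond alpha k W) Dm cge hDm u v z.
have [u [lu uE]] : exists u, l2 u /\ (forall z, lam * u z - jump (cond alpha k W) u z = f (latpt R k z)) /\
    u = resolvent_k alpha lam W k f.
  (* [resolvent_k] is a choice from a set, so a solution has to be exhibited before its equation can
     be used: [g] plus the solution of the error equation. *)
  have [|lu uE] := @getPex _ [set u | l2lat u /\ forall z, lam * u z - Lk alpha W k u z = f (latpt R k z)].
    have [v [lv vE]] := @jump_resolvent R _ (cond alpha k W) Dm lam cge csy hDm lam0 _ lh.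
    exists (fun z => v z + G z); split; first exact: (l2D lv lG).
    move=> z; rewrite Lk_jump //.
    have := jB (fun z => v z + G z) G z (l2D lv lG) lG.
    rewrite (_ : (fun y => v y + G y - G y) = v); last by apply/funext => y; rewrite addrK.
    move=> jE; have := vE z; rewrite jE /lattice_error -/G => vz.
    rewrite /f -/(G z); move: vz; set a := jump _ _ _; set b := jump _ _ _; set c := Lbar _ _ _ _ => vz.
    have : lam * (v z + G z) = lam * v z + lam * G z by ring.
    by move=> ->; move: vz; rewrite -/(G z); set p := lam * v z; set q := lam * G z; lra.
  exists (resolvent_k alpha lam W k f); split; first exact: lu.
  by split => // z; have := uE z; rewrite Lk_jump.
have [{}uE uR] := uE; rewrite -/W -uR.
pose v z := u z - G z.
have lv : l2 v by apply: (l2D lu); exact: l2N.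
have vE z : lam * v z - jump (cond alpha k W) v z = lattice_error alpha leb g k W z.
  rewrite /v (jB u G z lu lG) /lattice_error -/G.
  have := uE z; rewrite /f -/(G z).
  set a := jump _ u _; set b := jump _ _ _; set c := Lbar _ _ _ _ => uz.
  by rewrite mulrBr; lra.
have [vcrude vfine] := hv v lv vE.
have [rate0 r1 r2] := hCr k kpos L1.
have kd0 : 0 < k%:R ^+ d :> R by rewrite exprn_gt0.
case: (leqP k1 k) => kk1; last first.
  have hA0 : 0 <= Hcr k / k%:R ^+ d by rewrite divr_ge0 // ltW.
  have := hCx k u (Hcr k / k%:R ^+ d) kpos hA0; rewrite divfK ?gt_eqF // => /(_ vcrude) H.
  apply: le_trans H _; rewrite lee_fin -/(crude k) /C0.
  have c1 : crude k <= `|crude k / rate d alpha gamma k| * rate d alpha gamma k.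
    apply: (@le_trans _ _ (crude k / rate d alpha gamma k * rate d alpha gamma k)); last first.
      by rewrite ler_wpM2r ?(ltW rate0) // ler_norm.
    by rewrite divfK ?gt_eqF.
  apply: le_trans c1 _; rewrite ler_wpM2r ?(ltW rate0) //.
  rewrite (bigD1 (Ordinal kk1)) //=.
  set s := \sum_(i < k1 | _) _; have s0 : 0 <= s by apply: sumr_ge0.
  by move: Ca0 s0; move: (`|_|) => q; move: (_ * Cr) => p; lra.
have v2 := vfine kk1 good.
have [s sE] : exists s, s = (if 1 < alpha then 1 else ln k%:R `^ 2^-1) *
        (k%:R `^ (alpha / 2 - hoelder_exponent d alpha) * ln k%:R `^ ((1 + gamma) * alpha / (2 * d%:R))) by eexists.
have [rho rhoE] : exists rho : R, rho = k%:R `^ (- (1 - alpha / 2)) by eexists.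
rewrite -sE in r1; rewrite -rhoE in r2 v2.
have s0 : 0 <= s by rewrite sE !mulr_ge0 ?powR_ge0 //; case: ifP => // _; exact: powR_ge0.
have rho0 : 0 <= rho by rewrite rhoE powR_ge0.
have ampE : @amplitude R d alpha gamma k ^+ 2 = s ^+ 2 * k%:R ^+ d.
  rewrite /amplitude sE.
  have -> : k%:R `^ (d%:R / 2 + alpha / 2 - hoelder_exponent d alpha) = k%:R `^ (d%:R / 2) * k%:R `^ (alpha / 2 - hoelder_exponent d alpha) :> R.
    by rewrite -powRD ?(gt_eqF k0') ?implybT // addrA.
  have -> : k%:R ^+ d = (k%:R `^ (d%:R / 2)) ^+ 2 :> R.
    by rewrite sqr_powR mulrCA mulfV // mulr1 powR_mulrn // ltW.
  by ring.
have hA0 : 0 <= Cf * (s ^+ 2 + rho ^+ 2) by rewrite mulr_ge0 // addr_ge0 ?sqr_ge0.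
have := hCx k u (Cf * (s ^+ 2 + rho ^+ 2)) kpos hA0.
move=> /(_ _)/Wrap[].
  apply: le_trans v2 _; rewrite ampE lee_fin le_eqVlt; apply/orP; left; apply/eqP; ring.
move=> H; apply: le_trans H _; rewrite lee_fin.
have q1 : Num.sqrt (2 * (Cf * (s ^+ 2 + rho ^+ 2))) <= Num.sqrt (2 * Cf) * (s + rho).
  rewrite -[s + rho](ger0_norm (addr_ge0 s0 rho0)) -sqrtr_sqr -sqrtrM ?mulr_ge0 //.
  rewrite ler_sqrt; last by rewrite mulr_ge0 ?sqr_ge0 ?mulr_ge0.
  rewrite mulrA; apply: ler_wpM2l; first by rewrite mulr_ge0.
  by have := mulr_ge0 s0 rho0; rewrite sqrrD mulr2n; lra.
(* The error of extending [g] from lattice points to cells is of order [1/k], which the consistency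
   rate dominates. *)
have q2 : k%:R^-1 <= rho.
  rewrite rhoE -(powR_inv1 (ltW k0')); apply: ler_powR; first by rewrite ler1n.
  by lra.
have sC : 0 <= Num.sqrt (2 * Cf) by exact: sqrtr_ge0.
apply: (@le_trans _ _ ((2 * Num.sqrt (2 * Cf) + Cx) * Cr * rate d alpha gamma k)); last first.
  by rewrite ler_wpM2r ?(ltW rate0) // /C0 -addrA lerDl addr_ge0.
apply: le_trans (lerD q1 (ler_wpM2l Cx0 q2)) _.
move: r1 r2; move: (rate d alpha gamma k) => rt; rewrite -mulrA; move: (Cr * rt) => y r1 r2.
by have := ler_wpM2l sC r1; have := ler_wpM2l sC r2; have := ler_wpM2l Cx0 r2; lra.
Qed.
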